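(* Let $\mathfrak{g}$ be a simple Lie algebra over $\mathbb{C}$ (or $\mathfrak{g}=\mathfrak{gl}_n$), let $\overline{\mathfrak{g}}\subset\mathfrak{g}$ be a Levi subalgebra, and let $\mu,\nu\in\overline{P}_+$ be dominant integral weights of $\overline{\mathfrak{g}}$. (1) If there exists $u\in W$ with $u(\overline{R}_+)=\overline{R}_+$ and $\nu=u(\mu)$ (that is, $\mu$ and $\nu$ are conjugate under a Dynkin diagram automorphism of $\overline{\mathfrak{g}}$ lying in $W$), then $H_\mu=H_\nu$. (2) Conversely, assume $H_\mu=H_\nu$. Then there exists $u\in W$ with $u(\overline{R}_+)=\overline{R}_+$ and $\nu=u(\mu)$ whenever one of the following hypotheses is satisfied: (a) $\mu$ and $\nu$ belong to the same closed Weyl chamber of $\mathfrak{g}$, i.e. $\mu,\nu\in P_+^w$ for some $w\in W$ (in which case $\mu=\nu$); (b) each of the sets $E_\mu$ and $E_\nu$ is entirely contained in a closed Weyl chamber, i.e. there are $w,w'\in W$ with $E_\mu\subset P_+^{w}$ and $E_\nu\subset P_+^{w'}$; (c) $\mu+2\overline{\rho}\in P_+$ or $\nu+2\overline{\rho}\in P_+$; (d) $\mathfrak{g}=\mathfrak{gl}_n$ (with $\overline{\mathfrak{g}}$ any Levi subalgebra); (e) $\mathfrak{g}=\mathfrak{so}_{2n+1}$, $\mathfrak{sp}_{2n}$ or $\mathfrak{so}_{2n}$, $\overline{\mathfrak{g}}=\mathfrak{gl}_n$, and $\mu,\nu$ have integer coordinates.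
   Context: Setting. $\mathfrak{g}$ has Cartan subalgebra $\mathfrak{h}$, root system $R$ in a real Euclidean space $E$ spanned by $R$, with inner product $(\cdot,\cdot)$, positive roots $R_+$, simple roots $S\subset R_+$, coroots $\alpha^\vee=2\alpha/(\alpha,\alpha)$ and Weyl group $W$. The integral weights are $P=\{\beta\in E:(\beta,\alpha^\vee)\in\mathbb{Z}\ \forall\alpha\in R\}$ and the dominant ones are $P_+=\{\beta\in P:(\beta,\alpha^\vee)\ge 0\ \forall\alpha\in S\}$. For $w\in W$, $P_+^w:=w^{-1}(P_+)$ is the set of integral weights in the closed Weyl chamber $w^{-1}(\overline C)$, where $\overline C=\{x\in E:(x,\alpha^\vee)\ge0\ \forall \alpha\in S\}$. Let $\overline{S}\subset S$ be a subset, $\overline{R}\subset R$ the parabolic root subsystem generated by $\overline{S}$, $\overline{R}_+=\overline{R}\cap R_+$, $\overline{W}=\langle s_\alpha:\alpha\in\overline{S}\rangle$, and $\overline{\rho}=\frac12\sum_{\alpha\in\overline{R}_+}\alpha$. The Levi subalgebra is $\overline{\mathfrak{g}}=\mathfrak{h}\oplus\bigoplus_{\alpha\in\overline{R}}\mathfrak{g}_\alpha$; it has the same Cartan subalgebra and weight lattice $P$ as $\mathfrak{g}$, and its dominant weights are $\overline{P}_+=\{\beta\in P:(\beta,\alpha^\vee)\ge0\ \forall\alpha\in\overline{S}\}$. For $\lambda\in P_+$ let $V(\lambda)$ be the irreducible finite-dimensional $\mathfrak{g}$-module of highest weight $\lambda$, with character $s_\lambda$; for $\mu\in\overline{P}_+$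 let $\overline{V}(\mu)$ be the irreducible $\overline{\mathfrak{g}}$-module of highest weight $\mu$. Let $m_\mu^\lambda$ be the multiplicity of $\overline{V}(\mu)$ in the restriction of $V(\lambda)$ to $\overline{\mathfrak{g}}$. The induced character is the formal (possibly infinite) sum $H_\mu=\sum_{\lambda\in P_+}m_\mu^\lambda s_\lambda$; thus $H_\mu=H_\nu$ means $m_\mu^\lambda=m_\nu^\lambda$ for all $\lambda\in P_+$. For $\mu\in\overline{P}_+$ put $E_\mu=\{\mu+\overline{\rho}-\overline{w}(\overline{\rho}):\overline{w}\in\overline{W}\}$. For $\mathfrak{g}=\mathfrak{gl}_n$: $E=\mathbb{R}^n$ with the standard inner product, $P=\mathbb{Z}^n$, $R_+=\{\varepsilon_i-\varepsilon_j:i<j\}$, $W=S_n$, $P_+$ is the set of non-increasing integer sequences of length $n$, and $\overline{\mathfrak{g}}=\mathfrak{gl}_{m_1}\oplus\cdots\oplus\mathfrak{gl}_{m_r}$ is embedded block-diagonally. In (e), $\mathfrak{g}$ is simple, has the standard root system of type $B_n$, $C_n$ or $D_n$ in $\mathbb{R}^n$, and $\overline{\mathfrak{g}}=\mathfrak{gl}_n$ is the Levi subalgebra with $\overline{R}_+=\{\varepsilon_i-\varepsilon_j:1\le i<j\le n\}$, so that $\mu,\nu$ are non-increasing sequences of length $n$ of (possibly negative) integers. *)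

(* Defs.v *)
From HB Require Import structures.
From mathcomp Require Import all_boot all_order all_algebra.
From mathcomp Require Import boolp classical_sets reals.
From mathcomp Require Import complex.
From mathcomp Require Import ring.

Set Implicit Arguments.
Unset Strict Implicit.
Unset Printing Implicit Defensive.

Import Order.TTheory GRing.Theory Num.Theory.
Local Open Scope classical_set_scope.
Local Open Scope ring_scope.

Record lieAlg (F : fieldType) := LieAlg {
  lie_sort :> vectType F;
  brk : {bilinear lie_sort -> lie_sort -> lie_sort};
  brkxx : forall x, brk x x = 0;
  brk_jacobi : forall x y z,
    brk x (brk y z) + brk y (brk z x) + brk z (brk x y) = 0 }.

Definition lie_simple (F : fieldType) (g : lieAlg F) : Prop :=
  (exists x y : g, brk g x y != 0) /\
  forall I : {vspace g},
    (forall x y, y \in I -> brk g x y \in I) -> I = 0%VS \/ I = fullv.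

(* The usual definition for a complex semisimple (or reductive) Lie algebra:
   an abelian subalgebra, equal to its centralizer, acting diagonalizably in
   the adjoint representation. *)
Definition is_cartan (F : fieldType) (g : lieAlg F) (h : {vspace g}) : Prop :=
  [/\ {in h &, forall x y, brk g x y = 0},
      (forall x, {in h, forall y, brk g y x = 0} -> x \in h)
    & {in h, forall y, exists2 b : seq g, basis_of fullv b
        & {in b, forall x, exists c : F, brk g y x = c *: x}}].

Record lieMod (F : fieldType) (g : lieAlg F) := LieMod {
  mod_sort :> vectType F;
  act : {bilinear g -> mod_sort -> mod_sort};
  act_brk : forall x y v,
    act (brk g x y) v = act x (act y v) - act y (act x v) }.

(* [a] is the set of elements of a subalgebra. *)
Definition irreducible_sub (F : fieldType) (g : lieAlg F) (V : lieMod g)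
    (a : set g) (U : {vspace V}) : Prop :=
  let stable (U' : {vspace V}) :=
    forall x v, a x -> v \in U' -> act V x v \in U' in
  [/\ U != 0%VS, stable U
    & forall U' : {vspace V}, stable U' -> (U' <= U)%VS ->
        U' = 0%VS \/ U' = U].

(* [wteval] embeds the Euclidean space [euc] into the dual of [cartan]:
   [wteval x H] is the value at [H] of the functional attached to [x]; it is
   only meaningful for [H] in [cartan]. *)
Record lie_datum (R : realType) := LieDatum {
  alg : lieAlg R[i];
  cartan : {vspace alg};
  euc : vectType R;
  ip : {dot euc for idfun};
  wteval : euc -> alg -> R[i];
  root_set : seq euc;
  simple_roots : seq euc;
  wt_lattice : pred euc }.

Section Datum.
Variables (R : realType) (X : lie_datum R).
Local Notation g := (alg X).
Local Notation h := (cartan X).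
Local Notation E := (euc X).
Local Notation S := (simple_roots X).

(* [copair b a] is (b, a^vee). *)
Definition copair (b a : E) : R := 2%:R * ip X b a / ip X a a.
Definition reflect (a b : E) : E := b - copair b a *: a.

Definition is_root_system (Phi : seq E) : Prop :=
  [/\ uniq Phi && (0 \notin Phi),
      <<Phi>>%VS = fullv,
      {in Phi &, forall a b, reflect a b \in Phi /\ copair b a \is a Num.int}
    & {in Phi, forall a c, c *: a \in Phi -> c = 1 \/ c = -1}].

Definition nonneg_comb (a : E) : bool :=
  (a \in <<S>>%VS) &&
  [forall i, coord (in_tuple S) i a \is a Num.nat].

Definition is_base : Prop :=
  [/\ free S, {subset S <= root_set X}
    & {in root_set X, forall a, nonneg_comb a \/ nonneg_comb (- a)}].

Definition root_space (f : g -> R[i]) : set g :=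
  [set x | {in h, forall H, brk g H x = f H *: x}].

Definition is_root (f : g -> R[i]) : Prop :=
  (exists2 H, H \in h & f H != 0) /\ (exists2 x, x != 0 & root_space f x).

(* The inner product is any one for which the roots of (g, h) form a root
   system; e.g. the one coming from the Killing form. *)
Record simple_datum : Prop := SimpleDatum {
  sd_simple : lie_simple g;
  sd_cartan : is_cartan h;
  sd_evalE : forall c x y, {in h, forall H,
    wteval (c *: x + y) H = real_complex R c * wteval x H + wteval y H};
  sd_evalh : forall c x, {in h &, forall H H',
    wteval (x : E) (c *: H + H') = c * wteval x H + wteval x H'};
  sd_eval_inj : forall x : E, {in h, forall H, wteval x H = 0} -> x = 0;
  sd_roots : {in root_set X, forall a, is_root (wteval a)};
  sd_roots_all : forall f, is_root f ->
    exists2 a, a \in root_set X & {in h, f =1 wteval a};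
  sd_rootsys : is_root_system (root_set X);
  sd_base : is_base;
  sd_lattice : forall b, wt_lattice b =
    all (fun a => copair b a \is a Num.int) (root_set X) }.

Definition pos_roots : seq E := [seq a <- root_set X | nonneg_comb a].

Inductive in_weyl (A : seq E) : (E -> E) -> Prop :=
| weyl_id : in_weyl A id
| weyl_refl a w : a \in A -> in_weyl A w -> in_weyl A (reflect a \o w).

Definition dominant_for (A : seq E) (b : E) : bool :=
  wt_lattice b && all (fun a => 0 <= copair b a) A.

Definition Pplus : set E := [set b | dominant_for S b].

Definition Pplus_chamber (w : E -> E) : set E := w @^-1` Pplus.

Definition highest_weight (pos : seq E) (V : lieMod g) (U : {vspace V})
    (lam : E) : Prop :=
  exists2 v, v \in U & [/\ v != 0,
    {in h, forall H, act V H v = wteval lam H *: v}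
  & {in pos, forall a x, root_space (wteval a) x -> act V x v = 0}].

(* [V] is the irreducible module V(lam). *)
Definition is_irr_hw (V : lieMod g) (lam : E) : Prop :=
  irreducible_sub [set: g] (fullv : {vspace V}) /\
  highest_weight pos_roots (fullv : {vspace V}) lam.

Section Levi.
Variable Sbar : seq E.

Definition Rbar : seq E := [seq a <- root_set X | a \in <<Sbar>>%VS].
Definition Rbar_pos : seq E := [seq a <- Rbar | nonneg_comb a].
Definition rhobar : E := 2%:R^-1 *: \sum_(a <- Rbar_pos) a.
Definition Pbar_plus : set E := [set b | dominant_for Sbar b].

Definition levi : set g := [set x | exists (H : g) (z : E -> g),
  [/\ H \in h, {in Rbar, forall a, root_space (wteval a) (z a)}
    & x = H + \sum_(a <- Rbar) z a]].

(* The submodule [U] of the restriction of [V] is isomorphic to the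
   irreducible module of highest weight [mu] of the Levi subalgebra. *)
Definition is_levi_irr_hw (V : lieMod g) (U : {vspace V}) (mu : E) : Prop :=
  irreducible_sub levi U /\ highest_weight Rbar_pos U mu.

(* The restriction of [V] to the Levi subalgebra is a direct sum of
   irreducible submodules, exactly [m] of which have highest weight [mu]. *)
Definition multiplicity (V : lieMod g) (mu : E) (m : nat) : Prop :=
  exists (r : nat) (U : 'I_r -> {vspace V}),
    [/\ forall i, irreducible_sub levi (U i),
        (\sum_i U i)%VS = fullv, directv (\sum_i U i)
      & #|[pred i | `[< is_levi_irr_hw (U i) mu >]]| = m].

(* H_mu = H_nu, coefficient by coefficient. *)
Definition same_induced (mu nu : E) : Prop :=
  forall lam, Pplus lam -> forall V : lieMod g, is_irr_hw V lam ->
  forall m, multiplicity V mu m <-> multiplicity V nu m.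

Definition diagram_conj (mu nu : E) : Prop :=
  exists u, [/\ in_weyl (root_set X) u, map u Rbar_pos =i Rbar_pos & nu = u mu].

Definition Eset (mu : E) : set E :=
  [set mu + rhobar - w rhobar | w in in_weyl Sbar].

End Levi.
End Datum.

Arguments wteval {R X} _ _ : rename.
Arguments wt_lattice {R X} _ : rename.

Section Standard.
Variables (R : realType) (E : vectType R) (n : nat) (e : 'I_n -> E).

Definition pairs (p : rel 'I_n) : seq ('I_n * 'I_n) :=
  [seq ij <- enum {: 'I_n * 'I_n} | p ij.1 ij.2].

Definition A_roots : seq E :=
  [seq e ij.1 - e ij.2 | ij <- pairs (fun i j => i != j)].
Definition A_base : seq E :=
  [seq e ij.1 - e ij.2 | ij <- pairs (fun i j => i.+1 == j)].

Definition sum_roots : seq E :=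
  [seq e ij.1 + e ij.2 | ij <- pairs (fun i j => i < j)%N].

Definition with_opp (s : seq E) : seq E := s ++ map -%R s.

Inductive classical_type := typeB | typeC | typeD.

Definition classical_roots (t : classical_type) : seq E :=
  A_roots ++ with_opp sum_roots ++
  match t with
  | typeB => with_opp [seq e i | i <- enum 'I_n]
  | typeC => with_opp [seq e i *+ 2 | i <- enum 'I_n]
  | typeD => [::]
  end.

Definition classical_base (t : classical_type) : seq E :=
  A_base ++
  match t with
  | typeB => [seq e i | i <- [seq i : 'I_n <- enum 'I_n | i.+1 == n]]
  | typeC => [seq e i *+ 2 | i <- [seq i : 'I_n <- enum 'I_n | i.+1 == n]]
  | typeD => [seq e ij.1 + e ij.2 |
                ij <- pairs (fun i j => (i.+1 == j) && (j.+1 == n))]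
  end.

End Standard.

(* so(2n+1), sp(2n) or so(2n) with its standard root system in coordinates
   [e 0, ..., e (n - 1)], the Levi subalgebra gl(n), and integral
   coordinates for [mu] and [nu]. *)
Definition classical_gl_case (R : realType) (X : lie_datum R)
    (Sbar : seq (euc X)) (mu nu : euc X) : Prop :=
  simple_datum X /\
  exists (n : nat) (e : 'I_n -> euc X) (t : classical_type),
    [/\ forall i j, ip X (e i) (e j) = (i == j)%:R,
        <<codom e>>%VS = fullv,
        root_set X =i classical_roots e t,
        simple_roots X =i classical_base e t
      & Sbar =i A_base e /\
        forall b, b \in [:: mu; nu] ->
          forall i, ip X b (e i) \is a Num.int].

Section GL.
Variables (R : realType) (n : nat).
Local Notation C := R[i].

Definition gl_brk (A B : 'M[C]_n) : 'M[C]_n := A *m B - B *m A.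

Fact gl_brk_bilinear : bilinear_for *:%R *:%R gl_brk.
Proof.
split=> [B|A] c x y; rewrite /gl_brk /= mulmxDl mulmxDr -?scalemxAl -?scalemxAr.
  by rewrite scalerBr opprD addrACA.
by rewrite scalerBr opprD addrACA.
Qed.
HB.instance Definition _ :=
  bilinear_isBilinear.Build C 'M[C]_n 'M[C]_n 'M[C]_n *:%R *:%R gl_brk
    gl_brk_bilinear.

Fact gl_brkxx A : gl_brk A A = 0.
Proof. exact: subrr. Qed.

Fact gl_jacobi x y z :
  gl_brk x (gl_brk y z) + gl_brk y (gl_brk z x) + gl_brk z (gl_brk x y) = 0.
Proof.
rewrite /gl_brk !mulmxBl !mulmxBr !mulmxA !opprB.
move: (x *m y *m z) (x *m z *m y) (y *m z *m x) => a b c.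
move: (z *m y *m x) (y *m x *m z) (z *m x *m y) => d f k.
by apply/matrixP => i j; rewrite !mxE; ring.
Qed.

Definition gl_alg : lieAlg C := @LieAlg C 'M[C]_n gl_brk gl_brkxx gl_jacobi.

Definition std_ip (x y : 'rV[R]_n) : R := \sum_i x 0 i * y 0 i.

Fact std_ip_bilinear : bilinear_for *%R (idfun \; *%R) std_ip.
Proof.
split=> [v|u] c x y; rewrite /std_ip /= mulr_sumr -big_split;
  apply: eq_bigr => i _ /=; rewrite !mxE.
  by rewrite mulrDl mulrA.
by rewrite mulrDr mulrCA.
Qed.
HB.instance Definition _ :=
  bilinear_isBilinear.Build R 'rV[R]_n 'rV[R]_n R *%R (idfun \; *%R) std_ip
    std_ip_bilinear.

Fact std_ip_sym x y : std_ip x y = (-1) ^+ false * idfun (std_ip y x).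
Proof. by rewrite mul1r; apply: eq_bigr => i _; rewrite mulrC. Qed.
HB.instance Definition _ :=
  isHermitianSesquilinear.Build R 'rV[R]_n false idfun std_ip std_ip_sym.

Fact std_ip_gt0 x : x != 0 -> 0 < std_ip x x.
Proof.
move=> /rV0Pn[i xi]; rewrite /std_ip (bigD1 i) //=.
rewrite ltr_wpDr ?sumr_ge0 // => [j _|]; first by rewrite -expr2 sqr_ge0.
by rewrite -expr2 exprn_even_gt0.
Qed.
HB.instance Definition _ :=
  isDotProduct.Build R 'rV[R]_n std_ip std_ip_gt0.

Definition gl_eval (x : 'rV[R]_n) (A : 'M[C]_n) : C :=
  \sum_i real_complex R (x 0 i) * A i i.

Definition gl_datum : lie_datum R :=
  let eps (i : 'I_n) : 'rV[R]_n := delta_mx 0 i in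
  @LieDatum R gl_alg (limg (linfun (@diag_mx C n))) 'rV[R]_n std_ip gl_eval
    (A_roots eps) (A_base eps)
    [pred x : 'rV[R]_n | [forall i, x 0 i \is a Num.int]].

End GL.

(* Main.v *)
(* By complete reducibility and the Weyl character formula for the Levi
   subalgebra, the multiplicity of the weight mu in V is the alternating sum
   over Rbar+ of [y |-> dim V_(mu + y)], that is, the pairing of the weight
   multiplicities with e^mu times the Weyl denominator.  The latter is
   supported on the [rhobar - w rhobar], and weight multiplicities are
   invariant under W, which gives (1).  Conversely the characters of the V(lam)
   are unitriangular in the orbit sums, so H_mu = H_nu makes the alternating
   sums of f(mu + y) and f(nu + y) agree for every W-invariant f.

   Taking for f the indicators of W-orbits of extreme norm shows that nu lies
   in W mu and nu + 2 rhobar in W (mu + 2 rhobar), which settles (a), (b), (c).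
   For (d) and (e) take f(y) = prod_i x(y_i), with x even in (e), or odd in
   type D.  The alternating sum becomes a product of determinants
   det(x_(mu_i - i + j)), one for each block.  For gl(n) these satisfy unique
   factorization: eliminating the variable of largest index and comparing
   lowest terms under x_k -> x_k t^(k^2) shows that no two of them are
   proportional up to smaller factors.  For a single block and x even, the
   coefficient of the variable of largest index shows by induction that mu and
   nu agree up to reversal and sign; in type D with n odd this last case is
   excluded by the nonvanishing of the determinant on odd x. *)
Require Import Defs.
From HB Require Import structures.
From mathcomp Require Import all_boot all_order all_algebra.
From mathcomp Require Import boolp classical_sets functions reals.
From mathcomp Require Import complex.
From mathcomp Require Import perm.
From mathcomp Require Import ring lra zify.

Set Implicit Arguments.
Unset Strict Implicit.
Unset Printing Implicit Defensive.

Import Order.TTheory GRing.Theory Num.Theory.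
Local Open Scope classical_set_scope.
Local Open Scope ring_scope.

(** Simple Lie algebras and gl(n) are treated at once: [lie_frame] is their common ground, and (1)
    and the cases (a), (b), (c) rest on it alone. The inner product of the datum is only known to
    give a root system, whereas a Casimir operator needs one that comes from an invariant form on g.
    Hence a second form [bf] with the same coroot pairings, used for norms and Casimir values. The
    hypothesis H_mu = H_nu quantifies over modules V(lam), so it yields nothing until these exist.
    They are built inside the functions on words in the simple roots, where raising operators shift
    words: a function all of whose vacuum coefficients vanish is zero, which makes the submodule
    generated by the vacuum irreducible from the start. The general theory uses no sign character of
    the Weyl group: the Weyl denominator stays a product of factors 1 - e^a, and its support is
    found from its antisymmetry. Likewise there is no ring of polynomials in infinitely many
    variables: functions that are polynomial along every line ([plines]) suffice to cancel
    factors. *)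

Local Notation reflect := Defs.reflect.
Local Notation "r %:RC" := (real_complex _ r) (at level 2, format "r %:RC").

(** * Alternating sums over subsets of a sequence *)

Section AltSum.
Variables (E : zmodType) (A : zmodType).
Implicit Types (s : seq E) (f g : E -> A).

(* The sum of [(-1) ^ #|K| * f (\sum_(a in K) a)] over the subsets K of s; in
   the group ring, it pairs f with the product of the [1 - e^a], a in s. *)
Fixpoint altsum s f : A :=
  if s is a :: s' then altsum s' f - altsum s' (fun x => f (x + a)) else f 0.

Fixpoint subsums s : seq E :=
  if s is a :: s' then subsums s' ++ [seq x + a | x <- subsums s'] else [:: 0].

Lemma eq_in_altsum s f g : {in subsums s, f =1 g} -> altsum s f = altsum s g.
Proof.
elim: s f g => [|a s IH] f g fg /=; first by rewrite fg ?inE.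
congr (_ - _); apply: IH => x xs; apply: fg; rewrite /= mem_cat ?xs //.
by rewrite (map_f (fun x => x + a)) ?orbT.
Qed.

Lemma eq_altsum s f g : f =1 g -> altsum s f = altsum s g.
Proof. by move=> fg; apply: eq_in_altsum => x _. Qed.

Lemma altsum0 s : altsum s (fun=> 0) = 0.
Proof. by elim: s => //= a s ->; rewrite subrr. Qed.

Lemma altsumD s f g : altsum s (fun x => f x + g x) = altsum s f + altsum s g.
Proof. by elim: s f g => //= a s IH f g; rewrite !IH opprD addrACA. Qed.

Lemma altsumN s f : altsum s (fun x => - f x) = - altsum s f.
Proof. by elim: s f => //= a s IH f; rewrite !IH opprB opprK addrC. Qed.

Lemma altsum_sum (I : Type) (r : seq I) (P : pred I) s (F : I -> E -> A) :
  altsum s (fun x => \sum_(i <- r | P i) F i x) =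
  \sum_(i <- r | P i) altsum s (F i).
Proof.
elim: r => [|i r IH].
  by rewrite big_nil -[RHS](altsum0 s); apply: eq_altsum => x; rewrite big_nil.
rewrite big_cons; case: ifP => Pi.
  by rewrite -IH -altsumD; apply: eq_altsum => x; rewrite big_cons Pi.
by rewrite -IH; apply: eq_altsum => x; rewrite big_cons Pi.
Qed.

Lemma altsum_perm s s' f : perm_eq s s' -> altsum s f = altsum s' f.
Proof.
elim: s s' f => [|a s IH] s' f ss'.
  by move: ss'; rewrite perm_sym => /perm_nilP ->.
have as' : a \in s' by rewrite -(perm_mem ss') mem_head.
have perm2 : perm_eq s (rem a s').
  by rewrite -(perm_cons a); apply: (perm_trans ss'); apply: perm_to_rem.
rewrite /= !(IH _ _ perm2) {ss' perm2 IH s}.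
elim: s' f as' => //= b s' IH f; rewrite inE; case: (eqVneq a b) => [-> // |ab].
rewrite /= => as'; rewrite -!IH //=.
rewrite !opprB addrACA [RHS]addrACA; congr (_ + _); last exact: addrC.
by congr (_ + _); apply: eq_altsum => x; rewrite addrAC.
Qed.
End AltSum.

Lemma altsum_map (E E' A : zmodType) (u : E -> E') (s : seq E) (f : E' -> A) :
  u 0 = 0 -> {morph u : x y / x + y} -> altsum (map u s) f = altsum s (f \o u).
Proof.
move=> u0 uD; elim: s f => [|a s IH] f /=; first by rewrite u0.
by rewrite !IH; congr (_ - _); apply: eq_altsum => x /=; rewrite uD.
Qed.

Lemma altsum_morph (E A A' : zmodType) (h : {additive A -> A'}) (s : seq E) f :
  h (altsum s f) = altsum s (h \o f).
Proof. by elim: s f => //= a s IH f; rewrite raddfB !IH. Qed.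

Lemma altsumZ (E : zmodType) (A : pzRingType) (s : seq E) (f : E -> A) c :
  altsum s (fun x => c * f x) = c * altsum s f.
Proof. by elim: s f => //= a s IH f; rewrite !IH mulrBr. Qed.

(* For [T a] the traces in Freudenthal's recursion, this removes the infinite
   sums along root strings from that recursion. *)
Lemma altsum_telescope (E A : zmodType) (s : seq E) (T : E -> E -> A)
    (G : E -> E -> A) :
    (forall x y z, G x (y + z) = G x y + G x z) ->
    {in s, forall a x, T a x - T a (x + a) = G (x + a) a} ->
  \sum_(a <- s) altsum s (T a) = - altsum s (fun x => G x x).
Proof.
have key (t : seq E) (T' : E -> E -> A) (G' : E -> E -> E -> A) c :
    (forall x y z, G' c x (y + z) = G' c x y + G' c x z) ->
    {in t, forall a x, T' a x - T' a (x + a) = G' c (x + a) a} ->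
    \sum_(a <- t) altsum t (T' a) = - altsum t (fun x => G' c x x).
  elim: t T' G' c => [|a t IH] T' G' c GD TG.
    rewrite big_nil /=; have := GD 0 0 0; rewrite addr0 => /eqP.
    by rewrite -subr_eq0 opprD addNKr oppr_eq0 => /eqP ->; rewrite oppr0.
  rewrite big_cons /=.
  have -> : \sum_(b <- t) (altsum t (T' b) -
       altsum t (fun x => T' b (x + a))) =
     - altsum t (fun x => G' c x x) + altsum t (fun x => G' c (x + a) x).
    rewrite sumrB (IH T' G' c) //; last first.
      by move=> b bt x; apply: TG; rewrite inE bt orbT.
    rewrite (IH (fun b x => T' b (x + a)) (fun _ x y => G' c (x + a) y) c).
    - by rewrite opprK.
    - by move=> x y z; apply: GD.
    - by move=> b bt x; rewrite addrAC TG ?inE ?bt ?orbT // addrAC.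
  rewrite -altsumN -altsumD.
  rewrite (_ : altsum t (fun x => T' a x + _) =
     altsum t (fun x => G' c (x + a) a)); last first.
    by apply: eq_altsum => x; rewrite TG ?mem_head.
  rewrite opprB [RHS]addrC addrCA; congr (_ + _).
  rewrite -altsumD; apply: eq_altsum => x; rewrite -GD.
  by rewrite [a + x]addrC.
by move=> GD TG; apply: (key s T (fun=> G) 0).
Qed.

Section AltSumCoef.
Variables (E : zmodType) (R : pzRingType).
Implicit Types (s : seq E) (f : E -> R) (g : E).

(** The coefficient of e^g in the product of the 1 - e^a, obtained by pairing that product with the
    indicator of g. *)
Definition altcoef s g : R := altsum s (fun x => (x == g)%:R).

Lemma altsum_coef s f (r : seq E) : uniq r -> {subset subsums s <= r} ->
  altsum s f = \sum_(g <- r) f g * altcoef s g.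
Proof.
move=> ur sr; under eq_bigr do rewrite -altsumZ.
rewrite -altsum_sum; apply: eq_in_altsum => x xs.
rewrite (bigD1_seq x) ?sr //= eqxx mulr1 big1 ?addr0 // => y yx.
by rewrite eq_sym (negPf yx) mulr0.
Qed.

Lemma altcoef_subsum s g : altcoef s g != 0 -> g \in subsums s.
Proof.
apply: contraR => gs; rewrite /altcoef -[X in _ == X](altsum0 R s); apply/eqP.
apply: eq_in_altsum => x xs; case: eqP => // xg.
by rewrite -xg xs in gs.
Qed.

Lemma altsum_eq0 s f : (forall g, altcoef s g != 0 -> f g = 0) ->
  altsum s f = 0.
Proof.
move=> f0; rewrite (altsum_coef _ (undup_uniq (subsums s))); last first.
  by move=> x; rewrite mem_undup.
apply: big1 => g _; case: (eqVneq (altcoef s g) 0) => [->|/f0 ->].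
  by rewrite mulr0.
by rewrite mul0r.
Qed.

Lemma eq_altsum_coef s f f' :
  (forall g, altcoef s g != 0 -> f g = f' g) -> altsum s f = altsum s f'.
Proof.
move=> ff'; apply/eqP; rewrite -subr_eq0 -altsumN -altsumD; apply/eqP.
by apply: altsum_eq0 => g /ff' ->; rewrite subrr.
Qed.

Lemma altsum_coef1 s f g0 :
  (forall g, altcoef s g != 0 -> g != g0 -> f g = 0) ->
  altsum s f = f g0 * altcoef s g0.
Proof.
move=> fg; rewrite /altcoef -altsumZ; apply: eq_altsum_coef => g sg.
by case: (eqVneq g g0) => [->|/fg -> //]; rewrite ?mulr1 ?mulr0.
Qed.
End AltSumCoef.

(** * Root systems *)

Section Forms.
Variables (R : realType) (X : lie_datum R).
Local Notation E := (euc X).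
Local Notation S := (simple_roots X).
Local Notation Phi := (root_set X).
Implicit Types (a b x y z : E) (bf : E -> E -> R).

(** The facts on roots and weights shared with gl(n), whose roots do not span the space and whose
    weight lattice is Z^n. Hence no spanning condition, and implications on the lattice where
    [sd_lattice] has an equivalence. *)
Record root_axioms : Prop := RootAxioms {
  ra_uniq : uniq Phi;
  ra_neq0 : 0 \notin Phi;
  ra_refl : {in Phi &, forall a b, reflect a b \in Phi};
  ra_int : {in Phi &, forall a b, copair b a \is a Num.int};
  ra_red : {in Phi, forall a c, c *: a \in Phi -> c = 1 \/ c = -1};
  ra_base : is_base X;
  ra_wt : forall b, wt_lattice b ->
    {in Phi, forall a, copair b a \is a Num.int};
  ra_wtD : forall b, wt_lattice b -> {in Phi, forall a, wt_lattice (b + a)} }.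

(** An inner product with the same coroot pairings as the given one. The instance needed later is
    the dual of the Killing form, which is not assumed to be the inner product of the datum. *)
Record wform bf : Prop := WForm {
  wfDl : forall x y z, bf (x + y) z = bf x z + bf y z;
  wfZl : forall c x z, bf (c *: x) z = c * bf x z;
  wfC : forall x y, bf x y = bf y x;
  wf_gt0 : forall x, x != 0 -> 0 < bf x x;
  wf_co : forall b, {in Phi, forall a, bf b a = copair b a * (bf a a / 2)} }.

Lemma copairDl x y a : copair (x + y) a = copair x a + copair y a.
Proof. by rewrite /copair linearDl /= -mulrDl -mulrDr. Qed.

Lemma copairZl c x a : copair (c *: x) a = c * copair x a.
Proof. by rewrite /copair linearZl_LR /= !mulrA [2%:R * c]mulrC. Qed.

Lemma copairNl x a : copair (- x) a = - copair x a.
Proof. by rewrite -scaleN1r copairZl mulN1r. Qed.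

Lemma copairBl x y a : copair (x - y) a = copair x a - copair y a.
Proof. by rewrite copairDl copairNl. Qed.

Lemma copair0l a : copair 0 a = 0.
Proof. by rewrite -(scale0r 0) copairZl mul0r. Qed.

Lemma copair_suml (I : Type) (r : seq I) (P : pred I) (F : I -> E) a :
  copair (\sum_(i <- r | P i) F i) a = \sum_(i <- r | P i) copair (F i) a.
Proof.
by apply: (big_morph (fun x => copair x a)) => [x y|]; rewrite ?copairDl ?copair0l.
Qed.

Lemma ip_gt0 x : x != 0 -> 0 < ip X x x.
Proof. exact: neq0_dnorm_gt0. Qed.

Lemma ipC x y : ip X x y = ip X y x.
Proof. by rewrite (hermC (ip X)) expr0 mul1r. Qed.

Lemma copairxx a : a != 0 -> copair a a = 2.
Proof. by move=> /ip_gt0 a0; rewrite /copair mulfK // gt_eqF. Qed.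

Lemma reflectD a x y : reflect a (x + y) = reflect a x + reflect a y.
Proof. by rewrite /reflect copairDl scalerDl opprD addrACA. Qed.

Lemma reflectZ a c x : reflect a (c *: x) = c *: reflect a x.
Proof. by rewrite /reflect copairZl scalerBr scalerA. Qed.

Lemma reflectN a x : reflect a (- x) = - reflect a x.
Proof. by rewrite -scaleN1r reflectZ scaleN1r. Qed.

Lemma reflectB a x y : reflect a (x - y) = reflect a x - reflect a y.
Proof. by rewrite reflectD reflectN. Qed.

Lemma reflect0 a : reflect a 0 = 0.
Proof. by rewrite /reflect copair0l scale0r subr0. Qed.

Lemma reflect_sum a (I : Type) (r : seq I) (P : pred I) (F : I -> E) :
  reflect a (\sum_(i <- r | P i) F i) = \sum_(i <- r | P i) reflect a (F i).
Proof. by apply: (big_morph _ (reflectD a) (reflect0 a)). Qed.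

Lemma reflectxx a : a != 0 -> reflect a a = - a.
Proof.
move=> a0; rewrite /reflect copairxx // -[X in X - _]scale1r -scalerBl.
by rewrite (_ : 1 - 2 = -1) ?scaleN1r //; ring.
Qed.

Lemma copair_reflect a x : a != 0 -> copair (reflect a x) a = - copair x a.
Proof. by move=> a0; rewrite copairBl copairZl copairxx //; ring. Qed.

Lemma reflectK a : a != 0 -> involutive (reflect a).
Proof.
by move=> a0 x; rewrite {1}/reflect copair_reflect // scaleNr opprK subrK.
Qed.

Lemma copairNr x a : copair x (- a) = - copair x a.
Proof. by rewrite /copair linearNr linearNl linearNr /= opprK mulrN mulNr. Qed.

Lemma reflectNl a x : reflect (- a) x = reflect a x.
Proof. by rewrite /reflect copairNr scaleNr scalerN !opprK. Qed.

Section WForm.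
Variables (bf : E -> E -> R) (hb : wform bf).

Lemma wfDr x y z : bf z (x + y) = bf z x + bf z y.
Proof. by rewrite !(wfC hb z) wfDl. Qed.
Lemma wfZr c x z : bf z (c *: x) = c * bf z x.
Proof. by rewrite !(wfC hb z) wfZl. Qed.
Lemma wfNl x z : bf (- x) z = - bf x z.
Proof. by rewrite -scaleN1r wfZl // mulN1r. Qed.
Lemma wfNr x z : bf z (- x) = - bf z x.
Proof. by rewrite -scaleN1r wfZr // mulN1r. Qed.
Lemma wfBl x y z : bf (x - y) z = bf x z - bf y z.
Proof. by rewrite wfDl // wfNl. Qed.
Lemma wfBr x y z : bf z (x - y) = bf z x - bf z y.
Proof. by rewrite wfDr // wfNr. Qed.
Lemma wf0l z : bf 0 z = 0.
Proof. by rewrite -(scale0r 0) wfZl // mul0r. Qed.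
Lemma wf0r z : bf z 0 = 0.
Proof. by rewrite (wfC hb) wf0l. Qed.
Lemma wf_suml (I : Type) (r : seq I) (P : pred I) (F : I -> E) z :
  bf (\sum_(i <- r | P i) F i) z = \sum_(i <- r | P i) bf (F i) z.
Proof.
by apply: (big_morph (fun x => bf x z)) => [x y|]; rewrite ?wfDl ?wf0l.
Qed.
Lemma wf_sumr (I : Type) (r : seq I) (P : pred I) (F : I -> E) z :
  bf z (\sum_(i <- r | P i) F i) = \sum_(i <- r | P i) bf z (F i).
Proof. by rewrite (wfC hb) wf_suml; apply: eq_bigr => i _; apply: (wfC hb). Qed.

Lemma wf_ge0 x : 0 <= bf x x.
Proof. by case: (eqVneq x 0) => [->|/(wf_gt0 hb)/ltW //]; rewrite wf0l. Qed.

Lemma wf_eq0 x : (bf x x == 0) = (x == 0).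
Proof.
case: (eqVneq x 0) => [->|/(wf_gt0 hb)/gt_eqF //]; by rewrite wf0l eqxx.
Qed.

Definition wfE := (wfDr, wfDl hb, wfBl, wfBr, wfNl, wfNr, wfZl hb, wfZr, wf0l, wf0r).
End WForm.

Lemma ip_wform : 0 \notin Phi -> wform (ip X).
Proof.
move=> Phi0; split.
- by move=> x y z; rewrite linearDl.
- by move=> c x z; rewrite linearZl_LR.
- exact: ipC.
- exact: ip_gt0.
- move=> b a aPhi; rewrite /copair.
  have a0 : ip X a a != 0.
    by rewrite gt_eqF // ip_gt0 //; apply: contraNneq Phi0 => <-.
  by field.
Qed.
End Forms.
Arguments wfE {R X bf} hb.

Section Roots.
Variables (R : realType) (X : lie_datum R).
Local Notation E := (euc X).
Local Notation S := (simple_roots X).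
Local Notation Phi := (root_set X).
Implicit Types (a b x y z : E) (bf : E -> E -> R).
Hypothesis hr : root_axioms X.

Lemma root_neq0 a : a \in Phi -> a != 0.
Proof. by move=> aP; apply: contraNneq (ra_neq0 hr) => <-. Qed.

Lemma ipW : wform (X := X) (ip X).
Proof. exact: ip_wform (ra_neq0 hr). Qed.

Lemma oppr_root a : a \in Phi -> - a \in Phi.
Proof.
by move=> aP; rewrite -reflectxx ?root_neq0 //; apply: ra_refl.
Qed.

Lemma wf_reflect bf a x y : wform bf -> a \in Phi ->
  bf (reflect a x) (reflect a y) = bf x y.
Proof.
move=> hb aP; rewrite /reflect !(wfE hb) (wfC hb a y) (wf_co hb x aP) (wf_co hb y aP).
by field.
Qed.

Lemma copair_reflect2 a x b : a \in Phi ->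
  copair (reflect a x) (reflect a b) = copair x b.
Proof. by move=> aP; rewrite /copair !(wf_reflect _ _ ipW). Qed.

Lemma copair_sign bf x a : wform bf -> a \in Phi ->
  (0 <= copair x a) = (0 <= bf x a).
Proof.
move=> hb aP; have p : 0 < bf a a / 2 by apply: divr_gt0 => //; apply/(wf_gt0 hb)/root_neq0.
by rewrite (wf_co hb _ aP) (pmulr_lge0 _ p).
Qed.

Lemma copair_sign_gt bf x a : wform bf -> a \in Phi ->
  (0 < copair x a) = (0 < bf x a).
Proof.
move=> hb aP; have p : 0 < bf a a / 2 by apply: divr_gt0 => //; apply/(wf_gt0 hb)/root_neq0.
by rewrite (wf_co hb _ aP) (pmulr_lgt0 _ p).
Qed.

Local Notation cf := (coord (in_tuple S)).
Let S_free : free (in_tuple S). Proof. by case: (ra_base hr). Qed.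

Lemma simple_root a : a \in S -> a \in Phi.
Proof. by case: (ra_base hr) => _ SP _ /SP. Qed.

Lemma simpleP a : a \in S -> exists i : 'I_(size S), a = S`_i.
Proof.
move=> aS; have lt : (index a S < size S)%N by rewrite index_mem.
by exists (Ordinal lt); rewrite nth_index.
Qed.

Lemma cf_simple (i j : 'I_(size S)) : cf j S`_i = (i == j)%:R.
Proof. exact: (coord_free _ _ S_free). Qed.

Definition cone x := (x \in <<S>>%VS) && [forall i, 0 <= cf i x].

Lemma coneP x : Bool.reflect (x \in <<S>>%VS /\ forall i, 0 <= cf i x) (cone x).
Proof. by apply: (iffP andP) => -[-> /forallP H]; split=> //; apply/forallP. Qed.
End Roots.

Section Positive.
Variables (R : realType) (X : lie_datum R).
Local Notation E := (euc X).
Local Notation S := (simple_roots X).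
Local Notation Phi := (root_set X).
Local Notation cf := (coord (in_tuple S)).
Implicit Types (a b x y z : E) (bf : E -> E -> R).
Hypothesis hr : root_axioms X.

Lemma cf_span x : x \in <<S>>%VS -> x = \sum_i cf i x *: S`_i.
Proof. exact: (@coord_span _ _ _ (in_tuple S)). Qed.

Lemma cone0 : cone (0 : E).
Proof.
by apply/coneP; split=> [|i]; rewrite ?mem0v // linear0.
Qed.

Lemma coneD x y : cone x -> cone y -> cone (x + y).
Proof.
move=> /coneP[xS x0] /coneP[yS y0]; apply/coneP; split=> [|i].
  exact: memvD.
by rewrite linearD /= addr_ge0.
Qed.

Lemma coneZ c x : 0 <= c -> cone x -> cone (c *: x).
Proof.
move=> c0 /coneP[xS x0]; apply/coneP; split=> [|i]; first exact: memvZ.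
by rewrite linearZ /= mulr_ge0.
Qed.

Lemma cone_anti x : cone x -> cone (- x) -> x = 0.
Proof.
move=> /coneP[xS x0] /coneP[_ xN0]; rewrite (cf_span xS) big1 // => i _.
have := xN0 i; rewrite linearN /= oppr_ge0 => xi.
have /eqP -> : cf i x == 0 by rewrite eq_le xi x0.
exact: scale0r.
Qed.

Lemma pos_cone a : nonneg_comb a -> cone a.
Proof.
move=> /andP[aS /forallP an]; apply/coneP; split=> // i.
exact/natr_ge0.
Qed.

Lemma pos_or a : a \in Phi -> nonneg_comb a \/ nonneg_comb (- a).
Proof. by case: (ra_base hr) => _ _; apply. Qed.

Lemma pos_notN a : a \in Phi -> nonneg_comb a -> nonneg_comb (- a) = false.
Proof.
move=> aP /pos_cone a0; apply/negP => /pos_cone /(cone_anti a0) a00.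
by have := root_neq0 hr aP; rewrite a00 eqxx.
Qed.

Lemma cone_root a : a \in Phi -> cone a -> nonneg_comb a.
Proof.
move=> aP ac; case: (pos_or aP) => // /pos_cone /(cone_anti ac) a0.
by have := root_neq0 hr aP; rewrite a0 eqxx.
Qed.

Lemma simple_pos a : a \in S -> nonneg_comb a.
Proof.
move=> aS; apply: cone_root; first exact: simple_root.
have [i ->] := simpleP aS; apply/coneP; split=> [|j].
  by rewrite memv_span // mem_nth.
by rewrite cf_simple // ler0n.
Qed.

Lemma root_span a : a \in Phi -> a \in <<S>>%VS.
Proof.
by move=> /pos_or[|] /andP[aS _] //; rewrite -memvN.
Qed.

Definition ht x := \sum_i cf i x.

Lemma htD x y : ht (x + y) = ht x + ht y.
Proof. by rewrite /ht -big_split; apply: eq_bigr => i _; rewrite linearD. Qed.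

Lemma htZ c x : ht (c *: x) = c * ht x.
Proof. by rewrite /ht mulr_sumr; apply: eq_bigr => i _; rewrite linearZ. Qed.

Lemma ht0 : ht 0 = 0.
Proof. by rewrite -(scale0r 0) htZ mul0r. Qed.

Lemma htN x : ht (- x) = - ht x.
Proof. by rewrite -scaleN1r htZ mulN1r. Qed.

Lemma ht_sum (I : Type) (r : seq I) (P : pred I) (F : I -> E) :
  ht (\sum_(i <- r | P i) F i) = \sum_(i <- r | P i) ht (F i).
Proof. exact: (big_morph _ htD ht0). Qed.

Lemma ht_simple a : a \in S -> ht a = 1.
Proof.
move=> /simpleP[i ->]; rewrite /ht (bigD1 i) //= cf_simple // eqxx big1 ?addr0 //.
by move=> j ji; rewrite cf_simple // eq_sym (negPf ji).
Qed.

Lemma cone_ht0 x : cone x -> ht x = 0 -> x = 0.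
Proof.
move=> /coneP[xS x0] /eqP; rewrite psumr_eq0 // => /allP h.
rewrite (cf_span xS) big1 // => i _.
have /eqP -> := h i (mem_index_enum _); exact: scale0r.
Qed.

Lemma pos_ht a : nonneg_comb a -> exists n : nat, ht a = n%:R.
Proof.
move=> /andP[_ /forallP an]; apply/natrP; rewrite /ht.
by apply: rpred_sum => i _.
Qed.

Lemma posroot_ht a : a \in Phi -> nonneg_comb a -> 1 <= ht a.
Proof.
move=> aP a0; have [[|n] an] := pos_ht a0; last by rewrite an ler1n.
have := root_neq0 hr aP; by rewrite (cone_ht0 (pos_cone a0) an) eqxx.
Qed.

Lemma posroot_ht1 a : a \in Phi -> nonneg_comb a -> ht a = 1 -> a \in S.
Proof.
move=> aP /andP[aS /forallP an] a1.
have [i ai0] : exists i, cf i a != 0.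
  apply/existsP; rewrite -negb_forall; apply/negP => /forallP a0.
  have := root_neq0 hr aP; rewrite (cf_span aS) big1 ?eqxx // => i _.
  by rewrite (eqP (a0 i)) scale0r.
have ai1 : 1 <= cf i a.
  by case/natrP: (an i) ai0 => -[|n] ->; rewrite ?eqxx // ler1n.
move: a1; rewrite /ht (bigD1 i) //=; set s := \sum_(_ | _) _ => a1.
have s0 : 0 <= s by apply: sumr_ge0 => j _; apply: natr_ge0.
have se : s = 0 by lra.
have ae : cf i a = 1 by lra.
have /allP h : all (fun j => (j != i) ==> (cf j a == 0)) (index_enum 'I_(size S)).
  by rewrite -psumr_eq0 -/s ?se ?eqxx // => j _; apply: natr_ge0.
rewrite (cf_span aS) (bigD1 i) //= ae scale1r big1 ?addr0 ?mem_nth // => j ji.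
by have /implyP/(_ ji)/eqP -> := h j (mem_index_enum _); rewrite scale0r.
Qed.

(** By reducedness [a] has a positive coefficient at a simple root other than [s]. The reflection
    leaves that coefficient alone, and a root with one positive coefficient is positive. *)
Lemma simple_refl_pos s a : s \in S -> a \in Phi -> nonneg_comb a -> a != s ->
  nonneg_comb (reflect s a).
Proof.
move=> sS aP a0 as_; have sP := simple_root hr sS.
have [i si] := simpleP sS; have /andP[aS /forallP an] := a0.
have [j ji aj0] : exists2 j, j != i & cf j a != 0.
  apply/exists_inP; rewrite -[X in is_true X]negbK negb_exists_in.
  apply/negP => /forall_inP h.
  have ae : a = cf i a *: s.
    rewrite {1}(cf_span aS) (bigD1 i) //= -si big1 ?addr0 // => j ji.
    by have := h j ji; rewrite negbK => /eqP ->; rewrite scale0r.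
  have := aP; rewrite ae => /(ra_red hr sP)[] c1.
    by move: as_; rewrite ae c1 scale1r eqxx.
  by have := pos_cone a0 => /coneP[_ /(_ i)]; rewrite c1 oppr_ge0 ler10.
case: (pos_or (ra_refl hr sP aP)) => // /pos_cone/coneP[_ /(_ j)].
rewrite linearN /reflect linearB linearZ /= {2}si cf_simple //.
rewrite eq_sym (negPf ji) mulr0 subr0 oppr_ge0 => aj.
have := natr_ge0 (an j) => aj'.
by move: aj0; rewrite eq_le aj aj'.
Qed.

Section Levi.
Variable Sbar : seq E.
Hypothesis hS : {subset Sbar <= S}.
Local Notation Rp := (Rbar_pos Sbar).
Local Notation rho := (rhobar Sbar).

Lemma mem_Rp a : (a \in Rp) = [&& a \in Phi, a \in <<Sbar>>%VS & nonneg_comb a].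
Proof. by rewrite !mem_filter andbA andbC [nonneg_comb a && _]andbC. Qed.

Lemma Rp_root a : a \in Rp -> a \in Phi. Proof. by rewrite mem_Rp => /and3P[]. Qed.
Lemma Rp_span a : a \in Rp -> a \in <<Sbar>>%VS. Proof. by rewrite mem_Rp => /and3P[]. Qed.
Lemma Rp_pos a : a \in Rp -> nonneg_comb a. Proof. by rewrite mem_Rp => /and3P[]. Qed.

Lemma Rp_uniq : uniq Rp. Proof. by rewrite !filter_uniq // (ra_uniq hr). Qed.

Lemma Sbar_root s : s \in Sbar -> s \in Phi.
Proof. by move=> /hS; apply: simple_root. Qed.

Lemma Sbar_Rp s : s \in Sbar -> s \in Rp.
Proof.
move=> sS; rewrite mem_Rp Sbar_root // memv_span // simple_pos //; exact: hS.
Qed.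

Lemma cf_out x (i : 'I_(size S)) : x \in <<Sbar>>%VS -> S`_i \notin Sbar -> cf i x = 0.
Proof.
move=> /(@coord_span _ _ _ (in_tuple Sbar)) ->; move=> iS.
rewrite linear_sum big1 // => j _; rewrite linearZ /=.
have jS : Sbar`_j \in Sbar by rewrite mem_nth.
have [k jk] := simpleP (hS jS); rewrite jk cf_simple //.
case: (eqVneq k i) => [ki|_]; last by rewrite mulr0.
by move: iS; rewrite -ki -jk jS.
Qed.

Lemma span_Sbar x : x \in <<S>>%VS -> (forall i : 'I_(size S), S`_i \notin Sbar -> cf i x = 0) ->
  x \in <<Sbar>>%VS.
Proof.
move=> xS h; rewrite (cf_span xS); apply: memv_suml => i _.
have [iS|iS] := boolP (S`_i \in Sbar); first by rewrite memvZ // memv_span.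
by rewrite (h i iS) scale0r mem0v.
Qed.
End Levi.
End Positive.

(** * Weyl groups and dominance *)

Section WeylBasics.
Variables (R : realType) (X : lie_datum R).
Local Notation E := (euc X).
Local Notation S := (simple_roots X).
Local Notation Phi := (root_set X).
Implicit Types (a b x y z : E) (bf : E -> E -> R) (A : seq E).
Hypothesis hr : root_axioms X.

Lemma weylD A w : in_weyl A w -> {morph w : x y / x + y}.
Proof. by elim=> // a w' _ _ IH x y /=; rewrite IH reflectD. Qed.

Lemma weylZ A w : in_weyl A w -> forall c x, w (c *: x) = c *: w x.
Proof. by elim=> // a w' _ _ IH c x /=; rewrite IH reflectZ. Qed.

Lemma weyl0 A w : in_weyl A w -> w 0 = 0.
Proof. by move=> /weylZ/(_ 0 0); rewrite !scale0r. Qed.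

Lemma weylN A w : in_weyl A w -> {morph w : x / - x}.
Proof. by move=> /weylZ h x; rewrite -scaleN1r h scaleN1r. Qed.

Lemma weylB A w : in_weyl A w -> {morph w : x y / x - y}.
Proof. by move=> h x y; rewrite (weylD h) (weylN h). Qed.

Lemma weyl_sum A w (I : Type) (r : seq I) (P : pred I) (F : I -> E) :
  in_weyl A w ->
  w (\sum_(i <- r | P i) F i) = \sum_(i <- r | P i) w (F i).
Proof. by move=> h; apply: (big_morph w (weylD h) (weyl0 h)). Qed.

Lemma weyl_comp A w w' : in_weyl A w -> in_weyl A w' -> in_weyl A (w \o w').
Proof. by move=> hw hw'; elim: hw => // a v aA _ IH; apply: weyl_refl aA IH. Qed.

Lemma weyl1 A a : a \in A -> in_weyl A (reflect a).
Proof. by move=> aA; apply: weyl_refl aA (weyl_id A). Qed.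

Lemma weyl_sub A B w : {subset A <= B} -> in_weyl A w -> in_weyl B w.
Proof.
move=> AB; elim=> [|a v aA _ IH]; first exact: weyl_id.
exact: weyl_refl (AB _ aA) IH.
Qed.

Variable A : seq E.
Hypothesis AP : {subset A <= Phi}.

Lemma weyl_iso bf w x y : wform bf -> in_weyl A w -> bf (w x) (w y) = bf x y.
Proof. by move=> hb; elim=> // a v /AP aP _ /= <-; apply: wf_reflect. Qed.

Lemma weyl_copair w x a : in_weyl A w -> copair (w x) (w a) = copair x a.
Proof. by move=> hw; rewrite /copair !(weyl_iso _ _ (ipW hr) hw). Qed.

Lemma weyl_inv w : in_weyl A w ->
  exists2 w', in_weyl A w' & cancel w w' /\ cancel w' w.
Proof.
elim=> [|a v aA hv [w' hw' [vK wK]]]; first by exists id; first exact: weyl_id.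
have aK := reflectK (root_neq0 hr (AP aA)).
exists (w' \o reflect a); first by apply: weyl_comp hw' (weyl1 aA).
by split=> x /=; [rewrite aK vK|rewrite wK aK].
Qed.

Lemma weyl_root w a : in_weyl A w -> a \in Phi -> w a \in Phi.
Proof. by move=> hw aP; elim: hw => //= b v /AP bP _ vP; apply: ra_refl. Qed.

Lemma weyl_reflect w a x : in_weyl A w -> w (reflect a x) = reflect (w a) (w x).
Proof.
by move=> hw; rewrite /reflect (weylB hw) (weylZ hw) (weyl_copair _ _ hw).
Qed.

Lemma wt_int b a c : wt_lattice b -> a \in Phi -> c \is a Num.int ->
  wt_lattice (b + c *: a).
Proof.
have nat_case d : d \in Phi -> forall (n : nat) b, wt_lattice b ->
    wt_lattice (b + n%:R *: d).
  move=> dP; elim=> [|n IH] b' wb; first by rewrite scale0r addr0.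
  by rewrite -natr1 scalerDl scale1r addrA; apply: (ra_wtD hr) dP; apply: IH.
move=> wb aP /intrP[[n|n] ->]; first exact: nat_case aP _ _ wb.
rewrite NegzE mulrNz scaleNr -scalerN; exact: nat_case (oppr_root hr aP) _ _ wb.
Qed.

Lemma weyl_wt w b : in_weyl A w -> wt_lattice b -> wt_lattice (w b).
Proof.
move=> hw wb; elim: hw => //= a v /AP aP _ wv.
rewrite /reflect -scaleNr; apply: wt_int => //.
by rewrite rpredN; apply: (ra_wt hr).
Qed.

End WeylBasics.

Section Dominance.
Variables (R : realType) (X : lie_datum R).
Local Notation E := (euc X).
Local Notation S := (simple_roots X).
Local Notation Phi := (root_set X).
Local Notation cf := (coord (in_tuple S)).
Implicit Types (a b x y z : E) (bf : E -> E -> R) (A : seq E).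
Hypothesis hr : root_axioms X.

Definition dom A x := all (fun a => 0 <= copair x a) A.

Section LeviDom.
Variable Sbar : seq E.
Hypothesis hS : {subset Sbar <= S}.
Local Notation Rp := (Rbar_pos Sbar).
Local Notation rho := (rhobar Sbar).
Let SP : {subset Sbar <= Phi}. Proof. by move=> s; apply: Sbar_root. Qed.

Lemma dom_ge0 bf x y : wform bf -> dom Sbar x -> y \in <<Sbar>>%VS -> cone y ->
  0 <= bf x y.
Proof.
move=> hb /allP xd yS /coneP[yS' y0]; rewrite (cf_span yS') (wf_sumr hb).
apply: sumr_ge0 => i _; rewrite (wfZr hb).
have [iS|iS] := boolP (S`_i \in Sbar); last by rewrite (cf_out hr hS yS iS) mul0r.
by rewrite mulr_ge0 // -(copair_sign hr) ?SP //; apply: xd.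
Qed.

Lemma dom_gt0 bf x y : wform bf -> {in Sbar, forall a, 0 < copair x a} ->
  y \in <<Sbar>>%VS -> cone y -> y != 0 -> 0 < bf x y.
Proof.
move=> hb xd yS yc y0; rewrite lt0r dom_ge0 ?andbT //; last first.
  by apply/allP => a /xd/ltW.
have /coneP[yS' yn] := yc; apply: contraNneq y0 => xy0.
rewrite (cf_span yS') big1 // => i _.
have [iS|iS] := boolP (S`_i \in Sbar); last by rewrite (cf_out hr hS yS iS) scale0r.
have : \sum_i bf x (cf i y *: S`_i) == 0 by rewrite -(wf_sumr hb) -(cf_span yS') xy0.
rewrite psumr_eq0 => [/allP/(_ i (mem_index_enum _))|j _]; last first.
  rewrite (wfZr hb); have [jS|jS] := boolP (S`_j \in Sbar).
    by rewrite mulr_ge0 // -(copair_sign hr) ?SP // ltW // xd.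
  by rewrite (cf_out hr hS yS jS) mul0r.
have := xd _ iS; rewrite (copair_sign_gt hr _ hb) ?SP // => /gt_eqF xi.
by rewrite implyTb (wfZr hb) mulf_eq0 xi orbF => /eqP ->; rewrite scale0r.
Qed.

Lemma refl_Rp s a : s \in Sbar -> a \in Rp -> a != s -> reflect s a \in Rp.
Proof.
move=> sS; rewrite !mem_Rp // => /and3P[aP aS a0] as_.
apply/and3P; split; first by apply: (ra_refl hr) => //; apply: SP.
  by rewrite memvB // memvZ // memv_span.
exact: (simple_refl_pos hr (hS sS)).
Qed.

Lemma refl_rem s : s \in Sbar ->
  perm_eq (map (reflect s) (rem s Rp)) (rem s Rp).
Proof.
move=> sS; have sK := reflectK (root_neq0 hr (SP sS)).
have uR := Rp_uniq hr Sbar.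
have mem_sub : {subset map (reflect s) (rem s Rp) <= rem s Rp}.
  move=> _ /mapP[a + ->]; rewrite !mem_rem_uniq // !inE => /andP[as_ aR].
  rewrite refl_Rp // andbT; apply: contraTneq (Rp_pos aR) => sa.
  rewrite -[a]sK sa reflectxx ?(root_neq0 hr) ?SP //.
  by rewrite pos_notN // ?SP // simple_pos // hS.
apply: uniq_perm; rewrite ?(map_inj_uniq (inv_inj sK)) ?rem_uniq // => a.
apply/idP/idP => [/mem_sub //|aR].
rewrite -[a]sK map_f //; apply: mem_sub; exact: map_f.
Qed.

Lemma perm_Rp s : s \in Sbar -> perm_eq Rp (s :: rem s Rp).
Proof. by move=> sS; apply: perm_to_rem; apply: Sbar_Rp. Qed.

Lemma reflect_rho s : s \in Sbar -> reflect s rho = rho - s.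
Proof.
move=> sS; rewrite /rhobar reflectZ reflect_sum.
rewrite !(perm_big _ (perm_Rp sS)) !big_cons /= reflectxx ?(root_neq0 hr) ?SP //.
rewrite -(big_map (reflect s) xpredT id) (perm_big _ (refl_rem sS)) /=.
rewrite !scalerDr addrAC; congr (_ + _).
rewrite -[X in _ = _ - X]scale1r -scalerBl -scaleN1r scalerA; congr (_ *: _).
by field.
Qed.

Lemma copair_rho s : s \in Sbar -> copair rho s = 1.
Proof.
move=> sS; have := reflect_rho sS; rewrite /reflect => /addrI/oppr_inj.
move=> /eqP; rewrite -[X in _ == X]scale1r -subr_eq0 -scalerBl scaler_eq0.
by rewrite (negPf (root_neq0 hr (SP sS))) orbF subr_eq0 => /eqP.
Qed.

(** Induction on the number of positive roots of the Levi that pair negatively with [x]: reflecting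
    in an offending [s] permutes the other positive roots and makes the pairing with [s]
    positive. *)
Lemma weyl_dom x : exists2 w, in_weyl Sbar w &
  [/\ dom Sbar (w x), cone (w x - x) & w x - x \in <<Sbar>>%VS].
Proof.
have [n] := ubnP (count (fun a => copair x a < 0) Rp).
elim: n x => // n IH x; rewrite ltnS => le_n.
have [xd|/allPn[s sS]] := boolP (dom Sbar x).
  exists id; first exact: weyl_id.
  by rewrite subrr cone0 mem0v.
rewrite -ltNge => xs; have sP := SP sS; have s0 := root_neq0 hr sP.
have [|w hw [wd wc wS]] := IH (reflect s x).
  apply: leq_trans le_n; rewrite !(seq.permP (perm_Rp sS)) /= xs.
  rewrite copair_reflect // oppr_lt0 ltNge (ltW xs) add0n add1n ltnS.
  rewrite -(seq.permP (refl_rem sS)) count_map leq_eqVlt; apply/orP; left.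
  by apply/eqP/eq_count => a /=; rewrite copair_reflect2.
exists (w \o reflect s); first exact: weyl_comp hw (weyl1 sS).
have step : reflect s x - x = - copair x s *: s.
  by rewrite /reflect addrAC subrr add0r scaleNr.
rewrite /= -(subrKA (reflect s x)) step; split=> //.
  apply: coneD wc _; apply: coneZ; first by rewrite oppr_ge0 ltW.
  by apply/pos_cone/simple_pos => //; apply: hS.
by rewrite memvD // memvZ // memv_span.
Qed.

Lemma subsums_Rp g : g \in subsums Rp ->
  [/\ cone g, g \in <<Sbar>>%VS, cone (2 *: rho - g),
      forall a, a \in Phi -> copair g a \is a Num.int &
      forall b, wt_lattice b -> wt_lattice (b + g)].
Proof.
rewrite /rhobar scalerA divff ?pnatr_eq0 // scale1r.
have : {subset Rp <= Rp} by [].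
elim: {1 3 4}Rp g => [|a s IH] g sub /=.
  rewrite inE => /eqP ->; rewrite big_nil subr0 cone0 mem0v; split=> //.
    by move=> a _; rewrite copair0l.
  by move=> b; rewrite addr0.
have aR : a \in Rp by apply: sub; rewrite mem_head.
have /pos_cone ac := Rp_pos aR.
have sub' : {subset s <= Rp} by move=> b bs; apply: sub; rewrite inE bs orbT.
rewrite big_cons mem_cat => /orP[/(IH _ sub')[c1 c2 c3 c4 c5]|].
  by split=> //; rewrite -addrA; apply: coneD.
move=> /mapP[h /(IH _ sub')[c1 c2 c3 c4 c5] ->]; split.
- exact: coneD.
- by rewrite memvD // Rp_span.
- by rewrite opprD [- h - a]addrC addrACA subrr add0r.
- move=> b bP; rewrite copairDl; apply: rpredD; first exact: c4.
  exact: (ra_int hr) (Rp_root aR).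
- by move=> b wb; rewrite addrA; exact: (ra_wtD hr (c5 _ wb) (Rp_root aR)).
Qed.

Local Notation alt := (altcoef R Rp).

(** The reflection permutes the factors 1 - e^a with a different from s, and turns 1 - e^s into 1 -
    e^(-s) = - e^(-s) (1 - e^s). *)
Lemma alt_refl s g : s \in Sbar -> alt (s + reflect s g) = - alt g.
Proof.
move=> sS; have s0 := root_neq0 hr (SP sS).
rewrite /altcoef !(altsum_perm _ (perm_Rp sS)) /= opprB; congr (_ - _).
  rewrite -(altsum_perm _ (refl_rem sS)) (altsum_map _ _ (reflect0 s) (reflectD s)).
  apply: eq_altsum => x /=; congr (_%:R); congr nat_of_bool.
  rewrite -subr_eq -(inj_eq (inv_inj (reflectK s0))) reflectB.
  rewrite !reflectK // reflectxx // subr_eq [- s + g]addrC eq_sym subr_eq.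
  exact: eq_sym.
rewrite -(altsum_perm _ (refl_rem sS)) (altsum_map _ _ (reflect0 s) (reflectD s)).
apply: eq_altsum => x /=; congr (_%:R); congr nat_of_bool.
by rewrite [_ + s]addrC (inj_eq (addrI s)) (inj_eq (inv_inj (reflectK s0))).
Qed.

(** The map from g to [rho - w (rho - g)] is the action of w centred at rho. An unspecified sign is
    enough, since only vanishing is at stake. *)
Lemma alt_weyl_sign w g : in_weyl Sbar w ->
  alt (rho - w (rho - g)) = alt g \/ alt (rho - w (rho - g)) = - alt g.
Proof.
elim=> [|s v sS _ IH]; first by left; rewrite opprB addrC subrK.
move: IH; rewrite /=; move: (v _) => z IH.
have -> : rho - reflect s z = s + reflect s (rho - z).
  by rewrite reflectB reflect_rho // addrA [s + _]addrCA subrr addr0.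
by rewrite alt_refl //; case: IH => ->; [right|left; rewrite opprK].
Qed.

(** The support in Weyl's denominator formula. Move rho - g into the dominant chamber, giving rho -
    g'. Each simple s has (g', s^vee) <= 1 by dominance, and the value 1 is impossible because then
    [alt_refl] reads alt g' = - alt g'. So (g', s^vee) <= 0 for all s while g' is a sum of positive
    roots; hence (g', g') <= 0 and g' = 0. *)
Lemma alt_weyl g : alt g != 0 -> exists2 w, in_weyl Sbar w & g = rho - w rho.
Proof.
move=> ag; have [w hw [wd _ _]] := weyl_dom (rho - g).
have [w' hw' [wK w'K]] := weyl_inv hr SP hw.
exists w' => //; set g' := rho - w (rho - g).
have ag' : alt g' != 0.
  by case: (alt_weyl_sign g hw) => ->; rewrite ?oppr_eq0.
have [gc gS _ gi _] := subsums_Rp (altcoef_subsum ag').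
suff g0 : g' = 0.
  have -> : rho = w (rho - g) by apply/eqP; rewrite -subr_eq0 -/g' g0.
  by rewrite wK {1}(_ : w _ = rho) ?subKr //; apply/esym/eqP; rewrite -subr_eq0 -/g' g0.
have we : w (rho - g) = rho - g' by rewrite subKr.
have cle s : s \in Sbar -> copair g' s <= 0.
  move=> sS; have := allP wd _ sS; rewrite we copairBl copair_rho // subr_ge0.
  have /intrP[m ms] := gi s (SP sS); rewrite ms -[X in _ <= X -> _]/(1%:~R) -[0]/(0%:~R).
  rewrite !ler_int; case: (eqVneq m 1) => [m1 _|]; last by lia.
  have := alt_refl g' sS.
  rewrite (_ : s + reflect s g' = g') => [/eqP|]; last first.
    by rewrite /reflect ms m1 scale1r addrC subrK.
  by rewrite -subr_eq0 opprK -mulr2n mulrn_eq0 (negPf ag').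
apply/eqP; rewrite -(wf_eq0 (ipW hr)) eq_le (wf_ge0 (ipW hr)) andbT.
rewrite -oppr_ge0 -(wfNl (ipW hr)); apply: dom_ge0 (ipW hr) _ gS gc.
by apply/allP => s sS; rewrite copairNl oppr_ge0 cle.
Qed.

(** Used in the form (g, g) = 2 (g, rho), which makes norms of the mu + g affine in g. *)
Lemma alt_norm bf g : wform bf -> alt g != 0 ->
  bf (g - rho) (g - rho) = bf rho rho.
Proof.
move=> hb /alt_weyl[w hw ->]; rewrite addrAC subrr add0r (wfNl hb) (wfNr hb) opprK.
exact: (weyl_iso SP _ _ hb hw).
Qed.

(** Positive roots lie in a pointed cone, so only the empty subset sums to 0. *)
Lemma alt0 : alt 0 = 1.
Proof.
have : {subset Rp <= Rp} by [].
rewrite /altcoef; elim: {1 3}Rp => [|a s IH] sub /=; first by rewrite eqxx.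
have aR : a \in Rp by apply: sub; rewrite mem_head.
have sub' : {subset s <= Rp} by move=> b bs; apply: sub; rewrite inE bs orbT.
rewrite IH // (_ : altsum s _ = 0) ?subr0 // -[RHS](altsum0 R s).
apply: eq_in_altsum => x xs; case: eqP => // /eqP; rewrite addr_eq0 => /eqP xa.
have a0 := root_neq0 hr (Rp_root aR).
suff xc : cone x.
  have := cone_anti (pos_cone (Rp_pos aR)); rewrite -xa => /(_ xc) a0'.
  by rewrite a0' eqxx in a0.
elim: s x xs sub' {IH sub xa} => [|b s IH] x /=.
  by rewrite inE => /eqP -> _; apply: cone0.
rewrite mem_cat => h sub'.
have sub'' : {subset s <= Rp} by move=> c cs; apply: sub'; rewrite inE cs orbT.
case/orP: h => [xs|/mapP[y ys ->]]; first exact: IH.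
by apply: coneD; [apply: IH|apply/pos_cone/Rp_pos/sub'/mem_head].
Qed.

Lemma alt_simple s : s \in Sbar -> alt s != 0.
Proof.
move=> sS; have := alt_refl 0 sS; rewrite reflect0 addr0 alt0 => ->.
by rewrite oppr_eq0 oner_eq0.
Qed.

(** Taking complements of subsets exchanges the sums 0 and 2 rho, up to a global sign. *)
Lemma alt_2rho : alt (2 *: rho) != 0.
Proof.
have rev (s : seq E) f : altsum s (fun x => f (\sum_(a <- s) a - x)) =
    (-1) ^+ size s * altsum s f :> R.
  elim: s f => [|a s IH] f /=; first by rewrite big_nil subr0 mul1r.
  rewrite big_cons exprS -mulrA mulrBr -IH -(IH (fun x => f (x + a))).
  rewrite mulN1r opprB; congr (_ - _); apply: eq_altsum => x.
    by congr f; rewrite [a + _]addrC addrAC.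
  by congr f; rewrite [x + a]addrC opprD addrACA subrr add0r.
have := rev Rp (fun x => (x == 0)%:R); rewrite -/(alt 0) alt0 mulr1.
rewrite /rhobar scalerA divff ?pnatr_eq0 // scale1r => h.
rewrite /altcoef; under eq_altsum => x do rewrite eq_sym -subr_eq0.
by rewrite h signr_eq0.
Qed.

Lemma alt_cone g : alt g != 0 ->
  [/\ cone g, g \in <<Sbar>>%VS, cone (2 *: rho - g),
      forall a, a \in Phi -> copair g a \is a Num.int &
      forall b, wt_lattice b -> wt_lattice (b + g)].
Proof. by move=> ag; apply/subsums_Rp/(altcoef_subsum ag). Qed.

Lemma rho_span : 2 *: rho \in <<Sbar>>%VS.
Proof.
rewrite memvZ // memvZ // big_seq; apply: memv_suml => a aR; exact: Rp_span.
Qed.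
End LeviDom.
End Dominance.

(** * The closed chamber as a fundamental domain *)

Section Chambers.
Variables (R : realType) (X : lie_datum R).
Local Notation E := (euc X).
Local Notation S := (simple_roots X).
Local Notation Phi := (root_set X).
Local Notation cf := (coord (in_tuple S)).
Implicit Types (a b x y z : E) (bf : E -> E -> R) (A : seq E).
Hypothesis hr : root_axioms X.

Let SP : {subset S <= Phi}. Proof. by move=> s; apply: simple_root. Qed.
Let SS : {subset S <= S}. Proof. by []. Qed.

Definition wword A : E -> E := foldr (fun a f => reflect a \o f) id A.

Lemma wword_weyl A B : {subset A <= B} -> in_weyl B (wword A).
Proof.
elim: A => [|a A IH] AB; first exact: weyl_id.
apply: weyl_refl; first by apply: AB; rewrite mem_head.
by apply: IH => b bA; apply: AB; rewrite inE bA orbT.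
Qed.

Lemma weyl_wword B w : in_weyl B w -> exists2 A, {subset A <= B} & w = wword A.
Proof.
elim=> [|a v aB _ [A AB ->]]; first by exists nil.
by exists (a :: A) => // b; rewrite inE => /orP[/eqP -> //|/AB].
Qed.

Lemma wword_cat A B x : wword (A ++ B) x = wword A (wword B x).
Proof. by elim: A => //= a A ->. Qed.

(** The exchange condition. Follow [s] through the word from the right: at the letter where the
    image turns negative it equals that letter, the only positive root that this reflection makes
    negative. Then [s] cancels against this letter. *)
Lemma exchange A s : {subset A <= S} -> s \in S -> nonneg_comb (- wword A s) ->
  exists A', [/\ {subset A' <= S}, (size A' < size A)%N &
                 forall x, wword A (reflect s x) = wword A' x].
Proof.
elim: A => [|a A IH] AS sS /= neg.
  by move: neg; rewrite (pos_notN hr (SP sS)) // simple_pos.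
have AS' : {subset A <= S} by move=> b bA; apply: AS; rewrite inE bA orbT.
have aS : a \in S by apply: AS; rewrite mem_head.
have hw := wword_weyl AS'.
have bP : wword A s \in Phi by apply: weyl_root hw _ => //; apply: SP.
case: (pos_or hr bP) => [b0|/(IH AS' sS)[A' [A'S sz eA]]]; last first.
  exists (a :: A'); split=> //=; last by move=> x; rewrite eA.
  by move=> b; rewrite inE => /orP[/eqP -> //|/A'S].
have ba : wword A s = a.
  apply: contraTeq neg => ba; rewrite pos_notN //; last exact: simple_refl_pos.
  by apply: (ra_refl hr) => //; apply: SP.
exists A; split=> // x; rewrite (weyl_reflect hr SP _ _ hw) ba reflectK //.
exact: root_neq0 (SP aS).
Qed.

Lemma dom_uniqS A x : {subset A <= S} -> dom S x -> dom S (wword A x) ->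
  wword A x = x.
Proof.
have [n] := ubnP (size A); elim: n A => // n IH A.
case/lastP: A => // A s; rewrite size_rcons !ltnS => le_n AS dx dy.
have AS' : {subset A <= S}.
  by move=> b bA; apply: AS; rewrite mem_rcons inE bA orbT.
have sS : s \in S by apply: AS; rewrite mem_rcons mem_head.
have e z : wword (rcons A s) z = wword A (reflect s z).
  by rewrite -cats1 wword_cat.
have hw := wword_weyl AS'.
have bP : wword A s \in Phi by apply: weyl_root hw _ => //; apply: SP.
case: (pos_or hr bP) => [b0|/(exchange AS' sS)[A' [A'S sz eA]]]; last first.
  rewrite e eA; apply: IH => //; first exact: ltn_trans sz le_n.
  by rewrite -eA -e.
suff xs : reflect s x = x by rewrite e xs; apply: IH => //; rewrite -[x in wword A x]xs -e.
have : 0 <= ip X (wword (rcons A s) x) (wword A s).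
  apply: (dom_ge0 hr SS (ipW hr)) => //; last exact: pos_cone.
  exact: root_span.
rewrite e (weyl_iso SP _ _ (ipW hr) hw) -(copair_sign hr _ (ipW hr)) ?SP //.
rewrite copair_reflect ?(root_neq0 hr) ?SP // oppr_ge0 => xs0.
have := allP dx s sS => xs1; have xs : copair x s = 0.
  by apply/eqP; rewrite eq_le xs0 xs1.
by rewrite /reflect xs scale0r subr0.
Qed.

(** Since (a, a) > 0, some simple root pairs positively with [a]; reflecting in it lowers the height
    and keeps the root positive unless [a] is that simple root. *)
Lemma posroot_conj a : a \in Phi -> nonneg_comb a ->
  exists w s, [/\ in_weyl S w, s \in S & a = w s].
Proof.
move=> aP a0; have [n an] := pos_ht a0; have [m] := ubnPleq n.
elim: m a n aP a0 an => [|m IH] a n aP a0 an le_nm.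
  have := posroot_ht hr aP a0; rewrite an; move: le_nm.
  by rewrite leqn0 => /eqP ->; rewrite ler10.
have [aS|aS] := boolP (a \in S).
  by exists id, a; split=> //; exact: weyl_id.
have /hasP[s sS as0] : has (fun s => 0 < copair a s) S.
  apply: contraT; rewrite -all_predC => /allP h.
  have a_neq0 := root_neq0 hr aP.
  have : 0 <= ip X (- a) a.
    apply: (dom_ge0 hr SS (ipW hr)); last exact: pos_cone.
      by apply/allP => s /h /=; rewrite -leNgt copairNl oppr_ge0.
    exact: root_span.
  by rewrite (wfNl (ipW hr)) oppr_ge0 leNgt (wf_gt0 (ipW hr)).
have as_ : a != s by apply: contraNneq aS => ->.
have a'P : reflect s a \in Phi by apply: (ra_refl hr) => //; apply: SP.
have a'0 := simple_refl_pos hr sS aP a0 as_.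
have [k ak] := pos_ht a'0.
have [|w [s' [hw s'S e]]] := IH (reflect s a) k a'P a'0 ak.
  move: ak; rewrite /reflect htD htN htZ (ht_simple hr sS) mulr1 an => e.
  have : (k%:R : R) < n%:R by rewrite -e ltrBlDr ltrDl.
  by rewrite ltr_nat => lt_kn; rewrite -ltnS; apply: leq_trans lt_kn le_nm.
exists (reflect s \o w), s'; split=> //; first exact: weyl_refl sS hw.
by rewrite /= -e reflectK // root_neq0 // SP.
Qed.

Lemma weyl_simple w : in_weyl Phi w -> in_weyl S w.
Proof.
elim=> [|a v aP _ hv]; first exact: weyl_id.
suff hrefl b : b \in Phi -> nonneg_comb b -> in_weyl S (reflect b).
  apply: weyl_comp hv; case: (pos_or hr aP) => a0; first exact: hrefl.
  have -> : reflect a = reflect (- a) by apply/funext => x; rewrite reflectNl.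
  exact: hrefl (oppr_root hr aP) a0.
move=> bP b0; have [u [s [hu sS ->]]] := posroot_conj bP b0.
have [u' hu' [uK u'K]] := weyl_inv hr SP hu.
rewrite (_ : reflect (u s) = u \o (reflect s \o u')); last first.
  by apply/funext => x /=; rewrite (weyl_reflect hr SP _ _ hu) u'K.
by apply: weyl_comp hu _; apply: weyl_refl.
Qed.

Lemma dom_uniq w x : in_weyl Phi w -> dom S x -> dom S (w x) -> w x = x.
Proof. by move=> /weyl_simple/weyl_wword[A AS ->]; apply: dom_uniqS. Qed.

Lemma weyl_domS x : exists2 w, in_weyl Phi w & dom S (w x) /\ cone (w x - x).
Proof.
have [w hw [wd wc _]] := weyl_dom hr SS x.
by exists w => //; apply: weyl_sub hw.
Qed.

Lemma dom_max w x : in_weyl Phi w -> dom S x -> cone (x - w x).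
Proof.
move=> hw dx; have [v hv [vd vc]] := weyl_domS (w x).
have vwx := dom_uniq (weyl_comp hv hw) dx vd.
by move: vc; rewrite -[v (w x)]/((v \o w) x) vwx.
Qed.

Lemma dom_norm_lt bf x y : wform bf -> dom S x -> dom S y -> cone (x - y) ->
  x != y -> bf y y < bf x x.
Proof.
move=> hb dx dy c xy; rewrite -subr_gt0.
have -> : bf x x - bf y y = bf (x - y) (x - y) + 2 * bf y (x - y).
  by rewrite !(wfE hb) (wfC hb y x); ring.
rewrite ltr_pwDl ?(wf_gt0 hb) ?subr_eq0 // mulr_ge0 //.
apply: (dom_ge0 hr SS hb) => //; by case/coneP: c.
Qed.

(** The difference of the two norms is (x + y + 2 rho, x - y), and x + y + 2 rho is strictly
    dominant. This separates the Casimir values of comparable dominant weights. *)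
Lemma dom_rho_norm_lt Sbar bf x y : {subset Sbar <= S} -> wform bf ->
  dom Sbar x -> dom Sbar y -> cone (x - y) -> x - y \in <<Sbar>>%VS -> x != y ->
  bf (y + rhobar Sbar) (y + rhobar Sbar) < bf (x + rhobar Sbar) (x + rhobar Sbar).
Proof.
move=> hS hb dx dy c xyS xy; rewrite -subr_gt0.
have hrho s : s \in Sbar -> copair (rhobar Sbar) s = 1 by apply: copair_rho.
move: (rhobar Sbar) hrho => r hrho.
have -> : bf (x + r) (x + r) - bf (y + r) (y + r) =
    bf (x + y + 2 *: r) (x - y).
  by rewrite !(wfE hb) (wfC hb y x) (wfC hb r x) (wfC hb r y); ring.
apply: (dom_gt0 hr hS hb) => //; last by rewrite subr_eq0.
move=> s sS; rewrite !copairDl copairZl hrho // mulr1.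
by rewrite ltr_wpDl // addr_ge0 ?(allP dx) ?(allP dy).
Qed.
End Chambers.

(** * Linear algebra *)

Section Trace.
Variable K : fieldType.

(** The trace of [f] on a subspace. As [f] is a bare function, it is only meaningful where [f] is
    linear and keeps [W] stable. *)
Definition trs (V : vectType K) (W : {vspace V}) (f : V -> V) : K :=
  \sum_(i < \dim W) coord (vbasis W) i (f (vbasis W)`_i).

Lemma trs_exchange (V V' : vectType K) (W : {vspace V}) (W' : {vspace V'})
    (f : {linear V -> V'}) (g : {linear V' -> V}) :
    {in W, forall v, f v \in W'} -> {in W', forall v, g v \in W} ->
  trs W (g \o f) = trs W' (f \o g).
Proof.
move=> fW gW; rewrite /trs /=.
have bW i : (i < \dim W)%N -> (vbasis W)`_i \in W.
  by move=> iW; rewrite vbasis_mem // mem_nth // size_tuple.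
have bW' i : (i < \dim W')%N -> (vbasis W')`_i \in W'.
  by move=> iW; rewrite vbasis_mem // mem_nth // size_tuple.
under eq_bigr => i _ do
  rewrite [f _](coord_vbasis (fW _ (bW i (ltn_ord i)))) !linear_sum /=.
under [RHS]eq_bigr => j _ do
  rewrite [g _](coord_vbasis (gW _ (bW' j (ltn_ord j)))) !linear_sum /=.
rewrite exchange_big; apply: eq_bigr => j _ /=; apply: eq_bigr => i _.
by rewrite !linearZ /= mulrC.
Qed.

Lemma eq_in_trs (V : vectType K) (W : {vspace V}) f g :
  {in W, f =1 g} -> trs W f = trs W g.
Proof.
move=> fg; apply: eq_bigr => i _; rewrite fg //.
by rewrite vbasis_mem // mem_nth // size_tuple.
Qed.

Lemma trsD (V : vectType K) (W : {vspace V}) f g :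
  trs W (fun v => f v + g v) = trs W f + trs W g.
Proof. by rewrite /trs -big_split; apply: eq_bigr => i _; rewrite linearD. Qed.

Lemma trsZ (V : vectType K) (W : {vspace V}) c f :
  trs W (fun v => c *: f v) = c * trs W f.
Proof. by rewrite /trs mulr_sumr; apply: eq_bigr => i _; rewrite linearZ. Qed.

Lemma trs_sum (V : vectType K) (W : {vspace V}) (I : Type) (r : seq I)
    (F : I -> V -> V) :
  trs W (fun v => \sum_(i <- r) F i v) = \sum_(i <- r) trs W (F i).
Proof. by rewrite /trs exchange_big; apply: eq_bigr => i _; rewrite linear_sum. Qed.

Lemma trs_scal (V : vectType K) (W : {vspace V}) c f :
  {in W, forall v, f v = c *: v} -> trs W f = c * (\dim W)%:R.
Proof.
move=> fc; rewrite (eq_in_trs (g := fun v => c *: v)) // trsZ; congr (_ * _).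
rewrite /trs (eq_bigr (fun=> 1)) ?sumr_const ?card_ord // => i _.
by rewrite coord_free ?eqxx // (basis_free (vbasisP W)).
Qed.
End Trace.

Lemma min_subspace (K : fieldType) (V : vectType K) (P : {vspace V} -> Prop) :
    P fullv -> (forall U W, P U -> P W -> P (U :&: W)%VS) ->
  exists2 Z, P Z & forall U, P U -> (Z <= U)%VS.
Proof.
move=> Pf PI; have [n] := ubnP (\dim (fullv : {vspace V})).
elim: n {1 2}(fullv : {vspace V}) Pf => // n IH Z PZ; rewrite ltnS => le_n.
have [h|] := pselect (forall U, P U -> (Z <= U)%VS); first by exists Z.
move=> /existsNP[U /not_implyP[PU /negP nZU]].
apply: (IH (Z :&: U)%VS (PI _ _ PZ PU)); apply: leq_trans le_n.
rewrite ltn_neqAle dimvS ?capvSl // andbT; apply: contra nZU => /eqP e.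
have /eqP <- : ((Z :&: U) == Z)%VS by rewrite eqEdim capvSl e leqnn.
exact: capvSr.
Qed.

(** * Representations of sl2 *)

Section Sl2.
Variables (K : numFieldType) (M : lmodType K) (e f h : M -> M).
Hypotheses (eL : linear e) (fL : linear f) (hL : linear h).
Hypothesis ef : forall v, e (f v) = f (e v) + h v.
Hypothesis he : forall v, h (e v) = e (h v) + 2 *: e v.
Hypothesis hf : forall v, h (f v) = f (h v) - 2 *: f v.

Let e0 : e 0 = 0. Proof. by have := eL (-1) 0 0; rewrite scaler0 addr0 scaleN1r addNr. Qed.
Let f0 : f 0 = 0. Proof. by have := fL (-1) 0 0; rewrite scaler0 addr0 scaleN1r addNr. Qed.
Let eZ c v : e (c *: v) = c *: e v. Proof. by have := eL c v 0; rewrite e0 !addr0. Qed.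
Let fZ c v : f (c *: v) = c *: f v. Proof. by have := fL c v 0; rewrite f0 !addr0. Qed.
Let fD u v : f (u + v) = f u + f v. Proof. by have := fL 1 u v; rewrite !scale1r. Qed.

Lemma sl2_wt_f c v n : h v = c *: v ->
  h (iter n f v) = (c - n%:R *+ 2) *: iter n f v.
Proof.
move=> hv; elim: n => [|n IH]; first by rewrite mul0rn subr0.
rewrite iterS hf IH fZ -scalerBl; congr (_ *: _); rewrite -natr1; ring.
Qed.

Lemma sl2_wt_e c v : h v = c *: v -> h (e v) = (c + 2) *: e v.
Proof. by move=> hv; rewrite he hv eZ -scalerDl. Qed.

Lemma sl2_ef c v n : h v = c *: v -> e (iter n.+1 f v) =
  iter n.+1 f (e v) + (n.+1%:R * (c - n%:R)) *: iter n f v.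
Proof.
move=> hv; elim: n => [|n IH]; first by rewrite /= ef hv subr0 mul1r.
rewrite iterS ef IH fD fZ -/(iter n.+2 f (e v)) -addrA; congr (_ + _).
rewrite (sl2_wt_f _ hv) -iterS -scalerDl; congr (_ *: _).
rewrite -!natr1; ring.
Qed.

Lemma iter_fix0 (g : M -> M) n : g 0 = 0 -> iter n g 0 = 0.
Proof. by move=> g0; elim: n => //= n ->. Qed.

(** On weight k the operator f^k is injective. If f^k v = 0, then e v, of weight k + 2, is killed by
    f^(k+2), so e v = 0 by induction on the nilpotency of e. Then e f^(j+1) v is a nonzero multiple
    of f^j v for j < k, and one climbs back from f^k v = 0 to v = 0. Local nilpotence stands in for
    finite dimension, because this is also applied to functions on words. *)
Lemma sl2_lower n k v : iter n e v = 0 -> h v = k%:R *: v ->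
  iter k f v = 0 -> v = 0.
Proof.
elim: n k v => // n IH k v; rewrite iterSr => env hv fv.
have ev0 : e v = 0.
  apply: (IH k.+2) => //; first by rewrite (sl2_wt_e hv) -natrD addn2.
  have := sl2_ef k hv; rewrite subrr mulr0 scale0r addr0 (iterS k f) fv f0 e0.
  by move=> h0; rewrite iterS -h0 f0.
have down j : (j <= k)%N -> iter (k - j) f v = 0.
  elim: j => [|j IHj] jk; first by rewrite subn0.
  have := sl2_ef (k - j.+1) hv; rewrite ev0 iter_fix0 // add0r.
  rewrite -subSn // subSS IHj ?(ltnW jk) // e0 => /esym/eqP; rewrite scaler_eq0.
  rewrite mulf_eq0 pnatr_eq0 subn_eq0 leqNgt jk /= natrB // subKr.
  by rewrite pnatr_eq0 => /eqP.
by have := down k (leqnn k); rewrite subnn.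
Qed.

Lemma sl2_highest n c v : v != 0 -> e v = 0 -> iter n f v = 0 -> h v = c *: v ->
  exists m : nat, c = m%:R.
Proof.
move=> v0 ev fv hv; have exn : exists n, iter n f v == 0 by exists n; apply/eqP.
case: (ex_minnP exn) => -[|m] /eqP fm min; first by rewrite -[v]/(iter 0 f v) fm eqxx in v0.
exists m; have := sl2_ef m hv; rewrite fm e0 ev iter_fix0 // add0r.
move=> /esym/eqP; rewrite scaler_eq0 mulf_eq0 pnatr_eq0 /= subr_eq0.
by case/orP => [/eqP //|/min]; rewrite ltnn.
Qed.

(** Climb with e to a highest vector. The lowering operator must be nilpotent on every e^m v, as it
    is not known in advance where the climb ends. *)
Lemma sl2_integral n c v : v != 0 -> iter n e v = 0 ->
    (forall m, exists k, iter k f (iter m e v) = 0) -> h v = c *: v ->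
  exists m k : nat, c = m%:R - k%:R.
Proof.
elim: n c v => [|n IH] c v v0; first by move=> /= v00; rewrite v00 eqxx in v0.
rewrite iterSr => env fn hv; case: (eqVneq (e v) 0) => [ev0|ev0].
  have [k fk] := fn 0; have [m ->] := sl2_highest v0 ev0 fk hv.
  by exists m, 0; rewrite subr0.
have [|m [k e2]] := IH (c + 2) (e v) ev0 env _ (sl2_wt_e hv).
  by move=> m; have [k fk] := fn m.+1; exists k; rewrite -iterSr.
exists m, (k + 2)%N; rewrite natrD opprD addrA -e2; ring.
Qed.
End Sl2.

(** * Weight spaces of modules *)

Section Weights.
Variables (R : realType) (X : lie_datum R).
Local Notation g := (alg X).
Local Notation h := (cartan X).
Local Notation E := (euc X).
Implicit Types (a b : E).

Record eval_axioms : Prop := EvalAxioms {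
  evE : forall c (x y : E), {in h, forall H,
    wteval (c *: x + y) H = c%:RC * wteval x H + wteval y H};
  evh : forall c (x : E), {in h &, forall H H',
    wteval x (c *: H + H') = c * wteval x H + wteval x H'};
  ev_inj : forall x : E, {in h, forall H, wteval x H = 0} -> x = 0;
  ev_comm : {in h &, forall H H', brk g H H' = 0} }.

Hypothesis he : eval_axioms.

Lemma evD x y H : H \in h -> wteval (x + y : E) H = wteval x H + wteval y H.
Proof. by move=> hH; rewrite -{1}[x]scale1r (evE he) // rmorph1 mul1r. Qed.

Lemma ev0 H : H \in h -> wteval (0 : E) H = 0.
Proof.
move=> hH; have := evD 0 0 hH; rewrite addr0 => /eqP.
by rewrite -subr_eq0 opprD addNKr oppr_eq0 => /eqP.
Qed.

Lemma evZ c x H : H \in h -> wteval (c *: x : E) H = c%:RC * wteval x H.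
Proof. by move=> hH; rewrite -[c *: x]addr0 (evE he) // ev0 // addr0. Qed.

Lemma evN x H : H \in h -> wteval (- x : E) H = - wteval x H.
Proof. by move=> hH; rewrite -scaleN1r evZ // rmorphN1 mulN1r. Qed.

Lemma evB x y H : H \in h -> wteval (x - y : E) H = wteval x H - wteval y H.
Proof. by move=> hH; rewrite evD // evN. Qed.

Lemma ev_sum (I : Type) (r : seq I) (F : I -> E) H : H \in h ->
  wteval (\sum_(i <- r) F i) H = \sum_(i <- r) wteval (F i) H.
Proof.
move=> hH; apply: (big_morph (fun x : E => wteval x H)) => [x y|].
  exact: evD.
exact: ev0.
Qed.

Lemma evh0 (x : E) : wteval x (0 : g) = 0.
Proof.
have := evh he (-1) x (mem0v h) (mem0v h).
by rewrite scaler0 addr0 mulN1r addNr.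
Qed.

Lemma evhZ c (x : E) H : H \in h -> wteval x (c *: H) = c * wteval x H.
Proof.
by move=> hH; have := evh he c x hH (mem0v h); rewrite evh0 !addr0.
Qed.

Lemma evhD (x : E) H H' : H \in h -> H' \in h ->
  wteval x (H + H') = wteval x H + wteval x H'.
Proof. by move=> hH hH'; rewrite -{1}[H]scale1r (evh he) // mul1r. Qed.

Lemma evh_sum (I : Type) (r : seq I) (F : I -> g) (x : E) :
  (forall i, F i \in h) ->
  wteval x (\sum_(i <- r) F i) = \sum_(i <- r) wteval x (F i).
Proof.
move=> hF; elim: r => [|i r IH]; first by rewrite !big_nil evh0.
by rewrite !big_cons evhD ?IH // memv_suml.
Qed.

Lemma ev_sep a b : a != b -> exists2 H, H \in h & wteval a H != wteval b H.
Proof.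
move=> ab; apply: contrapT => nex; case/eqP: ab; apply/eqP.
rewrite -subr_eq0; apply/eqP/(ev_inj he) => H hH; rewrite evB //.
by apply/eqP; rewrite subr_eq0; apply: contrapT => /negP n; apply: nex; exists H.
Qed.

Section Module.
Variable V : lieMod g.
Implicit Types (U W : {vspace V}) (u v : V).

Lemma actDl x y v : act V (x + y) v = act V x v + act V y v.
Proof. exact: linearDl. Qed.
Lemma actZl c x v : act V (c *: x) v = c *: act V x v.
Proof. exact: linearZl_LR. Qed.
Lemma actDr x u v : act V x (u + v) = act V x u + act V x v.
Proof. exact: linearDr. Qed.
Lemma actZr c x v : act V x (c *: v) = c *: act V x v.
Proof. exact: linearZr_LR. Qed.
Lemma act0r x : act V x 0 = 0. Proof. exact: linear0r. Qed.
Lemma actBr x u v : act V x (u - v) = act V x u - act V x v.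
Proof. exact: linearBr. Qed.
Lemma act0l v : act V 0 v = 0. Proof. exact: linear0l. Qed.
Lemma act_suml (I : Type) (r : seq I) (F : I -> g) v :
  act V (\sum_(i <- r) F i) v = \sum_(i <- r) act V (F i) v.
Proof. exact: (big_morph (fun x => act V x v) (fun x y => actDl x y v) (act0l v)). Qed.

Definition wsp b : {vspace V} := (\bigcap_(i < \dim h)
  lker (linfun (act V (vbasis h)`_i) - wteval b (vbasis h)`_i *: \1%VF))%VS.

Lemma mem_wsp b v :
  v \in wsp b <-> {in h, forall H, act V H v = wteval b H *: v}.
Proof.
have mem_ker H c : (v \in lker (linfun (act V H) - c *: \1%VF)) =
    (act V H v == c *: v).
  rewrite memv_ker add_lfunE opp_lfunE scale_lfunE id_lfunE lfunE /=.
  exact: subr_eq0.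
rewrite /wsp memvE; split=> [/subv_bigcapP hv H|hv].
  move=> /coord_vbasis ->; move: (coord _) => c.
  rewrite act_suml; set n := \dim h; rewrite -/n in hv.
  have bh i : (vbasis h)`_i \in h.
    have [lt|ge] := ltnP i n; first by rewrite vbasis_mem // mem_nth // size_tuple.
    by rewrite nth_default ?mem0v // size_tuple.
  rewrite evh_sum => [|i]; last by rewrite memvZ.
  rewrite scaler_suml; apply: eq_bigr => i _; rewrite actZl evhZ // -scalerA; congr (_ *: _).
  by have := hv i isT; rewrite -memvE mem_ker => /eqP.
apply/subv_bigcapP => i _; rewrite -memvE mem_ker hv //.
by rewrite vbasis_mem // mem_nth // size_tuple.
Qed.
Definition hstable U := forall H v, H \in h -> v \in U -> act V H v \in U.

Lemma hstable0 : hstable 0.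
Proof. by move=> H v _; rewrite !memv0 => /eqP ->; rewrite linear0r. Qed.

(** Distinct weights are separated by some H, so applying H - b0(H) removes the component of weight
    b0 and rescales the others by nonzero factors. *)
Lemma wt_comp U (l : seq E) (vb : E -> V) : hstable U -> uniq l ->
    {in l, forall b, vb b \in wsp b} -> \sum_(b <- l) vb b \in U ->
  {in l, forall b, vb b \in U}.
Proof.
move=> hU; elim: l vb => // b0 l IH vb /= /andP[b0l ul] vbw sU.
have vbw0 : vb b0 \in wsp b0 by apply: vbw; rewrite mem_head.
have vbl b : b \in l -> vb b \in wsp b.
  by move=> bl; apply: vbw; rewrite inE bl orbT.
have rest : {in l, forall b, vb b \in U}.
  move=> b bl; have [|H hH bH] := @ev_sep b b0.
    by apply: contraNneq b0l => <-.
  have := hU _ _ hH sU; rewrite big_cons linearDr linear_sumr /=.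
  rewrite (iffLR (mem_wsp _ _) vbw0 H hH) => s2.
  have : \sum_(b <- l) (wteval b H - wteval b0 H) *: vb b \in U.
    have := memvB s2 (memvZ (wteval b0 H) sU).
    rewrite big_cons scalerDr opprD addrACA subrr add0r scaler_sumr -sumrB.
    rewrite big_seq [X in _ -> X \in _]big_seq.
    rewrite (eq_bigr (fun c => (wteval c H - wteval b0 H) *: vb c)) // => c cl.
    by rewrite (iffLR (mem_wsp _ _) (vbl c cl) H hH) scalerBl.
  move=> /IH-/(_ ul) K; have {}K := K _ b bl.
  rewrite -[vb b](scalerK (a := wteval b H - wteval b0 H)) ?subr_eq0 //.
  by apply/memvZ/K => c cl; apply/memvZ/vbl.
move=> b; rewrite inE => /orP[/eqP ->|]; last exact: rest.
rewrite -[vb b0](addrK (\sum_(b <- l) vb b)) memvB //.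
  by rewrite big_cons in sU.
by rewrite big_seq; apply: memv_suml => c /rest.
Qed.

Definition wdecomp (ws : seq E) U v := exists2 vb : E -> V,
  (forall b, vb b \in (U :&: wsp b)%VS) & v = \sum_(b <- ws) vb b.

Definition wdiag (ws : seq E) := uniq ws /\ forall v, wdecomp ws fullv v.

Lemma wsp_root a b x v : root_space (wteval a) x ->
  v \in wsp b -> act V x v \in wsp (b + a).
Proof.
move=> xa /mem_wsp vb; apply/mem_wsp => H hH.
have := act_brk H x v; rewrite xa // actZl => /eqP; rewrite eq_sym subr_eq.
by rewrite (vb H hH) actZr -scalerDl -evD // addrC => /eqP.
Qed.

Section Diag.
Variable ws : seq E.
Hypothesis hws : wdiag ws.

Lemma wsp_out b v : b \notin ws -> v \in wsp b -> v = 0.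
Proof.
case: hws => uws dws bws vb; have [w ww ve] := dws v.
pose vb' c := if c == b then v else - w c.
have e : {in ws, forall c, vb' c = - w c}.
  by move=> c cw; rewrite /vb'; case: eqP => // cb; rewrite -cb cw in bws.
have := @wt_comp 0%VS (b :: ws) vb' hstable0; rewrite /= bws uws => /(_ isT).
have hw : {in b :: ws, forall c, vb' c \in wsp c}.
  move=> c _; rewrite /vb'; case: eqP => [-> //|_].
  by have := ww c; rewrite capfv memvN.
move=> /(_ hw); rewrite big_cons {1}/vb' eqxx big_seq (eq_bigr _ e) -big_seq.
rewrite sumrN {1}ve subrr mem0v => /(_ isT b (mem_head _ _)).
by rewrite /vb' eqxx memv0 => /eqP.
Qed.

Lemma stable_decomp U v : hstable U -> v \in U -> wdecomp ws U v.
Proof.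
case: hws => uws dws hU vU; have [w ww ve] := dws v.
have hw : {in ws, forall b, w b \in U}.
  apply: wt_comp => //; last by rewrite -ve.
  by move=> b _; have := ww b; rewrite capfv.
exists (fun b => if b \in ws then w b else 0).
  move=> b; case: ifP => [bw|_]; last by rewrite mem0v.
  by rewrite memv_cap hw //; have := ww b; rewrite capfv.
by rewrite {1}ve [in LHS]big_seq [in RHS]big_seq; apply: eq_bigr => b ->.
Qed.

Lemma sub_wsp U W : hstable U -> (forall b, (U :&: wsp b <= W)%VS) ->
  (U <= W)%VS.
Proof.
move=> hU UW; apply/subvP => v /(stable_decomp hU)[w ww ->].
by apply: memv_suml => b _; apply: (subvP (UW b)).
Qed.
End Diag.
End Module.
End Weights.
Global Opaque wsp.

(** * The Casimir operator of a Levi subalgebra *)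

Section DualBasis.
Variables (R : realType) (X : lie_datum R) (bf : euc X -> euc X -> R).
Local Notation E := (euc X).

Lemma wf_dual_expand : wform bf -> exists n (e e' : 'I_n -> E),
  forall b, b = \sum_k bf b (e k) *: e' k.
Proof.
move=> hb; pose n := \dim (fullv : {vspace E}).
pose e (i : 'I_n) := (vbasis (fullv : {vspace E}))`_i.
pose G := \matrix_(i < n, j < n) bf (e i) (e j).
have span v : v = \sum_i coord (vbasis (fullv : {vspace E})) i v *: e i.
  exact/coord_vbasis/memvf.
have Gu : G \in unitmx.
  rewrite -row_free_unit -kermx_eq0; apply/rowV0P => v /sub_kermxP vG.
  pose w := \sum_i v 0 i *: e i.
  have wj j : bf w (e j) = 0.
    have := congr1 (fun m : 'rV_n => m 0 j) vG; rewrite !mxE => <-.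
    by rewrite (wf_suml hb); apply: eq_bigr => i _; rewrite (wfZl hb) mxE.
  have w0 : w = 0.
    apply/eqP; rewrite -(wf_eq0 hb) {2}/w (wf_sumr hb) big1 // => i _.
    by rewrite (wfZr hb) wj mulr0.
  apply/rowP => i; rewrite mxE.
  have fr : free (vbasis (fullv : {vspace E})) by apply: basis_free (vbasisP _).
  by rewrite -(coord_sum_free (v 0) i fr) -/w w0 linear0.
exists n, e, (fun k => \sum_l invmx G k l *: e l) => b.
pose u := \row_i coord (vbasis (fullv : {vspace E})) i b.
have bE k : bf b (e k) = (u *m G) 0 k.
  rewrite {1}[b]span (wf_suml hb) mxE; apply: eq_bigr => i _.
  by rewrite (wfZl hb) !mxE.
under eq_bigr do rewrite scaler_sumr.
rewrite exchange_big /= {1}[b]span; apply: eq_bigr => l _.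
under eq_bigr do rewrite scalerA; rewrite -scaler_suml; congr (_ *: _).
transitivity ((u *m G *m invmx G) 0 l); first by rewrite mulmxK // mxE.
by rewrite mxE; apply: eq_bigr => k _; rewrite bE.
Qed.

Lemma wf_dual : wform bf -> exists n (e e' : 'I_n -> E),
  forall b, \sum_k bf b (e k) * bf b (e' k) = bf b b.
Proof.
move=> hb; have [n [e [e' ee]]] := wf_dual_expand hb.
exists n, e, e' => b.
transitivity (bf b (\sum_k bf b (e k) *: e' k)); last by rewrite -ee.
rewrite (wf_sumr hb); by apply: eq_bigr => k _; rewrite (wfZr hb).
Qed.

Lemma wf_riesz (L : {linear E -> R^o}) : wform bf ->
  exists d, forall b, L b = bf b d.
Proof.
move=> hb; have [n [e [e' ee]]] := wf_dual_expand hb.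
exists (\sum_k L (e' k) *: e k) => b; rewrite {1}[b]ee linear_sum (wf_sumr hb).
by apply: eq_bigr => k _; rewrite linearZ (wfZr hb) /= mulrC.
Qed.

Lemma wf_CS b c : wform bf -> bf b c ^+ 2 <= bf b b * bf c c.
Proof.
move=> hb; have [->|c0] := eqVneq c 0.
  by rewrite (wf0r hb) (wf0r hb) mulr0 expr0n.
have cc := wf_gt0 hb c0.
have := wf_ge0 hb (bf c c *: b - bf b c *: c).
rewrite !(wfE hb) (wfC hb c b) => h0.
rewrite -subr_ge0 -(pmulr_rge0 _ cc); apply: le_trans h0 _.
by rewrite le_eqVlt; apply/orP; left; apply/eqP; ring.
Qed.
End DualBasis.

Section Adjoint.
Variables (F : fieldType) (g : lieAlg F).

Lemma brkC (x y : g) : brk g x y = - brk g y x.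
Proof.
have := brkxx (l := g) (x + y); rewrite linearDl !linearDr /= !brkxx add0r addr0.
by move=> /eqP; rewrite addr_eq0 => /eqP.
Qed.

Lemma brk_act (x y v : g) :
  brk g (brk g x y) v = brk g x (brk g y v) - brk g y (brk g x v).
Proof.
rewrite (brkC (brk g x y)) (brkC x v) linearNr /= opprK; apply/eqP.
rewrite eq_sym -addr_eq0; apply/eqP; exact: brk_jacobi.
Qed.

Definition adj : lieMod g := @LieMod F g g (brk g) brk_act.
End Adjoint.

Section Frame.
Variables (R : realType) (X : lie_datum R).
Local Notation g := (alg X).
Local Notation h := (cartan X).
Local Notation E := (euc X).
Local Notation S := (simple_roots X).
Local Notation Phi := (root_set X).
Implicit Types (a b : E).

(* All that is used of a simple Lie algebra, and also true of gl(n). *)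
Record lie_frame (bf : E -> E -> R) (x t : E -> g) (B : g -> g -> R[i]) : Prop :=
  LieFrame {
  lf_roots : root_axioms X;
  lf_form : wform bf;
  lf_eval : eval_axioms X;
  lf_x0 : {in Phi, forall a, x a != 0};
  lf_x : {in Phi, forall a, root_space (wteval a) (x a)};
  lf_dim1 : {in Phi, forall a z, root_space (wteval a) z ->
    exists c, z = c *: x a};
  lf_span : forall z : g, exists2 H, H \in h &
    exists c : E -> R[i], z = H + \sum_(a <- Phi) c a *: x a;
  lf_t : forall y, t y \in h;
  lf_tE : forall b y, wteval b (t y) = (bf b y)%:RC;
  lf_br : {in Phi, forall a, brk g (x a) (x (- a)) = t a};
  lf_BZl : forall c u v, B (c *: u) v = c * B u v;
  lf_BZr : forall c u v, B u (c *: v) = c * B u v;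
  lf_Binv : forall z u v, B (brk g z u) v = - B u (brk g z v);
  lf_B1 : {in Phi, forall a, B (x a) (x (- a)) = 1} }.

Variables (bf : E -> E -> R) (x t : E -> g) (B : g -> g -> R[i]).
Hypothesis lf : lie_frame bf x t B.

Let hr := lf_roots lf.
Let hb := lf_form lf.
Let he := lf_eval lf.

Lemma adj_wsp b z : z \in wsp (adj g) b <-> root_space (wteval b) z.
Proof. exact: mem_wsp. Qed.

Lemma adj_wdiag : wdiag (adj g) (0 :: Phi).
Proof.
split; first by rewrite /= (ra_uniq hr) (ra_neq0 hr).
move=> z; have [H hH [c ze]] := lf_span lf z.
pose vb b : g := if b == 0 then H else if b \in Phi then c b *: x b else 0.
exists vb => [b|].
  rewrite capfv; rewrite /vb; case: eqP => [->|_].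
    by apply/mem_wsp => // H' hH'; rewrite /= (ev_comm he) // ev0 // scale0r.
  case: ifP => bP; last exact: mem0v.
  by apply: memvZ; apply/adj_wsp; apply: (lf_x lf).
rewrite big_cons {1}/vb eqxx {1}ze; congr (_ + _).
rewrite [in LHS]big_seq [in RHS]big_seq; apply: eq_bigr => b bP.
by rewrite /vb bP (negPf (root_neq0 hr bP)).
Qed.

Lemma adj_root_brk a b u v : root_space (wteval a) u ->
  root_space (wteval b) v -> root_space (wteval (b + a)) (brk g u v).
Proof. by move=> ua /adj_wsp vb; apply/adj_wsp; apply: (wsp_root he ua vb). Qed.

Lemma brk_out a b : a \in Phi -> b \in Phi -> a + b \notin Phi -> a + b != 0 ->
  brk g (x a) (x b) = 0.
Proof.
move=> aP bP abP ab0; apply: (wsp_out he adj_wdiag (b := b + a)).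
  by rewrite addrC inE negb_or ab0.
by apply/adj_wsp; apply: adj_root_brk; apply: (lf_x lf).
Qed.

Lemma brk_struct a b : a \in Phi -> b \in Phi -> a + b \in Phi ->
  exists c, brk g (x a) (x b) = c *: x (a + b).
Proof.
move=> aP bP abP; apply: (lf_dim1 lf) => //.
by rewrite addrC; apply: adj_root_brk; apply: (lf_x lf).
Qed.

(** Invariance of [B] relates the structure constants of (a, b) and (a, - a - b); this is the
    cancellation behind the centrality of the Casimir operator. *)
Lemma brk_structN a b c c' : a \in Phi -> b \in Phi -> a + b \in Phi ->
  brk g (x a) (x b) = c *: x (a + b) ->
  brk g (x a) (x (- (a + b))) = c' *: x (- b) -> c' = - c.
Proof.
move=> aP bP abP e e'; have := lf_Binv lf (x a) (x b) (x (- (a + b))).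
rewrite e e' (lf_BZl lf) (lf_BZr lf) !(lf_B1 lf) // !mulr1 => ->.
by rewrite opprK.
Qed.

Section Levi.
Variables (V : lieMod g) (Sbar : seq E).
Hypothesis hS : {subset Sbar <= S}.
Local Notation Rb := (Rbar Sbar).
Local Notation Rp := (Rbar_pos Sbar).

Lemma mem_Rb a : (a \in Rb) = (a \in <<Sbar>>%VS) && (a \in Phi).
Proof. exact: mem_filter. Qed.

Lemma Rb_root a : a \in Rb -> a \in Phi.
Proof. by rewrite mem_Rb => /andP[]. Qed.

Lemma Rb_opp a : a \in Rb -> - a \in Rb.
Proof. by rewrite !mem_Rb => /andP[aS aP]; rewrite memvN aS oppr_root. Qed.

Lemma Rb_uniq : uniq Rb. Proof. exact/filter_uniq/(ra_uniq hr). Qed.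

Lemma Rb_add a c : a \in Rb -> c \in Rb -> (a + c \in Rb) = (a + c \in Phi).
Proof.
by rewrite !mem_Rb => /andP[aS _] /andP[cS _]; rewrite memvD.
Qed.

Lemma Rb_split (A : zmodType) (F : E -> A) :
  \sum_(a <- Rb) F a = \sum_(a <- Rp) (F a + F (- a)).
Proof.
rewrite big_split /= -[X in _ = _ + X](big_map (fun a => - a) xpredT F) -big_cat.
apply: perm_big; apply: uniq_perm; first exact: Rb_uniq.
  rewrite cat_uniq (Rp_uniq hr) map_inj_uniq ?(Rp_uniq hr) /=; last exact: oppr_inj.
  rewrite andbT; apply/hasPn => _ /mapP[a aR ->].
  by apply/negP => /Rp_pos; rewrite (pos_notN hr (Rp_root aR) (Rp_pos aR)).
move=> a; rewrite mem_cat; apply/idP/orP => [aR|[aR|/mapP[b bR ->]]].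
- move: (aR); rewrite mem_Rb => /andP[aS aP]; case: (pos_or hr aP) => a0.
    by left; rewrite mem_Rp aS aP.
  right; rewrite -[a]opprK map_f // mem_Rp a0 memvN aS andbT.
  by rewrite oppr_root.
- by rewrite mem_Rb (Rp_span aR) (Rp_root aR).
- by apply: Rb_opp; rewrite mem_Rb (Rp_span bR) (Rp_root bR).
Qed.

Variables (n : nat) (e e' : 'I_n -> E).
Hypothesis dual : forall b, \sum_k bf b (e k) * bf b (e' k) = bf b b.

(** Since [x a, x (-a)] = t a, the root vectors are dual for the invariant form. Of the dual bases
    [e], [e'] only the effect on weights is recorded: the Cartan part acts on weight b by (b, b). *)
Definition casimir (v : V) : V :=
  \sum_k act V (t (e k)) (act V (t (e' k)) v) +
  \sum_(a <- Rb) act V (x a) (act V (x (- a)) v).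

Lemma casimirP c u v : casimir (c *: u + v) = c *: casimir u + casimir v.
Proof.
rewrite /casimir scalerDr !scaler_sumr addrACA -!big_split.
by congr (_ + _); apply: eq_bigr => i _; rewrite !actDr !actZr.
Qed.

HB.instance Definition _ := GRing.isLinear.Build _ _ _ _ casimir casimirP.

Lemma act_t b y v : v \in wsp V b -> act V (t y) v = (bf b y)%:RC *: v.
Proof. by move=> /mem_wsp -> //; rewrite ?(lf_tE lf) ?(lf_t lf). Qed.

Lemma casimir_wsp b v : v \in wsp V b -> casimir v =
  (bf b b)%:RC *: v + \sum_(a <- Rb) act V (x a) (act V (x (- a)) v).
Proof.
move=> vb; congr (_ + _); rewrite -dual rmorph_sum scaler_suml.
apply: eq_bigr => k _; rewrite (act_t _ vb) actZr (act_t _ vb) scalerA.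
by rewrite rmorphM mulrC.
Qed.

(** Commuting x_c past the root part produces the terms [P a] and [Q a]. Those that involve a third
    root cancel in pairs, and the two others account for the change of the Cartan part from (b, b)
    to (b + c, b + c). *)
Lemma casimir_comm_wsp b c v : c \in Rb -> v \in wsp V b ->
  casimir (act V (x c) v) = act V (x c) (casimir v).
Proof.
move=> cR vb; have cP := Rb_root cR.
have xcv : act V (x c) v \in wsp V (b + c) := wsp_root he (lf_x lf cP) vb.
rewrite (casimir_wsp xcv) (casimir_wsp vb) actDr actZr linear_sumr /=.
pose P a := act V (brk g (x c) (x a)) (act V (x (- a)) v).
pose Q a := act V (x a) (act V (brk g (x c) (x (- a))) v).
have PQ a : act V (x c) (act V (x a) (act V (x (- a)) v)) =
    act V (x a) (act V (x (- a)) (act V (x c) v)) + (P a + Q a).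
  by rewrite /P /Q !act_brk actBr subrKA addrC subrK.
rewrite [in RHS](eq_bigr _ (fun a _ => PQ a)) big_split /= addrCA.
rewrite [LHS]addrC; congr (_ + _); rewrite big_split /=.
have Rb0 a : a \in Rb -> a != 0 by move=> /Rb_root/(root_neq0 hr).
(* [x_c, x_a] vanishes unless a = -c or a + c is a root. *)
have -> : \sum_(a <- Rb) P a =
    P (- c) + \sum_(a <- Rb | a + c \in Rb) P a.
  rewrite (bigD1_seq (- c)) ?Rb_opp ?Rb_uniq //=; congr (_ + _).
  rewrite big_mkcond [RHS]big_mkcond /=.
  rewrite [LHS]big_seq [RHS]big_seq; apply: eq_bigr => a aR.
  rewrite Rb_add //; have [->|ac] := eqVneq a (- c).
    by rewrite addNr (negPf (ra_neq0 hr)).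
  case: ifP => // /negbT acP.
  by rewrite /P brk_out ?act0l ?(Rb_root aR) // addrC // addr_eq0.
(* [x_c, x_(-a)] vanishes unless a = c or a - c is a root; shifting a by c indexes these terms like
   those of P. *)
have -> : \sum_(a <- Rb) Q a =
    Q c + \sum_(a <- Rb | a + c \in Rb) Q (a + c).
  rewrite (bigD1_seq c) ?Rb_uniq //=; congr (_ + _).
  transitivity (\sum_(a <- Rb | a - c \in Rb) Q a).
    rewrite big_mkcond [RHS]big_mkcond /=.
    rewrite [LHS]big_seq [RHS]big_seq; apply: eq_bigr => a aR.
    rewrite Rb_add ?Rb_opp //; have [->|ac] := eqVneq a c.
      by rewrite subrr (negPf (ra_neq0 hr)).
    case: ifP => // /negbT acP; rewrite /Q brk_out ?act0l ?linear0r //.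
    - exact/Rb_root/Rb_opp.
    - apply: contra acP => /(oppr_root hr).
      by rewrite opprD opprK addrC.
    - by rewrite subr_eq0 eq_sym.
  rewrite -[LHS]big_filter -[RHS]big_filter -[RHS](big_map (fun a => a + c) xpredT Q).
  apply: perm_big; apply: uniq_perm; first exact/filter_uniq/Rb_uniq.
    by rewrite (map_inj_uniq (addIr c)); apply/filter_uniq/Rb_uniq.
  move=> a; rewrite mem_filter; apply/andP/mapP => [[acR aR]|[d + ->]].
    by exists (a - c); rewrite ?subrK // mem_filter subrK aR.
  by rewrite mem_filter addrK => /andP[].
have PQ0 : \sum_(a <- Rb | a + c \in Rb) P a +
    \sum_(a <- Rb | a + c \in Rb) Q (a + c) = 0.
  rewrite -big_split big_seq_cond big1 // => a /andP[aR acR].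
  have aP := Rb_root aR; have acP := Rb_root acR; rewrite addrC in acP.
  have [N eN] := brk_struct cP aP acP.
  have := @brk_struct c (- (c + a)) cP (oppr_root hr acP).
  rewrite (_ : c - (c + a) = - a); last by rewrite opprD addrA subrr add0r.
  move=> /(_ (oppr_root hr aP))[N' eN'].
  have NN := brk_structN cP aP acP eN eN'.
  rewrite /P /Q eN [a + c]addrC eN' NN !actZl actZr scaleNr.
  exact: subrr.
(* What remains is t_c x_c v + x_c t_c v, with scalars (b + c, c) and (b, c). *)
rewrite addrACA PQ0 addr0 /P /Q !opprK (lf_br lf) //.
rewrite (act_t _ xcv) (act_t _ vb) actZr -!scalerDl; congr (_ *: _).
by rewrite -!rmorphD; congr (_%:RC); rewrite !(wfE hb) (wfC hb c b); ring.
Qed.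

Lemma casimir_comm ws c v : wdiag V ws -> c \in Rb ->
  casimir (act V (x c) v) = act V (x c) (casimir v).
Proof.
move=> [_ /(_ v)[vb vbw ->]] cR; rewrite linear_sumr /= !linear_sum /=.
rewrite ?linear_sumr /=; apply: eq_bigr => b _.
by apply: (@casimir_comm_wsp b) => //; have := vbw b; rewrite capfv.
Qed.

Lemma casimir_stable b v : v \in wsp V b -> casimir v \in wsp V b.
Proof.
move=> vb; rewrite (casimir_wsp vb) memvD ?memvZ // big_seq.
apply: memv_suml => a aR.
rewrite -[b](subrK a); apply: (wsp_root he (lf_x lf (Rb_root aR))).
apply: (wsp_root he (lf_x lf _)) vb; exact/Rb_root/Rb_opp.
Qed.
End Levi.
End Frame.

(** * Highest weight modules of a Levi subalgebra *)

(** Adjoin vectors until the dimension is exhausted. This lets submodules be introduced by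
    predicates. *)
Lemma pred_vspace (K : fieldType) (V : vectType K) (Pr : V -> Prop) :
    Pr 0 -> (forall c u v, Pr u -> Pr v -> Pr (c *: u + v)) ->
  exists W : {vspace V}, forall v, v \in W <-> Pr v.
Proof.
move=> P0 PL; pose ok (W : {vspace V}) := forall v, v \in W -> Pr v.
have: exists W, ok W by exists 0%VS => v; rewrite memv0 => /eqP ->.
case=> W0; have [n] := ubnP (\dim {:V} - \dim W0)%N.
elim: n W0 => // n IH W le_n okW.
have [h|] := pselect (forall v, Pr v -> v \in W); first by exists W => v; split; auto.
move=> /existsNP[v /not_implyP[Pv /negP vW]].
apply: (IH (W + <[v]>)%VS) => [|u].
  have lt : (\dim W < \dim (W + <[v]>))%N.
    rewrite ltn_neqAle dimvS ?addvSl // andbT; apply: contra vW => /eqP e.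
    have /eqP -> : (W == W + <[v]>)%VS by rewrite eqEdim addvSl e leqnn.
    exact: (subvP (addvSr W <[v]>)) (memv_line v).
  by have := dimvS (subvf (W + <[v]>)); lia.
by move=> /memv_addP[w /okW Pw [_ /vlineP[k ->] ->]]; rewrite addrC; apply: PL.
Qed.

Lemma seq_max (R : realDomainType) (T : eqType) (f : T -> R) (s : seq T) :
  s != [::] -> exists2 b, b \in s & {in s, forall c, f c <= f b}.
Proof.
elim: s => // a [|b s] IH _.
  by exists a; rewrite ?mem_head // => c; rewrite inE => /eqP ->.
have [//|m ms hm] := IH; case: (leP (f a) (f m)) => am.
  exists m; first by rewrite inE ms orbT.
  by move=> c; rewrite inE => /orP[/eqP -> //|/hm].
exists a; first exact: mem_head.
by move=> c; rewrite inE => /orP[/eqP -> //|/hm/le_trans]; apply; apply: ltW.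
Qed.

Section LeviModules.
Variables (R : realType) (X : lie_datum R).
Local Notation g := (alg X).
Local Notation h := (cartan X).
Local Notation E := (euc X).
Local Notation S := (simple_roots X).
Local Notation Phi := (root_set X).
Implicit Types (a b : E).
Variables (bf : E -> E -> R) (x t : E -> g) (B : g -> g -> R[i]).
Hypothesis lf : lie_frame bf x t B.

Let hr := lf_roots lf.
Let hb := lf_form lf.
Let he := lf_eval lf.

Variables (V : lieMod g) (ws : seq E).
Hypothesis hws : wdiag V ws.
Implicit Types (U W Z : {vspace V}) (u v : V).
Local Notation wsp := (wsp V).

Definition wdim U b := \dim (U :&: wsp b).

Lemma wdimE U b : wdim U b = \dim (U :&: wsp b). Proof. by []. Qed.

Lemma root_string_out a b : a \in Phi -> exists n : nat, b + n%:R *: a \notin ws.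
Proof.
move=> aP; apply: contrapT => h.
have sub : {subset [seq b + n%:R *: a | n <- iota 0 (size ws).+1] <= ws}.
  move=> _ /mapP[n _ ->]; apply: contrapT => /negP hn; apply: h; by exists n.
suff u : uniq [seq b + n%:R *: a | n <- iota 0 (size ws).+1].
  by have := uniq_leq_size u sub; rewrite size_map size_iota ltnn.
rewrite map_inj_uniq ?iota_uniq // => m n /addrI/eqP.
rewrite -subr_eq0 -scalerBl scaler_eq0 (negPf (root_neq0 hr aP)) orbF subr_eq0.
by rewrite eqr_nat => /eqP.
Qed.

Lemma iter_wsp a b n v : a \in Phi -> v \in wsp b ->
  iter n (act V (x a)) v \in wsp (b + n%:R *: a).
Proof.
move=> aP vb; elim: n => [|n IH]; first by rewrite scale0r addr0.
by rewrite -natr1 scalerDl scale1r addrA; apply: (wsp_root he (lf_x lf aP)).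
Qed.

Lemma root_nilp a b v : a \in Phi -> v \in wsp b ->
  exists n, iter n (act V (x a)) v = 0.
Proof.
move=> aP vb; have [n nw] := root_string_out b aP.
by exists n; apply: (wsp_out he hws nw); apply: iter_wsp.
Qed.

Section RootSl2.
Variable a : E.
Hypothesis aP : a \in Phi.
(** The factor that turns x a, x (-a), t a into an sl2-triple; the rescaled t a acts on weight b by
    [copair b a]. *)
Let c := (2 / bf a a)%:RC.
Let bfa : bf a a != 0. Proof. by rewrite (wf_eq0 hb) (root_neq0 hr). Qed.
Let e v := c *: act V (x a) v.
Let f v := act V (x (- a)) v.
Let hh v := c *: act V (t a) v.

Let eL : linear e.
Proof. by move=> k u v; rewrite /e actDr actZr scalerDr !scalerA mulrC. Qed.
Let fL : linear f.
Proof. by move=> k u v; rewrite /f actDr actZr. Qed.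
Let hL : linear hh.
Proof. by move=> k u v; rewrite /hh actDr actZr scalerDr !scalerA mulrC. Qed.
Let ef v : e (f v) = f (e v) + hh v.
Proof.
rewrite /e /f /hh actZr -scalerDr; congr (_ *: _).
by rewrite -(lf_br lf aP) act_brk addrC subrK.
Qed.
Let ta b y : root_space (wteval b) y -> brk g (t a) y = (bf b a)%:RC *: y.
Proof. by move=> /(_ _ (lf_t lf a)) ->; rewrite (lf_tE lf). Qed.
Let hev v : hh (e v) = e (hh v) + 2 *: e v.
Proof.
rewrite /hh /e !actZr !scalerA.
have := act_brk (t a) (x a) v; rewrite (ta (lf_x lf aP)) actZl => /eqP.
rewrite eq_sym subr_eq => /eqP ->; rewrite scalerDr scalerA addrC; congr (_ + _ *: _).
by rewrite [_ * c]mulrC -mulrA -rmorphM /= -mulrA mulVf // mulr1 rmorphMn rmorph1 mulrC.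
Qed.
Let hfv v : hh (f v) = f (hh v) - 2 *: f v.
Proof.
rewrite /hh /f !actZr.
have := act_brk (t a) (x (- a)) v.
rewrite (ta (lf_x lf (oppr_root hr aP))) actZl (wfNl hb) => /eqP.
rewrite eq_sym subr_eq => /eqP ->; rewrite scalerDr scalerA addrC.
congr (_ + _); rewrite -scaleNr; congr (_ *: _).
by rewrite rmorphN mulrN -rmorphM /= -mulrA mulVf // mulr1 rmorphMn rmorph1.
Qed.
Let hwt b v : v \in wsp b -> hh v = (copair b a)%:RC *: v.
Proof.
move=> vb; rewrite /hh (act_t lf _ vb) scalerA -rmorphM; congr (_%:RC *: _).
by rewrite (wf_co hb b aP); field.
Qed.
Let iter_e n v : iter n e v = c ^+ n *: iter n (act V (x a)) v.
Proof.
elim: n => [|n IH]; first by rewrite scale1r.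
by rewrite iterS IH /e actZr scalerA -exprS.
Qed.
Let e_nilp b v : v \in wsp b -> exists n, iter n e v = 0.
Proof.
by move=> /(root_nilp aP)[n n0]; exists n; rewrite iter_e n0 scaler0.
Qed.

Lemma root_lower b k v : v \in wsp b -> copair b a = k%:R ->
  iter k (act V (x (- a))) v = 0 -> v = 0.
Proof.
move=> vb bk; have [n n0] := e_nilp vb.
apply: (sl2_lower eL fL ef hev hfv n0).
by rewrite (hwt vb) bk rmorph_nat.
Qed.

Lemma root_highest b v : v \in wsp b -> v != 0 -> act V (x a) v = 0 ->
  exists m : nat, copair b a = m%:R.
Proof.
move=> vb v0 xv; have [n n0] := root_nilp (oppr_root hr aP) vb.
have ev : e v = 0 by rewrite /e xv scaler0.
have [m bm] := sl2_highest eL fL ef hfv v0 ev n0 (hwt vb).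
by exists m; apply: (@complexI R); rewrite bm rmorph_nat.
Qed.

Lemma root_int b v : v \in wsp b -> v != 0 -> copair b a \is a Num.int.
Proof.
move=> vb v0; have [n n0] := e_nilp vb.
have [|m [k e0]] := sl2_integral eL fL ef hev hfv v0 n0 _ (hwt vb).
  move=> m; have [k k0] := root_nilp (oppr_root hr aP) (iter_wsp m aP vb).
  exists k; rewrite iter_e -[LHS]/(iter k f _).
  elim: k (iter m _ v) k0 => [|k IH] u /=; first by move=> ->; rewrite scaler0.
  rewrite -/(iter k _ _) => k0; rewrite -iterS iterSr /f actZr IH //.
  by rewrite -iterSr.
have -> : copair b a = m%:R - k%:R.
  by apply: (@complexI R); rewrite e0 rmorphB !rmorph_nat.
by apply: rpredB; apply: rpred_nat.
Qed.
End RootSl2.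

Definition root_stable a U := forall v, v \in U -> act V (x a) v \in U.

(** For a nonnegative pairing k, the operator x_(-a)^k maps the weight space of b injectively into
    that of its reflection, by sl2 theory; for a negative pairing replace a by -a. *)
Lemma wdim_refl_le a b U : a \in Phi -> root_stable a U -> root_stable (- a) U ->
  (wdim U b <= wdim U (reflect a b))%N.
Proof.
move=> aP Ua UNa.
case: (eqVneq (U :&: wsp b)%VS 0%VS) => [U0|U0].
  by rewrite /wdim U0 dimv0.
have vUb : exists2 v, v \in (U :&: wsp b)%VS & v != 0.
  by exists (vpick (U :&: wsp b)); rewrite ?memv_pick ?vpick0.
have [u] := vUb; rewrite memv_cap => /andP[uU ub] u0.
have bi := root_int aP ub u0.
suff key c k : c \in Phi -> root_stable (- c) U -> copair b c = k%:R ->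
    (wdim U b <= wdim U (reflect c b))%N.
  case/intrP: bi => -[k|k] bk; first exact: (key a k aP UNa bk).
  rewrite -reflectNl; apply: (key (- a) k.+1) => //; first exact: oppr_root.
    by rewrite opprK.
  by rewrite copairNr bk NegzE mulrNz opprK.
move=> {u vUb uU ub u0 bi} cP Uc bk.
pose F := iter k (fun G : 'End(V) => (linfun (act V (x (- c))) \o G)%VF) \1%VF.
have FE v : F v = iter k (act V (x (- c))) v.
  rewrite /F; elim: (k) => [|k' IH] /=; first by rewrite id_lfunE.
  by rewrite comp_lfunE lfunE /= IH.
have F0 : (U :&: wsp b :&: lker F)%VS = 0%VS.
  apply/eqP; rewrite -subv0; apply/subvP => v; rewrite !memv_cap memv0 memv_ker.
  move=> /andP[/andP[_ vb]]; rewrite FE => /eqP Fv.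
  by apply/eqP/(root_lower cP vb bk Fv).
have dF : \dim (F @: (U :&: wsp b)) = wdim U b.
  by have := limg_ker_dim F (U :&: wsp b); rewrite F0 dimv0 add0n.
rewrite -dF; apply/dimvS/subvP => _ /memv_imgP[v + ->].
rewrite !memv_cap FE => /andP[vU vb].
have -> : reflect c b = b + k%:R *: - c by rewrite /reflect bk scalerN.
rewrite (iter_wsp _ (oppr_root hr cP) vb) andbT.
by elim: (k) => [//|k' IH]; apply: Uc.
Qed.

Lemma wdim_refl a b U : a \in Phi -> root_stable a U -> root_stable (- a) U ->
  wdim U (reflect a b) = wdim U b.
Proof.
move=> aP Ua UNa; have := wdim_refl_le (reflect a b) aP Ua UNa.
rewrite (reflectK (root_neq0 hr aP)) => le1.
exact: (anti_leq (introT andP (conj le1 (wdim_refl_le b aP Ua UNa)))).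
Qed.

Lemma wdim_weyl A w b U : {subset A <= Phi} ->
    {in A, forall a, root_stable a U /\ root_stable (- a) U} ->
  in_weyl A w -> wdim U (w b) = wdim U b.
Proof.
move=> AP UA; elim=> [|a v aA _ IH]; first by [].
have [Ua UNa] := UA a aA.
by rewrite /= (wdim_refl _ (AP _ aA) Ua UNa).
Qed.
End LeviModules.
Global Opaque wdim.

Section Generated.
Variables (R : realType) (X : lie_datum R).
Local Notation g := (alg X).
Local Notation h := (cartan X).
Local Notation E := (euc X).
Local Notation S := (simple_roots X).
Local Notation Phi := (root_set X).
Implicit Types (a b : E).
Variables (bf : E -> E -> R) (x t : E -> g) (B : g -> g -> R[i]).
Hypothesis lf : lie_frame bf x t B.

Let hr := lf_roots lf.
Let hb := lf_form lf.
Let he := lf_eval lf.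

Variables (V : lieMod g) (ws : seq E).
Hypothesis hws : wdiag V ws.
Implicit Types (U W Z : {vspace V}) (u v : V).
Local Notation wsp := (wsp V).
Local Notation wdim := (wdim (V := V)).

Variable Sbar : seq E.
Hypothesis hS : {subset Sbar <= S}.
Local Notation Rb := (Rbar Sbar).
Local Notation Rp := (Rbar_pos Sbar).
Local Notation rho := (rhobar Sbar).

Variables (n : nat) (e e' : 'I_n -> E).
Hypothesis dual : forall b, \sum_k bf b (e k) * bf b (e' k) = bf b b.
Local Notation cas := (casimir x t Sbar e e').

Let Rp_Rb a : a \in Rp -> a \in Rb.
Proof. by move=> aR; rewrite mem_Rb (Rp_span aR) (Rp_root aR). Qed.
Let RpN_Rb a : a \in Rp -> - a \in Rb.
Proof. by move=> /Rp_Rb; apply: (Rb_opp lf). Qed.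
Let SP s : s \in Sbar -> s \in Phi. Proof. exact: (Sbar_root hr hS). Qed.

Definition lstable U := hstable U /\ {in Rb, forall a, root_stable x a U}.

Lemma levi_stable U :
  (forall y v, levi Sbar y -> v \in U -> act V y v \in U) <-> lstable U.
Proof.
split=> [hU|[Uh Ux] y v [H [z [hH hz ->]]] vU].
  split=> [H v hH vU|a aR v vU]; apply: hU => //.
    exists H, (fun=> 0); split=> //; last by rewrite big1 ?addr0.
    by move=> a _ H' _; rewrite linear0r scaler0.
  exists 0, (fun b => if b == a then x a else 0); split; first exact: mem0v.
    move=> b bR; case: eqP => [->|_] H hH; last by rewrite linear0r scaler0.
    by apply: (lf_x lf) (Rb_root aR) _ _.
  rewrite add0r (bigD1_seq a) ?(Rb_uniq lf) //= eqxx big1 ?addr0 // => b ba.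
  by rewrite (negPf ba).
rewrite actDl; apply: memvD; first exact: Uh.
rewrite act_suml big_seq; apply: memv_suml => a aR.
have [c ->] := lf_dim1 lf (Rb_root aR) (hz a aR).
by rewrite actZl memvZ //; apply: Ux.
Qed.

Lemma lstableI U W : lstable U -> lstable W -> lstable (U :&: W)%VS.
Proof.
move=> [Uh Ux] [Wh Wx]; split=> [H v hH|a aR v]; rewrite !memv_cap => /andP[vU vW].
  by rewrite Uh ?Wh.
by rewrite Ux ?Wx.
Qed.

Lemma lstableD U W : lstable U -> lstable W -> lstable (U + W)%VS.
Proof.
move=> [Uh Ux] [Wh Wx]; split=> [H v hH|a aR v] /memv_addP[u uU [w wW ->]].
  by rewrite actDr memv_add ?Uh ?Wh.
by rewrite actDr memv_add ?Ux ?Wx.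
Qed.

Lemma lstable0 : lstable 0.
Proof.
by split=> [H v _|a _ v]; rewrite !memv0 => /eqP ->; rewrite act0r.
Qed.

Definition singular v b :=
  [/\ v != 0, v \in wsp b & {in Rp, forall a, act V (x a) v = 0}].

(** The Casimir value at highest weight b, that is |b + rho|^2 - |rho|^2. *)
Definition cval b := bf b b + 2 * bf b rho.

Lemma norm_rho b : bf (b + rho) (b + rho) = cval b + bf rho rho.
Proof.
by rewrite /cval; move: (rho) => r; rewrite !(wfE hb) (wfC hb r b); ring.
Qed.

Lemma wt_uniq (vb vb' : E -> V) : (forall b, vb b \in wsp b) ->
    (forall b, vb' b \in wsp b) ->
  \sum_(b <- ws) vb b = \sum_(b <- ws) vb' b -> forall b, vb b = vb' b.
Proof.
move=> hv hv' s b; have [bw|bw] := boolP (b \in ws); last first.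
  by rewrite (wsp_out he hws bw (hv b)) (wsp_out he hws bw (hv' b)).
have uws : uniq ws by case: hws.
have := @wt_comp _ _ he V 0%VS ws (fun b => vb b - vb' b) (@hstable0 _ _ V) uws.
rewrite sumrB s subrr mem0v => /(_ _ isT) h.
by apply/eqP; rewrite -subr_eq0 -memv0; apply: h => // c _; rewrite memvB.
Qed.

(** Rewrite x_a x_(-a) as x_(-a) x_a + t_a for positive a; the t_a add up to pairing with 2 rho. *)
Lemma casimir_pos b v : v \in wsp b -> cas v = (cval b)%:RC *: v +
  2 *: \sum_(a <- Rp) act V (x (- a)) (act V (x a) v).
Proof.
move=> vb; rewrite (casimir_wsp lf _ dual vb) (Rb_split lf).
have -> : \sum_(a <- Rp) (act V (x a) (act V (x (- a)) v) +
      act V (x (- a)) (act V (x (- - a)) v)) =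
    (2 * bf b rho)%:RC *: v + 2 *: \sum_(a <- Rp) act V (x (- a)) (act V (x a) v).
  rewrite /rhobar (wfZr hb) mulrA divff ?pnatr_eq0 // mul1r (wf_sumr hb).
  rewrite rmorph_sum scaler_suml scaler_sumr -big_split.
  rewrite [LHS]big_seq [RHS]big_seq; apply: eq_bigr => a aR /=.
  rewrite opprK scaler_nat mulr2n addrA; congr (_ + _).
  rewrite -(act_t lf _ vb) -(lf_br lf (Rp_root aR)) act_brk subrK //.
by rewrite addrA -scalerDl -rmorphD.
Qed.

Lemma casimir_singular b v : singular v b -> cas v = (cval b)%:RC *: v.
Proof.
move=> [_ vb vx]; rewrite (casimir_pos vb) big_seq big1 ?scaler0 ?addr0 //.
by move=> a aR; rewrite vx // act0r.
Qed.

Lemma casimir_commH H v : H \in h -> cas (act V H v) = act V H (cas v).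
Proof.
move=> hH; case: hws => _ /(_ v)[vb vbw ->]; rewrite linear_sumr /= !linear_sum /=.
rewrite ?linear_sumr /=; apply: eq_bigr => b _.
have vbb : vb b \in wsp b by have := vbw b; rewrite capfv.
have cb := casimir_stable (e := e) (e' := e') lf Sbar dual vbb.
rewrite (iffLR (mem_wsp he _ _) vbb H hH) (iffLR (mem_wsp he _ _) cb H hH).
by rewrite linearZ.
Qed.

Lemma singular_dom b v : singular v b -> dom Sbar b.
Proof.
move=> [v0 vb vx]; apply/allP => s sS.
have [|m ->] := root_highest lf hws (SP sS) vb v0; last exact: ler0n.
by apply: vx; apply: (Sbar_Rp hr hS).
Qed.

(** Among the weights of U take one of greatest height: raising operators increase the height, so
    they kill its vectors. *)
Lemma ex_singular U : lstable U -> U != 0%VS ->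
  exists v b, v \in U /\ singular v b.
Proof.
move=> [Uh Ux] U0; pose nz := [seq b <- ws | (U :&: wsp b)%VS != 0%VS].
have nz0 : nz != [::].
  rewrite -size_eq0 size_filter -lt0n -has_count; apply: contraNT U0.
  rewrite -all_predC => /allP h0; rewrite -subv0.
  apply: (sub_wsp he hws) => // b; have [bw|bw] := boolP (b \in ws).
    by have := h0 b bw; rewrite /= negbK => /eqP ->; apply: subvv.
  apply/subvP => v; rewrite memv_cap => /andP[_ vb].
  by rewrite (wsp_out he hws bw vb) mem0v.
have [b] := seq_max (@ht R X) nz0; rewrite mem_filter => /andP[Ub bw] bmax.
have [v [vU vb v0]] : exists v, [/\ v \in U, v \in wsp b & v != 0].
  exists (vpick (U :&: wsp b)); have := memv_pick (U :&: wsp b).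
  by rewrite memv_cap vpick0 => /andP[vU vb]; split.
exists v, b; split; first exact: vU; split; [exact: v0|exact: vb|move=> a aR].
have xv : act V (x a) v \in (U :&: wsp (b + a))%VS.
  rewrite memv_cap (Ux a (Rp_Rb aR) v vU).
  exact: (wsp_root he (lf_x lf (Rp_root aR)) vb).
have [baw|baw] := boolP (b + a \in ws); last first.
  by apply: (wsp_out he hws baw); move: xv; rewrite memv_cap => /andP[_ ->].
have [U0'|baU] := eqVneq (U :&: wsp (b + a))%VS 0%VS.
  by move: xv; rewrite U0' memv0 => /eqP.
have := bmax (b + a); rewrite mem_filter baU baw => /(_ isT); rewrite htD.
have := posroot_ht hr (Rp_root aR) (Rp_pos aR) => a1 a2.
by exfalso; lra.
Qed.

Section Gen.
Variables (v : V) (b : E).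
Hypothesis hv : singular v b.

(** The smallest subspace Z that contains [v] and is stable under h and the lowering operators is a
    submodule: the vectors of Z that all raising operators keep in Z form a subspace of the same
    kind, so they fill Z. *)
Lemma singular_gen : exists Z, [/\ v \in Z, lstable Z &
  forall W, v \in W -> hstable W -> {in Rp, forall a, root_stable x (- a) W} ->
    (Z <= W)%VS].
Proof.
have [v0 vb vx] := hv.
pose P W := [/\ v \in W, hstable W & {in Rp, forall a, root_stable x (- a) W}].
have [||Z [vZ Zh Zx] Zmin] := @min_subspace _ V P.
- split=> [|H u _ _|a _ u _]; exact: memvf.
- move=> U W [vU Uh Ux] [vW Wh Wx]; split; first by rewrite memv_cap vU.
    by move=> H u hH; rewrite !memv_cap => /andP[uU uW]; rewrite Uh ?Wh.
  by move=> a aR u; rewrite !memv_cap => /andP[uU uW]; rewrite Ux ?Wx.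
exists Z; split=> // [|W vW Wh Wx]; last exact: Zmin.
have [||W hW] := @pred_vspace _ V
    (fun u => u \in Z /\ {in Rp, forall a, act V (x a) u \in Z}).
- by split=> [|a _]; rewrite ?act0r mem0v.
- move=> c u w [uZ ux] [wZ wx]; split; first by rewrite memvD // memvZ.
  by move=> a aR; rewrite actDr actZr; apply: memvD; [apply/memvZ/ux|apply: wx].
have ZW : (Z <= W)%VS.
  apply: Zmin; split.
  - by apply/hW; split=> // a aR; rewrite vx ?mem0v.
  - move=> H u hH /hW[uZ ux]; apply/hW; split; first exact: Zh.
    move=> a aR; have := act_brk H (x a) u.
    rewrite (lf_x lf (Rp_root aR)) // actZl => /eqP; rewrite eq_sym subr_eq => /eqP e1.
    have -> : act V (x a) (act V H u) =
        act V H (act V (x a) u) - wteval a H *: act V (x a) u.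
      by rewrite e1 addrC addKr.
    apply: memvB; last exact/memvZ/ux.
    by apply: Zh => //; apply: ux.
  - move=> c cR u /hW[uZ ux]; apply/hW; split; first exact: Zx.
    move=> a aR; have := act_brk (x a) (x (- c)) u => /eqP.
    rewrite eq_sym subr_eq => /eqP ->.
    apply: memvD; last by apply: Zx => //; apply: ux.
    (* [x_a, x_(-c)] lies in h, or vanishes, or is a multiple of a raising or of a lowering
       operator. *)
    have aP := Rp_root aR; have cP := Rp_root cR.
    have [->|ac] := eqVneq a c; first by rewrite (lf_br lf cP); apply: Zh uZ; apply: (lf_t lf).
    have acS : a - c \in <<Sbar>>%VS by rewrite memvB ?Rp_span.
    have [acP|acP] := boolP (a - c \in Phi); last first.
      by rewrite (brk_out lf) ?act0l ?mem0v ?oppr_root // subr_eq0.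
    have [k ->] := brk_struct lf aP (oppr_root hr cP) acP.
    rewrite actZl; apply: memvZ; case: (pos_or hr acP) => ac0.
      by apply: ux; rewrite mem_Rp acP acS.
    rewrite -[a - c]opprK; apply: Zx => //.
    by rewrite mem_Rp ac0 memvN acS oppr_root.
split=> // a; rewrite mem_Rb => /andP[aS aP] u uZ.
case: (pos_or hr aP) => a0.
  by have /hW[_ h2] := subvP ZW u uZ; apply: h2; rewrite mem_Rp aP aS.
rewrite -[a]opprK; apply: Zx => //.
by rewrite mem_Rp a0 memvN aS oppr_root.
Qed.

Variable Z : {vspace V}.
Hypotheses (vZ : v \in Z) (Zs : lstable Z).
Hypothesis Zmin : forall W, v \in W -> hstable W ->
  {in Rp, forall a, root_stable x (- a) W} -> (Z <= W)%VS.

(** The vectors whose components all have weights below [b], the one of weight [b] lying on the line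
    of [v], form a subspace stable under h and the lowering operators, so it contains Z. *)
Lemma gen_weights u c : u \in Z -> u \in wsp c -> u != 0 ->
  [/\ cone (b - c), b - c \in <<Sbar>>%VS & c = b -> u \in <[v]>%VS].
Proof.
have [v0 vb vx] := hv.
have bws : b \in ws by apply: contraNT v0 => bw; rewrite (wsp_out he hws bw vb).
have uws : uniq ws by case: hws.
pose ok (vb : E -> V) := forall c, [/\ vb c \in wsp c,
  vb c != 0 -> cone (b - c) /\ b - c \in <<Sbar>>%VS &
  c = b -> vb c \in <[v]>%VS].
have [||W hW] := @pred_vspace _ V
    (fun u => exists2 vb, ok vb & u = \sum_(c <- ws) vb c).
- exists (fun=> 0); last by rewrite big1.
  by move=> c'; split; rewrite ?mem0v // eqxx.
- move=> k u1 u2 [w1 ok1 ->] [w2 ok2 ->].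
  exists (fun c => k *: w1 c + w2 c); last by rewrite scaler_sumr -big_split.
  move=> c'; have [p1 p2 p3] := ok1 c'; have [q1 q2 q3] := ok2 c'; split.
  + by apply: memvD q1; apply: memvZ.
  + case: (eqVneq (w1 c') 0) => [->|/p2 //]; rewrite scaler0 add0r; exact: q2.
  + by move=> cb; apply: memvD; [apply/memvZ/p3|apply: q3].
have WH : hstable W.
  move=> H w hH /hW[w1 ok1 ->]; apply/hW; exists (fun c => wteval c H *: w1 c).
    move=> c'; have [p1 p2 p3] := ok1 c'; split; first exact: memvZ.
      by rewrite scaler_eq0 negb_or => /andP[_ /p2].
    by move=> cb; apply/memvZ/p3.
  rewrite linear_sumr; apply: eq_bigr => c' _; have [p1 _ _] := ok1 c'.
  exact: (iffLR (mem_wsp he _ _) p1 H hH).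
have Wx : {in Rp, forall a, root_stable x (- a) W}.
  move=> a aR w /hW[w1 ok1 ->]; rewrite linear_sumr /=.
  rewrite big_seq; apply: memv_suml => d dw; have [p1 p2 p3] := ok1 d.
  have [w0|w0] := eqVneq (w1 d) 0; first by rewrite w0 act0r mem0v.
  have [dc dS] := p2 w0.
  have xd : act V (x (- a)) (w1 d) \in wsp (d - a).
    by apply: (wsp_root he (lf_x lf _)) => //; apply/oppr_root/(Rp_root aR).
  have [daw|daw] := boolP (d - a \in ws); last first.
    by rewrite (wsp_out he hws daw xd) mem0v.
  apply/hW; exists (fun c => if c == d - a then act V (x (- a)) (w1 d) else 0).
    move=> c'; case: eqP => [->|_]; last by split=> [||_]; rewrite ?mem0v ?eqxx.
    split=> [|_|dab]; first exact: xd.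
      have -> : b - (d - a) = b - d + a by rewrite opprB addrCA addrC.
      split; last by apply: memvD dS _; apply: Rp_span.
      by apply: coneD => //; apply/pos_cone/(Rp_pos aR).
    move: dc; rewrite (_ : b - d = - a); last by rewrite -dab addrAC subrr add0r.
    move=> /cone_anti; rewrite opprK => /(_ (pos_cone (Rp_pos aR)))/eqP.
    by rewrite oppr_eq0 (negPf (root_neq0 hr (Rp_root aR))).
  by rewrite (bigD1_seq (d - a)) //= eqxx big1 ?addr0 // => c' /negPf ->.
have vW : v \in W.
  apply/hW; exists (fun c => if c == b then v else 0).
    move=> c'; case: eqP => [->|_]; last by split=> [||_]; rewrite ?mem0v ?eqxx.
    by rewrite subrr; split=> [|_|_]; [exact: vb|split; [exact: cone0|exact: mem0v]|exact: memv_line].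
  by rewrite (bigD1_seq b) //= eqxx big1 ?addr0 // => c' /negPf ->.
move=> /(subvP (Zmin vW WH Wx))/hW[w okw uE] uc u0.
have cw : c \in ws by apply: contraNT u0 => cw; rewrite (wsp_out he hws cw uc).
suff e1 : w c = u.
  by have [_ p2 p3] := okw c; rewrite -e1 in u0 *; have [] := p2 u0; split.
have := @wt_uniq w (fun c' => if c' == c then u else 0) _ _ _ c.
rewrite eqxx; apply; first by move=> c'; case: (okw c').
  by move=> c'; case: eqP => [->|_]; [exact: uc|exact: mem0v].
by rewrite -uE (bigD1_seq c) //= eqxx big1 ?addr0 // => c' /negPf ->.
Qed.

Lemma gen_casimir u : u \in Z -> cas u = (cval b)%:RC *: u.
Proof.
have [||W hW] := @pred_vspace _ V (fun u => cas u = (cval b)%:RC *: u).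
- by rewrite linear0 scaler0.
- by move=> c u1 u2 e1 e2; rewrite linearP /= e1 e2 scalerDr !scalerA mulrC.
move=> uZ; apply/hW; apply: subvP uZ; apply: Zmin.
- by apply/hW/casimir_singular.
- by move=> H w hH /hW wc; apply/hW; rewrite casimir_commH // wc actZr.
- move=> a aR w /hW wc; apply/hW.
  by rewrite (casimir_comm lf dual _ hws (RpN_Rb aR)) wc actZr.
Qed.

Lemma gen_wdim : wdim Z b = 1.
Proof.
have [v0 vb _] := hv.
have d1 : \dim <[v]> = 1 by rewrite dim_vline v0.
rewrite wdimE -d1; congr (\dim _); apply/eqP; rewrite eqEsubv.
apply/andP; split; apply/subvP => u.
  rewrite memv_cap => /andP[uZ ub].
  have [->|u0] := eqVneq u 0; first exact: mem0v.
  by have [_ _] := gen_weights uZ ub u0; apply.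
by move=> /vlineP[k ->]; rewrite memvZ // memv_cap vZ.
Qed.
End Gen.
End Generated.

Lemma altcoef_map (E : zmodType) (A A' : pzRingType) (phi : {rmorphism A -> A'})
  (s : seq E) g : altcoef A' s g = phi (altcoef A s g).
Proof.
by rewrite /altcoef altsum_morph; apply: eq_altsum => y /=; rewrite rmorph_nat.
Qed.

(** * Characters of irreducible modules of the Levi subalgebra *)

Section Irreducible.
Variables (R : realType) (X : lie_datum R).
Local Notation g := (alg X).
Local Notation h := (cartan X).
Local Notation E := (euc X).
Local Notation S := (simple_roots X).
Local Notation Phi := (root_set X).
Implicit Types (a b : E).
Variables (bf : E -> E -> R) (x t : E -> g) (B : g -> g -> R[i]).
Hypothesis lf : lie_frame bf x t B.

Local Notation cval_def := cval.
Let hr := lf_roots lf.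
Let hb := lf_form lf.
Let he := lf_eval lf.

Variables (V : lieMod g) (ws : seq E).
Hypothesis hws : wdiag V ws.
Implicit Types (U W Z : {vspace V}) (u v : V).
Local Notation wsp := (wsp V).
Local Notation wdim := (wdim (V := V)).

Variable Sbar : seq E.
Hypothesis hS : {subset Sbar <= S}.
Local Notation Rb := (Rbar Sbar).
Local Notation Rp := (Rbar_pos Sbar).
Local Notation rho := (rhobar Sbar).
Local Notation lstable := (lstable x (V := V) Sbar).
Local Notation singular := (singular x (V := V) Sbar).
Local Notation cval := (cval bf Sbar).

Variables (n : nat) (e e' : 'I_n -> E).
Hypothesis dual : forall b, \sum_k bf b (e k) * bf b (e' k) = bf b b.
Local Notation cas := (casimir x t (V := V) Sbar e e').

Let Rp_Rb a : a \in Rp -> a \in Rb.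
Proof. by move=> aR; rewrite mem_Rb (Rp_span aR) (Rp_root aR). Qed.
Let RpN_Rb a : a \in Rp -> - a \in Rb.
Proof. by move=> /Rp_Rb; apply: (Rb_opp lf). Qed.
Let SP s : s \in Sbar -> s \in Phi. Proof. exact: (Sbar_root hr hS). Qed.

Section Freudenthal.
Variables (U : {vspace V}) (k : R[i]).
Hypotheses (Us : lstable U) (Uk : {in U, forall u, cas u = k *: u}).

Let T a b : R[i] := trs (U :&: wsp b)
  (fun v => act V (x (- a)) (act V (x a) v)).
Let d b : R[i] := (wdim U b)%:R.

Let trs_wt b (f : V -> V) c : {in wsp b, forall v, f v = c *: v} ->
  trs (U :&: wsp b) f = c * d b.
Proof.
move=> fc; rewrite /d wdimE; apply: trs_scal => v; rewrite memv_cap => /andP[_].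
exact: fc.
Qed.

(** By cyclicity, the trace of x_(-a) x_a on weight b is that of x_a x_(-a) on weight b + a; the
    commutator t_a acts there by (b + a, a). This is the hypothesis of [altsum_telescope]. *)
Lemma string_trace a b : a \in Rp ->
  T a b - T a (b + a) = (bf (b + a) a)%:RC * d (b + a).
Proof.
move=> aR; have aP := Rp_root aR; have [_ Ux] := Us.
have -> : T a b = trs (U :&: wsp (b + a))
    (fun v => act V (x a) (act V (x (- a)) v)).
  apply: (@trs_exchange _ V V (U :&: wsp b) (U :&: wsp (b + a))
    (act V (x a)) (act V (x (- a)))) => v; rewrite !memv_cap => /andP[vU vb].
    by rewrite (Ux a (Rp_Rb aR) v vU) (wsp_root he (lf_x lf aP) vb).
  rewrite (Ux (- a) (RpN_Rb aR) v vU) -[b](addrK a).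
  by rewrite (wsp_root he (lf_x lf (oppr_root hr aP)) vb).
apply/eqP; rewrite subr_eq; apply/eqP.
rewrite -(trs_wt (f := act V (t a))) => [|v vb]; last exact: (act_t lf _ vb).
rewrite /T -trsD; apply: eq_in_trs => v _.
by rewrite -(lf_br lf aP) act_brk subrK.
Qed.

Lemma casimir_trace b :
  k * d b = (cval b)%:RC * d b + 2 * \sum_(a <- Rp) T a b.
Proof.
have -> : k * d b = trs (U :&: wsp b) cas.
  rewrite /d wdimE; apply/esym/trs_scal => v; rewrite memv_cap => /andP[vU _].
  exact: Uk.
rewrite -(trs_wt (f := fun v => (cval b)%:RC *: v)) // -trs_sum -trsZ -trsD.
apply: eq_in_trs => v; rewrite memv_cap => /andP[_ vb].
exact: (casimir_pos lf Sbar dual vb).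
Qed.

(* Freudenthal's formula, multiplied by the Weyl denominator. *)
Lemma freudenthal mu :
  (k - (cval mu)%:RC) * altsum Rp (fun y => d (mu + y)) = 0.
Proof.
pose G y z := (bf (mu + y) z)%:RC * d (mu + y).
have tel : \sum_(a <- Rp) altsum Rp (fun y => T a (mu + y)) =
    - altsum Rp (fun y => G y y).
  apply: (altsum_telescope (T := fun a y => T a (mu + y)) (G := G)).
    by move=> y z z'; rewrite /G (wfDr hb) rmorphD mulrDl.
  by move=> a aR y; rewrite /G !addrA string_trace.
rewrite mulrBl; apply/eqP; rewrite subr_eq0 -!altsumZ; apply/eqP.
transitivity (altsum Rp (fun y =>
    (cval (mu + y) - 2 * bf (mu + y) y)%:RC * d (mu + y))).
  rewrite (eq_altsum _ (fun y => casimir_trace (mu + y))) altsumD altsumZ.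
  rewrite altsum_sum tel mulrN -altsumZ -altsumN -altsumD.
  apply: eq_altsum => y; rewrite /G mulrA -mulrBl; congr (_ * _).
  by rewrite rmorphB rmorphM rmorph_nat.
(* Only the y in the support of the denominator count, and for these (y, y) = 2 (y, rho) makes the
   scalar independent of y. *)
apply: eq_altsum_coef => y; rewrite (altcoef_map (real_complex R)) => yc.
have {}yc : altcoef R Rp y != 0 by apply: contraNneq yc => ->; rewrite rmorph0.
have hn := alt_norm hr hS hb yc.
suff -> : cval (mu + y) - 2 * bf (mu + y) y = cval mu by [].
move: hn; rewrite /cval_def.
move: (rho) => r; rewrite !(wfE hb) (wfC hb y mu) (wfC hb r y) => h0.
have {}h0 : bf y y = 2 * bf y r by lra.
by rewrite h0; ring.
Qed.
End Freudenthal.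

Section GenAlt.
Variables (v : V) (b : E) (Z : {vspace V}).
Hypotheses (hv : singular v b) (vZ : v \in Z) (Zs : lstable Z).
Hypothesis Zmin : forall W, v \in W -> hstable W ->
  {in Rp, forall a, root_stable x (- a) W} -> (Z <= W)%VS.

Lemma gen_wdim_neq0 c : wdim Z c != 0%N -> cone (b - c) /\ b - c \in <<Sbar>>%VS.
Proof.
rewrite wdimE dimv_eq0 -vpick0 => u0.
have := memv_pick (Z :&: wsp c); rewrite memv_cap => /andP[uZ uc].
by have [] := gen_weights lf hws hv Zmin uZ uc u0.
Qed.

(** Weyl's character formula, tested on dominant weights. For mu = b all terms but y = 0 vanish,
    since no weight lies above b. For another mu a nonzero sum would put mu strictly below b, while
    [freudenthal] would give mu and b the same Casimir value, against [dom_rho_norm_lt]. *)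
Lemma gen_alt mu : dom Sbar mu ->
  altsum Rp (fun y => (wdim Z (mu + y))%:R) = (mu == b)%:R :> R.
Proof.
move=> dmu; have [->|mub] := eqVneq mu b.
  rewrite (altsum_coef1 (g0 := 0)) => [|y yc y0].
    by rewrite addr0 (gen_wdim lf hws hv vZ Zmin) (alt0 hr) mul1r.
  apply/eqP; rewrite pnatr_eq0; apply/negPn/negP => /gen_wdim_neq0[c1 _].
  have [c2 _ _ _ _] := alt_cone hr yc.
  by move: c1 y0; rewrite opprD addrA subrr add0r => /(cone_anti c2) ->; rewrite eqxx.
apply: contraTeq isT => N0; rewrite /= in N0.
have [y yc yZ] : exists2 y, altcoef R Rp y != 0 & wdim Z (mu + y) != 0%N.
  apply: contrapT => nex; case/eqP: N0; apply: altsum_eq0 => y yc.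
  apply/eqP; rewrite pnatr_eq0; apply/negPn/negP => yZ; apply: nex; by exists y.
have [c1 s1] := gen_wdim_neq0 yZ; have [c2 s2 _ _ _] := alt_cone hr yc.
have e1 : b - mu = (b - (mu + y)) + y by rewrite opprD addrA subrK.
have := dom_rho_norm_lt hr hS hb (singular_dom lf hws hS hv) dmu.
rewrite e1 => /(_ (coneD c1 c2) (memvD s1 s2)); rewrite eq_sym => /(_ mub) lt.
have := freudenthal Zs (gen_casimir lf hws dual hv Zmin) mu.
move=> F0; exfalso; move: F0 => /eqP; rewrite mulf_eq0; apply/negP; rewrite negb_or; apply/andP; split.
  rewrite -rmorphB fmorph_eq0 subr_eq0; apply: contraTneq lt => e2.
  by rewrite -leNgt !(norm_rho lf) e2.
rewrite (eq_altsum _ (g := fun y => (real_complex R) (wdim Z (mu + y))%:R)).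
  by rewrite -(altsum_morph (real_complex R)) fmorph_eq0.
by move=> z; rewrite rmorph_nat.
Qed.
End GenAlt.

Definition lirr U := [/\ U != 0%VS, lstable U &
  forall U', lstable U' -> (U' <= U)%VS -> U' = 0%VS \/ U' = U].

Lemma lirrP U : irreducible_sub (levi Sbar) U <-> lirr U.
Proof.
split=> -[U0 Us Umin]; split=> //; try exact/(levi_stable lf Sbar U).
  by move=> U' /(levi_stable lf Sbar U'); apply: Umin.
by move=> U' /(levi_stable lf Sbar U'); apply: Umin.
Qed.

Lemma lirr_gen U v b : lirr U -> v \in U -> singular v b ->
  forall W, v \in W -> hstable W -> {in Rp, forall a, root_stable x (- a) W} ->
  (U <= W)%VS.
Proof.
move=> [U0 Us Umin] vU hv.
have [Z [vZ Zs Zmin]] := singular_gen lf hv.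
have ZU : (Z <= U)%VS.
  have [Uh Ux] := Us; apply: Zmin => // a aR; exact/Ux/RpN_Rb.
have [Z0|<-] := Umin Z Zs ZU; last exact: Zmin.
by move: vZ; have [v0 _ _] := hv; rewrite Z0 memv0 (negPf v0).
Qed.

(** A nonzero submodule of the generated module contains a singular vector. Its weight is dominant,
    lies below b and has the same Casimir value, so it is b and the vector is a multiple of the
    generator. *)
Lemma singular_irr v b : singular v b -> exists2 U, lirr U & v \in U.
Proof.
move=> hv; have [Z [vZ Zs Zmin]] := singular_gen lf hv.
exists Z => //; have [v0 vb _] := hv; split=> //.
  by apply: contraNneq v0 => Z0; rewrite -memv0 -Z0.
move=> U Us UZ; have [->|U0] := eqVneq U 0%VS; [by left|right].
have [u [c [uU hu]]] := ex_singular lf hws Us U0.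
have [u0 uc _] := hu; have uZ := subvP UZ u uU.
have [c1 s1 vl] := gen_weights lf hws hv Zmin uZ uc u0.
have ecv : cval c = cval b.
  apply: (@complexI R); apply/eqP; rewrite -subr_eq0.
  have := gen_casimir lf hws dual hv Zmin uZ.
  rewrite (casimir_singular lf dual hu) => /eqP.
  by rewrite -subr_eq0 -scalerBl scaler_eq0 (negPf u0) orbF.
have bc : b = c.
  apply/eqP; apply: contraTT isT => bc.
  have := dom_rho_norm_lt hr hS hb (singular_dom lf hws hS hv)
    (singular_dom lf hws hS hu) c1 s1 bc.
  by rewrite !(norm_rho lf) ecv ltxx.
apply/eqP; rewrite eqEsubv UZ /=; apply: Zmin.
- have /vlineP[k uE] := vl (esym bc); have k0 : k != 0.
    by apply: contraNneq u0 => k0; rewrite uE k0 scale0r.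
  by rewrite -[v](scalerK k0) -uE memvZ.
- by case: Us.
- by move=> a aR; have [_ Ux] := Us; apply/Ux/RpN_Rb.
Qed.

Lemma lirr_hw U : lirr U -> exists b,
  [/\ dom Sbar b,
      forall mu, dom Sbar mu ->
        altsum Rp (fun y => (wdim U (mu + y))%:R) = (mu == b)%:R :> R,
      {in U, forall u, cas u = (cval b)%:RC *: u},
      forall c, wdim U c != 0%N -> cone (b - c) /\ b - c \in <<Sbar>>%VS &
      forall c, (exists2 v, v \in U & singular v c) <-> c = b].
Proof.
move=> Ui; have [U0 Us Umin] := Ui.
have [v [b [vU hv]]] := ex_singular lf hws Us U0.
have gen := lirr_gen Ui vU hv; exists b; split.
- exact: (singular_dom lf hws hS hv).
- by move=> mu dmu; apply: (gen_alt hv vU Us gen).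
- by move=> u; apply: (gen_casimir lf hws dual hv gen).
- by move=> c; apply: (gen_wdim_neq0 hv gen).
move=> c; split=> [[u uU hu]|->]; last by exists v.
have gen' := lirr_gen Ui uU hu; have [u0 uc _] := hu; have [v0 vb _] := hv.
have [c1 _ _] := gen_weights lf hws hv gen uU uc u0.
have [c2 _ _] := gen_weights lf hws hu gen' vU vb v0.
apply/eqP; rewrite eq_sym -subr_eq0; apply/eqP; apply: cone_anti c1 _.
by rewrite opprB.
Qed.
End Irreducible.

(** * Complete reducibility and branching multiplicities *)

Lemma sub_sum_seq (K : fieldType) (V : vectType K) (T : eqType) (s : seq T)
    (F : T -> {vspace V}) W :
  {in s, forall y, (F y <= W)%VS} -> (\sum_(y <- s) F y <= W)%VS.
Proof.
elim: s => [|y s IH] h; first by rewrite big_nil sub0v.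
rewrite big_cons subv_add h ?mem_head //; apply: IH => z zs.
by apply: h; rewrite inE zs orbT.
Qed.

Section Reducibility.
Variables (R : realType) (X : lie_datum R).
Local Notation g := (alg X).
Local Notation h := (cartan X).
Local Notation E := (euc X).
Local Notation S := (simple_roots X).
Local Notation Phi := (root_set X).
Implicit Types (a b : E).
Variables (bf : E -> E -> R) (x t : E -> g) (B : g -> g -> R[i]).
Hypothesis lf : lie_frame bf x t B.

Local Notation cval_def := cval.
Let hr := lf_roots lf.
Let hb := lf_form lf.
Let he := lf_eval lf.

Variables (V : lieMod g) (ws : seq E).
Hypothesis hws : wdiag V ws.
Implicit Types (U W Z : {vspace V}) (u v : V).
Local Notation wsp := (wsp V).
Local Notation wdim := (wdim (V := V)).

Variable Sbar : seq E.
Hypothesis hS : {subset Sbar <= S}.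
Local Notation Rb := (Rbar Sbar).
Local Notation Rp := (Rbar_pos Sbar).
Local Notation rho := (rhobar Sbar).
Local Notation lstable := (lstable x (V := V) Sbar).
Local Notation singular := (singular x (V := V) Sbar).
Local Notation lirr := (lirr x (V := V) Sbar).
Local Notation cval := (cval bf Sbar).

Lemma lstable_sum (s : seq {vspace V}) : {in s, forall U, lstable U} ->
  lstable (\sum_(U <- s) U)%VS.
Proof.
elim: s => [|U s IH] hs; first by rewrite big_nil; apply: lstable0.
rewrite big_cons; apply: lstableD; first exact/hs/mem_head.
by apply: IH => U' Us; apply: hs; rewrite inE Us orbT.
Qed.

Lemma sum_wsp (s : seq {vspace V}) c : {in s, forall U, lstable U} ->
  ((\sum_(U <- s) U) :&: wsp c <= \sum_(U <- s) (U :&: wsp c))%VS.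
Proof.
elim: s => [|U s IH] hs; first by rewrite !big_nil cap0v.
have hs' : {in s, forall U, lstable U}.
  by move=> U' Us; apply: hs; rewrite inE Us orbT.
have [Uh _] := hs U (mem_head _ _); have [Wh _] := lstable_sum hs'.
apply/subvP => w; rewrite !big_cons memv_cap => /andP[/memv_addP[u uU [w' w'W wE]] wc].
have [vb1 v1 e1] := stable_decomp he hws Uh uU.
have [vb2 v2 e2] := stable_decomp he hws Wh w'W.
have [cw|cw] := boolP (c \in ws); last first.
  by rewrite (wsp_out he hws cw wc) mem0v.
have in1 b : vb1 b \in wsp b by have := v1 b; rewrite memv_cap => /andP[].
have in2 b : vb2 b \in wsp b by have := v2 b; rewrite memv_cap => /andP[].
have uws : uniq ws by case: hws.
have -> : w = vb1 c + vb2 c.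
  have := @wt_uniq _ _ _ _ _ _ lf V ws hws
    (fun b => if b == c then w else 0) (fun b => vb1 b + vb2 b) _ _ _ c.
  rewrite eqxx; apply.
  - by move=> b; case: eqP => [->|_]; [exact: wc|exact: mem0v].
  - by move=> b; exact: memvD (in1 b) (in2 b).
  - rewrite big_split /= -e1 -e2 -wE (bigD1_seq c) //= eqxx big1 ?addr0 //.
    by move=> b /negPf ->.
apply: memv_add; first exact: v1.
by apply: (subvP (IH hs')); apply: v2.
Qed.

(** Let mu be a weight of greatest height whose weight space is not inside the sum W, and v outside
    W of weight mu. All x_a v lie in W. A polynomial in the Casimir operator corrects v to a
    singular vector outside W; the irreducible module it generates meets W in 0. *)
Lemma lirr_extend (s : seq {vspace V}) : {in s, forall U, lirr U} ->
    (\sum_(U <- s) U)%VS != fullv ->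
  exists2 U, lirr U & (U :&: (\sum_(U <- s) U) = 0)%VS.
Proof.
move=> si Wf; set W := (\sum_(U <- s) U)%VS in Wf *.
have sl : {in s, forall U, lstable U} by move=> U /si[].
have Ws : lstable W by apply: lstable_sum.
have [Wh Wx] := Ws.
have [n [e [e' dual]]] := wf_dual hb.
pose cas := casimir x t (V := V) Sbar e e'.
have /boolp.choice[hw hhw] : forall U, exists b, U \in s -> [/\ dom Sbar b,
     {in U, forall u, cas u = (cval b)%:RC *: u} &
     forall c, wdim U c != 0%N -> cone (b - c) /\ b - c \in <<Sbar>>%VS].
  move=> U.
  have [Us|Us] := boolP (U \in s); last by exists 0.
  have [b [b1 _ b3 b4 _]] := lirr_hw lf hws hS dual (si U Us).
  by exists b.
pose bad := [seq b <- ws | ~~ (wsp b <= W)%VS].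
have bad0 : bad != [::].
  rewrite -size_eq0 size_filter -lt0n -has_count; apply: contraNT Wf.
  rewrite -all_predC => /allP ok; rewrite eqEsubv subvf /=.
  apply: (sub_wsp he hws) => [|b]; first by move=> *; apply: memvf.
  rewrite capfv; have [bw|bw] := boolP (b \in ws).
    by have := ok b bw; rewrite /= negbK.
  by apply/subvP => v vb; rewrite (wsp_out he hws bw vb) mem0v.
have [mu] := seq_max (@ht R X) bad0; rewrite mem_filter => /andP[muW muws] mumax.
have up c : ht mu < ht c -> (wsp c <= W)%VS.
  move=> lt; apply: contraLR lt => cW; rewrite -leNgt.
  have [cws|cws] := boolP (c \in ws); first by apply: mumax; rewrite mem_filter cW.
  case/negP: cW; apply/subvP => v vc; by rewrite (wsp_out he hws cws vc) mem0v.
have [v vmu vW] : exists2 v, v \in wsp mu & v \notin W.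
  by move/subvPn: muW => [v]; exists v.
have upx a u : a \in Rp -> u \in wsp mu -> act V (x a) u \in W.
  move=> aR umu; have aP := Rp_root aR.
  apply: (subvP (up (mu + a) _)); last exact: (wsp_root he (lf_x lf aP) umu).
  by rewrite htD ltrDl; apply: lt_le_trans (posroot_ht hr aP (Rp_pos aR)).
have Rb_S c : c \in Sbar -> c \in Rb /\ - c \in Rb.
  move=> cS; have cR : c \in Rb.
    by rewrite mem_Rb memv_span //= (Sbar_root hr hS).
  by split=> //; apply: (Rb_opp lf).
(* Otherwise the reflected weight is higher, so W contains its whole weight space; by reflection
   invariance of dimensions W then contains that of mu as well. *)
have dmu : dom Sbar mu.
  apply/allP => c cS; rewrite leNgt; apply/negP => mc.
  have [cR cNR] := Rb_S c cS; have cP := Sbar_root hr hS cS.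
  have le : (wsp (reflect c mu) <= W)%VS.
    apply: up; rewrite /reflect htD htN htZ (ht_simple hr (hS cS)) mulr1.
    by rewrite ltrDl oppr_gt0.
  have e1 := wdim_refl lf hws mu cP (Wx c cR) (Wx (- c) cNR).
  have e2 := @wdim_refl _ _ _ _ _ _ lf V ws hws c mu fullv cP
    (fun v _ => memvf _) (fun v _ => memvf _).
  have e3 : wdim W (reflect c mu) = wdim fullv (reflect c mu).
    by rewrite !wdimE capfv; congr (\dim _); apply/capv_idPr.
  have := e1; rewrite e3 e2 !wdimE capfv => e4.
  case/negP: muW; apply/capv_idPr/eqP; rewrite eqEdim capvSr /=.
  by rewrite e4.
(* The product of the [cas - c] over these values acts on weight mu modulo W by a nonzero scalar,
   yet kills every x_a v. *)
pose cs := [seq c <- map (fun U => cval (hw U)) s | c != cval mu].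
pose pr (l : seq R) u := foldr (fun k u => cas u - k%:RC *: u) u l.
have prL l c u w : pr l (c *: u + w) = c *: pr l u + pr l w.
  elim: l => //= k l ->; rewrite /cas linearP /= -/cas scalerBr.
  rewrite [k%:RC *: (_ + _)]scalerDr !scalerA.
  by rewrite opprD addrACA [k%:RC * c]mulrC.
have casmu u : u \in wsp mu ->
    exists2 w, w \in W & cas u = (cval mu)%:RC *: u + w.
  move=> umu; rewrite /cas (casimir_pos lf Sbar dual umu); eexists; last by [].
  apply: memvZ; rewrite big_seq; apply: memv_suml => a aR.
  apply: Wx; last exact: upx.
  by apply: (Rb_opp lf); rewrite mem_Rb (Rp_span aR) (Rp_root aR).
have prmu l u : u \in wsp mu -> pr l u \in wsp mu.
  move=> umu; elim: l => //= k l IH; apply: memvB; last exact: memvZ.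
  exact: (casimir_stable lf Sbar dual IH).
have prW l u : cval mu \notin l -> u \in wsp mu -> u \notin W -> pr l u \notin W.
  elim: l => //= k l IH; rewrite inE negb_or => /andP[kmu lmu] umu uW.
  have [w wW ->] := casmu _ (prmu l u umu).
  rewrite addrAC -scalerBl; apply: contra (IH lmu umu uW) => h0.
  have := memvB h0 wW; rewrite addrK => h1.
  have k0 : (cval mu)%:RC - k%:RC != 0 by rewrite -rmorphB fmorph_eq0 subr_eq0.
  by rewrite -[pr l u](scalerK k0) memvZ.
have prx l a u : a \in Rp -> act V (x a) (pr l u) = pr l (act V (x a) u).
  move=> aR; elim: l => //= k l IH; rewrite actBr actZr -IH; congr (_ - _).
  apply/esym; apply: (casimir_comm lf dual _ hws).
  by rewrite mem_Rb (Rp_span aR) (Rp_root aR).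
have prk l (k : R[i]) u : cas u = k *: u -> pr l u = (\prod_(c <- l) (k - c%:RC)) *: u.
  move=> uk; elim: l => [|c l IH] /=; first by rewrite big_nil scale1r.
  rewrite IH big_cons /cas linearZ /= -/cas uk !scalerA -scalerBl; congr (_ *: _).
  by rewrite mulrBl mulrC.
(* Summands with another Casimir value are killed by one of the factors. A summand with the value of
   mu has no weight mu + a: its highest weight would lie strictly above mu and have a larger
   value. *)
have pr0 a : a \in Rp -> {in (W :&: wsp (mu + a))%VS, forall u, pr cs u = 0}.
  move=> aR; have aP := Rp_root aR.
  have [||K hK] := @pred_vspace _ V (fun u => pr cs u = 0).
  - by have := prL cs (-1) 0 0; rewrite scaler0 addr0 scaleN1r addNr.
  - by move=> c u w u0 w0; rewrite prL u0 w0 scaler0 addr0.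
  move=> u uW; apply/hK.
  apply: subvP (subvP (sum_wsp (mu + a) sl) _ uW).
  apply: sub_sum_seq => U Us; apply/subvP => w wU; apply/hK.
  have [d1 ck wts] := hhw U Us; have [-> | w0] := eqVneq w 0.
    by apply/hK; apply: mem0v.
  have [ce|cne] := eqVneq (cval (hw U)) (cval mu); last first.
    move: wU; rewrite memv_cap => /andP[wU _]; rewrite (prk _ _ _ (ck w wU)).
    have csU : cval (hw U) \in cs by rewrite mem_filter cne; apply: (map_f (fun U => cval (hw U))).
    rewrite (_ : \prod_(c <- cs) _ = 0) ?scale0r //.
    by rewrite (big_rem _ csU) /= subrr mul0r.
  have [|c1 s1] := wts (mu + a).
    rewrite wdimE dimv_eq0; apply: contraNneq w0 => U0.
    by rewrite -memv0 -U0.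
  have e1 : hw U - mu = hw U - (mu + a) + a by rewrite opprD addrA subrK.
  have c2 : cone (hw U - mu) by rewrite e1; apply: coneD c1 (pos_cone (Rp_pos aR)).
  have s2 : hw U - mu \in <<Sbar>>%VS by rewrite e1 memvD // Rp_span.
  have ne : hw U != mu.
    rewrite -subr_eq0 e1; apply/negP => /eqP e2.
    have a0 : hw U - (mu + a) = - a by apply/eqP; rewrite -addr_eq0 e2.
    move: c1; rewrite a0 => /cone_anti; rewrite opprK => /(_ (pos_cone (Rp_pos aR)))/eqP.
    by rewrite oppr_eq0 (negPf (root_neq0 hr aP)).
  have := dom_rho_norm_lt hr hS hb d1 dmu c2 s2 ne.
  by rewrite !(norm_rho lf) ce ltxx.
pose v' := pr cs v.
have v'W : v' \notin W.
  by apply: prW => //; rewrite mem_filter eqxx.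
have hv' : singular v' mu.
  split; first by apply: contraNneq v'W => ->; apply: mem0v.
    exact: prmu.
  move=> a aR; rewrite /v' (prx cs a v aR); apply: (pr0 a aR).
  rewrite memv_cap (upx a v aR vmu).
  exact: (wsp_root he (lf_x lf (Rp_root aR)) vmu).
have [U Ui vU] := singular_irr lf hws hS dual hv'.
exists U => //; have [_ Us Umin] := Ui.
have [//|UW] := Umin _ (lstableI Us Ws) (capvSl _ _).
by case/negP: v'W; move: vU; rewrite -UW memv_cap => /andP[].
Qed.

Lemma complete_reducibility : exists s : seq {vspace V},
  [/\ {in s, forall U, lirr U}, (\sum_(U <- s) U)%VS = fullv &
      \dim (\sum_(U <- s) U)%VS = (\sum_(U <- s) \dim U)%N].
Proof.
suff key (m : nat) (s : seq {vspace V}) : {in s, forall U, lirr U} ->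
    \dim (\sum_(U <- s) U)%VS = (\sum_(U <- s) \dim U)%N ->
    (\dim {:V} - \dim (\sum_(U <- s) U)%VS < m)%N ->
    exists s : seq {vspace V}, [/\ {in s, forall U, lirr U},
      (\sum_(U <- s) U)%VS = fullv &
      \dim (\sum_(U <- s) U)%VS = (\sum_(U <- s) \dim U)%N].
  by apply: (key (\dim {:V}).+1 [::]) => //; rewrite !big_nil ?dimv0 ?subn0.
elim: m s => // m IH s si sd le_m.
have [Wf|Wf] := eqVneq (\sum_(U <- s) U)%VS fullv; first by exists s.
have [U Ui UW] := lirr_extend si Wf.
have U0 : (0 < \dim U)%N by have [U0 _ _] := Ui; rewrite lt0n dimv_eq0.
have dd : \dim (U + \sum_(U <- s) U)%VS = (\dim U + \dim (\sum_(U <- s) U)%VS)%N.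
  by apply: dimv_disjoint_sum.
apply: (IH (U :: s)).
- by move=> U'; rewrite inE => /orP[/eqP -> //|/si].
- by rewrite !big_cons dd sd.
- rewrite big_cons dd; have := dimvS (subvf (U + \sum_(U <- s) U)%VS).
  rewrite dd; lia.
Qed.

Local Notation branching mu :=
  (altsum Rp (fun y => (wdim fullv (mu + y))%:R) : R).

Lemma is_levi_irrP U mu : lirr U ->
  is_levi_irr_hw Sbar U mu <-> exists2 v, v \in U & singular v mu.
Proof.
move=> Ui; split=> [[_ [v vU [v0 vw vx]]]|[v vU [v0 vw vx]]].
  exists v => //; split=> //; first exact/(mem_wsp he).
  by move=> a aR; apply: (vx a aR); exact: (lf_x lf (Rp_root aR)).
split; first exact/(lirrP lf); exists v => //; split=> //; first exact/(mem_wsp he).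
move=> a aR y ya; have [c ->] := lf_dim1 lf (Rp_root aR) ya.
by rewrite actZl vx ?scaler0.
Qed.

Lemma wdim_sum r (U : 'I_r -> {vspace V}) c :
    (forall i, lstable (U i)) -> (\sum_i U i)%VS = fullv ->
    directv (\sum_i U i) ->
  wdim fullv c = (\sum_i wdim (U i) c)%N.
Proof.
move=> Us Uf Ud.
have dc : directv (\sum_i (U i :&: wsp c)).
  apply/directv_sum_independent => us usU us0 i _.
  move/directv_sum_independent: Ud; apply=> // j _.
  by have := usU j isT; rewrite memv_cap => /andP[].
under eq_bigr do rewrite wdimE; rewrite wdimE capfv.
move/directvP: dc => /= <-; congr (\dim _); apply/eqP; rewrite eqEsubv.
apply/andP; split; last by apply/subv_sumP => i _; apply: capvSr.
have := @sum_wsp [seq U i | i <- enum 'I_r] c.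
rewrite !big_map -!enumT /= !big_enum /= Uf capfv; apply.
by move=> _ /mapP[i _ ->].
Qed.

(** By [lirr_hw] each irreducible summand contributes 1 to the alternating sum if its highest weight
    is mu and 0 otherwise, so the count is the same for every decomposition; complete reducibility
    provides one. *)
Lemma multiplicityP mu m : dom Sbar mu ->
  multiplicity Sbar V mu m <-> m%:R = branching mu.
Proof.
move=> dmu.
have count r (U : 'I_r -> {vspace V}) : (forall i, lirr (U i)) ->
    (\sum_i U i)%VS = fullv -> directv (\sum_i U i) ->
    (#|[pred i | `[< is_levi_irr_hw Sbar (U i) mu >]]|)%:R = branching mu.
  move=> Ui Uf Ud; have [n [e [e' dual]]] := wf_dual hb.
  transitivity (\sum_i altsum Rp (fun y => (wdim (U i) (mu + y))%:R) : R).
    rewrite -sum1_card natr_sum big_mkcond; apply: eq_bigr => i _.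
    have [b [_ -> // _ _ hb']] := lirr_hw lf hws hS dual (Ui i).
    rewrite inE; case: asboolP => [/(is_levi_irrP _ (Ui i))/hb' ->|ne].
      by rewrite eqxx.
    case: eqP => // mb; case: ne; apply/(is_levi_irrP _ (Ui i)).
    exact/hb'.
  rewrite -altsum_sum; apply: eq_altsum => y; rewrite (wdim_sum _ _ Uf Ud).
    by rewrite natr_sum.
  by move=> i; have [] := Ui i.
split=> [[r [U [Ui Uf Ud <-]]]|me].
  by apply: count => // i; apply/(lirrP lf).
have [s [si sf sd]] := complete_reducibility.
pose U (i : 'I_(size s)) := nth 0%VS s i.
have Ui i : lirr (U i) by apply: si; rewrite mem_nth.
have Ue : (\sum_i U i)%VS = fullv by rewrite -sf (big_nth 0%VS) big_mkord.
have Ud : directv (\sum_i U i).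
  apply/directvP => /=; rewrite Ue -sf sd (big_nth 0%VS) big_mkord //.
exists (size s), U; split=> //; first by move=> i; apply/(lirrP lf).
by apply/eqP; rewrite -(eqr_nat R) me; apply/eqP/count.
Qed.
End Reducibility.

Section IrrModules.
Variables (R : realType) (X : lie_datum R).
Local Notation g := (alg X).
Local Notation h := (cartan X).
Local Notation E := (euc X).
Local Notation S := (simple_roots X).
Local Notation Phi := (root_set X).
Implicit Types (a b : E).
Variables (bf : E -> E -> R) (x t : E -> g) (B : g -> g -> R[i]).
Hypothesis lf : lie_frame bf x t B.

Let hr := lf_roots lf.
Let hb := lf_form lf.
Let he := lf_eval lf.

Variables (V : lieMod g) (lam : E).
Hypothesis hV : is_irr_hw V lam.
Implicit Types (U W : {vspace V}) (u v : V).

Lemma wdecomp_sub (ws ws' : seq E) u : uniq ws -> uniq ws' ->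
  {subset ws <= ws'} -> wdecomp ws fullv u -> wdecomp ws' fullv u.
Proof.
move=> uw uw' sub [vb hvb ->].
exists (fun b => if b \in ws then vb b else 0).
  by move=> b; case: ifP => _; [exact: hvb|exact: mem0v].
rewrite -big_mkcond -big_filter; apply: perm_big; apply: uniq_perm => //.
  exact: filter_uniq.
by move=> b; rewrite mem_filter; case: (boolP (b \in ws)) => // /sub ->.
Qed.

Lemma wdecomp_act a y (ws : seq E) u : root_space (wteval a) y ->
  wdecomp ws fullv u ->
  wdecomp [seq b + a | b <- ws] fullv (act V y u).
Proof.
move=> ya [vb hvb ->]; exists (fun c => act V y (vb (c - a))) => [b|].
  rewrite capfv; have := hvb (b - a); rewrite capfv => vba.
  by have := wsp_root he ya vba; rewrite subrK.
rewrite big_map linear_sumr; apply: eq_bigr => b _; by rewrite addrK.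
Qed.

(** Irreducibility as an induction principle on vectors. *)
Lemma g_stable_fullv (Pr : V -> Prop) :
    Pr 0 -> (forall c u v, Pr u -> Pr v -> Pr (c *: u + v)) ->
    (forall H u, H \in h -> Pr u -> Pr (act V H u)) ->
    (forall a u, a \in Phi -> Pr u -> Pr (act V (x a) u)) ->
    (exists2 v, v != 0 & Pr v) ->
  forall u, Pr u.
Proof.
move=> P0 PL Ph Px [v v0 Pv]; have [W hW] := pred_vspace P0 PL.
have [[_ _ Vmin] _] := hV.
have Ws y u : [set: g] y -> u \in W -> act V y u \in W.
  move=> _ uW; have [H hH [c ->]] := lf_span lf y; rewrite actDl.
  apply: memvD; first by apply/hW; apply: Ph => //; apply/hW.
  rewrite act_suml big_seq; apply: memv_suml => a aP; rewrite actZl.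
  by apply: memvZ; apply/hW; apply: Px => //; apply/hW.
have [W0|WV] := Vmin W Ws (subvf W).
  by move/hW: Pv; rewrite W0 memv0 (negPf v0).
by move=> u; apply/hW; rewrite WV memvf.
Qed.

(** The sums of weight vectors form a submodule that contains the highest weight vector. Finitely
    many weights suffice because a basis does. *)
Lemma irr_wdiag : exists ws, wdiag V ws.
Proof.
have [_ [v _ [v0 vh _]]] := hV.
have dec u : exists2 ws : seq E, uniq ws & wdecomp ws fullv u.
  move: u; apply: g_stable_fullv.
  - exists [::] => //; exists (fun=> 0) => [b|]; first exact: mem0v.
    by rewrite big_nil.
  - move=> c u w [ws1 uw1 d1] [ws2 uw2 d2]; exists (undup (ws1 ++ ws2)).
      exact: undup_uniq.
    have [|vb1 h1 ->] := wdecomp_sub uw1 (undup_uniq (ws1 ++ ws2)) _ d1.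
      by move=> b bw; rewrite mem_undup mem_cat bw.
    have [|vb2 h2 ->] := wdecomp_sub uw2 (undup_uniq (ws1 ++ ws2)) _ d2.
      by move=> b bw; rewrite mem_undup mem_cat bw orbT.
    exists (fun b => c *: vb1 b + vb2 b); last by rewrite scaler_sumr -big_split.
    by move=> b; apply: memvD (h2 b); apply: memvZ.
  - move=> H u hH [ws uw d]; exists ws => //.
    have -> : ws = [seq b + 0 | b <- ws].
      by rewrite -[LHS]map_id; apply: eq_map => b; rewrite addr0.
    apply: wdecomp_act d => H' hH'.
    by rewrite (ev_comm he hH' hH) (ev0 he hH') scale0r.
  - move=> a u aP [ws uw d]; exists [seq b + a | b <- ws].
      by rewrite (map_inj_uniq (addIr a)).
    exact: wdecomp_act (lf_x lf aP) d.
  - exists v => //; exists [:: lam] => //; exists (fun b => if b == lam then v else 0).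
      move=> b; case: eqP => [->|_]; last exact: mem0v.
      by rewrite capfv; apply/(mem_wsp he).
    by rewrite big_seq1 eqxx.
have /boolp.choice[wsf hwsf] : forall u, exists ws : seq E, uniq ws /\ wdecomp ws fullv u.
  by move=> u; have [ws uw d] := dec u; exists ws.
pose bs := vbasis (fullv : {vspace V}).
pose ws := undup (flatten [seq wsf u | u <- bs]).
exists ws; split; first exact: undup_uniq.
have decb i : wdecomp ws fullv bs`_i.
  have [lt|ge] := ltnP i (size bs).
    have [uw d] := hwsf bs`_i; apply: wdecomp_sub uw (undup_uniq _) _ d.
    move=> b bw; rewrite mem_undup; apply/flattenP.
    exists (wsf bs`_i) => //; apply: (map_f wsf); exact: mem_nth.
  exists (fun=> 0); first by move=> b; exact: mem0v.
  by rewrite nth_default // big1.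
have /boolp.choice[vb hvb] : forall i, exists vb : E -> V,
    (forall b, vb b \in (fullv :&: wsp V b)%VS) /\ bs`_i = \sum_(b <- ws) vb b.
  by move=> i; have [vb d1 d2] := decb i; exists vb.
move=> u; exists (fun b => \sum_(i < \dim (fullv : {vspace V})) coord bs i u *: vb i b).
  by move=> b; apply: memv_suml => i _; apply: memvZ; have [h1 _] := hvb i; apply: h1.
rewrite exchange_big {1}[u](coord_vbasis (memvf u)); apply: eq_bigr => i _ /=.
by have [_ {1}->] := hvb i; rewrite scaler_sumr.
Qed.

Lemma Rbar_simple : Rbar S = Phi.
Proof. by apply/all_filterP/allP => a /(root_span hr). Qed.

Lemma Rbar_pos_simple : Rbar_pos S = pos_roots X.
Proof. by rewrite /Rbar_pos Rbar_simple. Qed.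

Lemma irr_weights ws : wdiag V ws ->
  wdim (V := V) fullv lam = 1%N /\
  forall c, wdim (V := V) fullv c != 0%N -> cone (lam - c).
Proof.
move=> hws; have [_ [v _ [v0 vh vx]]] := hV.
have SS : {subset S <= S} by [].
have hv : singular x S v lam.
  split=> //; first exact/(mem_wsp he).
  move=> a; rewrite Rbar_pos_simple => aR; apply: (vx a aR).
  by apply: (lf_x lf); move: aR; rewrite mem_filter => /andP[].
have [Z [vZ [Zh Zx] Zmin]] := singular_gen lf hv.
have Zf : Z = fullv.
  apply/eqP; rewrite eqEsubv subvf; apply/subvP => u _; move: u.
  apply: g_stable_fullv; rewrite ?mem0v //.
  - by move=> c u w uZ wZ; apply: memvD wZ; apply: memvZ.
  - move=> a u aP uZ; have aR : a \in Rbar S by rewrite Rbar_simple.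
    exact: (Zx a aR u uZ).
  - by exists v.
rewrite -Zf; split; first exact: (gen_wdim lf hws hv vZ Zmin).
by move=> c /(gen_wdim_neq0 lf hws hv Zmin)[].
Qed.

Lemma irr_wdim_weyl ws w c : wdiag V ws -> in_weyl Phi w ->
  wdim (V := V) fullv (w c) = wdim (V := V) fullv c.
Proof.
move=> hws; apply: (wdim_weyl lf hws) => // a aP.
by split=> u _; apply: memvf.
Qed.
End IrrModules.

(** * Construction of the irreducible modules *)

Section GradedPairs.
Variables (K : fieldType) (g : lieAlg K) (F : lmodType K) (I : Type).
Variables (y : I -> g) (Y : I -> F -> F).

Definition opbr (X X' : F -> F) : F -> F := fun v => X (X' v) - X' (X v).

(* Pairing iterated brackets with iterated commutators expresses that Y extends
   to a representation before the latter is known to be well defined. *)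
Inductive brgen : nat -> g -> (F -> F) -> Prop :=
| brgen0 n : brgen n 0 (fun=> 0)
| brgen1 i : brgen 1 (y i) (Y i)
| brgenS n i x X : brgen n x X -> brgen n.+1 (brk g (y i) x) (opbr (Y i) X)
| brgenD n c x X x' X' : brgen n x X -> brgen n x' X' ->
    brgen n (c *: x + x') (fun v => c *: X v + X' v).

Hypothesis YL : forall i, linear (Y i).

Lemma opbr_linear X X' : linear X -> linear X' -> linear (opbr X X').
Proof.
move=> XL X'L c u v; rewrite /opbr X'L XL XL X'L.
by rewrite scalerBr opprD addrACA.
Qed.

Lemma brgen_linear n x X : brgen n x X -> linear X.
Proof.
elim=> [m|i|m i x' X' _ IH|m c x1 X1 x2 X2 _ IH1 _ IH2] //.
- by move=> c u v; rewrite scaler0 addr0.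
- exact: opbr_linear.
- move=> d u v; rewrite IH1 IH2 !scalerDr !scalerA mulrC.
  by rewrite addrACA.
Qed.

Lemma brgen_deg0 x X : brgen 0 x X -> x = 0 /\ X = fun=> 0.
Proof.
suff key n : brgen n x X -> n = 0%N -> x = 0 /\ X = fun=> 0 by move=> /key; apply.
elim=> // m c x1 X1 x2 X2 _ IH1 _ IH2 m0.
have [-> ->] := IH1 m0; have [-> ->] := IH2 m0.
by rewrite scaler0 addr0; split=> //; apply/funext => v; rewrite scaler0 addr0.
Qed.

Lemma brgenZ n c x X : brgen n x X -> brgen n (c *: x) (fun v => c *: X v).
Proof.
move=> h; have := brgenD c h (brgen0 n); rewrite addr0.
by under eq_fun do rewrite addr0.
Qed.

Variables (hh : {vspace g}) (Hop : g -> F -> F) (wt : I -> g -> K).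
Hypothesis HopL : forall H, linear (Hop H).
Hypothesis Hop0 : Hop 0 = fun=> 0.
Hypothesis hopP : {in hh &, forall H H' c,
  Hop (c *: H + H') = fun v => c *: Hop H v + Hop H' v}.
Hypothesis ywt : {in hh, forall H i, brk g H (y i) = wt i H *: y i}.
Hypothesis Ywt : {in hh, forall H i v, opbr (Hop H) (Y i) v = wt i H *: Y i v}.

Lemma opbr_jacobi X1 X2 X3 : linear X1 -> linear X2 -> linear X3 ->
  opbr X1 (opbr X2 X3) = fun v => opbr (opbr X1 X2) X3 v + opbr X2 (opbr X1 X3) v.
Proof.
move=> L1 L2 L3; apply/funext => v; rewrite /opbr.
have B (X : F -> F) : linear X -> forall u w, X (u - w) = X u - X w.
  by move=> XL u w; rewrite [u - w]addrC -[- w]scaleN1r XL scaleN1r addrC.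
rewrite !(B _ L1) !(B _ L2) !(B _ L3) !opprB.
move: (X1 (X2 (X3 v))) (X1 (X3 (X2 v))) (X2 (X3 (X1 v))) (X3 (X2 (X1 v)))
  (X2 (X1 (X3 v))) (X3 (X1 (X2 v))) => p1 p2 p3 p4 p5 p6.
rewrite [RHS]addrACA !subrKA [LHS]addrACA [RHS]addrACA; congr (_ + _); exact: addrC.
Qed.
Lemma opbrD (X1 : F -> F) c X2 X3 : linear X1 ->
  opbr X1 (fun v => c *: X2 v + X3 v) =
  fun v => c *: opbr X1 X2 v + opbr X1 X3 v.
Proof.
move=> L1; apply/funext => v; rewrite /opbr L1 scalerBr.
by rewrite opprD addrACA.
Qed.

Lemma opbrZl (X1 : F -> F) c X2 : linear X2 ->
  opbr (fun v => c *: X1 v) X2 = fun v => c *: opbr X1 X2 v.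
Proof.
move=> L2; apply/funext => v; rewrite /opbr scalerBr; congr (_ - _).
have X20 : X2 0 = 0 by have := L2 (-1) 0 0; rewrite scaler0 addr0 scaleN1r addNr.
by have := L2 c (X1 v) 0; rewrite X20 !addr0.
Qed.

Lemma opbr_zero (X1 : F -> F) : linear X1 -> opbr X1 (fun=> 0) = fun=> 0.
Proof.
move=> L1; apply/funext => v; rewrite /opbr subr0.
by have := L1 (-1) 0 0; rewrite scaler0 addr0 scaleN1r addNr.
Qed.

Lemma opbrC (X1 X2 : F -> F) v : opbr X1 X2 v = - opbr X2 X1 v.
Proof. by rewrite /opbr opprB. Qed.

Lemma brk_jac (x1 x2 x3 : g) :
  brk g x1 (brk g x2 x3) = brk g (brk g x1 x2) x3 + brk g x2 (brk g x1 x3).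
Proof. by rewrite brk_act subrK. Qed.

Lemma brgen_adH n x X H : H \in hh -> brgen n x X ->
  brgen n (brk g H x) (opbr (Hop H) X).
Proof.
move=> hH; elim=> [m|i|m i x' X' hx IH|m c x1 X1 x2 X2 h1 IH1 h2 IH2].
- by rewrite linear0r opbr_zero //; apply: brgen0.
- rewrite ywt // (_ : opbr _ _ = fun v => wt i H *: Y i v); last first.
    by apply/funext => v; rewrite Ywt.
  exact/brgenZ/brgen1.
- have XL := brgen_linear hx.
  rewrite brk_jac ywt // linearZl_LR opbr_jacobi //=.
  rewrite (_ : opbr (Hop H) (Y i) = fun v => wt i H *: Y i v); last first.
    by apply/funext => v; rewrite Ywt.
  by rewrite opbrZl //; apply: brgenD (brgenS i hx) (brgenS i IH).
- by rewrite linearDr linearZr_LR opbrD //=; apply: brgenD.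
Qed.

Variables (z : I -> g) (Z : I -> F -> F).
Hypothesis ZL : forall i, linear (Z i).
Hypothesis zy : forall k i, brk g (z k) (y i) \in hh /\
  opbr (Z k) (Y i) = Hop (brk g (z k) (y i)).

Lemma brgen_lower n x X k : brgen n x X ->
  (n = 1%N -> brk g (z k) x \in hh /\ opbr (Z k) X = Hop (brk g (z k) x)) /\
  (forall m, n = m.+2 -> brgen m.+1 (brk g (z k) x) (opbr (Z k) X)).
Proof.
elim=> [m|i|m i x' X' hx [IH1 IH2]|m c x1 X1 x2 X2 h1 [IH11 IH12] h2 [IH21 IH22]].
- rewrite linear0r opbr_zero //; split=> [_|m' _]; last exact: brgen0.
  by rewrite mem0v Hop0.
- by split=> // _; apply: zy.
- have XL := brgen_linear hx; have [zyh zyop] := zy k i.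
  case: m hx IH1 IH2 => [|[|m]] hx IH1 IH2.
  + have [-> ->] := brgen_deg0 hx; split=> // _.
    by rewrite linear0r /= linear0r !opbr_zero // Hop0 mem0v.
  + split=> // m' [<-] {m'}; have [zxh zxop] := IH1 erefl.
    rewrite brk_jac opbr_jacobi // zyop zxop -[brk g (brk g _ _) x']scale1r.
    rewrite (_ : (fun v => _) = fun v => 1 *: opbr (Hop (brk g (z k) (y i))) X' v +
      (- wt i (brk g (z k) x')) *: Y i v); last first.
      by apply/funext => v; rewrite scale1r [opbr (Y i) _ v]opbrC Ywt // scaleNr.
    rewrite [brk g (y i) _]brkC (ywt zxh) -scaleNr; apply: brgenD; first exact: brgen_adH.
    exact/brgenZ/brgen1.
  + split=> // m' [<-] {m'}.
    rewrite brk_jac opbr_jacobi // zyop -[brk g (brk g _ _) x']scale1r.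
    rewrite (_ : (fun v => _) = fun v => 1 *: opbr (Hop (brk g (z k) (y i))) X' v +
      opbr (Y i) (opbr (Z k) X') v); last first.
      by apply/funext => v; rewrite scale1r.
    by apply: brgenD; [apply: brgen_adH|apply/brgenS/IH2].
- rewrite linearDr linearZr_LR opbrD //=; split=> [m1|m' mm']; last first.
    by apply: brgenD; [apply: IH12|apply: IH22].
  have [d1 ->] := IH11 m1; have [d2 ->] := IH21 m1.
  by rewrite hopP //; split=> //; rewrite memvD // memvZ.
Qed.
End GradedPairs.

Lemma eigen_indep (K : fieldType) (V : lmodType K) (D : V -> V) (T : eqType)
    (c : T -> K) (l : seq T) (v : T -> V) :
    linear D -> injective c -> (forall z, D (v z) = c z *: v z) -> uniq l ->
  \sum_(z <- l) v z = 0 -> {in l, forall z, v z = 0}.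
Proof.
move=> DL c_inj; have D0 : D 0 = 0.
  by have := DL (-1) 0 0; rewrite scaler0 addr0 scaleN1r addNr.
have DD u w : D (u + w) = D u + D w by have := DL 1 u w; rewrite !scale1r.
have DZ k u : D (k *: u) = k *: D u by have := DL k u 0; rewrite D0 !addr0.
elim: l v => // y l IH v Dv /= /andP[yl ul]; rewrite big_cons => s0.
have rest : {in l, forall z, v z = 0}.
  move=> z zl; have zy : c z - c y != 0.
    by rewrite subr_eq0 (inj_eq c_inj); apply: contraNneq yl => <-.
  suff : (c z - c y) *: v z = 0.
    by move=> /eqP; rewrite scaler_eq0 (negPf zy) => /eqP.
  apply: (IH (fun z => (c z - c y) *: v z)) => // [z'|].
    by rewrite DZ Dv !scalerA mulrC.
  under eq_bigr do rewrite scalerBl; rewrite sumrB -scaler_sumr.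
  have : D (v y + \sum_(z <- l) v z) = 0 by rewrite s0.
  rewrite DD Dv (big_morph D DD D0); under eq_bigr do rewrite Dv.
  move=> /eqP; rewrite addrC addr_eq0 => /eqP ->.
  by rewrite -opprD -scalerDr s0 scaler0 oppr0.
move=> z; rewrite inE => /orP[/eqP ->|]; last exact: rest.
by move: s0; rewrite big_seq big1 ?addr0.
Qed.

(** * The module of functions on words *)

Section WordModule.
Variables (R : realType) (X : lie_datum R).
Local Notation g := (alg X).
Local Notation h := (cartan X).
Local Notation E := (euc X).
Local Notation S := (simple_roots X).
Local Notation Phi := (root_set X).
Implicit Types (a b : E).
Variables (bf : E -> E -> R) (x t : E -> g) (B : g -> g -> R[i]).
Hypothesis lf : lie_frame bf x t B.

Let hr := lf_roots lf.
Let hb := lf_form lf.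
Let he := lf_eval lf.

Variable lam : E.
Local Notation C := (R[i]^o : lmodType R[i]).
Local Notation I := 'I_(size S).
Local Notation al := (fun i : I => S`_i : E).
Local Notation F := (seq I -> C).
Implicit Types (w : seq I) (p q : F).

Definition word_wt w : E := \sum_(i <- w) al i.
(** The value p w is the vacuum coefficient of p after raising along the letters of w, so a function
    is determined by its vacuum coefficients. *)
Definition Eop (i : I) p : F := fun w => p (i :: w).
Definition cartan_op (H : g) p : F := fun w => wteval (lam - word_wt w) H * p w.
Local Notation Hop := cartan_op.
(* Determined by [Fop j] killing the coefficient of the empty word and by
   [[Eop i, Fop j] = delta_ij Hop (t (al i))]. *)
Fixpoint Fop (j : I) p w : C := if w is i :: w' then
  Fop j (Eop i p) w' + (if i == j then Hop (t (al j)) p w' else 0) else 0.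

Lemma alP i : al i \in Phi. Proof. by apply: (simple_root hr); apply: mem_nth. Qed.

Lemma Eop_linear i : linear (Eop i). Proof. by []. Qed.

Lemma Hop_linear H : linear (Hop H).
Proof.
move=> c p q; apply/funext => w; rewrite /Hop /=.
by rewrite -[(c *: p + q) w]/(c * p w + q w) mulrDr mulrCA.
Qed.

Lemma Fop_linear j : linear (Fop j).
Proof.
move=> c p q; apply/funext => w.
rewrite -[RHS]/(c * Fop j p w + Fop j q w).
elim: w p q => [|i w IH] p q /=; first by rewrite mulr0 addr0.
rewrite -[Eop i (c *: p + q)]/(c *: Eop i p + Eop i q) IH Hop_linear.
rewrite -[(c *: _ + _) w]/(c * Hop (t (al j)) p w + Hop (t (al j)) q w).
by case: (i == j); rewrite ?addr0 // mulrDr addrACA.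
Qed.

Lemma HopP : {in h &, forall H H' c,
  Hop (c *: H + H') = fun p => c *: Hop H p + Hop H' p}.
Proof.
move=> H H' hH hH' c; apply/funext => p; apply/funext => w.
rewrite /Hop (evh he) // mulrDl -mulrA //.
Qed.

Lemma Hop0 : Hop 0 = fun=> 0.
Proof. by apply/funext => p; apply/funext => w; rewrite /Hop (evh0 he) mul0r. Qed.

Lemma HopN H : H \in h -> Hop (- H) = fun p => - Hop H p.
Proof.
move=> hH; have := HopP hH (mem0v h) (-1); rewrite addr0 scaleN1r => ->.
by apply/funext => p; rewrite scaleN1r Hop0 addr0.
Qed.

Lemma HE H i p : H \in h -> opbr (Hop H) (Eop i) p = wteval (al i) H *: Eop i p.
Proof.
move=> hH; apply/funext => w.
rewrite -[LHS]/(Hop H (Eop i p) w - Hop H p (i :: w)).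
rewrite -[RHS]/(wteval (al i) H * p (i :: w)) /Hop /Eop -mulrBl; congr (_ * _).
rewrite /word_wt big_cons !(evB he) // (evD he) //.
by ring.
Qed.

Lemma HF H j p : H \in h -> opbr (Hop H) (Fop j) p = - wteval (al j) H *: Fop j p.
Proof.
move=> hH; apply/funext => w.
rewrite -[LHS]/(Hop H (Fop j p) w - Fop j (Hop H p) w).
rewrite -[RHS]/(- wteval (al j) H * Fop j p w).
elim: w p => [|i w IH] p /=; first by rewrite /Hop !mulr0 subr0.
have -> : Eop i (Hop H p) = (- wteval (al i) H) *: Eop i p + Hop H (Eop i p).
  apply/esym/eqP; rewrite scaleNr addrC -(HE i p hH) /opbr opprB.
  by rewrite addrCA subrr addr0.
have FL := Fop_linear j (- wteval (al i) H) (Eop i p) (Hop H (Eop i p)).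
rewrite FL -[(_ *: _ + _) w]/(- wteval (al i) H * Fop j (Eop i p) w +
  Fop j (Hop H (Eop i p)) w).
have /eqP := IH (Eop i p); rewrite subr_eq => /eqP IHi.
have wl : wteval (lam - word_wt (i :: w)) H =
    wteval (lam - word_wt w) H - wteval (al i) H.
  by rewrite /word_wt big_cons !(evB he) // (evD he) // opprD addrA addrAC.
rewrite {1}/Hop /= wl.
have -> : Fop j (Hop H (Eop i p)) w = wteval (lam - word_wt w) H *
    Fop j (Eop i p) w + wteval (al j) H * Fop j (Eop i p) w.
  by move: IHi; rewrite {1}/Hop => ->; ring.
by case: eqP => [->|_]; rewrite /Hop; ring.
Qed.

Lemma EF_brk k i : brk g (x (al k)) (x (- al i)) = if k == i then t (al i) else 0.
Proof.
case: eqVneq => [->|ki]; first exact: (lf_br lf (alP i)).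
have cfk : coord (in_tuple S) k (al k - al i) = 1.
  by rewrite linearB /= !(cf_simple hr) eqxx eq_sym (negPf ki) subr0.
have cfi : coord (in_tuple S) i (al k - al i) = -1.
  by rewrite linearB /= !(cf_simple hr) eqxx (negPf ki) sub0r.
apply: (brk_out lf (alP k) (oppr_root hr (alP i))); last first.
  by apply/negP => /eqP h0; move: cfk; rewrite h0 linear0 => /esym/eqP; rewrite oner_eq0.
apply/negP => /(pos_or hr)[] /pos_cone/coneP[_ h0].
  by have := h0 i; rewrite cfi oppr_ge0 ler10.
by have := h0 k; rewrite linearN /= cfk oppr_ge0 ler10.
Qed.

Lemma EF_op k i : opbr (Eop k) (Fop i) = Hop (brk g (x (al k)) (x (- al i))).
Proof.
apply/funext => p; apply/funext => w; rewrite EF_brk.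
rewrite -[LHS]/(Fop i p (k :: w) - Fop i (Eop k p) w) /= addrC addKr.
by case: eqP => // _; rewrite Hop0.
Qed.

Lemma EF_h k i : brk g (x (al k)) (x (- al i)) \in h.
Proof. by rewrite EF_brk; case: ifP; rewrite ?mem0v ?(lf_t lf). Qed.

Lemma FE_op k i : brk g (x (- al k)) (x (al i)) \in h /\
  opbr (Fop k) (Eop i) = Hop (brk g (x (- al k)) (x (al i))).
Proof.
rewrite brkC memvN EF_h; split=> //; rewrite HopN ?EF_h //.
by apply/funext => p; rewrite opbrC EF_op.
Qed.

Local Notation egen := (brgen (fun i => x (al i)) Eop).
Local Notation fgen := (brgen (fun i => x (- al i)) Fop).

Lemma ewt : {in h, forall H i, brk g H (x (al i)) = wteval (al i) H *: x (al i)}.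
Proof. by move=> H hH i; apply: (lf_x lf (alP i)). Qed.

Lemma fwt : {in h, forall H i, brk g H (x (- al i)) = - wteval (al i) H *: x (- al i)}.
Proof.
by move=> H hH i; rewrite (lf_x lf (oppr_root hr (alP i))) // (evN he).
Qed.

Lemma elower n y Y k : egen n y Y ->
  (n = 1%N -> brk g (x (- al k)) y \in h /\
     opbr (Fop k) Y = Hop (brk g (x (- al k)) y)) /\
  (forall m, n = m.+2 -> egen m.+1 (brk g (x (- al k)) y) (opbr (Fop k) Y)).
Proof.
apply: (brgen_lower (hh := h) (Hop := Hop) (wt := fun i H => wteval (al i) H)
  Eop_linear Hop_linear Hop0 HopP ewt _ (z := fun k => x (- al k)) Fop_linear).
  by move=> H hH i p; apply: HE.
exact: FE_op.
Qed.

Lemma flower n y Y k : fgen n y Y ->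
  (n = 1%N -> brk g (x (al k)) y \in h /\
     opbr (Eop k) Y = Hop (brk g (x (al k)) y)) /\
  (forall m, n = m.+2 -> fgen m.+1 (brk g (x (al k)) y) (opbr (Eop k) Y)).
Proof.
apply: (brgen_lower (hh := h) (Hop := Hop) (wt := fun i H => - wteval (al i) H)
  Fop_linear Hop_linear Hop0 HopP fwt _ (z := fun k => x (al k)) Eop_linear).
  by move=> H hH i p; apply: HF.
by move=> k' i; rewrite EF_op EF_h.
Qed.

Lemma egen_adH n y Y H : H \in h -> egen n y Y ->
  egen n (brk g H y) (opbr (Hop H) Y).
Proof.
apply: (brgen_adH (hh := h) (Hop := Hop) (wt := fun i H => wteval (al i) H)
  Eop_linear Hop_linear ewt) => H' hH' i p; exact: HE.
Qed.

Lemma fgen_adH n y Y H : H \in h -> fgen n y Y ->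
  fgen n (brk g H y) (opbr (Hop H) Y).
Proof.
apply: (brgen_adH (hh := h) (Hop := Hop) (wt := fun i H => - wteval (al i) H)
  Fop_linear Hop_linear fwt) => H' hH' i p; exact: HF.
Qed.

Definition vac : F := fun w => (w == [::])%:R.
Definition fword w : F := foldr Fop vac w.

(** The span of all words of lowering operators applied to the vacuum; it becomes V(lam). *)
Inductive wmod : F -> Prop :=
| wmod_word w : wmod (fword w)
| wmod0 : wmod 0
| wmodD c p q : wmod p -> wmod q -> wmod (c *: p + q).

Definition hdeg n p := forall w, size w != n -> p w = 0.

Lemma lin0 (Y : F -> F) : linear Y -> Y 0 = 0.
Proof. by move=> L; have := L (-1) 0 0; rewrite scaler0 addr0 scaleN1r addNr. Qed.

Lemma wmodF j p : wmod p -> wmod (Fop j p).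
Proof.
elim=> [w||c p1 p2 _ IH1 _ IH2]; first exact: (wmod_word (j :: w)).
  by rewrite lin0; [exact: wmod0|exact: Fop_linear].
by rewrite Fop_linear; apply: wmodD.
Qed.

Lemma Hop_vac H : Hop H vac = wteval lam H *: vac.
Proof.
apply/funext => w; rewrite /Hop -[RHS]/(wteval lam H * vac w) /vac.
by case: eqP => [->|_]; rewrite ?mulr0 // /word_wt big_nil subr0.
Qed.

Lemma Hop_word H w : H \in h ->
  Hop H (fword w) = wteval (lam - word_wt w) H *: fword w.
Proof.
move=> hH; elim: w => [|i w IH].
  by rewrite Hop_vac /word_wt big_nil subr0.
have := HF i (fword w) hH; rewrite /opbr IH => /eqP.
have FZ c p : Fop i (c *: p) = c *: Fop i p.
  have := Fop_linear i c p 0; rewrite (lin0 (Fop_linear i)) !addr0 //.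
rewrite FZ subr_eq -scalerDl => /eqP -> /=; congr (_ *: _).
by rewrite /word_wt big_cons !(evB he) // (evD he) // opprD addrCA.
Qed.

Lemma wmodZ c p : wmod p -> wmod (c *: p).
Proof. by move=> hp; rewrite -[_ *: _]addr0; apply: wmodD hp wmod0. Qed.

Lemma wmodH H p : H \in h -> wmod p -> wmod (Hop H p).
Proof.
move=> hH; elim=> [w||c p1 p2 _ IH1 _ IH2].
- by rewrite Hop_word //; apply/wmodZ/wmod_word.
- by rewrite lin0; [exact: wmod0|exact: Hop_linear].
- by rewrite Hop_linear; apply: wmodD.
Qed.

Lemma EF_comm k i p : Eop k (Fop i p) = 
  Hop (brk g (x (al k)) (x (- al i))) p + Fop i (Eop k p).
Proof.
by have := congr1 (fun f => f p) (EF_op k i); rewrite /opbr => <-; rewrite subrK.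
Qed.

Lemma Eop_vac k : Eop k vac = 0. Proof. by apply/funext. Qed.

Lemma wmodE k p : wmod p -> wmod (Eop k p).
Proof.
elim=> [w||c p1 p2 _ IH1 _ IH2]; last exact: wmodD.
  elim: w => [|i w IH]; first by rewrite /= Eop_vac; apply: wmod0.
  rewrite [fword _]/(Fop i (fword w)) EF_comm -[X in X + _]scale1r.
  by apply: wmodD; [apply/wmodH/wmod_word/EF_h|apply: wmodF].
exact: wmod0.
Qed.
End WordModule.

Lemma copairNN (R : realType) (X : lie_datum R) (b a : euc X) :
  copair (- b) (- a) = copair b a.
Proof. by rewrite /copair !linearNl !linearNr /= !opprK. Qed.

Lemma htB (R : realType) (X : lie_datum R) (b a : euc X) : ht (b - a) = ht b - ht a.
Proof. by rewrite -scaleN1r htD htZ mulN1r. Qed.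

Section HeightGrading.
Variables (R : realType) (X : lie_datum R).
Local Notation g := (alg X).
Local Notation E := (euc X).
Local Notation S := (simple_roots X).
Local Notation Phi := (root_set X).
Implicit Types (a b : E).
Variables (bf : E -> E -> R) (x t : E -> g) (B : g -> g -> R[i]).
Hypothesis lf : lie_frame bf x t B.

Let hr := lf_roots lf.
Let hb := lf_form lf.

Lemma ht_riesz : exists d : E, forall b, ht b = bf b d.
Proof.
have : forall i : 'I_(size S), exists d, forall b, coord (in_tuple S) i b = bf b d.
  move=> i; exact: (wf_riesz (coord (in_tuple S) i) hb).
move=> /boolp.choice[f hf]; exists (\sum_i f i) => b.
by rewrite (wf_sumr hb) /ht; apply: eq_bigr => i _; apply: hf.
Qed.

Lemma brk_string_neq0 r b : r \in Phi -> b \in Phi -> 0 < copair b r ->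
  brk g (x r) (x (- b)) != 0.
Proof.
move=> rP bP cbr; apply/negP => /eqP h0.
have := ra_int hr rP bP; rewrite intrEge0 ?ltW // => /natrP[k kE].
have rN := oppr_root hr rP; have bN := oppr_root hr bP.
have : x (- b) = 0.
  apply: (root_lower lf (adj_wdiag lf) rN (b := - b) (k := k)).
  - by apply/(adj_wsp lf); apply: (lf_x lf bN).
  - by rewrite copairNN.
  - rewrite opprK; move: kE cbr; case: k => [->|k _ _]; first by rewrite ltxx.
    by rewrite iterSr [act _ _ _]h0 iter_fix0 // linear0r.
by apply/eqP; apply: (lf_x0 lf bN).
Qed.

(** Nonvanishing is first obtained for [x_r, x_(-b)], by sl2 theory at the weight -b, and passes to
    [x_r, x_(b-r)] through the symmetry [brk_structN] of the structure constants. *)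
Lemma brk_raise r b : r \in Phi -> b \in Phi -> 0 < copair b r -> b != r ->
  b - r \in Phi /\ exists2 c, c != 0 & brk g (x r) (x (b - r)) = c *: x b.
Proof.
move=> rP bP cbr br; have n0 := brk_string_neq0 rP bP cbr.
have bN := oppr_root hr bP.
have rb : r - b \in Phi.
  apply: contraNT n0 => h0; apply/eqP; apply: (brk_out lf rP bN h0).
  by rewrite subr_eq0 eq_sym.
have brP : b - r \in Phi by rewrite -opprB; apply: (oppr_root hr).
split=> //; have [c cE] := brk_struct lf rP bN rb.
have [c' c'E] : exists c', brk g (x r) (x (b - r)) = c' *: x b.
  by have := brk_struct lf rP brP; rewrite addrC subrK; apply.
exists c' => //; have -> : c' = - c.
  apply: (brk_structN lf rP bN rb cE).
  by rewrite opprB opprK.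
by rewrite oppr_eq0; apply: contraNneq n0 => c0; rewrite cE c0 scale0r.
Qed.

Lemma posroot_descent b : b \in Phi -> nonneg_comb b -> b \notin S ->
  exists i : 'I_(size S), [/\ 0 < copair b S`_i, b - S`_i \in Phi & nonneg_comb (b - S`_i)].
Proof.
move=> bP bpos bS; have /coneP[bsp bc] := pos_cone bpos.
have [i bi] : exists i : 'I_(size S), 0 < copair b S`_i.
  apply: contrapT => /forallNP h.
  have : bf b b <= 0.
    have {2}-> : b = \sum_i coord (in_tuple S) i b *: S`_i by exact: (coord_span (X := in_tuple S)).
    rewrite (wf_sumr hb) sumr_le0 // => i _.
    rewrite (wfE hb) mulr_ge0_le0 // leNgt.
    have iP : S`_i \in Phi by apply: (simple_root hr); apply: mem_nth.
    by rewrite -(copair_sign_gt hr b hb iP); apply/negP/h.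
  by rewrite leNgt (wf_gt0 hb) // (root_neq0 hr).
have iS : S`_i \in S by apply: mem_nth.
have iP := simple_root hr iS.
have bi' : b != S`_i by apply: contraNneq bS => ->.
have [biP _] := brk_raise iP bP bi bi'.
exists i; split=> //; have [//|] := pos_or hr biP; rewrite opprB => neg.
have ibP : S`_i - b \in Phi by rewrite -opprB; apply: (oppr_root hr).
have := posroot_ht hr ibP neg; have := posroot_ht hr bP bpos.
rewrite htB (ht_simple hr iS) lerDl oppr_ge0 => b1 b0.
by have := le_trans b1 b0; rewrite ler10.
Qed.

End HeightGrading.

Section WordAction.
Variables (R : realType) (X : lie_datum R).
Local Notation g := (alg X).
Local Notation h := (cartan X).
Local Notation E := (euc X).
Local Notation S := (simple_roots X).
Local Notation Phi := (root_set X).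
Implicit Types (a b : E).
Variables (bf : E -> E -> R) (x t : E -> g) (B : g -> g -> R[i]).
Hypothesis lf : lie_frame bf x t B.

Let hr := lf_roots lf.
Let hb := lf_form lf.
Let he := lf_eval lf.

Variable lam : E.
Local Notation C := (R[i]^o : lmodType R[i]).
Local Notation I := 'I_(size S).
Local Notation al := (fun i : I => S`_i : E).
Local Notation F := (seq I -> C).
Local Notation Eop := (@Eop R X).
Local Notation Hop := (@cartan_op R X lam).
Local Notation Fop := (@Fop R X t lam).
Local Notation wmod := (@wmod R X t lam).
Local Notation fword := (@fword R X t lam).
Local Notation vac := (@vac R X).
Local Notation egen := (brgen (fun i => x (al i)) Eop).
Local Notation fgen := (brgen (fun i => x (- al i)) Fop).
Implicit Types (w : seq I) (p q : F).

Lemma egen_vac n y Y : egen n y Y -> Y vac = 0.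
Proof.
elim=> [m|i|m i x' X' hx IH|m c x1 X1 x2 X2 _ IH1 _ IH2] //.
- by rewrite /opbr IH Eop_vac; have /lin0 -> := brgen_linear (@Eop_linear R X) hx; rewrite subr0 (lin0 (@Eop_linear R X i)).
- by rewrite IH1 IH2 scaler0 addr0.
Qed.

Lemma fgen_nil n y Y : fgen n y Y -> forall p, Y p [::] = 0.
Proof.
elim=> [m|i|m i x' X' hx IH|m c x1 X1 x2 X2 _ IH1 _ IH2] p //.
- by rewrite -[LHS]/(Fop i (X' p) [::] - X' (Fop i p) [::]) IH subr0.
- by rewrite -[LHS]/(c * X1 p [::] + X2 p [::]) IH1 IH2 mulr0 addr0.
Qed.

Lemma wmod_ind_F (Y : F -> F) : linear Y -> Y vac = 0 ->
  (forall i p, wmod p -> Y p = 0 -> Y (Fop i p) = 0) -> forall p, wmod p -> Y p = 0.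
Proof.
move=> YL Y0 YF p; elim=> [w||c p1 p2 _ IH1 _ IH2].
- by elim: w => [|i w IH] //=; apply: YF => //; apply: wmod_word.
- exact: lin0.
- by rewrite YL IH1 IH2 scaler0 addr0.
Qed.

(** Induction on the degree: the commutator of Y with a lowering operator has smaller degree and
    again pairs with 0, so it vanishes on [wmod]. Thus Y commutes with the lowering operators, and
    it kills the vacuum. *)
Lemma egen_unique n Y p : egen n 0 Y -> wmod p -> Y p = 0.
Proof.
elim: n Y p => [|n IH] Y p hY.
  by have [_ ->] := brgen_deg0 hY.
have YL := brgen_linear (@Eop_linear R X) hY.
move: p; apply: wmod_ind_F => // [|i p pw Yp]; first exact: egen_vac hY.
have [h1 h2] := elower lf lam i hY.
suff : opbr (Fop i) Y p = 0.
  rewrite /opbr Yp (lin0 (@Fop_linear _ _ _ _ _)) => /eqP.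
  by rewrite sub0r oppr_eq0 => /eqP.
case: n IH hY h1 h2 => [|n] IH hY h1 h2.
  by have [_ ->] := h1 erefl; rewrite linear0r (Hop0 lf).
by apply: IH => //; have := h2 n erefl; rewrite linear0r.
Qed.

(** Now Y commutes with the raising operators, by induction on the degree. These read off values on
    words, and the value of Y p at the empty word is 0. *)
Lemma fgen_unique n Y p : fgen n 0 Y -> wmod p -> Y p = 0.
Proof.
elim: n Y p => [|n IH] Y p hY pw; first by have [_ ->] := brgen_deg0 hY.
apply/funext => w; elim: w p pw => [|i w IHw] p pw; first exact: fgen_nil hY p.
rewrite -[LHS]/(Eop i (Y p) w).
have [h1 h2] := flower lf i hY.
have : opbr (Eop i) Y p = 0.
  case: n IH hY h1 h2 => [|n] IH hY h1 h2.
    by have [_ ->] := h1 erefl; rewrite linear0r (Hop0 lf).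
  by apply: IH => //; have := h2 n erefl; rewrite linear0r.
rewrite /opbr => /eqP; rewrite subr_eq0 => /eqP ->.
by apply: IHw; apply: (wmodE lf).
Qed.

(** The degree is the height. [Negz n] stands for -(n+1), whence the degree [n.+1] on the lowering
    side. *)
Definition graded (z : int) y Y : Prop :=
  match z with
  | Posz 0 => y \in h /\ Y = Hop y
  | Posz n => egen n y Y
  | Negz n => fgen n.+1 y Y
  end.

Lemma graded_unique z Y p : graded z 0 Y -> wmod p -> Y p = 0.
Proof.
case: z => [[|n]|n] /=; last exact: fgen_unique; last exact: egen_unique.
by case=> _ -> _; rewrite (Hop0 lf).
Qed.

Lemma graded_linear z y Y : graded z y Y -> linear Y.
Proof.
case: z => [[|n]|n] /=.
- by case=> _ ->; apply: Hop_linear.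
- exact: (brgen_linear (@Eop_linear R X)).
- exact: (brgen_linear (@Fop_linear R X t lam)).
Qed.

Lemma graded0 z : graded z 0 (fun=> 0).
Proof. by case: z => [[|n]|n] /=; try exact: brgen0; rewrite mem0v (Hop0 lf). Qed.

Lemma gradedD z c y Y y' Y' : graded z y Y -> graded z y' Y' ->
  graded z (c *: y + y') (fun p => c *: Y p + Y' p).
Proof.
case: z => [[|n]|n] /=; try exact: brgenD.
case=> hy -> [hy' ->]; rewrite (HopP lf) //; split=> //.
by apply: memvD => //; apply: memvZ.
Qed.

Lemma graded_eigen d z y Y : d \in h -> (forall i, wteval (al i) d = 1) ->
  graded z y Y -> brk g d y = z%:~R *: y.
Proof.
move=> dh d1.
have egenE n y' Y' : egen n y' Y' -> brk g d y' = n%:R *: y'.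
  elim=> [m|i|m i x' X' hx IH|m c x1 X1 x2 X2 _ IH1 _ IH2].
  - by rewrite linear0r scaler0.
  - by rewrite (ewt lf) // d1.
  - rewrite brk_jac (ewt lf) // d1 scale1r IH linearZr_LR -natr1 scalerDl scale1r addrC //.
  - by rewrite linearDr linearZr_LR /= IH1 IH2 scalerDr !scalerA mulrC.
have fgenE n y' Y' : fgen n y' Y' -> brk g d y' = - n%:R *: y'.
  elim=> [m|i|m i x' X' hx IH|m c x1 X1 x2 X2 _ IH1 _ IH2].
  - by rewrite linear0r scaler0.
  - by rewrite (fwt lf) // d1.
  - rewrite brk_jac (fwt lf) // d1 IH linearZr_LR linearZl_LR -natr1 /=.
    by rewrite -scalerDl opprD addrC.
  - by rewrite linearDr linearZr_LR /= IH1 IH2 scalerDr !scalerA mulrC.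
case: z => [[|n]|n] /=.
- by case=> yh _; rewrite (ev_comm he) // scale0r.
- by move=> /egenE ->; rewrite pmulrn.
- by move=> /fgenE ->; rewrite NegzE mulrNz pmulrn.
Qed.

(** The graph of the future representation, at first only a relation. *)
Inductive opair : g -> (F -> F) -> Prop :=
| opair_gr z y Y : graded z y Y -> opair y Y
| opairD c y Y y' Y' : opair y Y -> opair y' Y' ->
    opair (c *: y + y') (fun p => c *: Y p + Y' p).

Lemma opair0 : opair 0 (fun=> 0). Proof. exact: opair_gr (graded0 0). Qed.

Lemma opair_linear y Y : opair y Y -> linear Y.
Proof.
elim=> [z y' Y'|c y1 Y1 y2 Y2 _ IH1 _ IH2]; first exact: graded_linear.
move=> d u v; rewrite IH1 IH2 !scalerDr !scalerA mulrC.
by rewrite addrACA.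
Qed.

Lemma opairZ c y Y : opair y Y -> opair (c *: y) (fun p => c *: Y p).
Proof.
move=> hy; have := opairD c hy opair0; rewrite addr0.
by under eq_fun do rewrite addr0.
Qed.

Lemma opair_split y Y : opair y Y -> exists (l0 : seq int) v V,
  (forall z, graded z (v z) (V z)) /\
  forall l, uniq l -> {subset l0 <= l} ->
    y = \sum_(z <- l) v z /\ forall p, Y p = \sum_(z <- l) V z p.
Proof.
elim=> [z y' Y' hz|c y1 Y1 y2 Y2 _ [l1 [v1 [V1 [g1 h1]]]] _ [l2 [v2 [V2 [g2 h2]]]]].
  exists [:: z], (fun z' => if z' == z then y' else 0),
    (fun z' => if z' == z then Y' else fun=> 0).
  split=> [z'|l ul zl]; first by case: eqP => [->|_]; [|exact: graded0].
  have {}zl : z \in l by apply: zl; rewrite mem_head.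
  split=> [|p]; rewrite (bigD1_seq z) //= eqxx big1 ?addr0 // => z' /negPf -> //.
exists (l1 ++ l2), (fun z => c *: v1 z + v2 z),
  (fun z p => c *: V1 z p + V2 z p).
split=> [z|l ul ll]; first exact: gradedD.
have [e1 E1] : _ := h1 l ul (fun z zl => ll z (etrans (mem_cat _ _ _) (introT orP (or_introl zl)))).
have [e2 E2] : _ := h2 l ul (fun z zl => ll z (etrans (mem_cat _ _ _) (introT orP (or_intror zl)))).
split=> [|p]; first by rewrite e1 e2 scaler_sumr big_split.
by rewrite E1 E2 scaler_sumr big_split.
Qed.

(** This makes the action well defined. Heights are eigenvalues of the bracket with [t d0], so the
    homogeneous parts of a pair over 0 each lie over 0, and [graded_unique] applies to them. *)
Lemma opair_unique Y p : opair 0 Y -> wmod p -> Y p = 0.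
Proof.
move=> /opair_split[l0 [v [V [gv hv]]]] pw.
have [|s0 ->] := hv (undup l0) (undup_uniq _); first by move=> z; rewrite mem_undup.
have [d0 d0E] := ht_riesz lf.
have dal i : wteval (al i) (t d0) = 1.
  by rewrite (lf_tE lf) -d0E (ht_simple hr) ?mem_nth.
have v0 : {in undup l0, forall z, v z = 0}.
  apply: (eigen_indep (D := brk g (t d0)) (c := fun z : int => z%:~R : R[i])) => //.
  - exact: linearPr.
  - exact: intr_inj.
  - by move=> z; apply: graded_eigen (gv z) => //; apply: (lf_t lf).
  - exact: undup_uniq.
rewrite big_seq big1 // => z zl; apply: (graded_unique (z := z)) => //.
by rewrite -(v0 z zl); apply: gv.
Qed.

Lemma opair_ext y Y y' Y' : y = y' -> (forall p, Y p = Y' p) -> opair y Y -> opair y' Y'.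
Proof. by move=> -> /funext ->. Qed.

Lemma opair_gen_brk y1 Y1 : linear Y1 ->
  (forall z y Y, graded z y Y -> opair (brk g y1 y) (opbr Y1 Y)) ->
  forall y Y, opair y Y -> opair (brk g y1 y) (opbr Y1 Y).
Proof.
move=> L1 h1 y Y; elim=> [z y' Y'|c y2 Y2 y3 Y3 _ IH2 _ IH3]; first exact: h1.
by rewrite linearDr linearZr_LR opbrD //=; apply: opairD.
Qed.

Lemma opair_E i y Y : opair y Y -> opair (brk g (x (al i)) y) (opbr (Eop i) Y).
Proof.
apply: opair_gen_brk; first exact: Eop_linear.
move=> z {}y {}Y; case: z => [[|n]|[|n]] /=.
- case=> yh ->.
  apply: (opair_ext (y := - wteval (al i) y *: x (al i))
      (Y := fun p => - wteval (al i) y *: Eop i p)).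
  + by rewrite brkC (ewt lf) // scaleNr.
  + by move=> p; rewrite opbrC (HE lf) // scaleNr.
  + by apply: opairZ; apply: (@opair_gr 1); apply: (brgen1 (fun i => x (al i))).
- by move=> hy; apply: (@opair_gr n.+2); apply: (brgenS (y := fun i => x (al i))).
- move=> hy; have [/(_ erefl)[h1 h2] _] := flower lf i hy.
  by apply: (@opair_gr 0); split.
- move=> hy; have [_ /(_ n erefl) h2] := flower lf i hy.
  by apply: (@opair_gr (Negz n)).
Qed.

Lemma opair_F i y Y : opair y Y -> opair (brk g (x (- al i)) y) (opbr (Fop i) Y).
Proof.
apply: opair_gen_brk; first exact: Fop_linear.
move=> z {}y {}Y; case: z => [[|[|n]]|n] /=.
- case=> yh ->.
  apply: (opair_ext (y := wteval (al i) y *: x (- al i))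
      (Y := fun p => wteval (al i) y *: Fop i p)).
  + by rewrite brkC (fwt lf) // scaleNr opprK.
  + by move=> p; rewrite opbrC (HF lf) // scaleNr opprK.
  + by apply: opairZ; apply: (@opair_gr (Negz 0)); apply: (brgen1 (fun i => x (- al i))).
- move=> hy; have [/(_ erefl)[h1 h2] _] := elower lf lam i hy.
  by apply: (@opair_gr 0); split.
- move=> hy; have [_ /(_ n erefl) h2] := elower lf lam i hy.
  by apply: (@opair_gr n.+1).
- by move=> hy; apply: (@opair_gr (Negz n.+1)); apply: (brgenS (y := fun i => x (- al i))).
Qed.

Lemma opair_H H y Y : H \in h -> opair y Y -> opair (brk g H y) (opbr (Hop H) Y).
Proof.
move=> hH; apply: opair_gen_brk; first exact: Hop_linear.
move=> z {}y {}Y; case: z => [[|n]|n] /=.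
- case=> yh ->; apply: opair_ext opair0; first by rewrite (ev_comm he).
  move=> p; apply/funext => w; rewrite /opbr /Defs.lie_sort /cartan_op.
  by apply/esym/eqP; rewrite subr_eq0 mulrCA.
- by move=> hy; apply: (@opair_gr n.+1); apply: (egen_adH lf).
- by move=> hy; apply: (@opair_gr (Negz n)); apply: (fgen_adH lf).
Qed.

Lemma opair_brgen (I' : Type) (u : I' -> g) (U : I' -> F -> F) n y Y :
  (forall i, linear (U i)) ->
  (forall i y' Y', opair y' Y' -> opair (brk g (u i) y') (opbr (U i) Y')) ->
  brgen u U n y Y -> forall y' Y', opair y' Y' -> opair (brk g y y') (opbr Y Y').
Proof.
move=> UL Uo; elim=> [m|i|m i x' X' hx IH|m c x1 X1 x2 X2 _ IH1 _ IH2] y' Y' oy'.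
- apply: opair_ext opair0; first by rewrite linear0l.
  by move=> p; rewrite /opbr (lin0 (opair_linear oy')) subr0.
- exact: Uo.
- apply: (opair_ext (y := (-1) *: brk g x' (brk g (u i) y') + brk g (u i) (brk g x' y'))
    (Y := fun p => (-1) *: opbr X' (opbr (U i) Y') p + opbr (U i) (opbr X' Y') p)).
  + by rewrite scaleN1r addrC [X in X - _]brk_jac addrK.
  + move=> p; rewrite scaleN1r addrC (opbr_jacobi (UL i) (brgen_linear UL hx) (opair_linear oy')).
    by rewrite addrK.
  + by apply: opairD; [apply/IH/Uo|apply/Uo/IH].
- apply: (opair_ext (y := c *: brk g x1 y' + brk g x2 y')
    (Y := fun p => c *: opbr X1 Y' p + opbr X2 Y' p)); last by apply: opairD; auto.
  + by rewrite linearDl linearZl_LR.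
  + move=> p; rewrite /opbr (opair_linear oy') scalerBr opprD addrACA //.
Qed.

Lemma opair_brk y Y y' Y' : opair y Y -> opair y' Y' -> opair (brk g y y') (opbr Y Y').
Proof.
move=> hy; elim: hy y' Y' => [z {}y {}Y gz|c y1 Y1 y2 Y2 _ IH1 _ IH2] y' Y'.
  case: z gz => [[|n]|n] /=.
  - by case=> yh ->; apply: opair_H.
  - move=> hy; apply: (opair_brgen (@Eop_linear R X) _ hy) => i; exact: opair_E.
  - move=> hy; apply: (opair_brgen (@Fop_linear R X t lam) _ hy) => i; exact: opair_F.
move=> oy'; apply: (opair_ext (y := c *: brk g y1 y' + brk g y2 y')
    (Y := fun p => c *: opbr Y1 Y' p + opbr Y2 Y' p)); last by apply: opairD; auto.
- by rewrite linearDl linearZl_LR.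
- by move=> p; rewrite /opbr (opair_linear oy') scalerBr opprD addrACA.
Qed.

Lemma wmod_opair y Y p : opair y Y -> wmod p -> wmod (Y p).
Proof.
move=> hy; elim: hy p => [z {}y {}Y gz|c y1 Y1 y2 Y2 _ IH1 _ IH2] p; last first.
  by move=> pw; apply: wmodD; auto.
have wB p1 p2 : wmod p1 -> wmod p2 -> wmod (p1 - p2).
  by move=> w1 w2; rewrite addrC -scaleN1r; apply: wmodD.
have gen (u : I -> g) (U : I -> F -> F) n : (forall i p, wmod p -> wmod (U i p)) ->
    forall y Y, brgen u U n y Y -> forall p, wmod p -> wmod (Y p).
  move=> hU y' Y'; elim=> [m|i|m i x' X' _ IH|m c x1 X1 x2 X2 _ IH1 _ IH2] p' pw; auto.
  - exact: wmod0.
  - by apply: wB; [apply/hU/IH|apply/IH/hU].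
  - by apply: wmodD; auto.
case: z gz => [[|n]|n] /=.
- by case=> yh ->; apply: (wmodH lf).
- move=> hy; apply: (gen _ _ _ _ _ _ hy) => i q; exact: (wmodE lf).
- move=> hy; apply: (gen _ _ _ _ _ _ hy) => i q; exact: wmodF.
Qed.

(** By descent in height every positive root vector is an iterated bracket of simple ones:
    [posroot_descent] supplies the simple root to subtract, and [brk_raise] a nonzero structure
    constant to divide by. *)
Lemma egen_posroot b : b \in Phi -> nonneg_comb b -> exists n Y, egen n (x b) Y.
Proof.
move=> bP bpos; have [n] := pos_ht bpos; elim: n b bP bpos => [|n IH] b bP bpos hn.
  by have := posroot_ht hr bP bpos; rewrite hn ler10.
have [bS|bS] := boolP (b \in S).
  have ib : (index b S < size S)%N by rewrite index_mem.
  exists 1%N, (Eop (Ordinal ib)).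
  by have := brgen1 (fun i => x (al i)) Eop (Ordinal ib); rewrite /= nth_index.
have [i [ci biP bipos]] := posroot_descent lf bP bpos bS.
have iS : S`_i \in S by apply: mem_nth.
have [|m [Y hY]] := IH (b - S`_i) biP bipos.
  by rewrite htB (ht_simple hr iS) hn -natr1 addrK.
have bi : b != S`_i by apply: contraNneq bS => ->.
have [_ [c c0 cE]] := brk_raise lf (simple_root hr iS) bP ci bi.
exists m.+1, (fun p => c^-1 *: opbr (Eop i) Y p).
have -> : x b = c^-1 *: brk g (x (al i)) (x (b - al i)).
  by rewrite cE scalerA mulVf // scale1r.
exact/brgenZ/(brgenS i).
Qed.

Lemma fgen_posroot b : b \in Phi -> nonneg_comb b -> exists n Y, fgen n (x (- b)) Y.
Proof.
move=> bP bpos; have [n] := pos_ht bpos; elim: n b bP bpos => [|n IH] b bP bpos hn.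
  by have := posroot_ht hr bP bpos; rewrite hn ler10.
have [bS|bS] := boolP (b \in S).
  have ib : (index b S < size S)%N by rewrite index_mem.
  exists 1%N, (Fop (Ordinal ib)).
  by have := brgen1 (fun i => x (- al i)) Fop (Ordinal ib); rewrite /= nth_index.
have [i [ci biP bipos]] := posroot_descent lf bP bpos bS.
have iS : S`_i \in S by apply: mem_nth.
have [|m [Y hY]] := IH (b - S`_i) biP bipos.
  by rewrite htB (ht_simple hr iS) hn -natr1 addrK.
have bi : - b != - S`_i by rewrite eqr_opp; apply: contraNneq bS => ->.
have iP := simple_root hr iS.
have ciN : 0 < copair (- b) (- S`_i) by rewrite copairNN.
have [_ [c c0 cE]] := brk_raise lf (oppr_root hr iP) (oppr_root hr bP) ciN bi.
exists m.+1, (fun p => c^-1 *: opbr (Fop i) Y p).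
have -> : x (- b) = c^-1 *: brk g (x (- al i)) (x (- (b - al i))).
  by rewrite opprB [al i - b]addrC -[X in x (- b + X)]opprK cE scalerA mulVf // scale1r.
exact/brgenZ/(brgenS i).
Qed.

Lemma opair_ex y : exists Y, opair y Y.
Proof.
have oD y1 y2 : (exists Y, opair y1 Y) -> (exists Y, opair y2 Y) -> exists Y, opair (y1 + y2) Y.
  by case=> Y1 h1 [Y2 h2]; rewrite -[y1]scale1r; eexists; apply: opairD h1 h2.
have [H hH [c ->]] := lf_span lf y; apply: (oD _ _).
  by exists (Hop H); apply: (@opair_gr 0).
rewrite big_seq; apply: (big_ind (fun y => exists Y, opair y Y)); [by eexists; apply: opair0|exact: oD|].
move=> b aP; suff [Y hY] : exists Y, opair (x b) Y by eexists; apply: opairZ hY.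
have [apos|apos] := pos_or hr aP.
  by have [[|n] [Y hY]] := egen_posroot aP apos; exists Y;
   [have [-> ->] := brgen_deg0 hY; exact: opair0|apply: (@opair_gr n.+1)].
have [n [Y]] := fgen_posroot (oppr_root hr aP) apos; rewrite opprK => hY; exists Y.
case: n hY => [|n] hY; last exact: (@opair_gr (Negz n)).
by have [-> ->] := brgen_deg0 hY; exact: opair0.
Qed.
End WordAction.

Section LieModOf.
Variables (K : fieldType) (g : lieAlg K) (V : vectType K) (f : g -> V -> V).
Hypothesis f_bilin : bilinear_for *:%R *:%R f.
Hypothesis f_brk : forall x y v, f (brk g x y) v = f x (f y v) - f y (f x v).

Definition lieMod_of : lieMod g :=
  let m := bilinear_isBilinear.Build K g V V *:%R *:%R f f_bilin in
  @LieMod K g V (HB.pack f m) f_brk.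

Lemma lieMod_ofE x v : act lieMod_of x v = f x v. Proof. by []. Qed.
End LieModOf.

Lemma iter_scale (K : fieldType) (M : lmodType K) (f : M -> M) c n v : linear f ->
  iter n (fun u => c *: f u) v = c ^+ n *: iter n f v.
Proof.
move=> fL; elim: n => [|n IH]; first by rewrite expr0 scale1r.
have fZ d u : f (d *: u) = d *: f u.
  have f0 : f 0 = 0 by have := fL (-1) 0 0; rewrite scaler0 addr0 scaleN1r addNr.
  by have := fL d u 0; rewrite f0 !addr0.
by rewrite !iterS IH fZ scalerA exprS.
Qed.

Lemma wf_norm_mono (R : realType) (X : lie_datum R) (bf : euc X -> euc X -> R) x y :
  wform bf -> 0 <= bf x (x - y) -> 0 <= bf y (x - y) -> bf y y <= bf x x.
Proof. by move=> hb; rewrite !(wfE hb) (wfC hb y x); lra. Qed.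

Lemma wf_norm_sub (R : realType) (X : lie_datum R) (bf : euc X -> euc X -> R) x y :
  wform bf -> bf y y <= bf x x -> bf (x - y) (x - y) <= 4 * bf x x.
Proof.
move=> hb; have := wf_ge0 hb (x + y).
by rewrite !(wfE hb) (wfC hb y x); lra.
Qed.

(** * Local nilpotence and finite dimension *)

Section HighestWeightModule.
Variables (R : realType) (X : lie_datum R).
Local Notation g := (alg X).
Local Notation h := (cartan X).
Local Notation E := (euc X).
Local Notation S := (simple_roots X).
Local Notation Phi := (root_set X).
Implicit Types (a b : E).
Variables (bf : E -> E -> R) (x t : E -> g) (B : g -> g -> R[i]).
Hypothesis lf : lie_frame bf x t B.

Let hr := lf_roots lf.
Let hb := lf_form lf.
Let he := lf_eval lf.

Variable lam : E.
Local Notation C := (R[i]^o : lmodType R[i]).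
Local Notation I := 'I_(size S).
Local Notation al := (fun i : I => S`_i : E).
Local Notation F := (seq I -> C).
Local Notation Eop := (@Eop R X).
Local Notation Hop := (@cartan_op R X lam).
Local Notation Fop := (@Fop R X t lam).
Local Notation wmod := (@wmod R X t lam).
Local Notation fword := (@fword R X t lam).
Local Notation vac := (@vac R X).
Local Notation egen := (brgen (fun i => x (al i)) Eop).
Local Notation opair := (@opair R X x t lam).
Implicit Types (w : seq I) (p q : F).

Lemma Fop_hdeg n j p : hdeg n p -> hdeg n.+1 (Fop j p).
Proof.
move=> hp w; elim: w n p hp => [|i w IH] n p hp //= sw.
rewrite /cartan_op hp // mulr0 if_same addr0.
case: n hp sw => [|n] hp sw; last by apply: (IH n) => // u su; apply: hp.
have -> : Eop i p = 0 by apply/funext => u; apply: hp.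
by rewrite (lin0 (@Fop_linear R X t lam j)).
Qed.

Lemma fword_hdeg w : hdeg (size w) (fword w).
Proof.
elim: w => [|i w IH]; last exact: Fop_hdeg.
by move=> u; rewrite -[fword [::] u]/((u == [::])%:R) -size_eq0 => /negPf ->.
Qed.

Lemma word_zero p : p [::] = 0 -> (forall k, Eop k p = 0) -> p = 0.
Proof.
by move=> p0 pE; apply/funext => -[|i w] //; rewrite -[LHS]/(Eop i p w) pE.
Qed.

Lemma alPhi i : al i \in Phi. Proof. by apply: (simple_root hr); apply: mem_nth. Qed.

Let sc i : R[i] := (2 / bf (al i) (al i))%:RC.
Let fs i p : F := sc i *: Fop i p.
Let hs i p : F := sc i *: Hop (t (al i)) p.

Lemma fs_linear i : linear (fs i).
Proof. by move=> c u v; rewrite /fs Fop_linear scalerDr !scalerA mulrC. Qed.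

Lemma sc_bf i b : sc i * (bf b (al i))%:RC = (copair b (al i))%:RC.
Proof.
rewrite /sc -rmorphM /= (wf_co hb b (alPhi i)); congr (_%:RC).
have : bf (al i) (al i) != 0.
  by rewrite gt_eqF //; apply: (wf_gt0 hb); apply: (root_neq0 hr); apply: alPhi.
by move=> n0; field.
Qed.

Lemma sc_neq0 i : sc i != 0.
Proof.
rewrite /sc fmorph_eq0 mulf_neq0 ?pnatr_eq0 // invr_eq0 gt_eqF //.
by apply: (wf_gt0 hb); apply: (root_neq0 hr); apply: alPhi.
Qed.

Lemma sl2_EF i p : Eop i (fs i p) = fs i (Eop i p) + hs i p.
Proof.
rewrite /fs /hs -[Eop i (_ *: _)]/(sc i *: Eop i (Fop i p)).
by rewrite (EF_comm lf) (EF_brk lf) eqxx scalerDr addrC.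
Qed.

Lemma hs_al i : sc i * wteval (al i) (t (al i)) = 2.
Proof.
rewrite (lf_tE lf) sc_bf copairxx ?(root_neq0 hr) ?alPhi //.
by rewrite rmorph_nat.
Qed.

Lemma sl2_HE i p : hs i (Eop i p) = Eop i (hs i p) + 2 *: Eop i p.
Proof.
have := HE lf lam i p (lf_t lf (al i)); rewrite /opbr => /eqP.
rewrite subr_eq => /eqP e; rewrite /hs e scalerDr scalerA hs_al addrC.
by congr (_ + _).
Qed.

Lemma sl2_HF i p : hs i (fs i p) = fs i (hs i p) - 2 *: fs i p.
Proof.
have := HF lf lam i p (lf_t lf (al i)); rewrite /opbr => /eqP.
rewrite subr_eq => /eqP e; rewrite /hs /fs.
have HZ c H u : Hop H (c *: u) = c *: Hop H u.
  by have := Hop_linear lam H c u 0; rewrite (lin0 (@Hop_linear R X lam H)) !addr0.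
have FZ c u : Fop i (c *: u) = c *: Fop i u.
  by have := Fop_linear t lam i c u 0; rewrite (lin0 (@Fop_linear R X t lam i)) !addr0.
rewrite HZ FZ e !scalerDr addrC; congr (_ + _).
have w2 : sc i * wteval S`_i (t S`_i) = 2 := hs_al i.
by rewrite scaleNr !scalerN !scalerA -mulrA w2 mulrC.
Qed.

Definition wtvec b p := forall H, H \in h -> Hop H p = wteval b H *: p.

Lemma wtvec_hs b p i : wtvec b p -> hs i p = (copair b (al i))%:RC *: p.
Proof.
by move=> bp; rewrite /hs bp ?(lf_t lf) // scalerA (lf_tE lf) sc_bf.
Qed.

Lemma wtvec_E b p i : wtvec b p -> wtvec (b + al i) (Eop i p).
Proof.
move=> bp H hH; have := HE lf lam i p hH; rewrite /opbr bp // => /eqP.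
rewrite -[Eop i (_ *: _)]/(wteval b H *: Eop i p) subr_eq -scalerDl => /eqP ->.
by rewrite (evD he) // addrC.
Qed.

Lemma wtvec_iterE n b p i : wtvec b p -> wtvec (b + n%:R *: al i) (iter n (Eop i) p).
Proof.
move=> bp; elim: n => [|n IH]; first by rewrite scale0r addr0.
by rewrite -natr1 scalerDl scale1r addrA; apply: wtvec_E.
Qed.

Lemma wtvec_word b p : wtvec b p -> p != 0 -> exists w, b = lam - word_wt w.
Proof.
move=> bp p0; have [w pw] : exists w, p w != 0.
  apply: contrapT => /forallNP h; move/eqP: p0; apply; apply/funext => w.
  by apply/eqP/negPn/negP/h.
exists w; apply/eqP; rewrite -subr_eq0; apply/eqP/(ev_inj he) => H hH.
have := congr1 (fun q => q w) (bp H hH).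
rewrite -[LHS]/(wteval (lam - word_wt w) H * p w) -[RHS]/(wteval b H * p w).
by move=> /(mulIf pw) e; rewrite (evB he) // e subrr.
Qed.

Lemma word_wt_cone w : cone (word_wt w : E).
Proof.
rewrite /word_wt; apply: (big_ind (fun y : E => is_true (cone y))).
- exact: cone0.
- exact: coneD.
- by move=> i _; apply: pos_cone; apply: (simple_pos hr); apply: mem_nth.
Qed.

Lemma word_wt_ht w : ht (word_wt w : E) = (size w)%:R.
Proof.
rewrite /word_wt ht_sum; elim: w => [|i w IH]; first by rewrite big_nil.
by rewrite big_cons IH (ht_simple hr) ?mem_nth //= -natr1 addrC.
Qed.

Definition nilpF i p := exists n, iter n (Fop i) p = 0.

Lemma iterF0 i n : iter n (Fop i) (0 : F) = 0.
Proof. by apply: iter_fix0; apply: lin0; apply: Fop_linear. Qed.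

Lemma iterF_linear i n : linear (iter n (Fop i)).
Proof. by elim: n => // n IH c u v; rewrite !iterS IH Fop_linear. Qed.

Lemma nilpD i c p q : nilpF i p -> nilpF i q -> nilpF i (c *: p + q).
Proof.
move=> [n pn] [m qm]; exists (n + m)%N; rewrite iterF_linear.
have -> : iter (n + m) (Fop i) p = 0 by rewrite addnC iterD pn iterF0.
by rewrite iterD qm iterF0 scaler0 addr0.
Qed.

Lemma nilpF0 i : nilpF i 0. Proof. by exists 0%N. Qed.

(** If the n-th iterated commutator with F_i vanishes, the operator preserves local nilpotence of
    F_i. Downward induction on the order of the commutators, and for each on the exponent that kills
    p. *)
Lemma nilp_ad i (D : nat -> F -> F) n p :
    (forall k, linear (D k)) ->
    (forall k q, D k.+1 q = opbr (Fop i) (D k) q) ->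
    (forall q, wmod q -> D n q = 0) ->
  wmod p -> nilpF i p -> nilpF i (D 0 p).
Proof.
move=> DL DS Dn pw hp.
suff key (k : nat) : forall p, wmod p -> nilpF i p -> nilpF i (D (n - k)%N p).
  by have := key n p pw hp; rewrite subnn.
elim: k => [|k IHk] {pw hp} p pw [m hm]; first by rewrite subn0 Dn //; apply: nilpF0.
case: (ltnP k n) => kn; last first.
  have e0 : (n - k.+1 = n - k)%N by lia.
  by rewrite e0; apply: IHk => //; exists m.
elim: m p pw hm => [|m IHm] p pw hm.
  by rewrite -[p]/(iter 0 (Fop i) p) hm (lin0 (DL _)); apply: nilpF0.
have [N hN] : nilpF i (Fop i (D (n - k.+1)%N p)).
  have -> : Fop i (D (n - k.+1)%N p) = 1 *: D (n - k)%N p + D (n - k.+1)%N (Fop i p).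
    have -> : (n - k = (n - k.+1)%N.+1)%N by lia.
    by rewrite scale1r DS /opbr subrK.
  apply: nilpD; first by apply: IHk => //; exists m.+1.
  by apply: IHm; [apply: wmodF|rewrite -iterSr].
by exists N.+1; rewrite iterSr.
Qed.

Hypothesis lam_dom : Pplus lam.

Lemma lam_nat i : exists m : nat, copair lam (al i) = m%:R.
Proof.
move: lam_dom => /andP[lw /allP lp].
have := ra_wt hr lw (alPhi i); rewrite intrEge0; first by move/natrP.
by apply: lp; apply: mem_nth.
Qed.

(** With m the pairing of lam with the i-th coroot, F_i^(m+1) applied to the vacuum is killed by
    every raising operator and has no vacuum coefficient, so it is zero. Integrality and dominance
    of lam enter here. *)
Lemma vac_nilp i : nilpF i vac.
Proof.
have [m mE] := lam_nat i; exists m.+1; apply: word_zero => // k.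
have [->|ki] := eqVneq k i; last first.
  have comm q : Eop k (Fop i q) = Fop i (Eop k q).
    by rewrite (EF_comm lf) (EF_brk lf) (negPf ki) (Hop0 lf) add0r.
  suff : Eop k (iter m.+1 (Fop i) vac) = iter m.+1 (Fop i) (Eop k vac).
    by rewrite Eop_vac iterF0.
  by elim: m.+1 => [|j IH] //; rewrite !iterS comm IH.
have vw : wtvec lam vac by move=> H hH; rewrite Hop_vac.
have := sl2_ef (@fs_linear i) (@sl2_EF i) (@sl2_HF i) m (wtvec_hs i vw).
rewrite mE rmorph_nat subrr mulr0 scale0r addr0 Eop_vac iter_fix0 ?(lin0 (@fs_linear i)) //.
rewrite (iter_scale _ _ _ (@Fop_linear R X t lam i)).
rewrite -[Eop i (_ *: _)]/(sc i ^+ m.+1 *: Eop i (iter m.+1 (Fop i) vac)) => /eqP.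
by rewrite scaler_eq0 expf_eq0 (negPf (sc_neq0 i)) andbF => /eqP.
Qed.

(** As there are finitely many roots, some power of the bracket with x_(-i) kills x_(-j).
    [opair_unique] carries this relation over to the operators, and [nilp_ad] to longer words. *)
Lemma wmod_nilp i p : wmod p -> nilpF i p.
Proof.
elim=> [w||c p1 p2 _ IH1 _ IH2]; [|exact: nilpF0|exact: nilpD].
elim: w => [|j w IH]; first exact: vac_nilp.
have oF k : opair (x (- al k)) (Fop k).
  by apply: (@opair_gr _ _ _ _ _ (Negz 0)); apply: (brgen1 (fun i => x (- al i))).
have iN := oppr_root hr (alPhi i); have jN := oppr_root hr (alPhi j).
pose D k := iter k (opbr (Fop i)) (Fop j).
have Do k : opair (iter k (brk g (x (- al i))) (x (- al j))) (D k).
  elim: k => [|k IHk]; first exact: oF.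
  by rewrite /D !iterS; apply: (opair_F lf).
have jw : (x (- al j) : adj g) \in wsp (adj g) (- al j).
  by apply/(adj_wsp lf); apply: (lf_x lf).
have [n hn] := root_nilp lf (adj_wdiag lf) iN jw.
apply: (@nilp_ad i D n) => //.
- by move=> k; apply: opair_linear (Do k).
- by move=> q qw; apply: (opair_unique lf) qw; rewrite -hn; apply: Do.
- exact: wmod_word.
Qed.

Lemma wtvec_raise b p i k : wmod p -> wtvec b p -> p != 0 -> copair b (al i) = - k%:R ->
  iter k (Eop i) p != 0.
Proof.
move=> pw bp p0 bk; apply: contraNneq p0 => Ek.
have [n hn] := wmod_nilp i pw.
apply/eqP; apply: (@sl2_lower _ _ (fs i) (Eop i) (fun q => - hs i q) _ _ _ _ _ n k) => //.
- exact: fs_linear.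
- by move=> q; rewrite sl2_EF addrK.
- move=> q; have fN : fs i (- hs i q) = - fs i (hs i q).
    by have := fs_linear i (-1) (hs i q) 0; rewrite addr0 (lin0 (@fs_linear i)) addr0 !scaleN1r.
  by rewrite sl2_HF fN opprB addrC.
- by move=> q; rewrite sl2_HE opprD.
- by rewrite (iter_scale _ _ _ (@Fop_linear R X t lam i)) hn scaler0.
- by rewrite (wtvec_hs i bp) bk rmorphN rmorph_nat scaleNr opprK.
Qed.

(** Induction on the height of lam - b. If b is dominant, compare norms directly. Otherwise a simple
    root pairs with b to -k < 0; E_i^k p is nonzero, has the reflected weight, of the same norm, and
    is closer to lam. *)
Lemma wtvec_norm b p : wmod p -> wtvec b p -> p != 0 -> bf b b <= bf lam lam.
Proof.
move=> pw bp p0; have [w wE] := wtvec_word bp p0.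
have : ht (lam - b) <= (size w)%:R by rewrite wE subKr word_wt_ht.
move: (size w) => n {w wE}; elim: n b p pw bp p0 => [|n IH] b p pw bp p0 hn;
  have [w wE] := wtvec_word bp p0.
all: have lamb : lam - b = word_wt w by rewrite wE subKr.
all: have [bd|] := boolP (dom S b).
1,3: have c1 := word_wt_cone w; have /coneP[c2 _] := c1;
  by apply: (wf_norm_mono hb); rewrite lamb;
     [apply: (dom_ge0 hr (Sbar := S) _ hb (proj2 (andP lam_dom)) c2 c1)|
      apply: (dom_ge0 hr (Sbar := S) _ hb bd c2 c1)].
- move=> /allPn[a aS]; rewrite -ltNge => ca.
  have w0 : w = [::].
    by apply/size0nil; move: hn; rewrite lamb word_wt_ht ler_nat leqn0 => /eqP.
  move: ca; rewrite wE w0 /word_wt big_nil subr0 ltNge.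
  by have /andP[_ /allP ->] := lam_dom.
- move=> /allPn[a aS]; rewrite -ltNge => ca.
  have ia : (index a S < size S)%N by rewrite index_mem.
  pose i := Ordinal ia; have aE : a = al i by rewrite /= nth_index.
  rewrite aE in ca.
  have lw : copair b (al i) \is a Num.int.
    have /andP[lamw _] := lam_dom.
    rewrite wE copairBl rpredB ?(ra_wt hr lamw) ?alPhi // /word_wt copair_suml.
    by apply: rpred_sum => j _; apply: (ra_int hr); apply: alPhi.
  have [k kE] : exists k : nat, - copair b (al i) = k%:R.
    by apply/natrP; rewrite -intrEge0 ?rpredN // oppr_ge0 ltW.
  have bk : copair b (al i) = - k%:R by rewrite -kE opprK.
  have k1 : (1 <= k%:R :> R).
    by rewrite ler1n lt0n; apply: contraTneq ca => k0; rewrite bk k0 oppr0 ltxx.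
  have q0 := wtvec_raise pw bp p0 bk.
  have qw : wmod (iter k (Eop i) p).
    by elim: (k) => // j IHj; rewrite iterS; apply: (wmodE lf).
  have := IH _ _ qw (wtvec_iterE k i bp) q0.
  have hti : ht (al i) = 1 by apply: (ht_simple hr); apply: mem_nth.
  rewrite opprD addrA htB htZ hti mulr1.
  have -> : b + k%:R *: al i = reflect (al i) b by rewrite /reflect bk scaleNr opprK.
  rewrite (wf_reflect b b hb (alPhi i)); apply.
  by move: hn; rewrite -natr1 lerBlDr => /le_trans; apply; rewrite lerD2l.
Qed.

(** The length of a word is the height of its weight, and heights are bounded on a ball by the
    Cauchy-Schwarz inequality. *)
Lemma fword_bound : exists M, forall w, (M < size w)%N -> fword w = 0.
Proof.
have [d dE] := ht_riesz lf.
(* Weights b satisfy |b| <= |lam|, hence |lam - b|^2 <= 4 |lam|^2, while the height is the pairing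
   with d. This bounds the square of the length, and a natural number is at most its square. *)
pose c := 4 * bf lam lam * bf d d; exists (Num.bound c) => w lw.
apply/eqP; apply: contraLR lw => w0; rewrite -leqNgt.
have ww : wtvec (lam - word_wt w) (fword w) by move=> H hH; rewrite (Hop_word lf).
have nrm := wtvec_norm (wmod_word _ _ w) ww w0.
have CS := wf_CS (word_wt w) d hb; rewrite -dE word_wt_ht in CS.
have c_ge : (size w)%:R ^+ 2 <= c.
  apply: (le_trans CS); rewrite /c ler_wpM2r ?(wf_ge0 hb) //.
  by have := wf_norm_sub hb nrm; rewrite subKr.
have s_le : (size w)%:R <= c.
  apply: le_trans c_ge; rewrite -natrX ler_nat.
  by case: (size w) => // n; rewrite expnS leq_pmulr // expn_gt0.
have := le_lt_trans s_le (archi_boundP (le_trans (ler0n _ _) s_le)).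
by rewrite ltr_nat => /ltnW.
Qed.

Lemma wmod_bound M : (forall w, (M < size w)%N -> fword w = 0) ->
  forall p, wmod p -> forall w, (M < size w)%N -> p w = 0.
Proof.
move=> hM p; elim=> [u||c p1 p2 _ IH1 _ IH2] w Mw //.
- have [su|su] := eqVneq (size w) (size u); last exact: fword_hdeg.
  by rewrite hM // -su.
- by rewrite -[LHS]/(c * p1 w + p2 w) IH1 // IH2 // mulr0 addr0.
Qed.

Lemma opair_eq y Y Y' p : opair y Y -> opair y Y' -> wmod p -> Y p = Y' p.
Proof.
move=> h1 h2 pw; have := opairD (-1) h1 h2; rewrite scaleN1r addNr => h3.
have /eqP := opair_unique lf h3 pw.
by rewrite scaleN1r addrC subr_eq0 => /eqP.
Qed.
End HighestWeightModule.

Section HighestWeightExistence.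
Variables (R : realType) (X : lie_datum R).
Local Notation g := (alg X).
Local Notation h := (cartan X).
Local Notation E := (euc X).
Local Notation S := (simple_roots X).
Local Notation Phi := (root_set X).
Implicit Types (a b : E).
Variables (bf : E -> E -> R) (x t : E -> g) (B : g -> g -> R[i]).
Hypothesis lf : lie_frame bf x t B.

Let hr := lf_roots lf.

Variable lam : E.
Local Notation C := (R[i]^o : lmodType R[i]).
Local Notation I := 'I_(size S).
Local Notation al := (fun i : I => S`_i : E).
Local Notation F := (seq I -> C).
Local Notation Eop := (@Eop R X).
Local Notation Hop := (@cartan_op R X lam).
Local Notation Fop := (@Fop R X t lam).
Local Notation wmod := (@wmod R X t lam).
Local Notation fword := (@fword R X t lam).
Local Notation vac := (@vac R X).
Local Notation opair := (@opair R X x t lam).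
Implicit Types (w : seq I) (p q : F).
Variable M : nat.
Hypothesis wmodM : forall p, wmod p -> forall w, (M < size w)%N -> p w = 0.

Local Notation V0 := {ffun M.-bseq I -> R[i]^o}.
(** The functions on all words form an infinite-dimensional space. Restriction to words of length at
    most [M] is injective on [wmod] and places it in a finite-dimensional one. *)
Definition res p : V0 := [ffun u : M.-bseq I => p u].

Lemma res_linear : linear res.
Proof. by move=> c p q; apply/ffunP => u; rewrite !ffunE. Qed.

Lemma res0 : res 0 = 0. Proof. by apply/ffunP => u; rewrite !ffunE. Qed.

Lemma res_inj p q : wmod p -> wmod q -> res p = res q -> p = q.
Proof.
move=> pw qw pq; apply/funext => w; have [sw|sw] := leqP (size w) M.
  by have := congr1 (fun f : V0 => f (Bseq sw)) pq; rewrite !ffunE.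
by rewrite !wmodM.
Qed.

Definition W0 : {vspace V0} := 
  <<[seq res (fword (val u)) | u <- enum (@predT (M.-bseq I))]>>%VS.

Lemma res_W0 p : wmod p -> res p \in W0.
Proof.
elim=> [w||c p1 p2 _ IH1 _ IH2].
- have [sw|sw] := leqP (size w) M.
    by apply: memv_span; apply/mapP; exists (Bseq sw); rewrite ?mem_enum.
  suff -> : res (fword w) = 0 by apply: mem0v.
  apply/ffunP => u; rewrite !ffunE; apply: fword_hdeg.
  by apply: contraTneq sw => <-; rewrite -leqNgt size_bseq.
- by rewrite res0 mem0v.
- by rewrite res_linear; apply: memvD => //; apply: memvZ.
Qed.

Lemma W0_lift v : v \in W0 -> exists p, wmod p /\ res p = v.
Proof.
rewrite /W0; elim: (enum (@predT (M.-bseq I))) v => [|u s IH] v.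
  by rewrite span_nil memv0 => /eqP ->; exists 0; rewrite res0; split=> //; apply: wmod0.
rewrite map_cons span_cons => /memv_addP[_ /vlineP[c ->] [v' /IH[p [pw <-]] ->]].
exists (c *: fword (val u) + p); split; last exact: res_linear.
by apply: wmodD => //; apply: wmod_word.
Qed.

Local Notation V := (subvs_of W0).

Lemma subvs_lift (v : V) : exists p, wmod p /\ res p = vsval v.
Proof. exact: W0_lift (subvsP v). Qed.

Lemma module_ex : exists (L : V -> F) (rho : g -> F -> F),
  (forall v, wmod (L v) /\ res (L v) = vsval v) /\ forall y, opair y (rho y).
Proof.
have [L hL] := boolp.choice subvs_lift.
by have [rho hrho] := boolp.choice (@opair_ex R X bf x t B lf lam); exists L, rho.
Qed.

Section Fixed.
Variables (L : V -> F) (rho : g -> F -> F).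
Hypothesis LP : forall v, wmod (L v) /\ res (L v) = vsval v.
Hypothesis rhoP : forall y, opair y (rho y).

Definition tov p : V := vsproj W0 (res p).

Lemma vsval_tov p : wmod p -> vsval (tov p) = res p.
Proof. by move=> pw; rewrite vsprojK // res_W0. Qed.

Lemma L_tov p : wmod p -> L (tov p) = p.
Proof.
move=> pw; have [Lw LE] := LP (tov p); apply: res_inj => //.
by rewrite LE vsval_tov.
Qed.

Lemma tov_L v : tov (L v) = v.
Proof. by have [Lw LE] := LP v; apply: val_inj; rewrite /= vsval_tov. Qed.

Lemma tov0 : tov 0 = 0. Proof. by rewrite /tov res0 linear0. Qed.

Lemma tov_linear : linear tov.
Proof. by move=> c p q; rewrite /tov res_linear linearP. Qed.

Definition word_act (y : g) (v : V) : V := tov (rho y (L v)).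

Lemma wmod_rho y p : wmod p -> wmod (rho y p).
Proof. by apply: (wmod_opair lf (rhoP y)). Qed.

Lemma word_act_bilinear : bilinear_for *:%R *:%R word_act.
Proof.
split=> [v|y] c y1 y2; rewrite /word_act.
  rewrite -tov_linear; congr tov; have [Lw _] := LP v.
  exact: (opair_eq lf (rhoP _) (opairD c (rhoP y1) (rhoP y2)) Lw).
have -> : L (c *: y1 + y2) = c *: L y1 + L y2.
  rewrite -[in RHS](L_tov (p := c *: L y1 + L y2)); last first.
    by apply: wmodD; [case: (LP y1)|case: (LP y2)].
  by rewrite tov_linear !tov_L.
by rewrite (opair_linear (rhoP y)) tov_linear.
Qed.

Lemma word_act_brk y1 y2 v : word_act (brk g y1 y2) v =
  word_act y1 (word_act y2 v) - word_act y2 (word_act y1 v).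
Proof.
have [Lw _] := LP v; rewrite /word_act !L_tov; try exact: wmod_rho.
rewrite (opair_eq lf (rhoP _) (opair_brk lf (rhoP y1) (rhoP y2)) Lw) /opbr.
by rewrite addrC -scaleN1r tov_linear scaleN1r addrC.
Qed.

Definition word_module : lieMod g := lieMod_of word_act_bilinear word_act_brk.

Lemma word_actE y Y p : opair y Y -> wmod p ->
  act word_module y (tov p) = tov (Y p).
Proof.
move=> oy pw; rewrite lieMod_ofE /word_act L_tov //.
by rewrite (opair_eq lf (rhoP y) oy pw).
Qed.

Lemma opairE i : opair (x (al i)) (Eop i).
Proof. by apply: (@opair_gr _ _ _ _ _ 1); apply: (brgen1 (fun i => x (al i))). Qed.

Lemma opairF i : opair (x (- al i)) (Fop i).
Proof.
by apply: (@opair_gr _ _ _ _ _ (Negz 0)); apply: (brgen1 (fun i => x (- al i))).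
Qed.

Lemma vac_wmod : wmod vac. Proof. exact: (wmod_word t lam [::]). Qed.

Lemma tov_neq0 p : wmod p -> p != 0 -> tov p != 0.
Proof.
move=> pw; apply: contraNneq => p0; rewrite -(L_tov pw) p0.
by rewrite -tov0 L_tov //; apply: wmod0.
Qed.

Lemma vac_neq0 : vac != 0.
Proof.
apply/negP => /eqP/(congr1 (fun f : F => f [::])).
rewrite -[LHS]/(1 : R[i]) -[RHS]/(0 : R[i]) => /eqP.
by rewrite oner_eq0.
Qed.

Lemma longest_word p : wmod p -> p != 0 -> exists w, p w != 0 /\
  forall u, (size w < size u)%N -> p u = 0.
Proof.
move=> pw p0; pose Q n := `[< exists w, size w = n /\ p w != 0 >].
have exQ : exists n, Q n.
  apply: contrapT => /forallNP hN; move/eqP: p0; apply; apply/funext => w.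
  apply/eqP/negPn/negP => pw0; apply: (hN (size w)); apply/asboolP.
  by exists w.
have Qle n : Q n -> (n <= M)%N.
  move=> /asboolP[w [<- pw0]]; rewrite leqNgt; apply: contraNN pw0 => lw.
  by rewrite wmodM.
have [n /asboolP[w [wn pw0]] max] := ex_maxnP exQ Qle.
exists w; split=> // u; rewrite wn => nu; apply/eqP/negPn/negP => pu.
have /max : Q (size u) by apply/asboolP; exists u.
by rewrite leqNgt nu.
Qed.

Lemma iterE_word w p u : foldl (fun q i => Eop i q) p w u = p (w ++ u).
Proof. by elim: w p => //= i w IH p; rewrite IH. Qed.

(** Raising a nonzero vector along a longest word of its support leaves a nonzero multiple of the
    vacuum, and lowering operators recover everything from the vacuum. *)
Lemma word_module_irr : irreducible_sub [set: g] (fullv : {vspace word_module}).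
Proof.
split.
- apply/negP => /eqP f0; have := tov_neq0 vac_wmod vac_neq0.
  have := memvf (tov vac : word_module); rewrite f0 memv0 => /eqP ->.
  by rewrite eqxx.
- by move=> y v _ _; apply: memvf.
move=> U stU _; have [U0|U0] := eqVneq U 0%VS; [by left|right].
have [v vU v0] : exists2 v : word_module, v \in U & v != 0.
  by exists (vpick U); rewrite ?memv_pick // vpick0.
pose inU p := wmod p /\ (tov p : word_module) \in U.
have inUo y Y p : opair y Y -> inU p -> inU (Y p).
  move=> oy [pw pU]; split; first exact: (wmod_opair lf oy pw).
  by rewrite -(word_actE oy pw); apply: stU.
have inU0 : inU 0.
  by split; [exact: wmod0|rewrite tov0; apply: mem0v].
have inUD c p q : inU p -> inU q -> inU (c *: p + q).
  move=> [pw pU] [qw qU]; split; first exact: wmodD.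
  by rewrite tov_linear; apply: memvD => //; apply: memvZ.
have vL : inU (L v) by have [Lw _] := LP v; split=> //; rewrite tov_L.
have [w [Lvw max]] : exists w, L v w != 0 /\
    forall u, (size w < size u)%N -> L v u = 0.
  apply: longest_word; first by have [] := LP v.
  by apply: contraNneq v0 => Lv0; rewrite -(tov_L v) Lv0 tov0.
have vacU : inU vac.
  have EU : inU (foldl (fun q i => Eop i q) (L v) w).
    elim: (w) (L v) vL => //= i w' IH p pU.
    by apply: IH; apply: (inUo _ _ _ (opairE i)).
  have -> : vac = (L v w)^-1 *: foldl (fun q i => Eop i q) (L v) w + 0.
    apply/funext => u; rewrite addr0.
    rewrite -[RHS]/((L v w)^-1 * foldl (fun q i => Eop i q) (L v) w u) iterE_word.
    rewrite -[LHS]/((u == [::])%:R : R[i]).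
    case: u => [|i u]; first by rewrite cats0 mulVf.
    have -> : L v (w ++ i :: u) = 0 by apply: max; rewrite size_cat /=; lia.
    by rewrite mulr0.
  exact: inUD.
have allU p : wmod p -> inU p.
  elim=> [u||c p1 p2 _ IH1 _ IH2] //; last exact: inUD.
  by elim: u => [|i u IH] //; apply: (inUo _ _ _ (opairF i)).
apply/eqP; rewrite eqEsubv subvf; apply/subvP => v' _.
by have [Lw _] := LP v'; have [_] := allU _ Lw; rewrite tov_L.
Qed.

Lemma word_module_hw : highest_weight (pos_roots X) (fullv : {vspace word_module}) lam.
Proof.
exists (tov vac : word_module); first exact: memvf.
split; first exact: tov_neq0 vac_wmod vac_neq0.
- move=> H hH; have oH : opair H (Hop H) by apply: (@opair_gr _ _ _ _ _ 0).
  rewrite (word_actE oH vac_wmod) Hop_vac.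
  have := tov_linear (wteval lam H) vac 0.
  by rewrite tov0 !addr0.
move=> a; rewrite mem_filter => /andP[apos aP] y ya.
have [c ->] := lf_dim1 lf aP ya.
have -> : act word_module (c *: x a) (tov vac) = c *: act word_module (x a) (tov vac).
  by rewrite linearZl_LR.
have [n [Y hY]] := egen_posroot lf aP apos.
have oY : opair (x a) Y.
  case: n hY => [|n] hY; last exact: (@opair_gr _ _ _ _ _ n.+1).
  by have [-> ->] := brgen_deg0 hY; apply: (opair0 lf).
by rewrite (word_actE oY vac_wmod) (egen_vac hY) tov0 scaler0.
Qed.
End Fixed.
End HighestWeightExistence.

Lemma irr_hw_ex (R : realType) (X : lie_datum R) bf x t B lam :
  @lie_frame R X bf x t B -> Pplus lam -> exists V : lieMod (alg X), is_irr_hw V lam.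
Proof.
move=> lf lamP; have [M hM] := fword_bound lf lamP.
have wM := wmod_bound hM; have [L [rho [LP rhoP]]] := module_ex lf lam M.
exists (word_module lf wM LP rhoP).
by split; [exact: word_module_irr|exact: word_module_hw].
Qed.

(** * The frame of a simple Lie algebra *)

Lemma trs_rank1 (K : fieldType) (V : vectType K) (phi : V -> K^o) (u : V) :
  linear phi -> trs fullv (fun v => phi v *: u) = phi u.
Proof.
move=> pL; have p0 : phi 0 = 0.
  by have := pL (-1) 0 0; rewrite scaler0 addr0 scaleN1r addNr.
have pD v w : phi (v + w) = phi v + phi w by have := pL 1 v w; rewrite !scale1r.
have pZ c v : phi (c *: v) = c * phi v by have := pL c v 0; rewrite p0 !addr0.
rewrite {2}(coord_vbasis (memvf u)) (big_morph phi pD p0); apply: eq_bigr => i _.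
by rewrite linearZ pZ mulrC.
Qed.

Lemma trs_eigen (K : fieldType) (V : vectType K) (b : seq V) (f : V -> V) (c : V -> K) :
    linear f -> basis_of fullv b -> {in b, forall x, f x = c x *: x} ->
  trs fullv f = \sum_(x <- b) c x.
Proof.
move=> fL bB fb; have f0 : f 0 = 0.
  by have := fL (-1) 0 0; rewrite scaler0 addr0 scaleN1r addNr.
have fD v w : f (v + w) = f v + f w by have := fL 1 v w; rewrite !scale1r.
have fZ k v : f (k *: v) = k *: f v by have := fL k v 0; rewrite f0 !addr0.
pose bt := in_tuple b.
have -> : trs fullv f = trs fullv (fun v => \sum_(i < size b) (coord bt i v * c b`_i) *: b`_i).
  apply: eq_in_trs => v _; rewrite {1}(coord_basis (X := bt) bB (memvf v)).
  rewrite (big_morph f fD f0); apply: eq_bigr => i _.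
  by rewrite fZ fb ?mem_nth // scalerA.
rewrite trs_sum (big_nth 0) big_mkord; apply: eq_bigr => i _.
rewrite (trs_rank1 (phi := fun v => coord bt i v * c b`_i)) => [|k v w].
  by rewrite (coord_free (X := bt) i i (basis_free bB)) eqxx mul1r.
by rewrite linearP /= mulrDl -mulrA.
Qed.

Lemma arith_out (K : numFieldType) (V : lmodType K) (ws : seq V) (b a : V) :
  a != 0 -> exists n : nat, b + n%:R *: a \notin ws.
Proof.
move=> a0; apply: contrapT => h.
have inw n : b + n%:R *: a \in ws by apply/negPn/negP => n_out; apply: h; exists n.
pose s := [seq b + n%:R *: a | n <- iota 0 (size ws).+1].
have us : uniq s.
  rewrite map_inj_uniq ?iota_uniq // => m n /addrI/eqP.
  by rewrite -subr_eq0 -scalerBl scaler_eq0 (negPf a0) orbF subr_eq0 eqr_nat => /eqP.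
have ss : {subset s <= ws} by move=> _ /mapP[n _ ->].
by have := uniq_leq_size us ss; rewrite size_map size_iota ltnn.
Qed.

(** Induction on the factors: (A - c) v splits into eigenvectors for the other values; dividing
    these by c' - c gives v' with (A - c) v' = (A - c) v, so v - v' is an eigenvector for c. *)
Lemma poly_kernel (K : fieldType) (V : lmodType K) (A : V -> V) (Q : V -> Prop)
    (cs : seq K) (v : V) :
    linear A -> (forall c u w, Q u -> Q w -> Q (c *: u + w)) ->
    (forall u, Q u -> Q (A u)) -> uniq cs -> Q v ->
    foldr (fun c u => A u - c *: u) v (rev cs) = 0 ->
  exists w : K -> V, v = \sum_(c <- cs) w c /\
    {in cs, forall c, Q (w c) /\ A (w c) = c *: w c}.
Proof.
move=> AL QL QA; elim: cs v => [|c cs IH] v.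
  by move=> _ _ /= ->; exists (fun=> 0); rewrite big_nil.
move=> /= /andP[ccs ucs] Qv; rewrite rev_cons foldr_rcons => h.
have A0 : A 0 = 0 by have := AL (-1) 0 0; rewrite scaler0 addr0 scaleN1r addNr.
have AZ k u : A (k *: u) = k *: A u by have := AL k u 0; rewrite A0 !addr0.
have AD u w : A (u + w) = A u + A w by have := AL 1 u w; rewrite !scale1r.
have Q0 : Q 0 by have := QL (-1) v v Qv Qv; rewrite scaleN1r addNr.
have QZ k u : Q u -> Q (k *: u) by move=> Qu; have := QL k u 0 Qu Q0; rewrite addr0.
have [|w [wE wP]] := IH (A v - c *: v) ucs _ h.
  by rewrite addrC -scaleNr; apply: QL => //; apply: QA.
pose v' := \sum_(c' <- cs) (c' - c)^-1 *: w c'.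
have Qv' : Q v'.
  rewrite /v' big_seq; apply: (big_ind Q) => // [u u' Qu Qu'|c' c'cs].
    by rewrite -[u]scale1r; apply: QL.
  by apply: QZ; case: (wP _ c'cs).
exists (fun d => if d == c then v - v' else (d - c)^-1 *: w d); split.
  rewrite big_cons eqxx [X in _ + X](_ : _ = v') ?subrK //.
  rewrite /v' [LHS]big_seq [RHS]big_seq; apply: eq_bigr => d dcs.
  by case: eqP => // dc; rewrite -dc dcs in ccs.
move=> d; rewrite inE; case: eqVneq => [-> _|dc /= dcs]; last first.
  by have [Qw Aw] := wP _ dcs; split; [apply: QZ|rewrite AZ Aw !scalerA mulrC].
split; first by rewrite addrC -scaleN1r; apply: QL.
have Av' : A v' - c *: v' = A v - c *: v.
  rewrite wE /v' (big_morph A AD A0) scaler_sumr -sumrB.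
  rewrite [LHS]big_seq [RHS]big_seq; apply: eq_bigr => d' d'cs.
  have [_ Aw] := wP _ d'cs; rewrite AZ Aw !scalerA -scalerBl.
  rewrite mulrC -mulrBl divff ?scale1r // subr_eq0.
  by apply: contraNneq ccs => <-.
have AB u u' : A (u - u') = A u - A u' by rewrite AD -scaleN1r AZ scaleN1r.
rewrite AB scalerBr.
have -> : A v = A v' - c *: v' + c *: v by rewrite Av' subrK.
by rewrite -addrA addrC subrKA.
Qed.

Section SimpleFrame.
Variables (R : realType) (X : lie_datum R).
Local Notation g := (alg X).
Local Notation h := (cartan X).
Local Notation E := (euc X).
Local Notation S := (simple_roots X).
Local Notation Phi := (root_set X).
Implicit Types (a b : E).
Hypothesis sd : simple_datum X.

Lemma simple_eval : eval_axioms X.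
Proof.
split; [exact: sd_evalE|exact: sd_evalh|exact: sd_eval_inj|].
by case: (sd_cartan sd).
Qed.

Lemma simple_roots_axioms : root_axioms X.
Proof.
have [/andP[u n0] sp refl red] := sd_rootsys sd.
apply: (RootAxioms u n0 _ _ red (sd_base sd)).
- by move=> a b aP bP; have [] := refl a b aP bP.
- by move=> a b aP bP; have [] := refl a b aP bP.
- by move=> b; rewrite (sd_lattice sd) => /allP.
move=> b; rewrite (sd_lattice sd) => /allP bw a aP; rewrite (sd_lattice sd).
apply/allP => c cP; rewrite copairDl rpredD ?bw //.
by have [] := refl c a cP aP.
Qed.

Let he := simple_eval.
Let hr := simple_roots_axioms.

(** Diagonalizability as annihilation by a polynomial with distinct roots, a form that [poly_kernel]
    can use inside the eigenspaces of other elements. *)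
Lemma cartan_diag y : y \in h -> exists cs : seq R[i], uniq cs /\
  forall z, foldr (fun c (u : g) => brk g y u - c *: u) z (rev cs) = 0.
Proof.
have [_ _ diag] := sd_cartan sd; move=> yh; have [b bB bE] := diag y yh.
have /boolp.choice[c cE] : forall x : g, exists c, x \in b -> brk g y x = c *: x.
  move=> x; have [xb|xb] := boolP (x \in b); last by exists 0.
  by have [c cx] := bE x xb; exists c.
exists (undup (map c b)); split=> [|z]; first exact: undup_uniq.
set cs := rev _; have mcs x : x \in b -> c x \in cs.
  by move=> xb; rewrite mem_rev mem_undup map_f.
pose Q l (u : g) := foldr (fun d (u : g) => brk g y u - d *: u) u l.
have QD l k u v : Q l (k *: u + v) = k *: Q l u + Q l v.
  elim: l => //= d l IH; rewrite /Q /= -!/(Q _ _) IH linearDr linearZr_LR /=.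
  by rewrite scalerDr scalerBr opprD !scalerA [d * k]mulrC addrACA.
have Qe l x : x \in b -> Q l x = (\prod_(d <- l) (c x - d)) *: x.
  move=> xb; elim: l => [|d l IH]; first by rewrite big_nil scale1r.
  by rewrite /Q /= -!/(Q _ _) IH linearZr_LR /= cE // big_cons !scalerA -scalerBl mulrBl [X in X - _]mulrC.
rewrite -/(Q cs z) (coord_basis (X := in_tuple b) bB (memvf z)).
have Q0 : Q cs 0 = 0 by have := QD cs (-1) 0 0; rewrite scaler0 addr0 scaleN1r addNr.
have QDD u v : Q cs (u + v) = Q cs u + Q cs v by have := QD cs 1 u v; rewrite !scale1r.
rewrite (big_morph (Q cs) QDD Q0) big1 // => i _.
have ib : b`_i \in b by rewrite mem_nth.
have := QD cs (coord (in_tuple b) i z) b`_i 0; rewrite Q0 !addr0 => ->.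
rewrite Qe // (big_rem _ (mcs _ ib)) /= subrr mul0r scale0r scaler0 //.
Qed.

Lemma simult_diag (l : seq g) : {subset l <= h} -> forall z : g,
  exists (T : finType) (w : T -> g), z = \sum_i w i /\
    forall i, {in l, forall y, exists c, brk g y (w i) = c *: w i}.
Proof.
elim: l => [|y l IH] lh z.
  by exists unit, (fun=> z); rewrite big_const card_unit /= addr0.
have yh : y \in h by apply: lh; rewrite mem_head.
have [z' z'l|T [w [-> wP]]] := IH _ z; first by apply: lh; rewrite inE z'l orbT.
have [cs [ucs csE]] := cartan_diag yh.
have /boolp.choice[W WP] : forall i, exists wi : R[i] -> g,
    w i = \sum_(c <- cs) wi c /\ {in cs, forall c,
    {in l, forall y', exists d, brk g y' (wi c) = d *: wi c} /\ brk g y (wi c) = c *: wi c}.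
  move=> i; have /boolp.choice[f fE] : forall y' : g, exists d, y' \in l -> brk g y' (w i) = d *: w i.
    move=> y'; have [y'l|] := boolP (y' \in l); last by exists 0.
    by have [d dE] := wP i y' y'l; exists d.
  have [||||//|wi [wiE wiP]] := @poly_kernel _ g (brk g y)
    (fun u => {in l, forall y', brk g y' u = f y' *: u}) cs (w i) _ _ _ ucs.
  - by move=> c u v; rewrite linearDr linearZr_LR.
  - move=> c u v uP vP y' y'l; rewrite linearDr linearZr_LR /= uP // vP //.
    by rewrite scalerDr !scalerA mulrC.
  - move=> u uP y' y'l; rewrite brk_jac (uP y' y'l) linearZr_LR /=.
    have [ab _ _] := sd_cartan sd; have -> : brk g y' y = 0 by apply: ab => //; apply: lh; rewrite inE y'l orbT.
    by rewrite linear0l add0r.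
  - by move=> y' y'l; apply: fE.
  exists wi; split=> // c ccs; have [w1 w2] := wiP c ccs.
  by split=> // y' y'l; exists (f y'); apply: w1.
exists (T * 'I_(size cs))%type, (fun p : T * 'I_(size cs) => W p.1 cs`_p.2); split=> [|[i j] y'].
  rewrite -(pair_bigA _ (fun i (j : 'I_(size cs)) => W i cs`_j)) /=; apply: eq_bigr => i _.
  by have [-> _] := WP i; rewrite (big_nth 0) big_mkord.
have jcs : cs`_j \in cs by rewrite mem_nth.
have [_ /(_ _ jcs)[w1 w2]] := WP i.
by rewrite inE => /orP[/eqP -> /=|/w1 //]; exists cs`_j.
Qed.

Lemma simple_span (z : g) : exists2 H, H \in h & exists w : E -> g,
  {in Phi, forall a, root_space (wteval a) (w a)} /\ z = H + \sum_(a <- Phi) w a.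
Proof.
pose P z := exists2 H, H \in h & exists w : E -> g,
  {in Phi, forall a, root_space (wteval a) (w a)} /\ z = H + \sum_(a <- Phi) w a.
have P0 : P 0.
  exists 0; first exact: mem0v.
  by exists (fun=> 0); split=> [a aP H hH|]; rewrite ?linear0r ?scaler0 // big1 // addr0.
have PD u v : P u -> P v -> P (u + v).
  move=> [H hH [w [wP ->]]] [H' hH' [w' [wP' ->]]].
  exists (H + H'); first exact: memvD.
  exists (fun a => w a + w' a); split; last by rewrite big_split addrACA.
  by move=> a aP K hK; rewrite linearDr wP // wP' // scalerDr.
have [y yb|T [w [-> wP]]] := @simult_diag (vbasis h) _ z; first exact: vbasis_mem.
apply: (big_ind P) => // i _; have [->|w0] := eqVneq (w i) 0; first exact: P0.
have /boolp.choice[f fE] : forall H, exists c, H \in h -> brk g H (w i) = c *: w i.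
  move=> H; have [hH|] := boolP (H \in h); last by exists 0.
  have /boolp.choice[f fP] : forall j : 'I_(\dim h), exists c, brk g (vbasis h)`_j (w i) = c *: w i.
    by move=> j; apply: wP; rewrite mem_nth // size_tuple.
  exists (\sum_j coord (vbasis h) j H * f j) => _.
  rewrite {1}(coord_vbasis hH) (big_morph (fun y => brk g y (w i)) (fun y z => linearDl _ _ _ _) (linear0l _ _)).
  rewrite scaler_suml; apply: eq_bigr => j _.
  by rewrite linearZl_LR /= fP scalerA.
have [[H hH fH]|f0] := pselect (exists2 H, H \in h & f H != 0).
  have fr : is_root f.
    by split; [exists H|exists (w i) => // K hK; apply: fE].
  have [a aP fa] := sd_roots_all sd fr; exists 0; first exact: mem0v.
  exists (fun b => if b == a then w i else 0); split.
    move=> b _ K hK; case: eqP => [->|_]; last by rewrite linear0r scaler0.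
    by rewrite fE // fa.
  by rewrite add0r (bigD1_seq a) ?(ra_uniq hr) //= eqxx big1 ?addr0 // => b /negPf ->.
exists (w i); last first.
  exists (fun=> 0); split; last by rewrite big1 ?addr0.
  by move=> a aP K hK; rewrite linear0r scaler0.
have [_ cent _] := sd_cartan sd; apply: cent => H hH; rewrite fE //.
have [->|fH] := eqVneq (f H) 0; first by rewrite scale0r.
by case: f0; exists H.
Qed.

Lemma simple_adj_wdiag : wdiag (adj g) (0 :: Phi).
Proof.
split; first by rewrite /= (ra_uniq hr) (ra_neq0 hr).
move=> z; have [H hH [w [wP ze]]] := simple_span z.
exists (fun b => if b == 0 then H else if b \in Phi then w b else 0) => [b|].
  rewrite capfv; case: eqP => [->|_].
    by apply/mem_wsp => // H' hH'; rewrite /= (ev_comm he) // ev0 // scale0r.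
  by case: ifP => bP; [apply/mem_wsp => //; apply: wP|apply: mem0v].
rewrite big_cons eqxx {1}ze; congr (_ + _).
rewrite [in LHS]big_seq [in RHS]big_seq; apply: eq_bigr => b bP.
by rewrite bP (negPf (root_neq0 hr bP)).
Qed.

Lemma root_brk a b (u v : g) : root_space (wteval a) u ->
  root_space (wteval b) v -> root_space (wteval (b + a)) (brk g u v).
Proof.
by move=> ua vb; apply/(mem_wsp he (V := adj g)); apply: (wsp_root he ua);
   apply/(mem_wsp he (V := adj g)).
Qed.

Lemma root_space0 (z : g) : root_space (wteval (0 : E)) z -> z \in h.
Proof.
move=> z0; have [_ cent _] := sd_cartan sd; apply: cent => H hH.
by rewrite z0 // (ev0 he) // scale0r.
Qed.

Lemma root_brkN a (u v : g) : root_space (wteval a) u ->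
  root_space (wteval (- a)) v -> brk g u v \in h.
Proof. by move=> ua va; apply: root_space0; rewrite -(addNr a); apply: root_brk. Qed.

Lemma root_space_out b (z : g) : b != 0 -> b \notin Phi ->
  root_space (wteval b) z -> z = 0.
Proof.
move=> b0 bP /(mem_wsp he (V := adj g)); apply: (wsp_out he simple_adj_wdiag).
by rewrite inE negb_or b0.
Qed.

Lemma simple_center (H : g) : (forall z, brk g H z = 0) -> H = 0.
Proof.
move=> cH; have [[u [v uv]] ideal] := sd_simple sd.
have [|l0|l1] := ideal <[H]>%VS.
- by move=> x y /vlineP[c ->]; rewrite linearZr_LR /= brkC cH oppr0 scaler0 mem0v.
- by apply/eqP; rewrite -memv0 -l0 memv_line.
have : u \in <[H]>%VS by rewrite l1 memvf.
by move=> /vlineP[c uE]; move: uv; rewrite uE linearZl_LR /= cH scaler0 eqxx.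
Qed.

Lemma roots_sep (H : g) : H \in h -> {in Phi, forall a, wteval a H = 0} -> H = 0.
Proof.
move=> hH aH; apply: simple_center => z; have [H' hH' [w [wP ->]]] := simple_span z.
rewrite linearDr /= (ev_comm he) // add0r linear_sumr big_seq big1 // => a aP.
by rewrite wP // aH // scale0r.
Qed.

Definition killing (u v : g) : R[i] := trs fullv (fun z => brk g u (brk g v z)).
Local Notation K := killing.

Lemma killingDl u u' v : K (u + u') v = K u v + K u' v.
Proof. by rewrite /K -trsD; apply: eq_in_trs => z _; rewrite linearDl. Qed.

Lemma killingZl c u v : K (c *: u) v = c * K u v.
Proof. by rewrite /K -trsZ; apply: eq_in_trs => z _; rewrite linearZl_LR. Qed.

Lemma killingC u v : K u v = K v u.
Proof.
have brkL y : linear (brk g y) by move=> c p q; rewrite linearDr linearZr_LR.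
pose adl y : {linear g -> g} := HB.pack (brk g y : g -> g) (GRing.isLinear.Build _ _ _ _ _ (brkL y)).
exact: (@trs_exchange _ g g fullv fullv (adl v) (adl u) (fun _ _ => memvf _) (fun _ _ => memvf _)).
Qed.

Lemma killingDr u v v' : K u (v + v') = K u v + K u v'.
Proof. by rewrite killingC killingDl !(killingC _ u). Qed.

Lemma killingZr c u v : K u (c *: v) = c * K u v.
Proof. by rewrite killingC killingZl killingC. Qed.

Lemma killing_inv z u v : K (brk g z u) v = - K u (brk g z v).
Proof.
have brkL y : linear (brk g y) by move=> c p q; rewrite linearDr linearZr_LR.
pose adl y : {linear g -> g} := HB.pack (brk g y : g -> g) (GRing.isLinear.Build _ _ _ _ _ (brkL y)).
have e1 : trs fullv (fun w => brk g z (brk g u (brk g v w))) =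
    trs fullv (fun w => brk g u (brk g v (brk g z w))).
  exact: (@trs_exchange _ g g fullv fullv (adl u \o adl v) (adl z) (fun _ _ => memvf _) (fun _ _ => memvf _)).
rewrite /K.
rewrite (@eq_in_trs _ _ _ _ (fun w => brk g z (brk g u (brk g v w)) + (-1) *: brk g u (brk g z (brk g v w)))); last first.
  by move=> w _; rewrite brk_act scaleN1r.
rewrite (@eq_in_trs _ _ _ (fun w => brk g u (brk g (brk g z v) w)) (fun w => brk g u (brk g z (brk g v w)) + (-1) *: brk g u (brk g v (brk g z w)))); last first.
  by move=> w _; rewrite brk_act linearBr scaleN1r.
by rewrite !trsD !trsZ e1 !mulN1r opprB addrC.
Qed.

Lemma killing_orth a b u v : root_space (wteval a) u -> root_space (wteval b) v ->
  a + b != 0 -> K u v = 0.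
Proof.
move=> ua vb ab; have [H hH abH] := ev_sep he ab.
rewrite (ev0 he) // (evD he) // in abH.
have := killing_inv H u v; rewrite ua // vb // killingZl killingZr => /eqP.
by rewrite -addr_eq0 -mulrDl mulf_eq0 (negPf abH) => /eqP.
Qed.

Lemma root_zero_h (H : g) : H \in h -> root_space (wteval (0 : E)) H.
Proof. by move=> hH H' hH'; rewrite (ev_comm he) // (ev0 he) // scale0r. Qed.

End SimpleFrame.

(** * Nondegeneracy of the Killing form *)

Section SimpleFrameExistence.
Variables (R : realType) (X : lie_datum R).
Local Notation g := (alg X).
Local Notation h := (cartan X).
Local Notation E := (euc X).
Local Notation S := (simple_roots X).
Local Notation Phi := (root_set X).
Implicit Types (a b : E).
Hypothesis sd : simple_datum X.
Local Notation K := (@killing R X).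

Let he := simple_eval sd.
Let hr := simple_roots_axioms sd.

Lemma brk_linear (y : g) : linear (brk g y).
Proof. by move=> c p q; rewrite linearDr linearZr_LR. Qed.

Lemma brk_nilp a (x : g) : a != 0 -> root_space (wteval a) x ->
  forall z, exists n, iter n (brk g x) z = 0.
Proof.
move=> a0 xa.
have brx0 n : iter n (brk g x) 0 = 0 by apply: iter_fix0; rewrite linear0r.
have iterD_ n u v : iter n (brk g x) (u + v) = iter n (brk g x) u + iter n (brk g x) v.
  by elim: n => // n IH; rewrite !iterS IH linearDr.
pose P z := exists n, iter n (brk g x) z = 0.
have PD u v : P u -> P v -> P (u + v).
  move=> [n un] [m vm]; exists (n + m)%N; rewrite iterD_.
  have -> : iter (n + m) (brk g x) u = 0 by rewrite addnC iterD un brx0.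
  by rewrite iterD vm brx0 addr0.
have Pw b z : root_space (wteval b) z -> P z.
  move=> zb; have [n out] := arith_out (0 :: Phi) b a0; exists n.
  move: out; rewrite inE negb_or => /andP[o1 o2].
  apply: (root_space_out sd o1 o2); elim: n {o1 o2} => [|n IH].
    by rewrite scale0r addr0.
  rewrite -natr1 scalerDl scale1r addrA iterS; exact: (root_brk sd).
move=> z; have [H hH [w [wP ->]]] := simple_span sd z; refine (PD _ _ _ _).
  exact: Pw (root_zero_h sd hH).
rewrite big_seq; apply: (big_ind P); [by exists 0%N|exact: PD|].
by move=> b bP; apply: (Pw b); apply: wP.
Qed.

Section Triple.
Variables (a : E) (x y : g).
Hypotheses (a0 : a != 0) (xa : root_space (wteval a) x) (ya : root_space (wteval (- a)) y).
Let H := brk g x y.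
Let c := wteval a H.
Hypothesis c0 : c != 0.
Let e := brk g x.
Let f v := (2 / c) *: brk g y v.
Let hh v := (2 / c) *: brk g H v.

Let hH : H \in h. Proof. exact: (root_brkN sd xa ya). Qed.

Let f_linear : linear f.
Proof. by move=> k u v; rewrite /f linearDr linearZr_LR scalerDr !scalerA mulrC. Qed.

Let ef v : e (f v) = f (e v) + hh v.
Proof.
by rewrite /e /f /hh linearZr_LR /= (brk_jac x y v) scalerDr addrC.
Qed.

Let two_c : 2 / c * c = 2. Proof. by rewrite divfK. Qed.

Let hE v : hh (e v) = e (hh v) + 2 *: e v.
Proof.
rewrite /e /hh linearZr_LR /= (brk_jac H x v) xa // linearZl_LR /=.
by rewrite scalerDr scalerA two_c addrC.
Qed.

Let hF v : hh (f v) = f (hh v) - 2 *: f v.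
Proof.
rewrite /f /hh !linearZr_LR /= (brk_jac H y v) ya // linearZl_LR /= (evN he) //.
rewrite !scalerDr scaleNr !scalerN addrC; congr (_ - _).
have two_c' : 2 / c * wteval a H = 2 := two_c.
rewrite !scalerA; congr (_ *: _).
by transitivity ((2 / c) * ((2 / c) * wteval a H)); [rewrite mulrA|rewrite two_c' mulrC].
Qed.

Let f_nilp z : exists n, iter n f z = 0.
Proof.
have [|n hn] := @brk_nilp (- a) y _ ya z; first by rewrite oppr_eq0.
by exists n; rewrite (iter_scale _ _ _ (@brk_linear y)) hn scaler0.
Qed.

Lemma triple_int (z : g) d : z != 0 -> brk g H z = d *: z ->
  exists m k : nat, 2 / c * d = m%:R - k%:R.
Proof.
move=> z0 zd; have [n en] := brk_nilp a0 xa z.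
apply: (@sl2_integral _ _ (brk g x) f hh (@brk_linear x) f_linear ef hE hF n _ z z0 en) => [m|].
  exact: f_nilp.
by rewrite /hh zd scalerA.
Qed.

Lemma triple_low (z : g) d (k : nat) : z != 0 -> brk g H z = d *: z ->
  2 / c * d = k%:R -> iter k (brk g y) z != 0.
Proof.
move=> z0 zd dk; apply: contraNneq z0 => z0; have [n en] := brk_nilp a0 xa z.
apply/eqP; apply: (sl2_lower (@brk_linear x) f_linear ef hE hF en (k := k)).
  by rewrite /hh zd scalerA dk.
by rewrite (iter_scale _ _ _ (@brk_linear y)) z0 scaler0.
Qed.
End Triple.

Lemma triple_raise a (x y : g) (z : g) d (k : nat) : a != 0 ->
    root_space (wteval a) x -> root_space (wteval (- a)) y ->
    wteval a (brk g x y) != 0 -> z != 0 -> brk g (brk g x y) z = d *: z ->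
    2 / wteval a (brk g x y) * d = - k%:R ->
  iter k (brk g x) z != 0.
Proof.
move=> a0 xa ya c0 z0 zd dk; have hH := root_brkN sd xa ya.
have cE : wteval (- a) (brk g y x) = wteval a (brk g x y).
  have -> : brk g y x = (-1) *: brk g x y by rewrite brkC scaleN1r.
  by rewrite (evhZ he) // (evN he) // mulN1r opprK.
apply: (@triple_low (- a) y x _ _ _ _ z (- d)) => //; rewrite ?oppr_eq0 ?opprK ?cE //.
  by rewrite [brk g y x]brkC linearNl /= zd scaleNr.
by rewrite mulrN dk opprK.
Qed.

(** For any root b, x and y commute with H = [x, y] and so preserve the eigenspace of ad H for b(H).
    There ad H is a commutator and has trace 0, hence b(H) = 0. An element of h on which all roots
    vanish is central, thus 0. *)
Lemma string_brk_eq0 a (x y : g) : root_space (wteval a) x -> root_space (wteval (- a)) y ->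
  wteval a (brk g x y) = 0 -> brk g x y = 0.
Proof.
move=> xa ya aH; set H := brk g x y; have hH : H \in h := root_brkN sd xa ya.
apply: (roots_sep sd) => // b bP.
have [U hU] := @pred_vspace _ g (fun v => brk g H v = wteval b H *: v)
  (etrans (linear0r _ _) (esym (scaler0 _ _)))
  (fun c u v uP vP => etrans (brk_linear H c u v)
    (etrans (congr2 (fun p q => c *: p + q) uP vP)
      (etrans (congr1 (fun p => p + _) (etrans (scalerA _ _ _) (etrans (congr1 (fun k => k *: u) (mulrC _ _)) (esym (scalerA _ _ _))))) (esym (scalerDr _ _ _))))).
have st (z : g) : brk g H z = 0 -> forall v, v \in U -> brk g z v \in U.
  move=> Hz v /hU vU; apply/hU; rewrite brk_jac Hz linear0l add0r vU.
  by rewrite linearZr_LR.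
have Hx : brk g H x = 0 by rewrite xa // aH scale0r.
have Hy : brk g H y = 0 by rewrite ya // (evN he) // aH oppr0 scale0r.
pose adl (z : g) : {linear g -> g} :=
  HB.pack (brk g z : g -> g) (GRing.isLinear.Build _ _ _ _ _ (brk_linear z)).
have ex := @trs_exchange _ g g U U (adl x) (adl y) (st x Hx) (st y Hy).
have tr0 : trs U (fun v => brk g H v) = 0.
  rewrite (@eq_in_trs _ _ _ _ (fun v => brk g x (brk g y v) + (-1) *: brk g y (brk g x v))); last first.
    by move=> v _; rewrite /H brk_act scaleN1r.
  by rewrite trsD trsZ mulN1r -ex subrr.
have /eqP : wteval b H * (\dim U)%:R = 0.
  by rewrite -(@trs_scal _ _ U _ (fun v => brk g H v)) // => v /hU.
rewrite mulf_eq0 pnatr_eq0 dimv_eq0 => /orP[/eqP //|/eqP U0].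
have [_ [z z0 zb]] := sd_roots sd bP; have : z \in U by apply/hU; apply: zb.
by rewrite U0 memv0 (negPf z0).
Qed.

(** Suppose the form is 0. If H = [x, y] with a(H) nonzero, the eigenvalues of ad H divided by
    a(H)/2 are integers by sl2 theory, and the sum of their squares is a multiple of K H H = 0; so
    ad H = 0, against a(H) != 0. Hence opposite root spaces commute and the sum of all root spaces
    is an ideal. If it is 0 then g = h is abelian; if it is g then h = 0 and there are no roots. *)
Lemma killing_neq0 : ~ forall u v, K u v = 0.
Proof.
move=> K0.
have zero a (x y : g) : a \in Phi -> root_space (wteval a) x ->
    root_space (wteval (- a)) y -> brk g x y = 0.
  move=> aP xa ya; have [/(string_brk_eq0 xa ya) //|c0] := eqVneq (wteval a (brk g x y)) 0.
  set H := brk g x y in c0 *; have hH : H \in h := root_brkN sd xa ya.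
  have [_ _ diag] := sd_cartan sd; have [b bB bE] := diag H hH.
  have /boolp.choice[d dE] : forall z : g, exists d, z \in b -> brk g H z = d *: z.
    move=> z; have [zb|zb] := boolP (z \in b); last by exists 0.
    by have [d dz] := bE z zb; exists d.
  have a0 := root_neq0 hr aP.
  have bn0 z : z \in b -> z != 0.
    by move=> zb; apply: contraTneq (basis_free bB) => z0; apply/negP => /free_not0 /(_ zb); rewrite z0 eqxx.
  have int z : z \in b -> 0 <= (2 / wteval a H * d z) ^+ 2.
    move=> zb; have [m [k ->]] := triple_int a0 xa ya c0 (bn0 z zb) (dE z zb).
    by rewrite real_exprn_even_ge0 // rpredB // realn.
  have s0 : \sum_(z <- b) (2 / wteval a H * d z) ^+ 2 = 0.
    have := K0 H H; rewrite /killing (@trs_eigen _ _ b _ (fun z => d z ^+ 2)) //.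
    - move=> sd0; under eq_bigr do rewrite exprMn.
      by rewrite -mulr_sumr sd0 mulr0.
    - by move=> k u v; rewrite !brk_linear.
    - by move=> z zb; rewrite (dE z zb) linearZr_LR /= (dE z zb) scalerA.
  have d0 z : z \in b -> d z = 0.
    move=> zb; move: s0; rewrite (big_rem z) //= => /eqP.
    rewrite paddr_eq0 ?int //; last first.
      by rewrite big_seq sumr_ge0 // => z' /mem_rem/int.
    rewrite sqrf_eq0 !mulf_eq0 invr_eq0 pnatr_eq0 (negPf c0) /= => /andP[/eqP //].
  have : brk g H x = 0.
    rewrite (coord_basis (X := in_tuple b) bB (memvf x)) linear_sumr /= big1 // => i _.
    by rewrite linearZr_LR /= dE ?mem_nth // d0 ?mem_nth // scale0r scaler0.
  by rewrite xa // => /eqP; rewrite scaler_eq0 (negPf c0) => /eqP x0; rewrite /H x0 linear0l.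
pose Q (z : g) := exists w : E -> g, {in Phi, forall a, root_space (wteval a) (w a)} /\
  z = \sum_(a <- Phi) w a.
have Q0 : Q 0.
  by exists (fun=> 0); split=> [a aP H hH|]; rewrite ?linear0r ?scaler0 // big1.
have QD c u v : Q u -> Q v -> Q (c *: u + v).
  move=> [w [wP ->]] [w' [wP' ->]]; exists (fun a => c *: w a + w' a); split.
    by move=> a aP H hH; rewrite linearDr linearZr_LR /= wP // wP' // scalerDr !scalerA mulrC.
  by rewrite big_split scaler_sumr.
have Q1 b v : b \in Phi -> root_space (wteval b) v -> Q v.
  move=> bP vb; exists (fun a => if a == b then v else 0); split.
    by move=> a aP H hH; case: eqP => [->|_]; [apply: vb|rewrite linear0r scaler0].
  by rewrite (bigD1_seq b) ?(ra_uniq hr) //= eqxx big1 ?addr0 // => a /negPf ->.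
have Qsum (I : Type) (r : seq I) (P : pred I) (F : I -> g) :
    (forall i, P i -> Q (F i)) -> Q (\sum_(i <- r | P i) F i).
  by move=> QF; apply: (big_ind Q) => // u v Qu Qv; rewrite -[u]scale1r; apply: QD.
have [W hW] := pred_vspace Q0 QD.
have Wideal (u v : g) : v \in W -> brk g u v \in W.
  move=> /hW[w [wP ->]]; apply/hW; rewrite linear_sumr big_seq; refine (Qsum _ _ _ _ _) => b bP.
  have [H hH [w' [wP' ->]]] := simple_span sd u.
  rewrite linearDl -[X in X + _]scale1r; apply: QD; first by rewrite wP //; apply: (Q1 b _ bP) => H' hH'; rewrite linearZr_LR /= wP // !scalerA mulrC.
  rewrite (big_morph (fun y => brk g y (w b)) (fun y z => linearDl _ _ _ _) (linear0l _ _)) big_seq.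
  refine (Qsum _ _ _ _ _) => a aP; have ab := root_brk sd (wP' a aP) (wP b bP).
  have [ba0|ba0] := eqVneq (b + a) 0.
    have bE : b = - a by apply/eqP; rewrite -addr_eq0 ba0.
    suff -> : brk g (w' a) (w b) = 0 by [].
    by apply: (zero a) => //; [apply: wP'|rewrite -bE; apply: wP].
  have [baP|baP] := boolP (b + a \in Phi); first exact: (Q1 _ _ baP ab).
  by rewrite (root_space_out sd ba0 baP ab).
have [[u [v uv]] ideal] := sd_simple sd.
have [W0|WT] := ideal W Wideal.
  have all_h z : z \in h.
    have [H hH [w [wP ->]]] := simple_span sd z.
    have : \sum_(a <- Phi) w a \in W by apply/hW; exists w.
    by rewrite W0 memv0 => /eqP ->; rewrite addr0.
  by move: uv; rewrite (ev_comm he) ?eqxx.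
have h0 H : H \in h -> H = 0.
  move=> hH; have : H \in W by rewrite WT memvf.
  move=> /hW[w [wP HE]].
  have := @wt_comp R X he (adj g) 0%VS (0 :: Phi) (fun b => if b == 0 then - H else w b) (@hstable0 _ _ (adj g)).
  rewrite /= (ra_neq0 hr) (ra_uniq hr) => /(_ isT) hc.
  suff : - H \in (0%VS : {vspace adj g}) by rewrite memv0 oppr_eq0 => /eqP.
  have := hc _ _ 0; rewrite eqxx; apply; last exact: mem_head.
    move=> b; rewrite inE; case: (eqVneq b 0) => [-> _|_ /= bP].
      apply/(mem_wsp he (V := adj g)) => H' hH'.
      by rewrite /= linearNr /= (ev_comm he) // oppr0 (ev0 he) // scale0r.
    by apply/(mem_wsp he (V := adj g)); apply: wP.
  rewrite big_cons eqxx [X in _ + X](_ : _ = H) ?addNr ?mem0v // {2}HE.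
  rewrite [LHS]big_seq [RHS]big_seq; apply: eq_bigr => b bP.
  by rewrite (negPf (root_neq0 hr bP)).
have noroot a : a \in Phi -> False.
  move=> aP; have [[H hH aH] _] := sd_roots sd aP.
  by move: aH; rewrite (h0 H hH) (evh0 he) eqxx.
have all0 (z : g) : z = 0.
  have : z \in W by rewrite WT memvf.
  by move=> /hW[w [_ ->]]; rewrite big_seq big1 // => a /noroot.
by move: uv; rewrite (all0 u) linear0l eqxx.
Qed.

Lemma killing_nondeg (u : g) : (forall v, K u v = 0) -> u = 0.
Proof.
move=> uK; have [U hU] := @pred_vspace _ g (fun u => forall v, K u v = 0)
  (fun v => etrans (congr1 (K ^~ v) (esym (scale0r v))) (etrans (killingZl _ _ _) (mul0r _)))
  (fun c u v uP vP w => etrans (killingDl _ _ _) (etrans (congr2 (fun p q => p + q)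
     (etrans (killingZl _ _ _) (etrans (congr1 _ (uP w)) (mulr0 _))) (vP w)) (addr0 _))).
have [_ ideal] := sd_simple sd; have [z v /hU vU|U0|UT] := ideal U.
- by apply/hU => w; rewrite killing_inv vU oppr0.
- by apply/eqP; rewrite -memv0 -U0; apply/hU.
by case: killing_neq0 => v; apply/hU; rewrite UT memvf.
Qed.

Lemma killing_h0 a H v : a \in Phi -> H \in h -> root_space (wteval a) v -> K H v = 0.
Proof.
move=> aP hH va; apply: (killing_orth sd (root_zero_h sd hH) va).
by rewrite add0r (root_neq0 hr).
Qed.

Lemma killing_h_nondeg H : H \in h -> {in h, forall H', K H H' = 0} -> H = 0.
Proof.
move=> hH HK; apply: killing_nondeg => v; have [H' hH' [w [wP ->]]] := simple_span sd v.
rewrite killingDr HK // add0r (big_morph (K H) (fun p q => killingDr H p q) (etrans (congr1 (K H) (esym (scale0r 0))) (etrans (killingZr _ _ _) (mul0r _)))).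
by rewrite big_seq big1 // => a aP; apply: (killing_h0 aP) => //; apply: wP.
Qed.

Lemma killing_dual a (x : g) : a \in Phi -> root_space (wteval a) x -> x != 0 ->
  exists2 y, root_space (wteval (- a)) y & K x y = 1.
Proof.
move=> aP xa x0; have aN := oppr_root hr aP.
have [v xv] : exists v, K x v != 0.
  apply: contrapT => h0; move/eqP: x0; apply; apply: killing_nondeg => v.
  by apply/eqP/negPn/negP => xv; apply: h0; exists v.
have [H hH [w [wP vE]]] := simple_span sd v.
have xw : K x v = K x (w (- a)).
  rewrite vE killingDr killingC (killing_h0 aP hH xa) add0r.
  rewrite (big_morph (K x) (fun p q => killingDr x p q) (etrans (congr1 (K x) (esym (scale0r 0))) (etrans (killingZr _ _ _) (mul0r _)))).
  rewrite (bigD1_seq (- a)) ?(ra_uniq hr) //= big_seq_cond big1 ?addr0 // => b /andP[bP ba].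
  by apply: (killing_orth sd xa (wP b bP)); rewrite addrC addr_eq0.
exists ((K x v)^-1 *: w (- a)).
  by move=> H' hH'; rewrite linearZr_LR /= wP // !scalerA mulrC.
by rewrite killingZr -xw mulVf.
Qed.

Lemma killing_brk a (x y : g) H : root_space (wteval a) x -> H \in h ->
  K (brk g x y) H = wteval a H * K x y.
Proof.
move=> xa hH; rewrite killing_inv brkC xa // -scaleNr killingZr mulNr opprK.
by rewrite (killingC y).
Qed.

Lemma triple_neq0 a (x y : g) : a \in Phi -> root_space (wteval a) x ->
  root_space (wteval (- a)) y -> K x y = 1 -> wteval a (brk g x y) != 0.
Proof.
move=> aP xa ya xy; apply/negP => /eqP /(string_brk_eq0 xa ya) t0.
have [[H hH aH] _] := sd_roots sd aP; have := killing_brk y xa hH.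
rewrite xy mulr1 t0 -(scale0r (0 : g)) killingZl mul0r => /esym/eqP.
by rewrite (negPf aH).
Qed.

(** Subtract from z the multiple of x that makes K z' y = 0; then [y, z'] = 0. But z' has weight 2
    for the triple, so applying y twice to a nonzero z' would give a nonzero vector. *)
Lemma root_dim1 a (x y z : g) : a \in Phi -> root_space (wteval a) x ->
  root_space (wteval (- a)) y -> K x y = 1 -> root_space (wteval a) z ->
  z = K z y *: x.
Proof.
move=> aP xa ya xy za; apply/eqP; rewrite -subr_eq0; set z' := z - _.
have za' : root_space (wteval a) z'.
  move=> H hH; rewrite /z' linearBr linearZr_LR /= za // xa //.
  by rewrite scalerBr !scalerA mulrC.
have z'y : K z' y = 0.
  by rewrite /z' -scaleN1r killingDl !killingZl xy mulr1 mulN1r subrr.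
have yz : brk g y z' = 0.
  rewrite brkC (_ : brk g z' y = 0) ?oppr0 //; apply: killing_h_nondeg.
    exact: (root_brkN sd za' ya).
  by move=> H hH; rewrite (killing_brk _ za') // z'y mulr0.
have c0 := triple_neq0 aP xa ya xy; apply/negPn/negP => z0.
have := @triple_low a x y (root_neq0 hr aP) xa ya c0 z' (wteval a (brk g x y)) 2 z0.
rewrite iterS [iter 1 _ _]yz linear0r eqxx => /(_ _ _)/negP; apply => //.
  by apply: za'; apply: (root_brkN sd xa ya).
by rewrite divfK.
Qed.
End SimpleFrameExistence.

Section SimpleLieFrame.
Variables (R : realType) (X : lie_datum R).
Local Notation g := (alg X).
Local Notation h := (cartan X).
Local Notation E := (euc X).
Local Notation S := (simple_roots X).
Local Notation Phi := (root_set X).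
Implicit Types (a b : E).
Hypothesis sd : simple_datum X.
Local Notation K := (@killing R X).

Let he := simple_eval sd.
Let hr := simple_roots_axioms sd.

Section Triple.
Variables (a : E) (x y : g).
Hypotheses (aP : a \in Phi) (xa : root_space (wteval a) x).
Hypotheses (ya : root_space (wteval (- a)) y) (xy : K x y = 1).
Let H := brk g x y.
Let c := wteval a H.
Let c0 : c != 0 := triple_neq0 sd aP xa ya xy.
Let hH : H \in h. Proof. exact: (root_brkN sd xa ya). Qed.
Let a0 := root_neq0 hr aP.

Lemma root_ne0 b : b \in Phi -> exists2 z : g, z != 0 & root_space (wteval b) z.
Proof. by move=> bP; have [_ [z z0 zb]] := sd_roots sd bP; exists z. Qed.

Let iter_root n b (u z : g) d : root_space (wteval d) u -> root_space (wteval b) z ->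
  root_space (wteval (b + n%:R *: d)) (iter n (brk g u) z).
Proof.
move=> ud zb; elim: n => [|n IH]; first by rewrite scale0r addr0.
by rewrite -natr1 scalerDl scale1r addrA iterS; apply: (root_brk sd).
Qed.

Lemma triple_refl b : b \in Phi -> (forall k, b != k *: a) ->
  exists n : int, 2 / c * wteval b H = n%:~R /\ b - n%:~R *: a \in Phi.
Proof.
move=> bP bna; have [z z0 zb] := root_ne0 bP.
have zd : brk g H z = wteval b H *: z by apply: zb.
have [m [k e]] := triple_int sd a0 xa ya c0 z0 zd.
have inP d (w : g) : w != 0 -> root_space (wteval (b + d *: a)) w -> b + d *: a \in Phi.
  move=> w0 wd; apply: contraNT w0 => out; apply/eqP.
  apply: (root_space_out sd _ out wd); rewrite addr_eq0 -scaleNr.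
  by rewrite bna.
exists (m%:Z - k%:Z); split; first by rewrite e rmorphB.
rewrite -scaleNr; case: (leqP k m) => km.
- have e' : 2 / c * wteval b H = (m - k)%:R by rewrite e natrB.
  apply: (inP _ _ (triple_low sd a0 xa ya c0 z0 zd e')).
  have -> : - (m%:Z - k%:Z)%:~R *: a = (m - k)%:R *: (- a).
    by rewrite scalerN scaleNr rmorphB /= natrB.
  exact: iter_root.
- have e' : 2 / wteval a (brk g x y) * wteval b H = - (k - m)%:R.
    by rewrite natrB ?opprB ?(ltnW km).
  apply: (inP _ _ (triple_raise sd a0 xa ya c0 z0 zd e')).
  have -> : - (m%:Z - k%:Z)%:~R *: a = (k - m)%:R *: a.
    by rewrite rmorphB /= natrB ?opprB ?(ltnW km).
  exact: iter_root.
Qed.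

(* If the reflections of b given by the sl2-triple and by the inner product
   differed, their composite would translate the finite a-string of b. *)
Lemma triple_copair b : b \in Phi -> 2 / c * wteval b H = (copair b a)%:RC.
Proof.
move=> bP; have [[k bk]|nk] := pselect (exists k, b = k *: a).
  by rewrite bk (evZ he) // copairZl copairxx // mulrCA divfK // rmorphM rmorph_nat.
have bna k : b != k *: a by apply/negP => /eqP bk; apply: nk; exists k.
have [n [nE _]] := triple_refl bP bna.
have /intrP[n' n'E] := ra_int hr aP bP.
rewrite nE n'E rmorph_int; congr (_%:~R); apply/eqP/negPn/negP => nn'.
pose d : R := (n' - n)%:~R.
have d0 : d != 0 by rewrite /d intr_eq0 subr_eq0 eq_sym.
have inP j : b + j%:R *: (d *: a) \in Phi.
  elim: j => [|j IH]; first by rewrite scale0r addr0.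
  set b' := b + _ in IH; have cE : b' = b + (j%:R * d) *: a by rewrite /b' scalerA.
  have b'na k : b' != k *: a.
    apply/negP => /eqP e; have := bna (k - j%:R * d).
    by rewrite scalerBl -e cE addrK eqxx.
  have co : copair b' a = n'%:~R + 2 * (j%:R * d).
    by rewrite cE copairDl copairZl copairxx // n'E mulrC.
  have r1 : reflect a b' \in Phi by apply: (ra_refl hr).
  have r1na k : reflect a b' != k *: a.
    apply/negP => /eqP; rewrite /reflect => e; have := b'na (k + copair b' a).
    by rewrite scalerDl -e subrK eqxx.
  have [m [mE]] := triple_refl r1 r1na.
  have mE' : (m%:~R : R) = n%:~R - 2 * n'%:~R - 2 * (j%:R * d).
    apply: complexI; rewrite rmorph_int -mE /reflect (evB he) // (evZ he) //.
    rewrite co cE (evD he) // (evZ he) // mulrBr mulrDr nE.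
    rewrite [2 / c * (_ * wteval a H)]mulrCA [2 / c * (_ * wteval a H)]mulrCA !divfK //.
    by rewrite !rmorphB !rmorphD !rmorphM /= !rmorph_int !rmorph_nat; ring.
  rewrite /reflect mE' co cE; set q := (X in X \in _ -> _).
  suff -> : q = b + j.+1%:R *: (d *: a) by [].
  rewrite /q -!addrA; congr (_ + _); rewrite -!scaleNr -!scalerDl scalerA; congr (_ *: _).
  by rewrite -natr1 /d rmorphB /=; ring.
have [|N] := arith_out Phi b (a := d *: a); first by rewrite scaler_eq0 negb_or d0.
by rewrite inP.
Qed.
End Triple.

Lemma killing0r u : K u 0 = 0.
Proof. by rewrite -(scale0r (0 : g)) killingZr mul0r. Qed.

Lemma killing_sumr (I : Type) (r : seq I) (P : pred I) (F : I -> g) u :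
  K u (\sum_(i <- r | P i) F i) = \sum_(i <- r | P i) K u (F i).
Proof. exact: (big_morph (K u) (fun p q => killingDr u p q) (killing0r u)). Qed.

(** [bf] is the dual of the Killing form on h. It is real by [triple_copair], and positive because
    (b, b) is the sum of the (a, b)^2 over all roots a. *)
Lemma simple_frame : exists bf x t, @lie_frame R X bf x t K.
Proof.
have Scomb b : b = \sum_(i < size S) coord (in_tuple S) i b *: S`_i.
  apply: (coord_span (X := in_tuple S)); have [_ sp _ _] := sd_rootsys sd.
  have : b \in <<Phi>>%VS by rewrite sp memvf.
  by apply/subvP/span_subvP => a; apply: (root_span hr).
have SP (i : 'I_(size S)) : S`_i \in Phi by apply: (simple_root hr); apply: mem_nth.
have /boolp.choice[p pP] : forall a, exists p : g * g, a \in Phi ->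
    [/\ root_space (wteval a) p.1, root_space (wteval (- a)) p.2 & K p.1 p.2 = 1].
  move=> a; have [aP|] := boolP (a \in Phi); last by exists (0, 0).
  have [x x0 xa] := root_ne0 aP; have [y ya xy] := killing_dual sd aP xa x0.
  by exists (x, y).
(* Both vectors of a pair a, -a come from the choice made at its positive member, so that K (x a) (x
   (-a)) = 1 holds for all roots. *)
pose x a := if nonneg_comb a then (p a).1 else (p (- a)).2.
have xE a : a \in Phi -> [/\ root_space (wteval a) (x a),
    root_space (wteval (- a)) (x (- a)) & K (x a) (x (- a)) = 1].
  move=> aP; have aN := oppr_root hr aP; rewrite /x.
  have [ap|ap] := pos_or hr aP.
    rewrite ap (pos_notN hr aP ap) opprK; exact: pP.
  have := pos_notN hr aN ap; rewrite opprK => ->; rewrite ap.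
  have [p1 p2 p3] := pP _ aN; split=> //; last by rewrite killingC.
  by rewrite opprK in p2.
have xr a aP := let: And3 r _ _ := xE a aP in r.
have xrN a aP := let: And3 _ r _ := xE a aP in r.
have x1 a aP := let: And3 _ _ r := xE a aP in r.
pose tau a := brk g (x a) (x (- a)).
have tauh a : a \in Phi -> tau a \in h by move=> aP; exact: (root_brkN sd (xr a aP) (xrN a aP)).
have tauK a H : a \in Phi -> H \in h -> K (tau a) H = wteval a H.
  by move=> aP hH; rewrite (killing_brk _ (xr a aP) hH) x1 // mulr1.
pose t (y : E) : g := \sum_(i < size S) (coord (in_tuple S) i y)%:RC *: tau S`_i.
have th y : t y \in h by apply: memv_suml => i _; apply/memvZ/tauh.
have tK y H : H \in h -> K (t y) H = wteval y H.
  move=> hH; rewrite killingC killing_sumr [in RHS](Scomb y).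
  rewrite (ev_sum he) //; apply: eq_bigr => i _.
  by rewrite killingZr killingC tauK // (evZ he).
have t_tau a : a \in Phi -> t a = tau a.
  move=> aP; apply/eqP; rewrite -subr_eq0; apply/eqP/(killing_h_nondeg sd).
    by rewrite memvB // tauh.
  move=> H hH; rewrite -scaleN1r killingDl killingZl tK // tauK //.
  by rewrite mulN1r subrr.
have trK H H' : H \in h -> H' \in h -> K H H' = \sum_(a <- Phi) wteval a H * wteval a H'.
  move=> hH hH'; rewrite {1}/killing (@eq_in_trs _ _ _ _
    (fun v => \sum_(a <- Phi) (wteval a H * wteval a H' * K v (x (- a))) *: x a)).
    rewrite trs_sum [LHS]big_seq [RHS]big_seq; apply: eq_bigr => a aP.
    rewrite (trs_rank1 (phi := fun v => wteval a H * wteval a H' * K v (x (- a)))).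
      by rewrite x1 // mulr1.
    move=> k u v; rewrite killingDl killingZl.
    by rewrite -[k *: _]/(k * _) mulrDr mulrCA.
  move=> v _; have [H0 hH0 [w [wP ->]]] := simple_span sd v.
  rewrite !linearDr /= (ev_comm he hH' hH0) linear0r add0r !linear_sumr /=.
  rewrite [LHS]big_seq [RHS]big_seq; apply: eq_bigr => a aP.
  have wE := root_dim1 sd aP (xr a aP) (xrN a aP) (x1 a aP) (wP a aP).
  have -> : K (H0 + \sum_(b <- Phi) w b) (x (- a)) = K (w a) (x (- a)).
    rewrite killingDl (killing_h0 sd (oppr_root hr aP) hH0 (xrN a aP)) add0r.
    rewrite killingC killing_sumr (bigD1_seq a) ?(ra_uniq hr) //= killingC.
    rewrite big_seq_cond big1 ?addr0 // => b /andP[bP ba].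
    by rewrite (killing_orth sd (xrN a aP) (wP b bP)) // addrC subr_eq0.
  by rewrite wP // linearZr_LR /= wP // [in LHS]wE !scalerA; congr (_ *: _); ring.
(* Write (b, a) for the value of b at [tau a]. The trace formula gives (a, a) as the sum of the (b,
   a)^2, and (b, a) = (copair b a / 2) (a, a); hence (a, a) = 1 / N a, a real number. *)
pose N a : R := \sum_(b <- Phi) (copair b a / 2) ^+ 2.
have co a b : a \in Phi -> b \in Phi ->
    wteval b (tau a) = (copair b a / 2)%:RC * wteval a (tau a).
  move=> aP bP; have c0 := triple_neq0 sd aP (xr a aP) (xrN a aP) (x1 a aP).
  have := triple_copair aP (xr a aP) (xrN a aP) (x1 a aP) bP.
  rewrite -/(tau a) in c0 * => e; rewrite rmorphM /= -e fmorphV rmorph_nat.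
  by field; rewrite c0.
have aaE a : a \in Phi -> wteval a (tau a) = ((N a)^-1)%:RC.
  move=> aP; have c0 := triple_neq0 sd aP (xr a aP) (xrN a aP) (x1 a aP).
  rewrite -/(tau a) in c0.
  have e : wteval a (tau a) = (N a)%:RC * wteval a (tau a) ^+ 2.
    rewrite -{1}tauK ?tauh // trK ?tauh // rmorph_sum mulr_suml.
    rewrite [LHS]big_seq [RHS]big_seq; apply: eq_bigr => b bP.
    by rewrite co // -expr2 exprMn rmorphXn.
  have nu : (N a)%:RC * wteval a (tau a) = 1.
    by apply: (mulIf c0); rewrite mul1r -mulrA -expr2 -e.
  have N0 : (N a)%:RC != 0.
    by apply: contra_eq_neq nu => ->; rewrite mul0r eq_sym oner_eq0.
  by rewrite fmorphV; apply: (mulfI N0); rewrite nu divff.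
(* The value of [b] at [t y], expanded in the simple roots so that it is visibly real. *)
pose bf b y : R := \sum_(i < size S) coord (in_tuple S) i y * (copair b S`_i / 2 * (N S`_i)^-1).
have tauE a b : a \in Phi -> wteval b (tau a) = (copair b a / 2 * (N a)^-1)%:RC.
  move=> aP; rewrite [in LHS](Scomb b) (ev_sum he) ?tauh //.
  rewrite [in RHS](Scomb b) copair_suml !mulr_suml rmorph_sum; apply: eq_bigr => i _.
  rewrite (evZ he) ?tauh // co // aaE // copairZl -!rmorphM /=; congr (_%:RC).
  by rewrite !mulrA.
have tE b y : wteval b (t y) = (bf b y)%:RC.
  rewrite /t (evh_sum he) => [|i]; last by apply/memvZ/tauh.
  rewrite /bf rmorph_sum; apply: eq_bigr => i _.
  by rewrite (evhZ he) ?tauh // tauE // -rmorphM.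
have bfK b y : (bf b y)%:RC = K (t b) (t y) by rewrite tK // tE.
have bf2 b : bf b b = \sum_(a <- Phi) bf a b ^+ 2.
  apply: complexI; rewrite bfK trK // rmorph_sum; apply: eq_bigr => a _.
  by rewrite tE -expr2 rmorphXn.
exists bf, x, t; split=> //.
- split.
  + by move=> u v w; apply: complexI; rewrite rmorphD /= -!tE (evD he).
  + by move=> c u w; apply: complexI; rewrite rmorphM /= -!tE (evZ he).
  + by move=> u v; apply: complexI; rewrite !bfK killingC.
  + move=> y y0; rewrite lt_def bf2 sumr_ge0 ?andbT => [|a _]; last exact: sqr_ge0.
    apply: contraNneq y0 => s0; apply/eqP; apply: (ev_inj he) => H hH.
    have t0 : t y = 0.
      apply: (roots_sep sd) => // a aP; rewrite tE; apply/eqP.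
      rewrite fmorph_eq0 -sqrf_eq0; apply/eqP; move/eqP: s0.
      rewrite psumr_eq0 => [/allP/(_ _ aP)/eqP //|b _]; exact: sqr_ge0.
    by rewrite -tK // t0 -(scale0r (0 : g)) killingZl mul0r.
  + move=> b a aP; apply: complexI; rewrite -tE t_tau // tauE //.
    congr (_%:RC); have -> : bf a a = (N a)^-1.
      by apply: complexI; rewrite -tE t_tau // aaE.
    by rewrite mulrAC mulrA.
- move=> a aP; apply/negP => /eqP x0; have := x1 a aP; rewrite x0.
  by rewrite -(scale0r (0 : g)) killingZl mul0r => /esym/eqP; rewrite oner_eq0.
- move=> a aP z za; exists (K z (x (- a))).
  exact: (root_dim1 sd aP (xr a aP) (xrN a aP) (x1 a aP) za).
- move=> z; have [H hH [w [wP ->]]] := simple_span sd z; exists H => //.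
  exists (fun a => K (w a) (x (- a))); congr (_ + _).
  rewrite [LHS]big_seq [RHS]big_seq; apply: eq_bigr => a aP.
  exact: (root_dim1 sd aP (xr a aP) (xrN a aP) (x1 a aP) (wP a aP)).
- by move=> a aP; rewrite t_tau.
- exact: killingZl.
- exact: killingZr.
- exact: killing_inv.
Qed.
End SimpleLieFrame.

(** * The frame of gl(n) *)

Lemma mem_pairs n (p : rel 'I_n) ij : (ij \in pairs p) = p ij.1 ij.2.
Proof. by rewrite mem_filter mem_enum andbT. Qed.

Lemma pairs_uniq n (p : rel 'I_n) : uniq (pairs p).
Proof. exact/filter_uniq/enum_uniq. Qed.

Lemma free_dual (K : fieldType) (V : vectType K) (s : seq V) : uniq s ->
  {in s, forall a, exists f : V -> K, [/\ forall c u v, f (c *: u + v) = c * f u + f v,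
    f a != 0 & {in s, forall b, b != a -> f b = 0}]} -> free s.
Proof.
move=> us hs; rewrite -[s]/(tval (in_tuple s)); apply/freeP => k k0 i.
have iS : s`_i \in s by rewrite mem_nth.
have [f [fL fi fo]] := hs _ iS.
have f0 : f 0 = 0 by have := fL (-1) 0 0; rewrite scaler0 addr0 mulN1r addNr.
have fZ c v : f (c *: v) = c * f v by have := fL c v 0; rewrite f0 !addr0.
have fD u v : f (u + v) = f u + f v by have := fL 1 u v; rewrite scale1r mul1r.
have := congr1 f k0; rewrite (big_morph f fD f0) f0 (bigD1 i) //= big1 ?addr0 => [|j ji].
  by move=> /eqP; rewrite fZ mulf_eq0 (negPf fi) orbF => /eqP.
by rewrite fZ fo ?mulr0 ?mem_nth // nth_uniq.
Qed.

Section GLFrame.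
Variables (R : realType) (n : nat).
Local Notation X := (gl_datum R n).
Local Notation E := ('rV[R]_n).
Local Notation g := ('M[R[i]]_n).
Local Notation eps := (fun i : 'I_n => delta_mx 0 i : E).
Local Notation Phi := (A_roots eps).
Local Notation S := (A_base eps).

Lemma epsE i k : eps i 0 k = (k == i)%:R.
Proof. by rewrite mxE eqxx. Qed.

Lemma mem_A_roots (V : vectType R) (e : 'I_n -> V) a :
  a \in A_roots e <-> exists i j, i != j /\ a = e i - e j.
Proof.
split=> [/mapP[[i j]]|[i [j [ij ->]]]].
  by rewrite mem_pairs /= => ij ->; exists i, j.
by apply/mapP; exists (i, j); rewrite ?mem_pairs.
Qed.

Lemma gl_ip_eps (y : E) i : ip X y (eps i) = y 0 i.
Proof.
rewrite -[LHS]/(\sum_k y 0 k * eps i 0 k) (bigD1 i) //= epsE eqxx mulr1.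
by rewrite big1 ?addr0 // => k ki; rewrite epsE (negPf ki) mulr0.
Qed.

Lemma gl_ip_root (y : E) i j : ip X y (eps i - eps j) = y 0 i - y 0 j.
Proof. by rewrite linearBr /= !gl_ip_eps. Qed.

Lemma gl_copair (y : E) i j : i != j -> copair (X := X) y (eps i - eps j) = y 0 i - y 0 j.
Proof.
move=> ij; rewrite /copair !gl_ip_root !mxE !eqxx /= [j == i]eq_sym (negPf ij).
by rewrite sub0r subr0 opprK mulrAC divff ?mul1r // pnatr_eq0.
Qed.

Lemma gl_reflect_eps i j k : i != j ->
  reflect (X := X) (eps i - eps j) (eps k) = eps (tperm i j k).
Proof.
move=> ij; rewrite /Defs.reflect gl_copair // !epsE.
case: tpermP => [->|->|/eqP ki /eqP kj].
- by rewrite eqxx eq_sym (negPf ij) subr0 scale1r opprB addrCA subrr addr0.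
- by rewrite (negPf ij) eqxx sub0r scaleN1r opprK addrCA subrr addr0.
- by rewrite ![_ == k]eq_sym (negPf ki) (negPf kj) subrr scale0r subr0.
Qed.

Lemma reflectB_gl a (u v : E) :
  reflect (X := X) a (u - v) = reflect (X := X) a u - reflect (X := X) a v.
Proof.
rewrite /Defs.reflect copairBl scalerBl !opprB addrACA [RHS]addrACA.
by congr (_ + _); apply: addrC.
Qed.

Lemma gl_root_eq i j k l : i != j -> k != l -> eps i - eps j = eps k - eps l ->
  i = k /\ j = l.
Proof.
move=> ij kl e; have ei m := congr1 (fun y : E => y 0 m) e.
have := ei i; have := ei j; rewrite !mxE !eqxx /= (negPf ij) [j == i]eq_sym (negPf ij).
rewrite sub0r subr0; have [jk|jk] := eqVneq j k.
  rewrite jk (negPf kl) subr0 => /eqP; rewrite eq_sym -subr_eq0 opprK -natrD.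
  by rewrite pnatr_eq0.
rewrite sub0r => /oppr_inj; have [jl _|_ /eqP] := eqVneq j l; last by rewrite oner_eq0.
rewrite -jl (negPf ij) subr0; have [-> //|_ /eqP] := eqVneq i k.
by rewrite oner_eq0.
Qed.

(** The pairing with a fundamental coweight: on the span of the simple roots it reads off the
    coefficient of eps k - eps (k+1). *)
Definition psum (k : 'I_n) (y : E) : R := \sum_(m < n | (m <= k)%N) y 0 m.

Lemma psumP k c u v : psum k (c *: u + v) = c * psum k u + psum k v.
Proof.
rewrite /psum mulr_sumr -big_split; apply: eq_bigr => m _ /=.
by rewrite !mxE.
Qed.

Lemma psum_eps k i : psum k (eps i) = (i <= k)%N%:R.
Proof.
rewrite /psum; case: leqP => ik.
  rewrite (bigD1 i) //= epsE eqxx big1 ?addr0 // => m /andP[_ mi].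
  by rewrite epsE (negPf mi).
by rewrite big1 // => m mk; rewrite epsE; case: eqP mk => // ->; rewrite leqNgt ik.
Qed.

Lemma psumB k u v : psum k (u - v) = psum k u - psum k v.
Proof. by rewrite addrC -scaleN1r psumP mulN1r addrC. Qed.

Lemma gl_A_base_uniq : uniq S.
Proof.
rewrite map_inj_in_uniq ?pairs_uniq // => -[i j] [k l]; rewrite !mem_pairs /=.
move=> /eqP ij /eqP kl /gl_root_eq[]; last by move=> -> ->.
  by apply/eqP => e; rewrite e in ij; lia.
by apply/eqP => e; rewrite e in kl; lia.
Qed.

Lemma gl_free : free (S : seq (euc X)).
Proof.
apply: free_dual; first exact: gl_A_base_uniq.
move=> a0 /mapP[[i j]]; rewrite mem_pairs /= => /eqP ij -> {a0}.
exists (psum i); split; first exact: psumP.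
  by rewrite psumB !psum_eps leqnn -ij ltnn subr0 oner_neq0.
move=> b0 /mapP[[k l]]; rewrite mem_pairs /= => /eqP kl -> {b0} ne.
rewrite psumB !psum_eps -kl; have [ki|ki] := eqVneq k i.
  have lj : l = j by apply: val_inj; rewrite /= -kl -ij ki.
  by rewrite ki lj eqxx in ne.
by rewrite [(k <= i)%N]leq_eqVlt (inj_eq val_inj) (negPf ki) subrr.
Qed.

Lemma gl_base_sub a : a \in S -> a \in Phi.
Proof.
move=> /mapP[[i j]]; rewrite mem_pairs /= => /eqP ij ->.
by apply/mem_A_roots; exists i, j; split=> //; apply/eqP => e; rewrite e in ij; lia.
Qed.

Lemma gl_span_eps (i j : 'I_n) : (i <= j)%N -> eps i - eps j \in <<S : seq (euc X)>>%VS.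
Proof.
move=> ij; have [m] : exists m, j = (i + m)%N :> nat by exists (j - i)%N; lia.
elim: m j ij => [|m IH] j ij je.
  have -> : j = i by apply: val_inj; rewrite /= je addn0.
  by rewrite subrr mem0v.
have kn : (i + m < n)%N by have := ltn_ord j; lia.
pose k := Ordinal kn.
rewrite -(subrKA (eps k)); apply: memvD; first by apply: IH => //=; lia.
apply: memv_span; apply/mapP; exists (k, j) => //.
by rewrite mem_pairs /= je addnS.
Qed.

Lemma gl_nonneg (i j : 'I_n) : (i < j)%N -> nonneg_comb (X := X) (eps i - eps j).
Proof.
move=> ij; have sp := gl_span_eps (ltnW ij); apply/andP; split=> //.
apply/forallP => m; have := mem_nth 0 (ltn_ord m).
move=> /mapP[[k l]]; rewrite mem_pairs /= => /eqP kl mE.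
have -> : coord (in_tuple (simple_roots X)) m (eps i - eps j) = psum k (eps i - eps j).
  rewrite [in RHS](coord_span (X := in_tuple (simple_roots X)) sp).
  have p0 : psum k 0 = 0 by rewrite /psum big1 // => q _; rewrite mxE.
  have pD u v : psum k (u + v) = psum k u + psum k v by have := psumP k 1 u v; rewrite scale1r mul1r.
  have pZ c u : psum k (c *: u) = c * psum k u by have := psumP k c u 0; rewrite p0 !addr0.
  rewrite (big_morph (psum k) pD p0) (bigD1 m) //= big1 ?addr0 => [|q qm].
    by rewrite pZ mE psumB !psum_eps leqnn -kl ltnn subr0 mulr1.
  have := mem_nth 0 (ltn_ord q); move=> /mapP[[k' l']]; rewrite mem_pairs /= => /eqP kl' qE.
  rewrite pZ qE psumB !psum_eps -kl'; have [kk|kk] := eqVneq k' k.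
    have ll : l' = l by apply: val_inj; rewrite /= -kl' -kl kk.
    have : (simple_roots X)`_q = (simple_roots X)`_m by rewrite qE mE kk ll.
    by move=> /eqP; rewrite nth_uniq ?gl_A_base_uniq // (inj_eq val_inj) (negPf qm).
  by rewrite [(k' <= k)%N]leq_eqVlt (inj_eq val_inj) (negPf kk) subrr mulr0.
rewrite psumB !psum_eps; case: (leqP j k) => jk.
  by rewrite (leq_trans (ltnW ij) jk) subrr rpred0.
by rewrite subr0 natr_nat.
Qed.

Lemma gl_root_axioms : root_axioms X.
Proof.
have co b i j : i != j -> copair (X := X) b (eps i - eps j) = b 0 i - b 0 j by exact: gl_copair.
apply: RootAxioms.
- rewrite map_inj_in_uniq ?pairs_uniq // => -[i j] [k l]; rewrite !mem_pairs /=.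
  by move=> ij kl /(gl_root_eq ij kl)[-> ->].
- apply/negP => /mem_A_roots[i [j [ij e]]]; have := congr1 (fun y : E => y 0 i) e.
  rewrite !mxE !eqxx /= (negPf ij) subr0 => /esym/eqP; by rewrite oner_eq0.
- move=> a b /mem_A_roots[i [j [ij ->]]] /mem_A_roots[k [l [kl ->]]].
  apply/mem_A_roots; rewrite reflectB_gl !gl_reflect_eps //.
  by exists (tperm i j k), (tperm i j l); rewrite (inj_eq perm_inj).
- move=> a b /mem_A_roots[i [j [ij ->]]] /mem_A_roots[k [l [kl ->]]].
  by rewrite co // !mxE rpredB // rpredB // natr_int.
- move=> a /mem_A_roots[i [j [ij ->]]] c /mem_A_roots[k [l [kl e]]].
  have := congr1 (fun y : E => y 0 i) e.
  rewrite !mxE !eqxx /= (negPf ij) subr0 mulr1 => cE.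
  have [ik|ik] := eqVneq i k; first by rewrite cE ik eqxx (negPf kl) subr0; left.
  have [il|il] := eqVneq i l; first by rewrite cE (negPf ik) il eqxx sub0r; right.
  have c0 : c = 0 by rewrite cE (negPf ik) (negPf il) subrr.
  have := congr1 (fun y : E => y 0 k) e; rewrite c0 scale0r !mxE !eqxx (negPf kl) subr0.
  by move=> /esym/eqP; rewrite oner_eq0.
- split; [exact: gl_free|exact: gl_base_sub|].
  move=> a /mem_A_roots[i [j [ij ->]]]; rewrite opprB.
  by case: (ltngtP i j) => [/gl_nonneg|/gl_nonneg|/val_inj/eqP]; [left|right|rewrite (negPf ij)].
- move=> b /forallP bw a /mem_A_roots[i [j [ij ->]]].
  by rewrite co // rpredB.
- move=> b /forallP bw a /mem_A_roots[i [j [ij ->]]].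
  by apply/forallP => k; rewrite !mxE rpredD // rpredB // natr_int.
Qed.

Lemma gl_cartanP (H : alg X) : H \in cartan X <-> exists d, H = diag_mx d.
Proof.
split=> [/memv_imgP[d _ ->]|[d ->]]; first by exists d; rewrite lfunE.
by apply/memv_imgP; exists d; rewrite ?memvf ?lfunE.
Qed.

Lemma gl_evalE (y : E) (d : 'rV[R[i]]_n) :
  wteval (R := R) (X := X) y (diag_mx d) = \sum_i (y 0 i)%:RC * d 0 i.
Proof. by apply: eq_bigr => i _; rewrite !mxE eqxx mulr1n. Qed.

Lemma gl_eval_axioms : eval_axioms X.
Proof.
split.
- move=> c x y H _; rewrite -[RHS]/(c%:RC * (\sum_i (x 0 i)%:RC * H i i) + \sum_i (y 0 i)%:RC * H i i).
  rewrite mulr_sumr -big_split; apply: eq_bigr => i _ /=.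
  by rewrite !mxE rmorphD rmorphM mulrDl mulrA.
- move=> c x H H' _ _; rewrite -[RHS]/(c * (\sum_i (x 0 i)%:RC * H i i) + \sum_i (x 0 i)%:RC * H' i i).
  rewrite mulr_sumr -big_split; apply: eq_bigr => i _ /=.
  by rewrite !mxE mulrDr mulrCA.
- move=> x x0; apply/rowP => i; rewrite mxE; apply: complexI; rewrite rmorph0.
  have := x0 (diag_mx (delta_mx 0 i)) (iffRL (gl_cartanP _) (ex_intro _ _ erefl)).
  rewrite gl_evalE (bigD1 i) //= mxE !eqxx mulr1 big1 ?addr0 // => j ji.
  by rewrite mxE eqxx (negPf ji) mulr0.
- move=> H H' /gl_cartanP[d ->] /gl_cartanP[d' ->].
  by rewrite -[LHS]/(diag_mx d *m diag_mx d' - diag_mx d' *m diag_mx d) diag_mx_comm subrr.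
Qed.

(** The elementary matrix E_ij for the root eps i - eps j; the sum recovers i and j from the
    vector. *)
Definition gl_x (a : E) : g :=
  \sum_(ij <- pairs (fun i j => i != j) | a == eps ij.1 - eps ij.2) delta_mx ij.1 ij.2.

Lemma gl_xE i j : i != j -> gl_x (eps i - eps j) = delta_mx i j.
Proof.
move=> ij; rewrite /gl_x big_mkcond (bigD1_seq (i, j)) ?mem_pairs ?pairs_uniq //=.
rewrite eqxx big_seq_cond big1 ?addr0 // => -[k l]; rewrite mem_pairs /=.
move=> /andP[kl ne]; case: eqP => // e; have [ki lj] := gl_root_eq ij kl e.
by rewrite ki lj eqxx in ne.
Qed.

Definition gl_t (y : E) : g := diag_mx (\row_i (y 0 i)%:RC).

Lemma gl_brk_diag (d : 'rV[R[i]]_n) (z : g) k l :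
  gl_brk (diag_mx d) z k l = (d 0 k - d 0 l) * z k l.
Proof.
rewrite /gl_brk mxE mul_diag_mx mxE [X in _ + X]mxE mul_mx_diag mxE.
by rewrite mulrBl [z k l * _]mulrC.
Qed.

Lemma gl_root_space i j (z : alg X) : i != j ->
  root_space (X := X) (wteval (R := R) (X := X) (eps i - eps j)) z <->
  z = (z : g) i j *: (delta_mx i j : g).
Proof.
move=> ij; have ev d : wteval (R := R) (X := X) (eps i - eps j) (diag_mx d) = d 0 i - d 0 j.
  rewrite (evB gl_eval_axioms); last by apply/gl_cartanP; exists d.
  have s m : \sum_k (eps m 0 k)%:RC * d 0 k = d 0 m.
    rewrite (bigD1 m) //= epsE eqxx mul1r big1 ?addr0 // => k km.
    by rewrite epsE (negPf km) mul0r.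
  by rewrite !gl_evalE !s.
split=> [zr|-> _ /gl_cartanP[d ->]].
  have zd (d : 'rV[R[i]]_n) k l : (d 0 k - d 0 l) * (z : g) k l = (d 0 i - d 0 j) * (z : g) k l.
    have := zr (diag_mx d) (iffRL (gl_cartanP _) (ex_intro _ _ erefl)).
    by rewrite ev => /(congr1 (fun m : g => m k l)); rewrite gl_brk_diag mxE.
  apply/matrixP => k l; rewrite !mxE.
  have [-> /=|ki] := eqVneq k i; last first.
    rewrite mulr0; have := zd (delta_mx 0 i) k l; rewrite !mxE !eqxx /= (negPf ki) [j == i]eq_sym (negPf ij).
    rewrite subr0 mul1r sub0r; case: eqP => [->|_]; last by rewrite oppr0 mul0r => <-.
    rewrite mulN1r => /eqP; rewrite eq_sym -subr_eq0 opprK -mulr2n mulrn_eq0 /=.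
    by move/eqP.
  have [-> /=|lj] := eqVneq l j; first by rewrite mulr1.
  rewrite mulr0; have := zd (delta_mx 0 j) i l; rewrite !mxE !eqxx /= (negPf ij) [l == j](negPf lj).
  rewrite subrr mul0r sub0r mulN1r => /eqP; by rewrite eq_sym oppr_eq0 => /eqP.
apply/matrixP => k l; rewrite ev -[LHS]/(gl_brk (diag_mx d) ((z : g) i j *: delta_mx i j) k l).
rewrite gl_brk_diag !mxE; case: eqP => [->|_]; last by rewrite !mulr0.
by case: eqP => [->|_]; rewrite ?mulr0.
Qed.

Lemma gl_trace_inv (z u v : g) :
  \tr ((z *m u - u *m z) *m v) = - \tr (u *m (z *m v - v *m z)).
Proof.
have trB (p q : g) : \tr (p - q) = \tr p - \tr q.
  by rewrite /mxtrace -sumrB; apply: eq_bigr => i _; rewrite !mxE.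
rewrite mulmxBl mulmxBr !trB opprB !mulmxA; congr (_ - _).
exact: (etrans (congr1 _ (esym (mulmxA z u v))) (mxtrace_mulC z (u *m v))).
Qed.

Lemma gl_frame : lie_frame (X := X) (ip X) gl_x gl_t (fun u v : g => \tr (u *m v)).
Proof.
have hr := gl_root_axioms.
split.
- exact: hr.
- exact: ipW hr.
- exact: gl_eval_axioms.
- move=> a /mem_A_roots[i [j [ij ->]]]; rewrite gl_xE //.
  apply/negP => /eqP/matrixP/(_ i j); rewrite !mxE !eqxx => /eqP.
  by rewrite oner_eq0.
- move=> a /mem_A_roots[i [j [ij ->]]]; apply/gl_root_space => //.
  by rewrite gl_xE // mxE !eqxx scale1r.
- move=> a /mem_A_roots[i [j [ij ->]]] z /(gl_root_space _ ij) zE.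
  by exists ((z : g) i j); rewrite gl_xE.
- move=> z; exists (diag_mx (\row_i (z : g) i i)); first by apply/gl_cartanP; eexists.
  exists (fun a => \sum_(ij <- pairs (fun i j => i != j) | a == eps ij.1 - eps ij.2) (z : g) ij.1 ij.2).
  rewrite big_map; apply/matrixP => k l; rewrite [RHS]mxE summxE.
  have e (ij : 'I_n * 'I_n) : ij \in pairs (fun i j => i != j) ->
      ((\sum_(kl <- pairs (fun i j => i != j) | eps ij.1 - eps ij.2 == eps kl.1 - eps kl.2)
      (z : g) kl.1 kl.2) *: gl_x (eps ij.1 - eps ij.2)) k l =
      (if ij == (k, l) then (z : g) k l else 0).
    case: ij => i j; rewrite mem_pairs /= => ij; rewrite gl_xE //.
    rewrite big_mkcond (bigD1_seq (i, j)) ?mem_pairs ?pairs_uniq //= eqxx big_seq_cond big1 ?addr0; last first.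
      move=> -[k' l']; rewrite mem_pairs /= => /andP[kl ne]; case: eqP => // e.
      by have [ki lj] := gl_root_eq ij kl e; rewrite ki lj eqxx in ne.
    rewrite !mxE xpair_eqE ![k == i]eq_sym ![l == j]eq_sym.
    by case: eqP => [->|_]; case: eqP => [->|_]; rewrite ?mulr1 ?mulr0.
  rewrite [X in _ + X]big_seq (eq_bigr _ e) -big_seq !mxE.
  have [kl|kl] := eqVneq k l; last first.
    rewrite mulr0n add0r (bigD1_seq (k, l)) ?mem_pairs ?pairs_uniq //= eqxx big1 ?addr0 //.
    by move=> ij /negPf ->.
  rewrite mulr1n kl big_seq big1 ?addr0 // => -[i j]; rewrite mem_pairs /= => ij.
  by case: eqP => // -[il jl]; rewrite il jl eqxx in ij.
- by move=> y; apply/gl_cartanP; eexists.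
- move=> b y; rewrite gl_evalE -[RHS]/((\sum_i b 0 i * y 0 i)%:RC) rmorph_sum.
  by apply: eq_bigr => i _; rewrite mxE rmorphM.
- move=> a /mem_A_roots[i [j [ij ->]]]; rewrite opprB !gl_xE // 1?eq_sym //.
  rewrite -[LHS]/(delta_mx i j *m delta_mx j i - delta_mx j i *m delta_mx i j : g).
  rewrite !mul_delta_mx; apply/matrixP => k l; rewrite !mxE.
  have [->|kl] := eqVneq k l; last first.
    have z m : (k == m) && (l == m) = false.
      by apply/negP => /andP[/eqP km /eqP lm]; rewrite km lm eqxx in kl.
    by rewrite !z subrr mulr0n.
  by rewrite mulr1n !andbb rmorphB !rmorph_nat.
- by move=> c u v; rewrite -scalemxAl mxtraceZ.
- by move=> c u v; rewrite -scalemxAr mxtraceZ.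
- move=> z u v; rewrite -[LHS]/(\tr ((z *m u - u *m z) *m v)).
  exact: gl_trace_inv.
- move=> a /mem_A_roots[i [j [ij ->]]]; rewrite opprB !gl_xE // 1?eq_sym //.
  rewrite mul_delta_mx /mxtrace (bigD1 i) //= mxE eqxx big1 ?addr0 // => k ki.
  by rewrite mxE (negPf ki).
Qed.
End GLFrame.

(** * Alternating sums of Weyl group invariant functions *)

Lemma count_lt (T : eqType) (p q : pred T) (s : seq T) y : subpred p q ->
  y \in s -> q y -> ~~ p y -> (count p s < count q s)%N.
Proof.
move=> pq + qy py; elim: s => // z s IH; rewrite inE /= => /orP[/eqP <-|/IH lt].
  by rewrite qy (negPf py) add0n add1n ltnS sub_count.
by have := pq z; case: (p z) => [->//|_]; first by rewrite ltn_add2l; rewrite (leq_trans lt) ?leq_addl.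
Qed.

Section InvariantSums.
Variables (R : realType) (X : lie_datum R).
Local Notation g := (alg X).
Local Notation E := (euc X).
Local Notation S := (simple_roots X).
Local Notation Phi := (root_set X).
Implicit Types (a b : E).
Variables (bf : E -> E -> R) (x t : E -> g) (B : g -> g -> R[i]).
Hypothesis lf : lie_frame bf x t B.

Let hr := lf_roots lf.
Let hb := lf_form lf.

Variable Sbar : seq E.
Hypothesis hS : {subset Sbar <= S}.
Local Notation Rp := (Rbar_pos Sbar).
Local Notation alt := (altcoef R Rp).
Local Notation rho := (rhobar Sbar).

Lemma multiplicity_ex (V : lieMod g) ws mu : wdiag V ws ->
  exists m, multiplicity Sbar V mu m.
Proof.
move=> hws; have [s [si sf sd]] := complete_reducibility lf hws hS.
pose U (i : 'I_(size s)) := nth 0%VS s i.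
have Ue : (\sum_i U i)%VS = fullv by rewrite -sf (big_nth 0%VS) big_mkord.
exists #|[pred i | `[< is_levi_irr_hw Sbar (U i) mu >]]|, (size s), U; split=> //.
  by move=> i; apply/(lirrP lf); apply: si; rewrite mem_nth.
by apply/directvP => /=; rewrite Ue -sf sd (big_nth 0%VS) big_mkord.
Qed.

Definition weyl_inv_fun (f : E -> R) := forall w y, in_weyl Phi w -> f (w y) = f y.

Definition same_alt (mu nu : E) := forall f, weyl_inv_fun f ->
  altsum Rp (fun y => f (mu + y)) = altsum Rp (fun y => f (nu + y)).

Lemma dom_rep_ex y : exists z, dom S z /\ exists2 w, in_weyl Phi w & z = w y.
Proof. by have [w hw [wd _]] := weyl_domS hr y; exists (w y); split=> //; exists w. Qed.

Definition dom_rep : E -> E := projT1 (boolp.choice dom_rep_ex).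

Lemma dom_repP y : dom S (dom_rep y) /\ exists2 w, in_weyl Phi w & dom_rep y = w y.
Proof. by rewrite /dom_rep; case: boolp.choice. Qed.

Lemma PhiS : {subset Phi <= Phi}. Proof. by []. Qed.

Lemma dom_rep_dom y : dom S y -> dom_rep y = y.
Proof.
move=> yd; have [yd' [w hw e]] := dom_repP y; rewrite e; apply: (dom_uniq hr hw yd).
by rewrite -e.
Qed.

Lemma dom_rep_weyl w y : in_weyl Phi w -> dom_rep (w y) = dom_rep y.
Proof.
move=> hw; have [d1 [w1 h1 e1]] := dom_repP (w y); have [d2 [w2 h2 e2]] := dom_repP y.
have [w2' h2' [c1 c2]] := weyl_inv hr PhiS h2.
have e : dom_rep (w y) = (w1 \o (w \o w2')) (dom_rep y) by rewrite e1 e2 /= c1.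
rewrite e; apply: (dom_uniq hr) => //; last by rewrite -e.
by apply: weyl_comp => //; apply: weyl_comp.
Qed.

Lemma dom_rep_id f y : weyl_inv_fun f -> f (dom_rep y) = f y.
Proof. by move=> fw; have [_ [w hw ->]] := dom_repP y; apply: fw. Qed.

(** Only the finite set [D] of dominant representatives of the weights involved matters, and the
    difference of the two sums is the pairing of f with a function [c] on [D]. Testing on the weight
    multiplicities of V(k), which exists by [irr_hw_ex], gives c k = 0 by induction on the norm of
    k: the other dominant weights of V(k) are shorter. *)
Lemma same_alt_of_induced mu nu : Pbar_plus Sbar mu -> Pbar_plus Sbar nu ->
  same_induced Sbar mu nu -> same_alt mu nu.
Proof.
move=> /andP[muw mud] /andP[nuw nud] hind.
pose r := undup (subsums Rp); have ur : uniq r := undup_uniq _.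
have sr : {subset subsums Rp <= r} by move=> y; rewrite mem_undup.
pose D := undup ([seq dom_rep (mu + y) | y <- r] ++ [seq dom_rep (nu + y) | y <- r]).
have uD : uniq D := undup_uniq _.
have muD y : y \in r -> dom_rep (mu + y) \in D.
  by move=> yr; rewrite mem_undup mem_cat (map_f (fun y => dom_rep (mu + y))).
have nuD y : y \in r -> dom_rep (nu + y) \in D.
  by move=> yr; rewrite mem_undup mem_cat (map_f (fun y => dom_rep (nu + y))) ?orbT.
pose c k := \sum_(y <- r) ((dom_rep (mu + y) == k)%:R - (dom_rep (nu + y) == k)%:R) * alt y.
have pick_ k0 (f : E -> R) : k0 \in D -> f k0 = \sum_(k <- D) f k * (k0 == k)%:R.
  move=> kD; rewrite (bigD1_seq k0) //= eqxx mulr1 big1 ?addr0 // => k kk.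
  by rewrite eq_sym (negPf kk) mulr0.
have Fc f : weyl_inv_fun f -> altsum Rp (fun y => f (mu + y)) -
    altsum Rp (fun y => f (nu + y)) = \sum_(k <- D) f k * c k.
  move=> fw; rewrite !(altsum_coef _ ur sr) -sumrB.
  under [RHS]eq_bigr do rewrite mulr_sumr.
  rewrite [RHS]exchange_big /=; apply: eq_big_seq => y yr.
  rewrite -mulrBl -(dom_rep_id (mu + y) fw) -(dom_rep_id (nu + y) fw).
  rewrite (pick_ _ f (muD y yr)) (pick_ _ f (nuD y yr)) -sumrB mulr_suml.
  by apply: eq_bigr => k _; rewrite -mulrBr mulrA.
have Dw k : k \in D -> Pplus k.
  rewrite mem_undup mem_cat => kD; have [k0 [kw ->]] : exists k0, wt_lattice k0 /\ k = dom_rep k0.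
    case/orP: kD => /mapP[y]; rewrite mem_undup => /(subsums_Rp hr)[_ _ _ _ h] ->.
      by exists (mu + y); split=> //; apply: h.
    by exists (nu + y); split=> //; apply: h.
  have [kd [w hw e]] := dom_repP k0; apply/andP; split; last exact: kd.
  by rewrite e; apply: (weyl_wt hr PhiS hw).
have c0 : {in D, forall k, c k = 0}.
  (* Real norms are not well founded, so the induction counts the elements of [D] of smaller
     norm. *)
  pose cn k := count (fun k' => bf k' k' < bf k k) D.
  suff key (n : nat) k : k \in D -> (cn k < n)%N -> c k = 0.
    by move=> k kD; apply: (key (cn k).+1).
  elim: n k => // n IH k kD cnt.
  have [d [dw dk1 dlt dmn]] : exists d : E -> R, [/\ weyl_inv_fun d, d k = 1,
      forall k', d k' != 0 -> cone (k - k') &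
      altsum Rp (fun y => d (mu + y)) = altsum Rp (fun y => d (nu + y))].
    have [V hV] := irr_hw_ex lf (Dw k kD); have [ws hws] := irr_wdiag lf hV.
    have [dk dcone] := irr_weights lf hV hws.
    exists (fun y => (wdim (V := V) fullv y)%:R); split.
    - by move=> w y hw; rewrite (irr_wdim_weyl lf _ hws hw).
    - by rewrite dk.
    - by move=> k' dk'; apply: dcone; apply: contraNneq dk' => ->.
    have [m hm] := multiplicity_ex mu hws.
    apply: etrans (esym (iffLR (multiplicityP lf hws hS m mud) hm)) _.
    exact: (iffLR (multiplicityP lf hws hS m nud) (iffLR (hind k (Dw k kD) V hV m) hm)).
  have := Fc d dw; rewrite dmn subrr.
  rewrite (bigD1_seq k) //= dk1 mul1r big_seq_cond big1 ?addr0 // => k' /andP[k'D k'k].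
  have [-> |dk'] := eqVneq (d k') 0; first by rewrite mul0r.
  suff lt' : (cn k' < cn k)%N by rewrite (IH k') ?mulr0 // (leq_trans lt').
  have lt : bf k' k' < bf k k.
    have /andP[_ d1] := Dw k kD; have /andP[_ d2] := Dw k' k'D.
    by apply: (dom_norm_lt hr hb d1 d2 (dlt k' dk')); rewrite eq_sym.
  apply: (count_lt _ k'D) => //= [y /lt_trans|]; first exact.
  by rewrite ltxx.
move=> f fw; apply/eqP; rewrite -subr_eq0 Fc // big_seq big1 // => k /c0 ->.
by rewrite mulr0.
Qed.

Lemma same_induced_conj mu nu : Pbar_plus Sbar mu -> Pbar_plus Sbar nu ->
  diagram_conj Sbar mu nu -> same_induced Sbar mu nu.
Proof.
move=> /andP[_ mud] /andP[_ nud] [u [hu uR e]]; rewrite e in nud *.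
move=> lam hlam V hV m.
have [ws hws] := irr_wdiag lf hV.
rewrite (multiplicityP lf hws hS m mud) (multiplicityP lf hws hS m nud).
have am (d : E -> R) : weyl_inv_fun d ->
    altsum Rp (fun y => d (u mu + y)) = altsum Rp (fun y => d (mu + y)).
  move=> dw; have [u' hu' [uK _]] := weyl_inv hr PhiS hu.
  have pR : perm_eq Rp (map u Rp).
    rewrite perm_sym; apply: uniq_perm => //; last exact: Rp_uniq.
    by rewrite map_inj_uniq ?(Rp_uniq hr) //; apply: can_inj uK.
  rewrite (altsum_perm _ pR).
  apply: (etrans (@altsum_map E E R u Rp (fun y => d (u mu + y)) (weyl0 hu) (weylD hu))).
  by apply: eq_altsum => y /=; rewrite -(weylD hu) dw.
have dw : weyl_inv_fun (fun y => (wdim (V := V) fullv y)%:R).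
  by move=> w y hw; rewrite (irr_wdim_weyl lf _ hws hw).
by have e' := am _ dw; split=> ->; [apply: esym|].
Qed.
End InvariantSums.

(** * Orbits of extreme norm and the cases (a), (b), (c) *)

Section Conjugacy.
Variables (R : realType) (X : lie_datum R).
Local Notation g := (alg X).
Local Notation E := (euc X).
Local Notation S := (simple_roots X).
Local Notation Phi := (root_set X).
Implicit Types (a b : E).
Variables (bf : E -> E -> R) (x t : E -> g) (B : g -> g -> R[i]).
Hypothesis lf : lie_frame bf x t B.

Let hr := lf_roots lf.
Let hb := lf_form lf.

Variable Sbar : seq E.
Hypothesis hS : {subset Sbar <= S}.
Local Notation Rp := (Rbar_pos Sbar).
Local Notation alt := (altcoef R Rp).
Local Notation rho := (rhobar Sbar).
Local Notation same_alt := (@same_alt R X Sbar).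
Local Notation dom_rep := (dom_rep lf).
Implicit Types (mu nu : E).

Definition dom_ind (k y : E) : R := (dom_rep y == k)%:R.

Lemma dom_ind_inv k : weyl_inv_fun (dom_ind k).
Proof. by move=> w y hw; rewrite /dom_ind dom_rep_weyl. Qed.

Lemma dom_rep_norm y : bf (dom_rep y) (dom_rep y) = bf y y.
Proof.
have [_ [w hw ->]] := dom_repP lf y; exact: (weyl_iso (@PhiS _ X) y y hb hw).
Qed.

Lemma dom_rep_eq y z : dom_rep y = dom_rep z -> exists2 w, in_weyl Phi w & z = w y.
Proof.
move=> e; have [_ [w1 h1 e1]] := dom_repP lf y; have [_ [w2 h2 e2]] := dom_repP lf z.
have [w2' h2' [c1 c2]] := weyl_inv hr (@PhiS _ X) h2.
exists (w2' \o w1); first exact: weyl_comp.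
by rewrite /= -e1 e e2 c1.
Qed.

Lemma alt_ind_norm mu k g0 :
    (forall y, alt y != 0 -> y != g0 -> bf (mu + y) (mu + y) != bf k k) ->
  dom S k -> dom_rep (mu + g0) = k ->
  altsum Rp (fun y => dom_ind k (mu + y)) = alt g0.
Proof.
move=> hn kd e; rewrite (altsum_coef1 (g0 := g0)) => [|y y0 yg]; first by rewrite /dom_ind e eqxx mul1r.
rewrite /dom_ind; case: eqP => // e'; have := hn y y0 yg.
by rewrite -(dom_rep_norm (mu + y)) e' eqxx.
Qed.

Lemma alt_ind_ex nu k : altsum Rp (fun y => dom_ind k (nu + y)) != 0 ->
  exists y, alt y != 0 /\ dom_rep (nu + y) = k.
Proof.
move=> h; apply: contrapT => hn; move/eqP: h; apply; apply: altsum_eq0 => y y0.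
by rewrite /dom_ind; case: eqP => // e; case: hn; exists y.
Qed.

Lemma alt_norm_ge mu y : dom Sbar mu -> alt y != 0 -> bf mu mu + bf y y <= bf (mu + y) (mu + y).
Proof.
move=> mud /(alt_cone hr)[c1 c2 _ _ _]; have := dom_ge0 hr hS hb mud c2 c1.
by rewrite !(wfE hb) (wfC hb y mu); move: (bf mu mu) (bf y y) (bf mu y) => p q r; lra.
Qed.

Lemma alt_norm_gt mu y : dom Sbar mu -> alt y != 0 -> y != 0 -> bf mu mu < bf (mu + y) (mu + y).
Proof.
move=> mud y0 yn; have := alt_norm_ge mud y0; apply: lt_le_trans.
by rewrite ltrDl (wf_gt0 hb).
Qed.

Lemma same_alt_sym mu nu : same_alt mu nu -> same_alt nu mu.
Proof. by move=> h f fw; rewrite h. Qed.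

(** The indicator of the orbit of mu has alternating sum 1 at mu, all terms with y != 0 being
    longer. So some nu + y lies in that orbit and mu is at least as long as nu; by symmetry the
    lengths agree and y = 0. *)
Lemma same_alt_min mu nu : dom Sbar mu -> dom Sbar nu -> same_alt mu nu ->
  dom_rep mu = dom_rep nu.
Proof.
have key m n : dom Sbar m -> dom Sbar n -> same_alt m n ->
    exists y, alt y != 0 /\ dom_rep (n + y) = dom_rep m.
  move=> md nd h; apply: alt_ind_ex; rewrite -h; last exact: dom_ind_inv.
  rewrite (@alt_ind_norm _ _ 0); rewrite ?addr0 ?(alt0 hr) ?oner_neq0 //.
    by move=> y y0 yn; rewrite dom_rep_norm gt_eqF // alt_norm_gt.
  by have [] := dom_repP lf m.
move=> mud nud h; have [y [y0 ey]] := key _ _ mud nud h.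
have [z [z0 ez]] := key _ _ nud mud (same_alt_sym h).
suff y00 : y = 0 by rewrite -ey y00 addr0.
apply/eqP/negPn/negP => yn; have := alt_norm_gt nud y0 yn.
rewrite -(dom_rep_norm (nu + y)) ey dom_rep_norm; apply/negP; rewrite -leNgt.
have := alt_norm_ge mud z0; rewrite -(dom_rep_norm (mu + z)) ez dom_rep_norm.
by apply: le_trans; rewrite lerDl (wf_ge0 hb).
Qed.

(** As (y, y) = 2 (y, rho) on the support, the difference of the two norms is 2 (mu + rho, 2 rho -
    y), and mu + rho is strictly dominant for the Levi. *)
Lemma alt_norm_lt mu y : dom Sbar mu -> alt y != 0 -> y != 2 *: rho ->
  bf (mu + y) (mu + y) < bf (mu + 2 *: rho) (mu + 2 *: rho).
Proof.
move=> mud y0 yr; have [_ c2 c3 _ _] := alt_cone hr y0.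
have := alt_norm hr hS hb y0.
have : 0 < bf (mu + rho) (2 *: rho - y).
  apply: (dom_gt0 hr hS hb) => //.
  - move=> a aS; rewrite copairDl (copair_rho hr hS aS) ltr_wpDl //.
    by move/allP: mud; apply.
  - exact: memvB (rho_span _) c2.
  - by rewrite subr_eq0 eq_sym.
have := wfC hb y mu; have := wfC hb y rho; have := wfC hb rho mu.
rewrite !(wfE hb).
move: (bf mu mu) (bf y y) (bf mu y) (bf y mu) (bf rho y) (bf y rho) (bf rho rho) (bf mu rho) (bf rho mu).
by move=> ? ? ? ? ? ? ? ? ?; lra.
Qed.

Lemma same_alt_max mu nu : dom Sbar mu -> dom Sbar nu -> same_alt mu nu ->
  dom_rep (mu + 2 *: rho) = dom_rep (nu + 2 *: rho).
Proof.
have key m n : dom Sbar m -> dom Sbar n -> same_alt m n ->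
    exists y, alt y != 0 /\ dom_rep (n + y) = dom_rep (m + 2 *: rho).
  move=> md nd h; apply: alt_ind_ex; rewrite -h; last exact: dom_ind_inv.
  rewrite (@alt_ind_norm _ _ (2 *: rho)) ?(alt_2rho hr) //.
    by move=> y y0 yn; rewrite dom_rep_norm lt_eqF // alt_norm_lt.
  by have [] := dom_repP lf (m + 2 *: rho).
have le m y : dom Sbar m -> alt y != 0 ->
    bf (m + y) (m + y) <= bf (m + 2 *: rho) (m + 2 *: rho).
  by move=> md y0; have [->|yn] := eqVneq y (2 *: rho); last exact/ltW/alt_norm_lt.
move=> mud nud h; have [y [y0 ey]] := key _ _ mud nud h.
have [z [z0 ez]] := key _ _ nud mud (same_alt_sym h).
suff yr : y = 2 *: rho by rewrite -ey yr.
apply/eqP/negPn/negP => yn; have := alt_norm_lt nud y0 yn.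
rewrite -(dom_rep_norm (nu + y)) ey dom_rep_norm; apply/negP; rewrite -leNgt.
have := le _ _ mud z0; rewrite -(dom_rep_norm (mu + z)) ez dom_rep_norm.
exact.
Qed.

Lemma conj_refl mu : diagram_conj Sbar mu mu.
Proof.
exists id; split=> //; first exact: weyl_id.
by move=> a; rewrite map_id.
Qed.

Lemma conj_sym mu nu : diagram_conj Sbar mu nu -> diagram_conj Sbar nu mu.
Proof.
move=> [u [hu uR ->]]; have [u' hu' [c1 c2]] := weyl_inv hr (@PhiS _ X) hu.
exists u'; split=> //.
move=> a; apply/mapP/idP => [[b + ->]|aR].
  by rewrite -uR => /mapP[c cR ->]; rewrite c1.
by exists (u a); rewrite ?c1 // -uR map_f.
Qed.

Lemma case_same_chamber mu nu w : dom Sbar mu -> dom Sbar nu -> same_alt mu nu ->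
  in_weyl Phi w -> dom S (w mu) -> dom S (w nu) -> mu = nu.
Proof.
move=> mud nud h hw d1 d2; have [v hv e] := dom_rep_eq (same_alt_min mud nud h).
have [w' hw' [c1 c2]] := weyl_inv hr (@PhiS _ X) hw.
have e' : w nu = (w \o (v \o w')) (w mu) by rewrite /= c1 e.
apply: (can_inj c1); rewrite e'; apply/esym; apply: (dom_uniq hr) => //.
  by apply: weyl_comp => //; apply: weyl_comp.
by rewrite -e'.
Qed.

(** Images of positive roots of the Levi are roots in the cone and in the span, hence positive roots
    of the Levi; injectivity on a finite set gives equality. *)
Lemma perm_Rp_of_simple u : in_weyl Phi u -> {in Sbar, forall s, u s \in Rp} ->
  map u Rp =i Rp.
Proof.
move=> hu uS; have [u' hu' [uK _]] := weyl_inv hr (@PhiS _ X) hu.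
have sub : {subset map u Rp <= Rp}.
  move=> _ /mapP[a aR ->]; move: (aR); rewrite !mem_Rp => /and3P[aP asp apos].
  have uaP : u a \in Phi := weyl_root hr (@PhiS _ X) hu aP.
  have S_span b : b \in S -> b \in <<S>>%VS := @memv_span _ _ S b.
  have ac := pos_cone apos; have /coneP[asS aco] := ac.
  have aE := cf_span asS.
  have term i : coord (in_tuple S) i a *: S`_i = 0 \/ S`_i \in Sbar.
    have [iS|iS] := boolP (S`_i \in Sbar); [by right|left].
    by rewrite (cf_out hr hS asp iS) scale0r.
  have [csp ccone] : u a \in <<Sbar>>%VS /\ cone (u a).
    rewrite aE (weyl_sum _ _ _ hu); split.
      apply: memv_suml => i _; case: (term i) => [->|iS]; first by rewrite (weyl0 hu) mem0v.
      by rewrite (weylZ hu); apply: memvZ; have := uS _ iS; rewrite mem_Rp => /and3P[].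
    apply: (big_ind (fun y : E => is_true (cone y))) => [||i _]; [exact: cone0|exact: coneD|].
    case: (term i) => [->|iS]; first by rewrite (weyl0 hu) cone0.
    rewrite (weylZ hu); apply: coneZ => //; have := uS _ iS; rewrite mem_Rp => /and3P[_ _].
    exact: pos_cone.
  by rewrite uaP csp (cone_root hr uaP ccone).
have um : uniq (map u Rp) by rewrite map_inj_uniq ?(Rp_uniq hr) //; apply: can_inj uK.
by have [] := uniq_min_size um sub; rewrite ?size_map.
Qed.

(** Points of one closed chamber lie in distinct orbits, so orbit indicators read off every single
    coefficient: alt y = alt (u (mu + y) - nu) with u = w'^-1 w. At y = 0 this and equality of norms
    give u mu = nu. For a simple root s it gives alt (u s) != 0, so the root u s is a sum of
    positive roots of the Levi. *)
Lemma case_Eset mu nu w w' : dom Sbar mu -> dom Sbar nu -> same_alt mu nu ->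
    in_weyl Phi w -> in_weyl Phi w' ->
    (forall z, in_weyl Sbar z -> dom S (w (mu + rho - z rho))) ->
    (forall z, in_weyl Sbar z -> dom S (w' (nu + rho - z rho))) ->
  diagram_conj Sbar mu nu.
Proof.
move=> mud nud h hw hw' Emu Enu.
have [v hv [c1 c2]] := weyl_inv hr (@PhiS _ X) hw.
have [v' hv' [c1' c2']] := weyl_inv hr (@PhiS _ X) hw'.
pose u := v' \o w; have hu : in_weyl Phi u by apply: weyl_comp.
have sup m z : (forall y, in_weyl Sbar y -> dom S (z (m + rho - y rho))) ->
    in_weyl Phi z -> forall y, alt y != 0 -> dom_rep (m + y) = z (m + y).
  move=> Em hz y /(alt_weyl hr hS)[y' hy' ->].
  by rewrite -(dom_rep_weyl lf _ hz) dom_rep_dom // addrA; apply: Em.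
have smu := sup mu w Emu hw; have snu := sup nu w' Enu hw'.
have one m z k : (forall y, alt y != 0 -> dom_rep (m + y) = z (m + y)) -> injective z ->
    forall g0, z (m + g0) = k -> altsum Rp (fun y => dom_ind k (m + y)) = alt g0.
  move=> sm zi g0 zg; rewrite (altsum_coef1 (g0 := g0)) => [|y y0 yg].
    have [a0|a0] := eqVneq (alt g0) 0; first by rewrite a0 mulr0.
    by rewrite /dom_ind sm // zg eqxx mul1r.
  rewrite /dom_ind sm //; case: eqP => // e; case/eqP: yg.
  by move: e; rewrite -zg => /zi/addrI.
have tr y : alt y = alt (u (mu + y) - nu).
  rewrite -(one mu w (w (mu + y)) smu (can_inj c1) y erefl) h; last exact: dom_ind_inv.
  by apply: (one nu w') => //; [apply: can_inj c1'|rewrite addrC subrK /u /= c2'].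
have umu : u mu = nu.
  have : alt (u mu - nu) != 0 by have := tr 0; rewrite addr0 => <-; rewrite (alt0 hr) oner_neq0.
  move=> a0; have [//|ne] := eqVneq (u mu) nu.
  have := alt_norm_gt nud a0; rewrite subr_eq0 => /(_ ne).
  rewrite addrC subrK (weyl_iso (@PhiS _ X) _ _ hb hu).
  by rewrite -dom_rep_norm -(dom_rep_norm mu) (same_alt_min mud nud h) ltxx.
exists u; split=> //; apply: perm_Rp_of_simple => // s sS.
have : alt (u s) != 0.
  have := tr s; rewrite (weylD hu) umu addrAC subrr add0r => <-.
  exact: (alt_simple hr hS).
move=> /(alt_cone hr)[k1 k2 _ _ _]; have sP := Sbar_root hr hS sS.
have usP := weyl_root hr (@PhiS _ X) hu sP.
by rewrite mem_Rp usP k2 (cone_root hr usP k1).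
Qed.

Lemma rho_coord (i : 'I_(size S)) : S`_i \in Sbar -> 0 < coord (in_tuple S) i (2 *: rho).
Proof.
move=> iS; have sR := Sbar_Rp hr hS iS.
have -> : 2 *: rho = \sum_(a <- Rp) a by rewrite /rhobar scalerA divff ?pnatr_eq0 // scale1r.
rewrite linear_sum /= (big_rem _ sR) /= (cf_simple hr) eqxx.
rewrite ltr_wpDr // big_seq sumr_ge0 // => a /mem_rem; rewrite mem_Rp => /and3P[_ _ /pos_cone/coneP[_]].
exact.
Qed.

(** A Weyl element y is found with y nu = mu that keeps the positive roots of the Levi positive. As
    mu + 2 rho is dominant and conjugate to nu + 2 rho, the vector 2 rho - y (2 rho) lies in the
    cone. But y does not lower the height of any root of [Sbar], so all these heights stay 1, y
    fixes 2 rho, and y maps [Sbar] into itself. *)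
Lemma case_dominant mu nu : dom Sbar mu -> dom Sbar nu -> same_alt mu nu ->
  dom S (mu + 2 *: rho) -> diagram_conj Sbar mu nu.
Proof.
move=> mud nud h d2.
have muD : dom S mu.
  apply/allP => a aS; have [aSb|aSb] := boolP (a \in Sbar); first by move/allP: mud; apply.
  have aP := simple_root hr aS; have aE : a \notin <<Sbar>>%VS.
    have [i ai] := simpleP aS; apply: contra aSb => asp; rewrite ai in asp *.
    apply: contraT => iS; have := cf_out hr hS asp iS.
    by rewrite (cf_simple hr) eqxx => /eqP; rewrite oner_eq0.
  (* If a positive root b of the Levi paired positively with a simple root a outside it, b - a would
     be a root with coefficients of both signs. *)
  have neg : copair (2 *: rho) a <= 0.
    have -> : 2 *: rho = \sum_(b <- Rp) b by rewrite /rhobar scalerA divff ?pnatr_eq0 // scale1r.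
    rewrite copair_suml big_seq sumr_le0 // => b; rewrite mem_Rp => /and3P[bP bsp bpos].
    rewrite leNgt; apply/negP => cab.
    have ba : b != a by apply: contraNneq aE => <-.
    have [baP _] := brk_raise lf aP bP cab ba.
    have [i ai] := simpleP aS; have iS : S`_i \notin Sbar by rewrite -ai.
    have ci : coord (in_tuple S) i (b - a) = -1.
      by rewrite linearB /= ai (cf_simple hr) eqxx (cf_out hr hS bsp iS) sub0r.
    have [/pos_cone/coneP[_ /(_ i)]|/pos_cone/coneP[_ pc]] := pos_or hr baP.
      by rewrite ci oppr_ge0 ler10.
    have bsub : a - b \in Phi by rewrite -opprB; apply: (oppr_root hr).
    have b0 : b = 0; last by move: bP; rewrite b0 (negPf (ra_neq0 hr)).
    apply: cone_anti; first exact: pos_cone.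
    apply/coneP; split; first by rewrite memvN; have /coneP[] := pos_cone bpos.
    move=> j; have [ji|ji] := eqVneq j i.
      by rewrite ji linearN /= (cf_out hr hS bsp iS) oppr0.
    by have := pc j; rewrite opprB linearB linearN /= ai (cf_simple hr) eq_sym (negPf ji) sub0r.
  move/allP/(_ a aS): d2; rewrite copairDl => /le_trans; apply.
  by rewrite gerDl.
have [v hv e] := dom_rep_eq (same_alt_min mud nud h).
have [v' hv' [k1 k2]] := weyl_inv hr (@PhiS _ X) hv.
(* The element carrying nu to mu is determined up to the stabilizer of mu; [z], in the group
   generated by [J], uses this freedom to make the image of rho dominant for [J]. *)
pose J := [seq a <- S | copair mu a == 0].
have JS : {subset J <= S} by move=> a; rewrite mem_filter => /andP[].
have [z hz [zd _ _]] := weyl_dom hr JS (v' rho).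
have JP : {subset J <= Phi} by move=> a /JS/(simple_root hr).
have zmu : z mu = mu.
  elim: hz {zd} => // a w aJ _ IH; rewrite /= IH /Defs.reflect.
  by move: aJ; rewrite mem_filter => /andP[/eqP -> _]; rewrite scale0r subr0.
have hzP : in_weyl Phi z := weyl_sub JP hz.
pose y := z \o v'; have hy : in_weyl Phi y by apply: weyl_comp.
have ynu : y nu = mu by rewrite /y /= e k1 zmu.
(* If y a were negative, (mu, y a) = (nu, a) >= 0 and dominance of mu would force (mu, y a) = 0, so
   -(y a) would lie in the span of [J]; its pairing with y rho would be nonnegative, against (rho,
   a) > 0. *)
have ypos a : a \in Rp -> nonneg_comb (y a).
  move=> aR; move: (aR); rewrite mem_Rp => /and3P[aP asp apos].
  have yaP := weyl_root hr (@PhiS _ X) hy aP.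
  have [//|neg] := pos_or hr yaP.
  have nge : 0 <= bf nu a by apply: (dom_ge0 hr hS hb nud asp); apply: pos_cone.
  have SS : {subset S <= S} by [].
  have /coneP[nsp _] := pos_cone neg.
  have mge := dom_ge0 hr SS hb muD nsp (pos_cone neg).
  have m0 : bf mu (- y a) = 0.
    apply/eqP; rewrite eq_le mge andbT (wfE hb) -{1}ynu (weyl_iso (@PhiS _ X) _ _ hb hy).
    by rewrite oppr_le0.
  have nJ : - y a \in <<J>>%VS.
    apply: span_Sbar => // i iJ; apply/eqP/negPn/negP => ci.
    have iS : S`_i \in S by apply: mem_nth.
    have cmu : 0 < bf mu S`_i.
      rewrite -(copair_sign_gt hr _ hb (simple_root hr iS)) lt_def.
      move/allP/(_ _ iS): muD => ->; rewrite andbT.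
      by move: iJ; rewrite mem_filter iS andbT.
    have /coneP[_ cge] := pos_cone neg.
    have : 0 < bf mu (- y a).
      rewrite {1}(cf_span nsp) (wf_sumr hb) (bigD1 i) //= (wfE hb).
      apply: ltr_pwDl; first by rewrite mulr_gt0 // lt_def ci cge.
      apply: sumr_ge0 => j _; rewrite (wfE hb) mulr_ge0 // -(copair_sign hr _ hb).
        by move/allP: muD; apply; apply: mem_nth.
      by apply: (simple_root hr); apply: mem_nth.
    by rewrite m0 ltxx.
  have := dom_ge0 hr JS hb zd nJ (pos_cone neg).
  rewrite (wfE hb) -/(y rho) (weyl_iso (@PhiS _ X) _ _ hb hy) oppr_ge0 leNgt => /negP[].
  apply: (dom_gt0 hr hS hb) => //; last exact: (root_neq0 hr).
    by move=> s sS; rewrite (copair_rho hr hS sS).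
  exact: pos_cone.
have yS s : s \in Sbar -> y s \in Phi /\ nonneg_comb (y s).
  move=> sS; split; last exact/ypos/(Sbar_Rp hr hS).
  exact: (weyl_root hr (@PhiS _ X) hy (Sbar_root hr hS sS)).
have /coneP[rsp rcf] : cone (2 *: rho).
  have [c1 _ _ _ _] := alt_cone hr (alt_2rho hr Sbar); exact: c1.
have rE := cf_span rsp.
have term i : coord (in_tuple S) i (2 *: rho) = 0 \/ S`_i \in Sbar.
  have [iS|iS] := boolP (S`_i \in Sbar); [by right|left].
  exact: (cf_out hr hS (rho_span _) iS).
have yrE : y (2 *: rho) = \sum_i coord (in_tuple S) i (2 *: rho) *: y S`_i.
  by rewrite {1}rE (weyl_sum _ _ _ hy); apply: eq_bigr => i _; rewrite (weylZ hy).
have htle i : 0 <= coord (in_tuple S) i (2 *: rho) * (ht (y S`_i) - 1).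
  case: (term i) => [->|iS]; first by rewrite mul0r.
  have [p1 p2] := yS _ iS.
  by rewrite mulr_ge0 // subr_ge0; apply: (posroot_ht hr).
have cone_d : cone (2 *: rho - y (2 *: rho)).
  have emax := same_alt_max mud nud h; rewrite dom_rep_dom // in emax.
  have [_ [w hw ew]] := dom_repP lf (nu + 2 *: rho); rewrite -emax in ew.
  have [w' hw' [q1 q2]] := weyl_inv hr (@PhiS _ X) hw.
  have := dom_max hr (weyl_comp hy hw') d2.
  have -> : (y \o w') (mu + 2 *: rho) = y (nu + 2 *: rho) by rewrite /= ew q1.
  by rewrite (weylD hy) ynu opprD addrACA subrr add0r.
have htd : ht (2 *: rho - y (2 *: rho)) = - \sum_i coord (in_tuple S) i (2 *: rho) * (ht (y S`_i) - 1).
  rewrite htB {1}rE yrE !ht_sum -sumrB -sumrN; apply: eq_bigr => i _.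
  by rewrite !htZ (ht_simple hr) ?mem_nth // mulrBr opprB.
have htge : 0 <= ht (2 *: rho - y (2 *: rho)).
  by move/coneP: cone_d => [_ cge]; rewrite /ht sumr_ge0.
have s0 : \sum_i coord (in_tuple S) i (2 *: rho) * (ht (y S`_i) - 1) = 0.
  apply/eqP; rewrite eq_le sumr_ge0 // andbT -oppr_ge0 -htd //.
have ht1 (i : 'I_(size S)) : S`_i \in Sbar -> ht (y S`_i) = 1.
  move=> iS; move/eqP: s0; rewrite psumr_eq0 // => /allP/(_ i (mem_index_enum _))/eqP.
  move=> /eqP; rewrite mulf_eq0 gt_eqF ?rho_coord //= subr_eq0 => /eqP //.
have yrho : y (2 *: rho) = 2 *: rho.
  have d0 : ht (2 *: rho - y (2 *: rho)) = 0 by rewrite htd s0 oppr0.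
  apply/esym/eqP; rewrite -subr_eq0; move/coneP: cone_d => [dsp dge].
  rewrite (cf_span dsp) big1 // => i _; move/eqP: d0; rewrite psumr_eq0 //.
  by move=> /allP/(_ i (mem_index_enum _))/eqP ->; rewrite scale0r.
apply: conj_sym; exists y; split=> //; apply: perm_Rp_of_simple => // s sS.
have [i si] := simpleP (hS sS); have iS : S`_i \in Sbar by rewrite -si.
have [p1 p2] := yS _ iS; have ysS := posroot_ht1 hr p1 p2 (ht1 i iS).
(* Were the simple root y s outside [Sbar], its coefficient in y (2 rho) = 2 rho would be 0; yet
   this coefficient is a sum of nonnegative terms, and the one from s is positive. *)
rewrite si; apply: (Sbar_Rp hr hS); apply: contraT => ynS.
have [j ej] := simpleP ysS; have jS : S`_j \notin Sbar by rewrite -ej.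
have : coord (in_tuple S) j (y (2 *: rho)) = 0.
  by rewrite yrho (cf_out hr hS (rho_span _) jS).
rewrite yrE linear_sum /= => /eqP; rewrite psumr_eq0 => [/allP/(_ i (mem_index_enum _))|k _].
  by rewrite ej linearZ /= (cf_simple hr) eqxx mulr1 gt_eqF ?rho_coord.
rewrite linearZ /=; case: (term k) => [->|kS]; first by rewrite mul0r.
by have /coneP[_ yc] := pos_cone (proj2 (yS _ kS)); rewrite mulr_ge0.
Qed.
End Conjugacy.

(** * Determinants *)

Lemma altsum_reindex (E : zmodType) (R : comPzRingType) (I : finType) (h : I -> E)
    (rs : seq E) (f : E -> R) : injective h ->
    (forall y, altcoef R rs y != 0 -> exists i, y = h i) ->
  altsum rs f = \sum_i altcoef R rs (h i) * f (h i).
Proof.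
move=> h_inj hP; pose r := undup (subsums rs).
rewrite (altsum_coef _ (undup_uniq (subsums rs))) => [|y]; last by rewrite mem_undup.
rewrite -/r; transitivity (\sum_(y <- r) \sum_i (y == h i)%:R * (f y * altcoef R rs y)).
  apply: eq_bigr => y _; have [y0|y0] := eqVneq (altcoef R rs y) 0.
    by rewrite y0 mulr0 big1 // => i _; rewrite mulr0.
  have [i yi] := hP y y0; rewrite (bigD1 i) //= -yi eqxx mul1r big1 ?addr0 // => j ji.
  by rewrite yi (inj_eq h_inj) eq_sym (negPf ji) mul0r.
rewrite exchange_big; apply: eq_bigr => i _ /=.
have [ir|ir] := boolP (h i \in r).
  rewrite (bigD1_seq (h i) ir (undup_uniq _)) eqxx mul1r big1 => [|y yi].
    by rewrite /= addr0 mulrC.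
  by rewrite (negPf yi) mul0r.
have -> : altcoef R rs (h i) = 0.
  by apply/eqP; apply: contraNT ir => i0; rewrite mem_undup; exact: altcoef_subsum i0.
rewrite mul0r big_seq big1 // => y yr; case: eqP => [e|_]; last by rewrite mul0r.
by rewrite -e yr in ir.
Qed.

Section GLDeterminant.
Variables (R : realType) (m : nat).
Local Notation X := (gl_datum R m).
Local Notation E := ('rV[R]_m).
Local Notation eps := (fun i : 'I_m => delta_mx 0 i : E).
Local Notation S := (A_base eps).
Local Notation Rp := (Rbar_pos (X := X) S).
Local Notation alt := (altcoef (E := E) R Rp).

Definition gl_pos : seq E :=
  [seq eps ij.1 - eps ij.2 | ij <- pairs (fun i j : 'I_m => (i < j)%N)].

Let hr := gl_root_axioms R m.
Let SS : {subset S <= simple_roots X}. Proof. by []. Qed.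

Lemma gl_pos_uniq : uniq gl_pos.
Proof.
rewrite map_inj_in_uniq ?pairs_uniq // => -[i j] [k l]; rewrite !mem_pairs /= => ij kl.
by move=> /gl_root_eq[||-> ->] //; [move: ij|move: kl]; rewrite ltn_neqAle => /andP[].
Qed.

Lemma gl_pos_Rp : perm_eq Rp gl_pos.
Proof.
apply: uniq_perm; [exact: Rp_uniq hr S|exact: gl_pos_uniq|move=> a].
rewrite mem_Rp; apply/and3P/mapP => [[/mem_A_roots[i [j [ij ->]]] _ pos]|[[i j]]].
  exists (i, j) => //; rewrite mem_pairs /=; case: (ltngtP i j) => // [ji|/val_inj e].
    have := gl_nonneg R ji; rewrite -opprB (pos_notN hr) //.
    by apply/mem_A_roots; exists i, j.
  by rewrite e eqxx in ij.
rewrite mem_pairs /= => ij ->; split; last exact: gl_nonneg.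
  by apply/mem_A_roots; exists i, j; split=> //; move: ij; rewrite ltn_neqAle => /andP[].
exact: (gl_span_eps R (ltnW ij)).
Qed.

Lemma gl_reflectE i j (y : E) k : i != j ->
  (reflect (X := X) (eps i - eps j) y) 0 k = y 0 (tperm i j k).
Proof.
move=> ij; rewrite /Defs.reflect gl_copair // !mxE !eqxx /=.
case: tpermP => [->|->|/eqP ki /eqP kj].
- by rewrite eqxx (negPf ij) subr0 mulr1 opprB addrCA subrr addr0.
- by rewrite eqxx [j == i]eq_sym (negPf ij) sub0r mulrN1 opprK addrCA subrr addr0.
- by rewrite (negPf ki) (negPf kj) subrr mulr0 subr0.
Qed.

Lemma gl_weyl_perm w : in_weyl (X := X) (root_set X) w ->
  exists s : 'S_m, forall (y : E) i, (w y : E) 0 i = y 0 (s i).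
Proof.
elim=> [|a w' /mem_A_roots[i [j [ij ->]]] _ [s hs]].
  by exists 1%g => y i; rewrite perm1.
by exists (tperm i j * s)%g => y k; rewrite /= gl_reflectE // hs permM.
Qed.

(** The vector rho - w rho for a permutation w, as the coordinates of rho satisfy rho_i - rho_j = j
    - i. *)
Definition perm_shift (s : 'S_m) : E := \row_i ((s i)%:R - i%:R).

Lemma perm_shift_inj : injective perm_shift.
Proof.
move=> s t e; apply/permP => i; have := congr1 (fun y : E => y 0 i) e.
by rewrite !mxE => /addIr/eqP; rewrite eqr_nat => /eqP/val_inj.
Qed.

Lemma gl_rho i j : (rhobar (X := X) S : E) 0 i - (rhobar (X := X) S : E) 0 j = j%:R - i%:R.
Proof.
wlog ij : i j / (i <= j)%N => [h|].
  have [/h //|/ltnW/h e] := leqP i j.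
  by rewrite -opprB e opprB.
have [k] : exists k, j = (i + k)%N :> nat by exists (j - i)%N; lia.
elim: k j ij => [|k IH] j ij jk.
  have -> : j = i by apply: val_inj; rewrite /= jk addn0.
  by rewrite !subrr.
have kn : (i + k < m)%N by have := ltn_ord j; lia.
pose l := Ordinal kn; have lj : l != j by apply/eqP => e; have := congr1 val e; rewrite /= jk; lia.
have jS : eps l - eps j \in S.
  by apply/mapP; exists (l, j); rewrite ?mem_pairs //= jk addnS.
have := copair_rho hr SS jS; rewrite gl_copair // => e.
rewrite -(subrKA ((rhobar (X := X) S : E) 0 l)) e IH //= ?leq_addr // jk addnS -natr1.
by rewrite addrAC.
Qed.

Lemma gl_alt_perm y : alt y != 0 -> exists s, y = perm_shift s.
Proof.
move=> /(alt_weyl hr SS)[w hw ->].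
have wP : in_weyl (X := X) (root_set X) w.
  by apply: weyl_sub hw => a aS; apply: (simple_root hr); apply: SS.
have [s hs] := gl_weyl_perm wP; exists s; apply/rowP => i.
by rewrite [LHS]mxE [X in _ + X]mxE hs gl_rho mxE.
Qed.

(** Neighbouring indices are the case of [alt_refl]; other transpositions are conjugates, by
    induction on the distance. *)
Lemma gl_alt_tperm (i j : 'I_m) s : i != j -> alt (perm_shift (tperm i j * s)%g) = - alt (perm_shift s).
Proof.
wlog ij : i j / (i < j)%N => [h|_].
  by case: (ltngtP i j) => [/h//|/h + ij|/val_inj -> /eqP //]; rewrite tpermC eq_sym; apply.
have [k] : exists k, j = (i + k).+1 :> nat by exists (j - i).-1; lia.
elim: k j ij s => [|k IH] j ij s jk.
  have ijn : i != j by apply: contraTneq ij => ->; rewrite ltnn.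
  have jS : eps i - eps j \in S.
    by apply/mapP; exists (i, j); rewrite ?mem_pairs //= jk addn0.
  rewrite -(alt_refl hr SS (perm_shift s) jS); congr (altcoef _ _ _); apply/rowP => l.
  rewrite [RHS]mxE gl_reflectE // !mxE !eqxx /= permM.
  case: tpermP => [->|->|/eqP li /eqP lj].
  - by rewrite eqxx (negPf ijn) jk addn0 -natr1 /=; ring.
  - by rewrite eqxx [j == i]eq_sym (negPf ijn) jk addn0 -natr1 /=; ring.
  - by rewrite (negPf li) (negPf lj) subrr add0r.
have ln : ((i + k).+1 < m)%N by have := ltn_ord j; lia.
pose l := Ordinal ln.
have il : i != l by apply/eqP => e; have := congr1 val e; rewrite /=; lia.
have lj : l != j by apply/eqP => e; have := congr1 val e; rewrite /= jk; lia.
have ijn : i != j by apply/eqP => e; have := congr1 val e; rewrite /= jk; lia.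
have adj_ t : alt (perm_shift (tperm l j * t)%g) = - alt (perm_shift t).
  have jS : eps l - eps j \in S.
    by apply/mapP; exists (l, j); rewrite ?mem_pairs //= jk addnS.
  rewrite -(alt_refl hr SS (perm_shift t) jS); congr (altcoef _ _ _); apply/rowP => q.
  rewrite [RHS]mxE gl_reflectE // !mxE !eqxx /= permM.
  case: tpermP => [->|->|/eqP li /eqP lj'].
  - by rewrite eqxx (negPf lj) jk addnS -[in (i + k).+2%:R]natr1 /=; ring.
  - by rewrite eqxx [j == l]eq_sym (negPf lj) jk addnS -[in (i + k).+2%:R]natr1 /=; ring.
  - by rewrite (negPf li) (negPf lj') subrr add0r.
have -> : tperm i j = (tperm l j * (tperm i l * tperm l j))%g.
  rewrite -{1}[tperm l j]tpermV -[(_^-1 * _)%g]/(tperm i l ^ tperm l j)%g tpermJ.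
  by rewrite tpermL tpermD // eq_sym.
rewrite -!mulgA adj_ IH ?adj_ ?opprK //=; lia.
Qed.

Lemma gl_alt_sign s : alt (perm_shift s) = (-1) ^+ s.
Proof.
have [ts -> dts] := prod_tpermP s; rewrite odd_perm_prod //.
elim: ts dts => [|t ts IH] /=.
  move=> _; rewrite big_nil (_ : perm_shift _ = 0) ?(alt0 hr) //.
  by apply/rowP => i; rewrite !mxE perm1 subrr.
move=> /andP[td tsd]; rewrite big_cons gl_alt_tperm // IH //.
by case: (odd _); rewrite ?expr0 ?expr1 ?opprK.
Qed.

Lemma gl_altsum_perm (f : E -> R) :
  altsum gl_pos f = \sum_(s : 'S_m) (-1) ^+ s * f (perm_shift s).
Proof.
rewrite -(altsum_perm _ gl_pos_Rp).
rewrite (altsum_reindex f perm_shift_inj gl_alt_perm).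
by apply: eq_bigr => s _; rewrite gl_alt_sign.
Qed.

Lemma gl_altsum_det (F : 'I_m -> R -> R) :
  altsum gl_pos (fun y => \prod_i F i (y 0 i)) = \det (\matrix_(i, j) F i (j%:R - i%:R)).
Proof.
rewrite gl_altsum_perm /determinant; apply: eq_bigr => s _; congr (_ * _).
by apply: eq_bigr => i _; rewrite !mxE.
Qed.

(** The case of gl(m) of [alt_norm_gt], in coordinates. It makes the identity the only permutation
    of least exponent in [jt_low]. *)
Lemma gl_norm_lt (a : E) (s : 'S_m) : (forall i j : 'I_m, (i <= j)%N -> a 0 j <= a 0 i) ->
  s != 1%g -> \sum_i a 0 i ^+ 2 < \sum_i (a 0 i + ((s i)%:R - i%:R)) ^+ 2.
Proof.
move=> adec s1; have hb := ipW hr.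
have normE (y : E) : ip X y y = \sum_i y 0 i ^+ 2.
  by apply: eq_bigr => i _; rewrite expr2.
have ad : dom (X := X) S a.
  apply/allP => b /mapP[[i j]]; rewrite mem_pairs /= => /eqP ij -> {b}.
  rewrite gl_copair ?subr_ge0 ?adec -?ij //.
  by apply/eqP => e; rewrite e in ij; lia.
have s0 : alt (perm_shift s) != 0 by rewrite gl_alt_sign signr_eq0.
have ne : perm_shift s != 0.
  apply: contraNneq s1 => e; apply/eqP/perm_shift_inj; rewrite e.
  by apply/rowP => i; rewrite !mxE perm1 subrr.
have := alt_norm_gt (gl_frame R m) SS ad s0 ne; rewrite !normE.
by under [X in _ < X]eq_bigr do rewrite !mxE.
Qed.
End GLDeterminant.

Lemma det_add_delta (R : comPzRingType) n (A : 'M[R]_n) i j s :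
  \det (A + s *: delta_mx i j) = \det A + s * cofactor A i j.
Proof.
rewrite (expand_det_row _ i) (expand_det_row A i).
have cof k : cofactor (A + s *: delta_mx i j) i k = cofactor A i k.
  rewrite /cofactor; congr (_ * \det _); apply/matrixP => p q.
  by rewrite !mxE eq_sym (negPf (neq_lift i p)) mulr0 addr0.
under eq_bigr do rewrite cof !mxE eqxx mulrDl.
rewrite big_split /=; congr (_ + _); rewrite (bigD1 j) //= eqxx mulr1 big1 ?addr0 // => k kj.
by rewrite (negPf kj) mulr0 mul0r.
Qed.

Lemma det_add_two (R : comPzRingType) n (A : 'M[R]_n.+1) i j k l s t :
  \det (A + s *: delta_mx i j + t *: delta_mx (lift i k) (lift j l)) =
  \det A + s * cofactor A i j + t * cofactor A (lift i k) (lift j l) +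
  s * t * ((-1) ^+ (i + j) * cofactor (row' i (col' j A)) k l).
Proof.
rewrite addrAC det_add_delta det_add_delta.
have -> : cofactor (A + t *: delta_mx (lift i k) (lift j l)) i j =
    cofactor A i j + t * ((-1) ^+ (i + j) * cofactor (row' i (col' j A)) k l).
  rewrite {1}/cofactor (_ : row' i (col' j _) = row' i (col' j A) + t *: delta_mx k l).
    by rewrite det_add_delta mulrDr mulrCA.
  by apply/matrixP => p q; rewrite !mxE !(inj_eq lift_inj).
by ring.
Qed.

Lemma poly_zero (R : numDomainType) (p : {poly R}) : (forall t, p.[t] = 0) -> p = 0.
Proof.
move=> p0; apply/eqP/negPn/negP => pn.
pose rs := [seq i%:R : R | i <- iota 0 (size p)].
have rr : all (root p) rs by apply/allP => r _; apply/eqP/p0.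
have ur : uniq rs by rewrite map_inj_uniq ?iota_uniq // => i j /eqP; rewrite eqr_nat => /eqP.
by have := max_poly_roots pn rr ur; rewrite size_map size_iota ltnn.
Qed.

(** * Jacobi-Trudi determinants *)

Section JacobiTrudi.
Variable R : realType.
Implicit Types (a b : nat -> int) (x y : int -> R).

(* A Jacobi-Trudi determinant with indeterminate entries. *)
Definition jt m a x : R := \det (\matrix_(i < m, j < m) x (a i - i%:Z + j%:Z)).

Lemma eq_jt m a b x y : (forall i, (i < m)%N -> a i = b i) ->
    (forall i j, (i < m)%N -> (j < m)%N -> x (a i - i%:Z + j%:Z) = y (a i - i%:Z + j%:Z)) ->
  jt m a x = jt m b y.
Proof.
move=> ab xy; congr (\det _); apply/matrixP => i j; rewrite !mxE.
by rewrite xy // ab.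
Qed.

Lemma jt0 a x : jt 0 a x = 1. Proof. exact: det_mx00. Qed.

Definition decr m a := forall i j, (i <= j)%N -> (j < m)%N -> a j <= a i.

(** For decreasing [a] the largest index a_0 + m occurs in the upper right corner only, so changing
    that variable affects one entry. *)
Lemma jt_top m a x y s :
    (forall i j, (i <= m)%N -> (j <= m)%N ->
      y (a i - i%:Z + j%:Z) = s *+ ((i == 0%N) && (j == m))) ->
  jt m.+1 a (fun k => x k + y k) =
  jt m.+1 a x + s * ((-1) ^+ m * jt m (fun i => a i.+1 - 1) x).
Proof.
move=> hy; rewrite /jt; pose A := \matrix_(i < m.+1, j < m.+1) x (a i - i%:Z + j%:Z).
have -> : (\matrix_(i < m.+1, j < m.+1) (x (a i - i%:Z + j%:Z) + y (a i - i%:Z + j%:Z))) =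
    A + s *: delta_mx ord0 ord_max.
  apply/matrixP => i j; rewrite !mxE (hy i j (ltn_ord i) (ltn_ord j)) mulr_natr.
  by [].
rewrite det_add_delta /cofactor /= add0n /A; congr (_ + s * (_ * \det _)).
apply/matrixP => i j; rewrite !mxE /= /bump; have jm := ltn_ord j.
have -> : (m <= j)%N = false by lia.
by rewrite /= !add0n !add1n; congr x; lia.
Qed.

(** The coefficient of s t is the determinant without the first two rows and the last two columns;
    the linear coefficients are left unnamed. *)
Lemma jt_two m a x : exists c c' : R, forall s t y,
    (forall i j, (i < m.+2)%N -> (j < m.+2)%N -> y (a i - i%:Z + j%:Z) =
      s *+ ((i == 0%N) && (j == m)) + t *+ ((i == 1%N) && (j == m.+1))) ->
  jt m.+2 a (fun k => x k + y k) =
  jt m.+2 a x + s * c + t * c' + s * t * jt m (fun i => a i.+2 - 2) x.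
Proof.
rewrite /jt; set A := (\matrix_(i < m.+2, j < m.+2) _).
have mm : (m < m.+2)%N by [].
exists (cofactor A ord0 (Ordinal mm)), (cofactor A (lift ord0 ord0) (lift (Ordinal mm) ord_max)).
move=> s t y hy.
have -> : (\matrix_(i < m.+2, j < m.+2) (x (a i - i%:Z + j%:Z) + y (a i - i%:Z + j%:Z))) =
    A + s *: delta_mx ord0 (Ordinal mm) +
    t *: delta_mx (lift ord0 ord0) (lift (Ordinal mm) ord_max).
  apply/matrixP => i j; rewrite !mxE (hy i j (ltn_ord i) (ltn_ord j)) -addrA; congr (_ + _).
  rewrite !mulr_natr; congr (_ *+ nat_of_bool (_ && _) + _ *+ nat_of_bool (_ && _)).
  by rewrite -(inj_eq val_inj) /= /bump leqnn add1n.
rewrite det_add_two; congr (_ + _ * _).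
have sg : (-1 : R) ^+ m * (-1) ^+ m = 1 by rewrite -expr2 sqrr_sign.
rewrite /cofactor /= !add0n mulrA sg mul1r /A.
congr (\det _); apply/matrixP => i j; rewrite !mxE /= /bump /=.
have jm := ltn_ord j; have -> : (m <= j)%N = false by lia.
by rewrite add0n leqNgt jm add0n !add1n; congr x; lia.
Qed.

(** Here [z] may change the first row arbitrarily, as its variable can occur there too. This does no
    harm in the coefficient of s, a minor without the first row. *)
Lemma jt_two_rows m a x : exists c : R, forall s t y z,
    (forall i j, (i < m.+2)%N -> (j < m.+2)%N ->
      y (a i - i%:Z + j%:Z) = s *+ ((i == 0%N) && (j == m))) ->
    (forall i j, (0 < i < m.+2)%N -> (j < m.+2)%N ->
      z (a i - i%:Z + j%:Z) = t *+ ((i == 1%N) && (j == m.+1))) ->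
  jt m.+2 a (fun k => x k + z k + y k) =
  jt m.+2 a (fun k => x k + z k) + s * (c + t * jt m (fun i => a i.+2 - 2) x).
Proof.
have mm : (m < m.+2)%N by [].
pose A := \matrix_(i < m.+2, j < m.+2) x (a i - i%:Z + j%:Z).
exists (cofactor A ord0 (Ordinal mm)) => s t y z hy hz; rewrite /jt.
pose Z := \matrix_(i < m.+2, j < m.+2) (x (a i - i%:Z + j%:Z) + z (a i - i%:Z + j%:Z)).
have -> : (\matrix_(i < m.+2, j < m.+2) (x (a i - i%:Z + j%:Z) + z (a i - i%:Z + j%:Z) +
    y (a i - i%:Z + j%:Z))) = Z + s *: delta_mx ord0 (Ordinal mm).
  by apply/matrixP => i j; rewrite !mxE (hy i j (ltn_ord i) (ltn_ord j)) mulr_natr.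
rewrite det_add_delta; congr (_ + _ * _); rewrite /cofactor /= add0n.
have -> : row' ord0 (col' (Ordinal mm) Z) = row' ord0 (col' (Ordinal mm) A) +
    t *: delta_mx ord0 ord_max.
  apply/matrixP => i j; rewrite !mxE (hz (lift ord0 i) (lift (Ordinal mm) j)) ?ltn_ord //.
  have jm := ltn_ord j; rewrite mulr_natr /= /bump leq0n add1n eqSS; congr (_ + _ *+ nat_of_bool (_ && _)).
  by rewrite -(inj_eq val_inj) /=; apply/eqP/eqP; case: leqP; lia.
rewrite det_add_delta mulrDr; congr (_ + _); rewrite mulrCA /cofactor /= add0n; congr (_ * _).
rewrite mulrA -expr2 sqrr_sign mul1r /A.
congr (\det _); apply/matrixP => i j; rewrite !mxE /= /bump /=.
have jm := ltn_ord j; have -> : (m <= j)%N = false by lia.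
by rewrite add0n leqNgt jm add0n !add1n; congr x; lia.
Qed.

(** For opposite indices at the two corners, a parity condition ties these two entries together. The
    quadratic coefficient is then, up to sign, the determinant without the outer rows and
    columns. *)
Lemma jt_corner m a x e : exists c : R, forall s y,
    (forall i j, (i < m.+2)%N -> (j < m.+2)%N -> y (a i - i%:Z + j%:Z) =
      s *+ ((i == 0%N) && (j == m.+1)) + (e * s) *+ ((i == m.+1) && (j == 0%N))) ->
  jt m.+2 a (fun k => x k + y k) =
  jt m.+2 a x + s * c - e * s ^+ 2 * jt m (fun i => a i.+1) x.
Proof.
rewrite /jt; set A := (\matrix_(i < m.+2, j < m.+2) _).
exists (cofactor A ord0 ord_max + e * cofactor A (lift ord0 ord_max) (lift ord_max ord0)).
move=> s y hy.
have -> : (\matrix_(i < m.+2, j < m.+2) (x (a i - i%:Z + j%:Z) + y (a i - i%:Z + j%:Z))) =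
    A + s *: delta_mx ord0 ord_max + (e * s) *: delta_mx (lift ord0 ord_max) (lift ord_max ord0).
  apply/matrixP => i j; rewrite !mxE (hy i j (ltn_ord i) (ltn_ord j)) -addrA; congr (_ + _).
  by rewrite !mulr_natr; congr (_ *+ nat_of_bool (_ && _) + _ *+ nat_of_bool (_ && _)).
rewrite det_add_two {1}/cofactor [cofactor (row' _ _) _ _]/cofactor.
set d := (\det (row' ord_max _)); have -> : d = jt m (fun i => a i.+1) x.
  rewrite /d /A; congr (\det _); apply/matrixP => i j; rewrite !mxE /= /bump /=.
  have im := ltn_ord i; have jm := ltn_ord j.
  rewrite [(m <= i)%N]leqNgt im /= !add0n !add1n [(m.+1 <= j.+1)%N]leqNgt ltnS jm /= add0n.
  by congr x; lia.
rewrite /= !add0n addn0 exprS; set u := (-1) ^+ m; set D := jt m _ x.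
have uu : u * u = 1 by rewrite -expr2 sqrr_sign.
have key : s * (e * s) * (-1 * u * (u * D)) = - (e * s ^+ 2 * D) * (u * u) by ring.
rewrite key uu mulr1 [in RHS]mulrDr; congr (_ + _).
rewrite -addrA; congr (_ + _); rewrite [in RHS]/cofactor /= !add0n exprS -/u.
by rewrite [s * (e * _)]mulrCA mulrA.
Qed.

(* The lowest term in t comes from the identity permutation alone. *)
Lemma jt_low m a x : decr m a -> exists q : {poly R}, forall t,
  jt m a (fun k => x k * t ^+ (`|k| ^ 2)%N) =
  (\prod_(i < m) x (a i)) * t ^+ (\sum_(i < m) (`|a i| ^ 2))%N +
  t ^+ (\sum_(i < m) (`|a i| ^ 2)).+1%N * q.[t].
Proof.
move=> ad; set e := (\sum_(i < m) _)%N.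
pose k (s : 'S_m) (i : 'I_m) : int := a i - i%:Z + (s i)%:Z.
pose es (s : 'S_m) := (\sum_(i < m) (`|k s i| ^ 2))%N.
pose cs (s : 'S_m) : R := (-1) ^+ s * \prod_i x (k s i).
have sq (z : int) : ((`|z| ^ 2)%N%:R : R) = z%:~R ^+ 2.
  by rewrite natrX natr_absz intr_norm real_normK ?num_real.
have elt (s : 'S_m) : s != 1%g -> (e < es s)%N.
  move=> s1; rewrite -(ltr_nat R) /e /es !natr_sum.
  have := @gl_norm_lt R m (\row_i (a i)%:~R) s _ s1.
  have -> : \sum_i (\row_i (a i)%:~R : 'rV[R]_m) 0 i ^+ 2 = \sum_(i < m) (a i)%:~R ^+ 2.
    by apply: eq_bigr => i _; rewrite mxE.
  have -> : \sum_i ((\row_i (a i)%:~R : 'rV[R]_m) 0 i + ((s i)%:R - i%:R)) ^+ 2 =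
      \sum_(i < m) (k s i)%:~R ^+ 2.
    by apply: eq_bigr => i _; rewrite mxE /k rmorphD rmorphB /= -addrA [- _ + _]addrC.
  move=> h; under eq_bigr do rewrite sq; under [X in _ < X]eq_bigr do rewrite sq; apply: h.
  by move=> i j ij; rewrite !mxE ler_int; apply: ad.
exists (\sum_(s : {perm 'I_m} | s != 1%g) cs s *: 'X^(es s - e.+1)) => t.
have dE : jt m a (fun k => x k * t ^+ (`|k| ^ 2)%N) = \sum_s cs s * t ^+ es s.
  rewrite /jt /determinant; apply: eq_bigr => s _; rewrite /cs -mulrA; congr (_ * _).
  under eq_bigr do rewrite mxE; rewrite big_split /=; congr (_ * _).
  by rewrite prodrXr.
rewrite dE (bigD1 (1%g : {perm 'I_m})) //=; congr (_ + _).
  rewrite /cs odd_perm1 expr0 mul1r; congr (_ * t ^+ _).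
    by apply: eq_bigr => i _; rewrite /k perm1 subrK.
  by apply: eq_bigr => i _; rewrite /k perm1 subrK.
rewrite horner_sum mulr_sumr; apply: eq_bigr => s s1.
rewrite hornerZ hornerXn mulrCA -exprD subnKC //; exact: elt.
Qed.

Lemma low_cmp (p p' : R) e e' (q q' : {poly R}) : p != 0 -> p' != 0 ->
  (forall t, p * t ^+ e + t ^+ e.+1 * q.[t] = p' * t ^+ e' + t ^+ e'.+1 * q'.[t]) -> p = p'.
Proof.
move=> p0 p'0 h.
have pE : p *: 'X^e + 'X^(e.+1) * q = p' *: 'X^e' + 'X^(e'.+1) * q' :> {poly R}.
  apply/eqP; rewrite -subr_eq0; apply/eqP/poly_zero => t.
  by rewrite hornerD hornerN !hornerD !hornerZ !hornerM !hornerXn h subrr.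
have co (u : R) f (r : {poly R}) d : (u *: 'X^f + 'X^(f.+1) * r)`_d =
    u * (d == f)%:R + (if (d < f.+1)%N then 0 else r`_(d - f.+1)).
  by rewrite coefD coefZ coefXn coefXnM.
have := congr1 (fun r : {poly R} => r`_(minn e e')) pE; rewrite !co.
case: (ltngtP e e') => [ee|ee|->].
- rewrite eqxx !ltnS leqnn (ltn_eqF ee) (ltnW ee).
  by rewrite mulr1 mulr0 !addr0 => pe; rewrite pe eqxx in p0.
- rewrite eqxx !ltnS leqnn (ltn_eqF ee) (ltnW ee).
  by rewrite mulr1 mulr0 !addr0 => pe; rewrite -pe eqxx in p'0.
- by rewrite eqxx ltnS leqnn !mulr1 !addr0.
Qed.

(** Test with the value 2 at one point and 1 elsewhere: the exponent of 2 counts occurrences. *)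
Lemma perm_of_prod (T : eqType) (l1 l2 : seq T) :
    (forall s : T -> R, (forall z, 0 < s z) ->
      \prod_(z <- l1) s z = \prod_(z <- l2) s z) ->
  perm_eq l1 l2.
Proof.
move=> h; apply/allP => c _; apply/eqP => /=.
pose s z : R := if z == c then 2 else 1.
have pE l : \prod_(z <- l) s z = 2 ^+ count_mem c l.
  elim: l => [|z l IH]; first by rewrite big_nil.
  by rewrite big_cons IH /s /=; case: eqP => _; rewrite ?mul1r // exprS.
have /h : forall z, 0 < s z by move=> z; rewrite /s; case: eqP => _; lra.
rewrite !pE; apply: ieexprIn; [exact: ltr0n|by rewrite pnatr_eq1].
Qed.

(** Stands for a polynomial in the infinitely many variables x_k; polynomiality on lines is all that
    cancelling a factor requires. *)
Definition plines (P : (int -> R) -> R) := forall x y, exists p : {poly R},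
  forall t, P (fun k => x k + t * y k) = p.[t].

Lemma plines_ext P Q : (forall x, P x = Q x) -> plines P -> plines Q.
Proof. by move=> PQ h x y; have [p hp] := h x y; exists p => t; rewrite -PQ hp. Qed.

Lemma plines_cst c : plines (fun=> c).
Proof. by move=> x y; exists c%:P => t; rewrite hornerC. Qed.

Lemma plinesM P Q : plines P -> plines Q -> plines (fun x => P x * Q x).
Proof.
move=> hP hQ x y; have [p hp] := hP x y; have [q hq] := hQ x y.
by exists (p * q) => t; rewrite hp hq hornerM.
Qed.

Lemma plinesB P Q : plines P -> plines Q -> plines (fun x => P x - Q x).
Proof.
move=> hP hQ x y; have [p hp] := hP x y; have [q hq] := hQ x y.
by exists (p - q) => t; rewrite hp hq hornerD hornerN.
Qed.

Lemma plines_prod (T : Type) (l : seq T) (F : T -> (int -> R) -> R) :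
  (forall i, plines (F i)) -> plines (fun x => \prod_(i <- l) F i x).
Proof.
move=> hF; elim: l => [|i l IH].
  by apply: plines_ext (plines_cst 1) => x; rewrite big_nil.
by apply: plines_ext (plinesM (hF i) IH) => x; rewrite big_cons.
Qed.

Lemma plines_jt m a : plines (jt m a).
Proof.
move=> x y; exists (\det (\matrix_(i < m, j < m)
  ((x (a i - i%:Z + j%:Z))%:P + y (a i - i%:Z + j%:Z) *: 'X))) => t.
rewrite -horner_evalE -det_map_mx; congr (\det _); apply/matrixP => i j.
transitivity ((x (a i - i%:Z + j%:Z))%:P + y (a i - i%:Z + j%:Z) *: 'X).[t].
  by rewrite mxE !hornerE mulrC.
by rewrite !mxE.
Qed.

(** On the line from a point with P nonzero to one with Q nonzero, both would be nonzero polynomials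
    in t with product 0. *)
Lemma plines_dom P Q : plines P -> plines Q -> (forall x, P x * Q x = 0) ->
  (exists x, P x != 0) -> forall y, Q y = 0.
Proof.
move=> hP hQ PQ [x Px] y; apply/eqP/negPn/negP => Qy.
have [p hp] := hP x (fun k => y k - x k); have [q hq] := hQ x (fun k => y k - x k).
have /eqP : p * q = 0 by apply: poly_zero => t; rewrite hornerM -hp -hq PQ.
rewrite mulf_eq0 => /orP[] /eqP r0.
  have := hp 0; rewrite r0 horner0 => /eqP.
  rewrite (_ : (fun k => _) = x) ?(negPf Px) //.
  by apply/funext => k; rewrite mul0r addr0.
have := hq 1; rewrite r0 horner0 => /eqP.
rewrite (_ : (fun k => _) = y) ?(negPf Qy) //.
by apply/funext => k; rewrite mul1r addrC subrK.
Qed.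

(** The even choice x_k = t^(k^2) makes the determinant t^e plus higher terms, by [jt_low], which
    cannot vanish for all t. *)
Lemma jt_neq0 m a : decr m a -> exists2 x, (forall k, x (- k) = x k) & jt m a x != 0.
Proof.
move=> ad; have [q hq] := jt_low (fun=> 1) ad.
pose e := (\sum_(i < m) (`|a i| ^ 2))%N.
apply: contrapT => h0; have z t : ('X^e + 'X^(e.+1) * q : {poly R}).[t] = 0.
  rewrite hornerD hornerM !hornerXn -[t ^+ e]mul1r.
  have := hq t; rewrite big1 // => <-; apply/eqP/negPn/negP => n0; apply: h0.
  by eexists; [|exact: n0] => k /=; rewrite abszN.
have := congr1 (fun r : {poly R} => r`_e) (poly_zero z).
rewrite coefD coefXn coefXnM eqxx ltnS leqnn addr0 coef0 => /eqP.
by rewrite oner_eq0.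
Qed.
End JacobiTrudi.

Section AltsumBlocks.
Variables (E : zmodType) (R : comPzRingType).

Lemma altsum_mul (s1 s2 : seq E) (f1 f2 : E -> R) :
    {in s1, forall a y, f2 (y + a) = f2 y} -> {in s2, forall a y, f1 (y + a) = f1 y} ->
  altsum (s1 ++ s2) (fun y => f1 y * f2 y) = altsum s1 f1 * altsum s2 f2.
Proof.
elim: s1 f1 => [|a s1 IH] f1 h2 h1 /=.
  elim: s2 f2 h1 {h2} => [//|b s2 IH] f2 h1 /=.
  have h1' : {in s2, forall a y, f1 (y + a) = f1 y}.
    by move=> c cs; apply: h1; rewrite inE cs orbT.
  rewrite mulrBr (IH _ h1'); congr (_ - _); rewrite -(IH _ h1').
  by apply: eq_altsum => y; rewrite h1 // mem_head.
have h2' : {in s1, forall a y, f2 (y + a) = f2 y}.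
  by move=> c cs; apply: h2; rewrite inE cs orbT.
rewrite mulrBl (IH _ h2' h1); congr (_ - _); rewrite -(IH (fun y => f1 (y + a))) //.
  by apply: eq_altsum => y; rewrite h2 // mem_head.
by move=> c cs y; rewrite addrAC; apply: h1.
Qed.

(** Roots of one colour do not change the factors of the other colours, so subsets can be summed
    colour by colour. *)
Lemma altsum_blocks (I C : eqType) (rt : I -> E) (col : I -> C) (G : C -> E -> R)
    (l : seq I) :
    (forall c i y, i \in l -> col i != c -> G c (y + rt i) = G c y) ->
  forall ps, uniq ps ->
  altsum [seq rt i | i <- l & col i \in ps] (fun y => \prod_(c <- ps) G c y) =
  \prod_(c <- ps) altsum [seq rt i | i <- l & col i == c] (G c).
Proof.
move=> hG; elim=> [|c ps IH] /=.
  by rewrite !big_nil filter_pred0 /= big_nil.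
move=> /andP[cps ups]; rewrite big_cons -IH // -altsum_mul.
- rewrite -map_cat; under eq_altsum do rewrite big_cons; apply: altsum_perm; apply: perm_map.
  rewrite -(perm_filterC (fun i => col i == c) [seq i <- l | col i \in c :: ps]).
  rewrite -!filter_predI; apply: perm_cat.
    by rewrite (@eq_filter _ _ (fun i => col i == c)) ?perm_refl // => i /=; rewrite inE; case: eqP.
  rewrite (@eq_filter _ _ (fun i => col i \in ps)) ?perm_refl // => i /=.
  by rewrite inE; case: eqP => // ->; rewrite (negPf cps).
- move=> a /mapP[i + ->]; rewrite mem_filter => /andP[/eqP ic il] y.
  apply: eq_big_seq => d dps; apply: hG => //; rewrite ic.
  by apply: contraNneq cps => ->.
- move=> a /mapP[i + ->]; rewrite mem_filter => /andP[ic il] y.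
  by apply: hG => //; apply: contraNneq cps => <-.
Qed.
End AltsumBlocks.

(** * Unique factorization of Jacobi-Trudi determinants *)

Definition dec : pred (seq int) := sorted (fun y z : int => z <= y).
Definition pred_seq : seq int -> seq int := map (fun z => z - 1).

Lemma dec_head a0 a z : dec (a0 :: a) -> z \in a -> z <= a0.
Proof.
move=> /order_path_min h; apply: (allP (h _)) => x y u xy uy; exact: le_trans uy xy.
Qed.

Lemma dec_behead a0 a : dec (a0 :: a) -> dec a.
Proof. exact: path_sorted. Qed.

Lemma dec_pred a : dec a -> dec (pred_seq a).
Proof.
rewrite /dec /pred_seq sorted_map; apply: sub_sorted => x y /=; by rewrite lerD2r.
Qed.

Lemma head_notin_pred a0 a : dec (a0 :: a) -> a0 \notin pred_seq (a0 :: a).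
Proof.
move=> ad; apply/mapP => -[z za e]; have : z <= a0.
  by move: za; rewrite inE => /predU1P[->//|/(dec_head ad)].
by lia.
Qed.

(** The head of [a] does not occur in [a] shifted down, so it occurs in [b], and conversely. Thus
    the heads agree, and they cancel together with their shifts. *)
Lemma dec_perm a b : dec a -> dec b -> perm_eq (b ++ pred_seq a) (a ++ pred_seq b) -> a = b.
Proof.
elim: a b => [|a0 a IH] [|b0 b] //.
- move=> _ bd; rewrite cats0 => /perm_mem/(_ b0).
  by rewrite mem_head (negPf (head_notin_pred bd)).
- move=> ad _; rewrite perm_sym cats0 => /perm_mem/(_ a0).
  by rewrite mem_head (negPf (head_notin_pred ad)).
move=> ad bd pe.
have ab : a0 \in b0 :: b.
  have := perm_mem pe a0; rewrite !mem_cat mem_head /=.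
  by rewrite (negPf (head_notin_pred ad)) orbF.
have ba : b0 \in a0 :: a.
  have := perm_mem pe b0; rewrite !mem_cat mem_head /=.
  by rewrite (negPf (head_notin_pred bd)) orbF => <-.
have e : a0 = b0.
  apply/eqP; rewrite eq_le; move: ab ba; rewrite !inE.
  move=> /predU1P[->|/(dec_head bd) ->]; first by rewrite lexx.
  by move=> /predU1P[->|/(dec_head ad) ->] //; rewrite lexx.
rewrite -e in bd pe *; congr (_ :: _); apply: IH (dec_behead ad) (dec_behead bd) _.
move: pe; rewrite /= perm_cons.
by rewrite perm_sym -cat1s perm_catCA /= perm_sym -cat1s perm_catCA /= perm_cons.
Qed.

Section JacobiTrudiUFD.
Variable R : realType.
Implicit Types (a b : seq int) (x y : int -> R).

Definition jts a x : R := jt (size a) (nth 0 a) x.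

Lemma dec_decr a : dec a -> decr (size a) (nth 0 a).
Proof.
move=> ad i j ij jm; have := sorted_leq_nth _ _ 0 ad; apply=> //.
- by move=> y x z /= xy yz; apply: le_trans yz xy.
- exact: leq_ltn_trans ij jm.
Qed.

Lemma jts_neq0 a : dec a -> exists x, jts a x != 0.
Proof. by move=> /dec_decr/(jt_neq0 R)[x _ xn]; exists x. Qed.

Lemma plines_jts a : plines (jts a).
Proof. exact: plines_jt. Qed.

Definition top a : int := if a is a0 :: a' then a0 + (size a')%:Z else 0.

(** The coefficient of x_k in [jts a] when no larger index occurs ([jts_line]): a signed minor if k
    is the top index, and 0 otherwise. *)
Definition topc (k : int) a x : R := if a is a0 :: a' then
  (a0 + (size a')%:Z == k)%:R * ((-1) ^+ size a' * jts (pred_seq a') x) else 0.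

Lemma plines_topc k a : plines (topc k a).
Proof.
case: a => [|a0 a] /=; first exact: plines_cst.
by apply: plinesM; [exact: plines_cst|apply: plinesM; [exact: plines_cst|exact: plines_jts]].
Qed.

Lemma jts_line (k : int) a x s : dec a -> top a <= k \/ a = [::] ->
  jts a (fun j => x j + s *+ (j == k)) = jts a x + s * topc k a x.
Proof.
case: a => [|a0 a] ad; first by rewrite /jts !jt0 mulr0 addr0.
have le0 (i : nat) : (i <= size a)%N -> nth 0 (a0 :: a) i <= a0.
  move=> im; exact: (dec_decr ad (leq0n i)).
case=> //= tk; have [e|ne] := eqVneq (a0 + (size a)%:Z) k.
  rewrite /jts /= (@jt_top _ _ _ _ _ s) => [|i j im jm].
    rewrite mul1r; congr (_ + s * (_ * _)); rewrite /pred_seq size_map.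
    by apply: eq_jt => // i im; rewrite (nth_map 0).
  congr (_ *+ nat_of_bool _); rewrite -e.
  case: i im => [|i] im /=; first by apply/eqP/eqP; lia.
  move: (a`_i : int) (le0 i.+1 im : a`_i <= a0) => z zl; apply/eqP; lia.
rewrite mul0r mulr0 addr0; apply: eq_jt => // i j im jm.
rewrite (_ : _ == k = false) ?addr0 //; apply/eqP => e.
have lk : a0 + (size a)%:Z < k by rewrite lt_neqAle ne.
by move: ((a0 :: a)`_i : int) (le0 i im : (a0 :: a)`_i <= a0) jm e => z zl /= jm e; lia.
Qed.

Definition low (p : R) (F : R -> R) := exists e (q : {poly R}),
  forall t, F t = p * t ^+ e + t ^+ e.+1 * q.[t].

Lemma low_mul p p' F F' : low p F -> low p' F' -> low (p * p') (fun t => F t * F' t).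
Proof.
move=> [e [q h]] [e' [q' h']]; exists (e + e')%N.
exists (p *: q' + p' *: q + 'X * (q * q')) => t; rewrite h h' !hornerD !hornerZ !hornerM hornerX !exprS exprD.
by ring.
Qed.

Lemma low_scale c p F : low p F -> low (c * p) (fun t => c * F t).
Proof.
move=> [e [q h]]; exists e, (c *: q) => t; rewrite h hornerZ; ring.
Qed.

Lemma low_uniq p p' F F' : p != 0 -> p' != 0 -> (forall t, F t = F' t) ->
  low p F -> low p' F' -> p = p'.
Proof.
move=> p0 p'0 FF [e [q h]] [e' [q' h']]; apply: (@low_cmp R p p' e e' q q' p0 p'0) => t.
by rewrite -h -h'.
Qed.

Lemma jts_low a x : dec a ->
  low (\prod_(z <- a) x z) (fun t => jts a (fun k => x k * t ^+ (`|k| ^ 2)%N)).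
Proof.
move=> ad; have [q hq] := jt_low x (dec_decr ad).
by exists (\sum_(i < size a) `|(a`_i)%R| ^ 2)%N, q => t; rewrite /jts hq (big_nth 0) big_mkord.
Qed.

(** Substitute x_k = s_k t^(k^2) with s positive: by [jts_low] the lowest terms are monomials in s
    up to sign, and absolute values discard the sign. *)
Lemma jts_cross p p' a a' b b' : dec a -> dec a' -> dec b -> dec b' ->
    (forall x, (-1) ^+ p * (jts a x * jts a' x) = (-1) ^+ p' * (jts b x * jts b' x)) ->
  perm_eq (a ++ a') (b ++ b').
Proof.
move=> ad ad' bd bd' h; apply: (@perm_of_prod R) => s s0; rewrite !big_cat /=.
have pos l : 0 < \prod_(z <- l) s z by apply: prodr_gt0 => z _.
have := low_uniq _ _ (fun t => h (fun k => s k * t ^+ (`|k| ^ 2)%N))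
  (low_scale _ (low_mul (jts_low s ad) (jts_low s ad')))
  (low_scale _ (low_mul (jts_low s bd) (jts_low s bd'))).
move=> /(_ _ _)/(congr1 Num.norm).
rewrite !normrM !normrX !normrN1 !expr1n !mul1r !(gtr0_norm (pos _)); apply.
  by rewrite mulf_neq0 ?signr_eq0 // mulf_neq0 ?gt_eqF.
by rewrite mulf_neq0 ?signr_eq0 // mulf_neq0 ?gt_eqF.
Qed.

Lemma topc_neq0 a : dec a -> a != [::] -> exists x, topc (top a) a x != 0.
Proof.
case: a => // a0 a /dec_behead/dec_pred/jts_neq0[x xn] _; exists x.
by rewrite /topc /top eqxx mul1r mulf_neq0 ?signr_eq0.
Qed.

(** Comparing lowest terms by [jts_cross], the multisets of [b] with the shifted tail of [a], and of
    [a] with the shifted tail of [b], coincide. The heads agree, being maximal, and [dec_perm]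
    handles the tails. *)
Lemma jts_inj_top a b : dec a -> dec b -> a != [::] -> b != [::] -> top a = top b ->
  (forall x, jts b x * topc (top a) a x = jts a x * topc (top a) b x) -> a = b.
Proof.
case: a b => [//|a0 a] [//|b0 b] ad bd _ _ topb Qb.
have pe : perm_eq ((b0 :: b) ++ pred_seq a) ((a0 :: a) ++ pred_seq b).
  apply: (@jts_cross (size a) (size b)) => //.
    exact: dec_pred (dec_behead ad).
    exact: dec_pred (dec_behead bd).
  move=> x; have := Qb x; rewrite /topc topb eqxx -topb eqxx !mul1r => e.
  by rewrite mulrCA e mulrCA.
have np c0 (c : seq int) : dec (c0 :: c) -> c0 \notin pred_seq c.
  by move=> /head_notin_pred; rewrite inE negb_or => /andP[].
have e : a0 = b0.
  apply/eqP; rewrite eq_le; apply/andP; split.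
    have := perm_mem pe a0; rewrite mem_cat (negPf (np _ _ ad)) orbF mem_cat mem_head /=.
    by rewrite inE => /predU1P[->//|/(dec_head bd)].
  have := perm_mem pe b0; rewrite [in RHS]mem_cat (negPf (np _ _ bd)) orbF mem_cat mem_head /=.
  by move/esym; rewrite inE => /predU1P[->//|/(dec_head ad)].
rewrite -e; congr (_ :: _); apply: dec_perm (dec_behead ad) (dec_behead bd) _.
by move: pe; rewrite e /= perm_cons.
Qed.

Lemma prod_plines_eq0 (T : eqType) (l : seq T) (F : T -> (int -> R) -> R) :
    (forall c, plines (F c)) -> (forall x, \prod_(c <- l) F c x = 0) ->
  exists2 c, c \in l & forall x, F c x = 0.
Proof.
move=> hF; elim: l => [|c l IH] h.
  by have /eqP := h (fun=> 0); rewrite big_nil oner_eq0.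
have [h0|h0] := pselect (forall x, F c x = 0); first by exists c; rewrite ?mem_head.
have [] := IH; last by move=> d dl hd; exists d; rewrite // inE dl orbT.
apply: (plines_dom (hF c) (plines_prod l hF)); first by move=> x; rewrite -(h x) big_cons.
by apply: contrapT => n; apply: h0 => x; apply/eqP/negPn/negP => xn; apply: n; exists x.
Qed.

(** All factors are affine in the variable x_k of largest index. Where its coefficient in [jts a] is
    nonzero, the root of that factor is a root of some factor on the right, so the product of the
    resultants [Q b] vanishes. Hence some [Q b] is identically 0, which forces a = b. *)
Lemma jts_top_mem La Lb a : all dec La -> all dec Lb -> [::] \notin La -> [::] \notin Lb ->
    (forall x, \prod_(c <- La) jts c x = \prod_(c <- Lb) jts c x) ->
    a \in La -> {in La ++ Lb, forall c, top c <= top a} ->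
  a \in Lb.
Proof.
move=> /allP Lad /allP Lbd La0 Lb0 h aL amax; set k := top a in amax.
have h' x s : \prod_(c <- La) (jts c x + s * topc k c x) =
    \prod_(c <- Lb) (jts c x + s * topc k c x).
  have := h (fun j => x j + s *+ (j == k)).
  rewrite (eq_big_seq (fun c => jts c x + s * topc k c x)) => [->|c cL].
    apply: eq_big_seq => c cL; apply: jts_line; first exact: Lbd.
    by left; apply: amax; rewrite mem_cat cL orbT.
  apply: jts_line; first exact: Lad.
  by left; apply: amax; rewrite mem_cat cL.
pose Q b x := jts b x * topc k a x - jts a x * topc k b x.
have hQ x : topc k a x * \prod_(b <- Lb) Q b x = 0.
  have [->|n0] := eqVneq (topc k a x) 0; first by rewrite mul0r.
  have := h' x (- jts a x / topc k a x).
  rewrite (big_rem a aL) /= mulfVK // subrr mul0r => /esym/eqP.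
  rewrite prodf_seq_eq0 => /hasP[b bL /eqP b0]; rewrite (big_rem b bL) /=.
  have -> : Q b x = topc k a x * (jts b x + - jts a x / topc k a x * topc k b x).
    by rewrite /Q; field.
  by rewrite /= b0 mulr0 mul0r mulr0.
have plQ b : plines (Q b).
  by apply: plinesB; apply: plinesM; rewrite //; first [exact: plines_jts|exact: plines_topc].
have a0 : exists x, topc k a x != 0.
  by apply: topc_neq0; [apply: Lad|apply: (memPn La0)].
have [b bL Qb] := prod_plines_eq0 plQ (plines_dom (plines_topc k a) (plines_prod _ plQ) hQ a0).
have [bd ad] := (Lbd _ bL, Lad _ aL).
(* If x_k did not occur in [jts b], then [Q b] would be [jts b] times the nonzero coefficient of x_k
   in [jts a]. *)
have topb : top b = k.
  apply: contrapT => tb; have [x] := jts_neq0 bd; apply/negP; rewrite negbK; apply/eqP; move: x.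
  apply: plines_dom (plines_topc k a) (plines_jts b) _ a0 => x.
  have := Qb x; rewrite /Q (_ : topc k b x = 0) ?mulr0 ?subr0 1?mulrC //.
  case: (b) tb => //= b0 b' /eqP/negPf ->; by rewrite mul0r.
suff -> : a = b by [].
apply: jts_inj_top (Lad _ aL) bd (memPn La0 _ aL) (memPn Lb0 _ bL) (esym topb) _ => x.
by have /eqP := Qb x; rewrite subr_eq0 => /eqP.
Qed.

Lemma jts_ufd La Lb : all dec La -> all dec Lb -> [::] \notin La -> [::] \notin Lb ->
    (forall x, \prod_(c <- La) jts c x = \prod_(c <- Lb) jts c x) ->
  perm_eq La Lb.
Proof.
have [n] := ubnP (size La + size Lb)%N.
elim: n La Lb => // n IH La Lb; rewrite ltnS => sn Lad Lbd La0 Lb0 h.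
have [/eqP|Ln] := eqVneq (La ++ Lb) [::].
  by case: La {Lad La0 h sn} => //; case: Lb {Lbd Lb0}.
have [a + amax] := seq_max top Ln; rewrite mem_cat => aL.
have [aLa aLb] : a \in La /\ a \in Lb.
  case/orP: aL => aL; split=> //.
    exact: jts_top_mem aL amax.
  apply: (jts_top_mem Lbd Lad Lb0 La0 _ aL) => [x|c]; first by rewrite h.
  by rewrite mem_cat orbC -mem_cat; apply: amax.
apply: perm_trans (perm_to_rem aLa) _; rewrite perm_sym.
apply: perm_trans (perm_to_rem aLb) _; rewrite perm_cons perm_sym.
have sub (L : seq (seq int)) : all dec L -> all dec (rem a L).
  by move=> /allP Ld; apply/allP => c /mem_rem/Ld.
have sub0 (L : seq (seq int)) : [::] \notin L -> [::] \notin rem a L.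
  by apply: contra; apply: mem_rem.
apply: IH; rewrite ?sub ?sub0 //.
  by move: sn; rewrite !size_rem //; case: (La) (Lb) aLa aLb => [//|c l] [//|c' l'] _ _ /=; lia.
move=> x; apply/eqP; rewrite -subr_eq0; apply/eqP; move: x.
apply: (plines_dom (plines_jts a)).
- by apply: plinesB; apply: plines_prod; exact: plines_jts.
- by move=> x; rewrite mulrBr; have := h x; rewrite (big_rem a aLa) (big_rem a aLb) /= => ->;
    rewrite subrr.
- by apply: jts_neq0; apply: (allP Lad).
Qed.
End JacobiTrudiUFD.

(** * The general linear case *)

Lemma perm_map_match (T U : eqType) (f g : T -> U) (s1 s2 : seq T) : uniq s1 -> uniq s2 ->
    perm_eq (map f s1) (map g s2) ->
  exists t : T -> T, [/\ {in s1, forall p, t p \in s2}, {in s1, forall p, g (t p) = f p}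
    & {in s1 &, injective t}].
Proof.
elim: s1 s2 => [|p s1 IH] s2 /=; first by exists id.
move=> /andP[ps1 us1] us2 pe.
have /mapP[q qs2 fq] : f p \in map g s2 by rewrite -(perm_mem pe) mem_head.
have [] := IH (rem q s2) us1 (rem_uniq q us2).
  have := perm_trans pe (perm_map g (perm_to_rem qs2)).
  by rewrite /= fq perm_cons.
move=> t [t2 tg tinj]; exists (fun z => if z == p then q else t z).
have np z : z \in s1 -> (z == p) = false by move=> zs; apply: contraNF ps1 => /eqP <-.
have nq z : z \in s1 -> t z <> q.
  by move=> /t2 + e; rewrite e mem_rem_uniqF.
split=> [z|z|z w]; rewrite !inE.
- by case: eqP => //= _ /t2/mem_rem.
- by case: eqP => [->|] //= _ /tg.
case/predU1P=> [->|zs]; case/predU1P=> [->|ws] //; rewrite ?eqxx ?np //.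
- by move=> e; case: (nq w ws).
- by move=> e; case: (nq z zs).
- exact: tinj.
Qed.

Section GLCase.
Variables (R : realType) (n : nat).
Local Notation X := (gl_datum R n).
Local Notation E := ('rV[R]_n).
Local Notation eps := (fun i : 'I_n => delta_mx 0 i : E).
Variable Sbar : seq (euc X).
Hypothesis hS : {subset Sbar <= simple_roots X}.
Local Notation Rp := (Rbar_pos (X := X) Sbar).
Let hr := gl_root_axioms R n.

Lemma gl_perm_weyl (s : 'S_n) :
  in_weyl (X := X) (root_set X) (fun y : E => \row_i y 0 (s i)).
Proof.
have [ts -> dts] := prod_tpermP s; elim: ts dts => [_|t ts IH] /=.
  rewrite big_nil (_ : (fun y : E => _) = id); first exact: weyl_id.
  by apply/funext => y; apply/rowP => i; rewrite mxE perm1.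
move=> /andP[td tsd]; rewrite big_cons.
rewrite (_ : (fun y : E => _) = Defs.reflect (X := X) (eps t.1 - eps t.2) \o
    (fun y : E => \row_i y 0 ((\prod_(t <- ts) tperm t.1 t.2)%g i))).
  by apply: weyl_refl (IH tsd); apply/mem_A_roots; exists t.1, t.2.
apply/funext => y; apply/rowP => i.
by rewrite /= gl_reflectE // !mxE permM.
Qed.

Definition lnk (i j : 'I_n) : bool := eps i - eps j \in <<Sbar>>%VS.
(** A representative of the block of i: [pick] depends only on the extension of the predicate, so
    linked indices get the same one. *)
Definition st (i : 'I_n) : 'I_n := odflt i [pick p | lnk i p].
Definition blk (p : 'I_n) : seq 'I_n := [seq i <- enum 'I_n | st i == p].
Definition blk_pairs := pairs (fun i j : 'I_n => (i < j)%N && (st i == st j)).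
Let rt (ij : 'I_n * 'I_n) : E := eps ij.1 - eps ij.2.

Lemma st_eq i j : (st i == st j) = lnk i j.
Proof.
have lii k : lnk k k by rewrite /lnk subrr mem0v.
have ls k l : lnk k l = lnk l k by rewrite /lnk -[X in X \in _]opprB memvN.
have lt k l m : lnk k l -> lnk l m -> lnk k m.
  by move=> kl lm; have := memvD kl lm; rewrite /= subrKA.
have stP k : lnk k (st k).
  by rewrite /st; case: pickP => //= /(_ k); rewrite lii.
apply/eqP/idP => [e|ij].
  by apply: lt (stP i) _; rewrite e ls.
rewrite /st (eq_pick (_ : lnk i =1 lnk j)).
  by case: pickP => //= /(_ j); rewrite lii.
by move=> k; apply/idP/idP; [rewrite ls in ij|]; apply: lt.
Qed.

Lemma gl_Rp_mem (i j : 'I_n) : (i < j)%N -> (eps i - eps j \in Rp) = (st i == st j).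
Proof.
move=> ij; rewrite [LHS](mem_Rp (X := X)) gl_nonneg // andbT st_eq /lnk.
by rewrite (_ : _ \in root_set X) //; apply/mem_A_roots; exists i, j; split=> //;
  apply: contraTneq ij => ->; rewrite ltnn.
Qed.

Lemma gl_Rp_perm : perm_eq Rp [seq rt ij | ij <- blk_pairs].
Proof.
apply: uniq_perm; first exact: Rp_uniq hr Sbar.
  rewrite map_inj_in_uniq ?pairs_uniq // => -[i j] [k l]; rewrite !mem_pairs /=.
  move=> /andP[ij _] /andP[kl _] e; have [||-> ->] := @gl_root_eq R n i j k l _ _ e => //.
    by apply: contraTneq ij => ->; rewrite ltnn.
  by apply: contraTneq kl => ->; rewrite ltnn.
move=> a; apply/idP/mapP => [aR|[[i j]]]; last first.
  by rewrite mem_pairs /= => /andP[ij e ->]; rewrite gl_Rp_mem.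
have := aR; rewrite mem_Rp => /and3P[/mem_A_roots[i [j [ij e]]] _ pos].
exists (i, j) => //; rewrite mem_pairs /=.
suff lij : (i < j)%N by rewrite lij -gl_Rp_mem // -e.
case: (ltngtP i j) => // [ji|/val_inj e']; last by rewrite e' eqxx in ij.
have aP : a \in root_set X by apply/mem_A_roots; exists i, j.
have := gl_nonneg R ji; rewrite -opprB -e => posN.
by have := pos_notN hr aP pos; rewrite posN.
Qed.

Lemma mem_blk i p : (i \in blk p) = (st i == p).
Proof. by rewrite mem_filter mem_enum andbT. Qed.

Lemma blk_sorted p : sorted (fun i j : 'I_n => (i < j)%N) (blk p).
Proof.
apply: sorted_filter; first by move=> j i k; apply: ltn_trans.
have := iota_ltn_sorted 0 n; rewrite -val_enum_ord sorted_map.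
exact.
Qed.

Lemma blk_ltn i0 p k l : (k < size (blk p))%N -> (l < size (blk p))%N ->
  (nth i0 (blk p) k < nth i0 (blk p) l)%N = (k < l)%N.
Proof.
move=> kb lb; have tr : transitive (fun i j : 'I_n => (i < j)%N).
  by move=> j i m; apply: ltn_trans.
have h := sorted_ltn_nth tr i0 (blk_sorted p).
case: (ltngtP k l) => [kl|lk|->]; last by rewrite ltnn.
  exact: h.
by apply/negbTE; rewrite -leqNgt ltnW //; apply: h.
Qed.

Definition blk_wt (m : 'I_n -> int) p : seq int := [seq m i | i <- blk p].

Lemma gl_block_altsum (m : 'I_n -> int) (mu : E) (x : int -> R) p :
    (forall i, mu 0 i = (m i)%:~R) ->
  altsum [seq rt ij | ij <- blk_pairs & st ij.1 == p]
    (fun y : E => \prod_(i <- blk p) x (Num.floor ((mu + y) 0 i))) =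
  jts (blk_wt m p) x.
Proof.
move=> muE; set b := blk p; pose N := size b.
pose bt (k : 'I_N) : 'I_n := tnth (in_tuple b) k.
have btn k i0 : bt k = nth i0 b k by rewrite /bt (tnth_nth i0).
pose h (y : 'rV[R]_N) : E := \sum_k y 0 k *: (delta_mx 0 (bt k) : E).
have bt_lt k l : (bt k < bt l)%N = (k < l)%N.
  by have := @blk_ltn (bt k) p _ _ (ltn_ord k) (ltn_ord l); rewrite -/b -!btn.
have bt_inj : injective bt.
  move=> k l e; apply: val_inj => /=; have := bt_lt k l; have := bt_lt l k.
  by rewrite e ltnn; case: ltngtP.
have btb k : bt k \in b by apply: mem_tnth.
have bsurj i : i \in b -> exists k, i = bt k.
  by move=> ib; have /tnthP[k ->] : i \in in_tuple b by []; exists k.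
have hE y k : (h y : E) 0 (bt k) = y 0 k.
  rewrite /h summxE (bigD1 k) //= !mxE !eqxx mulr1 big1 ?addr0 // => l lk.
  by rewrite !mxE (inj_eq bt_inj) [k == l]eq_sym (negPf lk) mulr0.
have hr0 (k l : 'I_N) : h (delta_mx 0 k - delta_mx 0 l) = rt (bt k, bt l).
  have hd (q : 'I_N) : \sum_r (delta_mx 0 q : 'rV[R]_N) 0 r *: (delta_mx 0 (bt r) : E) = delta_mx 0 (bt q).
    rewrite (bigD1 q) //= mxE !eqxx scale1r big1 ?addr0 // => r rq.
    by rewrite mxE (negPf rq) scale0r.
  rewrite /h /rt /= -hd -[in RHS](hd l) -sumrB; apply: eq_bigr => r _.
  by rewrite !mxE scalerBl.
have hD : {morph h : u v / u + v}.
  by move=> u v; rewrite /h -big_split; apply: eq_bigr => k _; rewrite mxE scalerDl.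
have h0 : h 0 = 0 by rewrite /h big1 // => k _; rewrite mxE scale0r.
have pe : perm_eq [seq rt ij | ij <- blk_pairs & st ij.1 == p] (map h (gl_pos R N)).
  apply: uniq_perm.
  - rewrite map_inj_in_uniq ?(filter_uniq _ (pairs_uniq _)) // => -[i j] [k l].
    rewrite [(i, j) \in _]mem_filter [(k, l) \in _]mem_filter !mem_pairs /= => /and3P[_ ij _] /and3P[_ kl _] e.
    have [||-> ->] := @gl_root_eq R n i j k l _ _ e => //.
      by apply: contraTneq ij => ->; rewrite ltnn.
    by apply: contraTneq kl => ->; rewrite ltnn.
  - rewrite map_inj_uniq ?gl_pos_uniq // => u v e; apply/rowP => k.
    by rewrite -!hE e.
  move=> a; apply/mapP/mapP => [[[i j]]|[z /mapP[[k l]]]].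
    rewrite mem_filter mem_pairs /= => /and3P[/eqP ip ij /eqP sij] ->.
    have [k ik] : exists k, i = bt k by apply: bsurj; rewrite mem_blk ip.
    have [l jl] : exists l, j = bt l by apply: bsurj; rewrite mem_blk -sij ip.
    exists (delta_mx 0 k - delta_mx 0 l); last by rewrite hr0 ik jl.
    by apply/mapP; exists (k, l) => //; rewrite mem_pairs /= -bt_lt -ik -jl.
  rewrite mem_pairs /= => kl -> ->; exists (bt k, bt l); last by rewrite hr0.
  have := btb k; have := btb l; rewrite !mem_blk => /eqP e1 /eqP e2.
  by rewrite mem_filter mem_pairs /= bt_lt kl e1 e2 !eqxx.
rewrite (altsum_perm _ pe) (altsum_map _ _ h0 hD).
pose F (k : 'I_N) (v : R) := x (Num.floor ((m (bt k))%:~R + v)).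
transitivity (altsum (gl_pos R N) (fun y => \prod_k F k (y 0 k))).
  apply: eq_altsum => y /=; rewrite (big_tnth _ _ b); apply: eq_bigr => k _.
  by rewrite /F -/(bt k) mxE hE muE.
rewrite gl_altsum_det /jts /jt /blk_wt size_map -/b -/N; congr (\det _).
apply/matrixP => k l; rewrite !mxE /F (nth_map (bt k)) // -btn.
congr x; rewrite -[RHS](@intrKfloor R); congr Num.floor.
by rewrite !rmorphD rmorphN /= -!pmulrn addrA addrAC.
Qed.

Lemma gl_altsum_blocks (m : 'I_n -> int) (mu : E) (x : int -> R) :
    (forall i, mu 0 i = (m i)%:~R) ->
  altsum Rp (fun y : E => \prod_i x (Num.floor ((mu + y) 0 i))) =
  \prod_(c <- [seq blk_wt m p | p <- enum 'I_n & blk p != [::]]) jts c x.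
Proof.
move=> muE; rewrite (altsum_perm _ gl_Rp_perm).
pose G p (y : E) := \prod_(i <- blk p) x (Num.floor ((mu + y) 0 i)).
transitivity (altsum [seq rt ij | ij <- blk_pairs & st ij.1 \in enum 'I_n]
  (fun y : E => \prod_(p <- enum 'I_n) G p y)).
  rewrite (@eq_filter _ _ predT) => [|ij]; last by rewrite mem_enum.
  rewrite filter_predT; apply: eq_altsum => y.
  rewrite (partition_big st xpredT) //= big_enum /=; apply: eq_bigr => p _.
  by rewrite /G /blk big_filter big_enum_cond.
rewrite (altsum_blocks (col := fun ij => st ij.1)) ?enum_uniq //; last first.
  move=> c [i j] y; rewrite mem_pairs /= => /andP[_ /eqP sij] ic.
  apply: eq_big_seq => k; rewrite mem_blk => /eqP kc.
  have ki : k == i = false by apply: contraNF ic => /eqP <-; rewrite kc.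
  have kj : k == j = false by apply: contraNF ic => /eqP kj; rewrite sij -kj kc.
  by rewrite /rt !mxE /= ki kj subr0 addr0.
rewrite big_map big_filter [RHS]big_mkcond; apply: eq_bigr => p _.
rewrite (gl_block_altsum x p muE); case: eqP => // e.
by rewrite /jts /blk_wt e /= jt0.
Qed.

Lemma gl_dec_wt (m : 'I_n -> int) (mu : E) p : (forall i, mu 0 i = (m i)%:~R) ->
  dom (X := X) Sbar mu -> dec (blk_wt m p).
Proof.
move=> muE mud; have bp := blk_sorted p.
apply: (@homo_sorted_in _ _ [pred i | st i == p] m _ _ _ _ _ bp); last first.
  by apply/allP => i; rewrite mem_blk.
move=> i j /eqP ip /eqP jp ij; rewrite -(ler_int R) -!muE -subr_ge0.
have : eps i - eps j \in Rp by rewrite gl_Rp_mem // ip jp.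
rewrite [X in is_true X](mem_Rp (X := X)) => /and3P[_ sp pos].
by have := dom_ge0 hr hS (ipW hr) mud sp (pos_cone pos); rewrite gl_ip_root.
Qed.

(** Unique factorization matches each block of mu with a block of nu that carries the same sequence.
    Moving blocks onto their partners in increasing order sends mu to nu and preserves the positive
    roots of the Levi. *)
Lemma case_gl (mu nu : E) : Pbar_plus (X := X) Sbar mu -> Pbar_plus (X := X) Sbar nu ->
  same_alt (X := X) Sbar mu nu -> diagram_conj (X := X) Sbar mu nu.
Proof.
move=> /andP[/forallP mui mud] /andP[/forallP nui nud] h.
pose m i := Num.floor (mu 0 i); pose k i := Num.floor (nu 0 i).
have muE i : mu 0 i = (m i)%:~R by rewrite /m; have /intrP[z ->] := mui i; rewrite intrKfloor.
have nuE i : nu 0 i = (k i)%:~R by rewrite /k; have /intrP[z ->] := nui i; rewrite intrKfloor.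
pose ps := [seq p <- enum 'I_n | blk p != [::]].
have ups : uniq ps by apply/filter_uniq/enum_uniq.
have pe : perm_eq (map (blk_wt m) ps) (map (blk_wt k) ps).
  apply: (@jts_ufd R).
  - by apply/allP => _ /mapP[p _ ->]; apply: gl_dec_wt muE mud.
  - by apply/allP => _ /mapP[p _ ->]; apply: gl_dec_wt nuE nud.
  - apply/mapP => -[p + e]; rewrite mem_filter => /andP[+ _].
    by rewrite -size_eq0 -(size_map m) -/(blk_wt m p) -e.
  - apply/mapP => -[p + e]; rewrite mem_filter => /andP[+ _].
    by rewrite -size_eq0 -(size_map k) -/(blk_wt k p) -e.
  move=> x; rewrite -(gl_altsum_blocks x muE) -(gl_altsum_blocks x nuE).
  apply: (h (fun y : E => \prod_i x (Num.floor (y 0 i)))) => w y /gl_weyl_perm[s hs].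
  rewrite [RHS](reindex_inj (@perm_inj _ s)); apply: eq_bigr => i _.
  by rewrite hs.
have [t [tps tE tinj]] := perm_map_match ups ups pe.
have stps i : st i \in ps.
  by rewrite mem_filter mem_enum andbT; apply/eqP => e; have := mem_blk i (st i); rewrite e eqxx.
have szt i : size (blk (t (st i))) = size (blk (st i)).
  by have := congr1 size (tE _ (stps i)); rewrite !size_map.
have idx i : (index i (blk (st i)) < size (blk (st i)))%N by rewrite index_mem mem_blk.
pose sg i := nth i (blk (t (st i))) (index i (blk (st i))).
have sgst i : st (sg i) = t (st i).
  by apply/eqP; rewrite -mem_blk mem_nth // szt.
have sglt i j : st i = st j -> (sg i < sg j)%N = (i < j)%N.
  move=> ij; pose q := st i.
  have E z : st z = q -> sg z = nth i (blk (t q)) (index z (blk q)).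
    by move=> <-; apply: set_nth_default; rewrite szt idx.
  have iq : i \in blk q by rewrite mem_blk.
  have jq : j \in blk q by rewrite mem_blk -ij.
  rewrite (E i erefl) (E j (esym ij)) blk_ltn ?szt ?index_mem //.
  by rewrite -(@blk_ltn i q) ?index_mem // !nth_index.
have sg_inj : injective sg.
  move=> i j e; have ij : st i = st j by apply: tinj; rewrite -?sgst ?e ?stps.
  apply: val_inj => /=; have := sglt _ _ ij; have := sglt _ _ (esym ij).
  by rewrite e ltnn; case: ltngtP.
pose s := perm sg_inj.
have nuE' i : nu 0 (s i) = mu 0 i.
  rewrite permE nuE muE; congr (_%:~R).
  have := congr1 (fun l : seq int => nth 0 l (index i (blk (st i)))) (tE _ (stps i)).
  rewrite !(nth_map i) ?szt ?idx // nth_index ?mem_blk //.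
have hu := gl_perm_weyl s^-1%g.
exists (fun y : E => \row_i y 0 (s^-1%g i)); split=> //; last first.
  by apply/rowP => i; rewrite mxE -{1}(permKV s i) nuE'.
apply: (perm_Rp_of_simple (gl_frame R n) hS hu) => a aS.
have aR := Sbar_Rp hr hS aS.
have := aR; rewrite (perm_mem gl_Rp_perm) => /mapP[[i j]].
rewrite mem_pairs /= => /andP[ij /eqP sij] ->.
have -> : \row_q (rt (i, j) : E) 0 (s^-1%g q) = eps (sg i) - eps (sg j).
  have inv q z : (s^-1%g q == z) = (q == sg z).
    by rewrite -(inj_eq (@perm_inj _ s)) permKV permE.
  by apply/rowP => q; rewrite !mxE !inv.
by rewrite gl_Rp_mem ?sglt // !sgst sij.
Qed.
End GLCase.

(** * Even and odd specializations *)

(** Let c be the multiplicity function of K. Counting the absolute value w + 1 on both sides gives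
    c(w) + c(-w-2) = c(w+2) + c(-w) for w >= 0. As c vanishes far out, c(w) = c(-w) follows by
    descending induction. *)
Lemma abs_shift_sym (K : seq int) :
    perm_eq (map (fun z : int => absz (z + 1)%R) K) (map (fun z : int => absz (z - 1)%R) K) ->
  perm_eq K (map -%R K).
Proof.
move=> pe; pose c (v : int) := count_mem v K.
have cE (u : int -> nat) (w : nat) v v' : v != v' ->
    (forall z, (u z == w) = (z == v) || (z == v')) ->
    count_mem w (map u K) = (c v + c v')%N.
  move=> vv uP; rewrite count_map /c -(count_predUI (pred1 v) (pred1 v')).
  rewrite [X in (_ + X)%N](_ : _ = 0%N) ?addn0.
    by apply: eq_count => z /=; rewrite uP.
  rewrite -[RHS](count_pred0 K); apply: eq_count => z /=.
  by apply/negbTE/negP => /andP[/eqP -> /eqP e]; rewrite e eqxx in vv.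
have step (w : nat) : (c w%:Z + c (- w%:Z - 2)%R = c (w%:Z + 2)%R + c (- w%:Z)%R)%N.
  rewrite -(cE (fun z => absz (z + 1)%R) w.+1); first last.
  - by move=> z; apply/eqP/orP => [h|[/eqP->|/eqP->]]; try lia;
      have [->|->] : z = w%:Z \/ z = - w%:Z - 2 by lia.
  - by apply/eqP; lia.
  rewrite -(cE (fun z => absz (z - 1)%R) w.+1).
  - by have /seq.permP/(_ (pred1 w.+1)) := pe.
  - by apply/eqP; lia.
  by move=> z; apply/eqP/orP => [h|[/eqP->|/eqP->]]; try lia;
    have [->|->] : z = w%:Z + 2 \/ z = - w%:Z by lia.
pose N := (\sum_(z <- K) `|z|%N).+1.
have big_out (v : int) : (N <= `|v|)%N -> c v = 0%N.
  move=> Nv; apply/count_memPn/negP => vK; move: Nv; rewrite /N (big_rem v vK) /=; lia.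
have sym (w : nat) : c w%:Z = c (- w%:Z).
  have [j hj] : exists j, (N <= w + j)%N by exists N; lia.
  elim: j w hj => [|j IH] w hj.
    by rewrite !big_out //; lia.
  have h2 : c (w%:Z + 2) = c (- w%:Z - 2).
    by have := IH w.+2; rewrite (_ : w.+2%:Z = w%:Z + 2) ?opprD; [apply; lia|lia].
  by have := step w; rewrite h2; lia.
apply/allP => v _; apply/eqP => /=.
have -> : count_mem v (map -%R K) = c (- v).
  by rewrite count_map; apply: eq_count => z /=; rewrite -(inj_eq oppr_inj) opprK.
rewrite -/(c v); case: (v) => m; first exact: sym.
by rewrite NegzE opprK -sym.
Qed.

Section Parity.
Variable R : realType.
Implicit Types (a b : nat -> int) (x y : int -> R).

(** The sequence -w0(a), highest weight of the dual module. *)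
Definition star n a i : int := - a (n - i.+1)%N.

Definition eqst n a b := (forall i, (i < n)%N -> b i = a i) \/
  (forall i, (i < n)%N -> b i = star n a i).

Lemma starK n a i : (i < n)%N -> star n (star n a) i = a i.
Proof. by move=> im; rewrite /star opprK; congr a; lia. Qed.

Lemma eqst_sym n a b : eqst n a b -> eqst n b a.
Proof.
case=> h; [left|right] => i im; first by rewrite h.
by rewrite /star h ?/star ?opprK; [congr a|]; lia.
Qed.

Lemma eqst_trans n a b c : eqst n a b -> eqst n b c -> eqst n a c.
Proof.
case=> h [] h'.
- by left=> i im; rewrite h' ?h.
- by right=> i im; rewrite h' // /star h //; lia.
- by right=> i im; rewrite h' ?h.
- by left=> i im; rewrite h' // /star h ?/star ?opprK; [congr a|]; lia.
Qed.

Lemma star_decr n a : decr n a -> decr n (star n a).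
Proof. by move=> ad i j ij jn; rewrite /star lerN2; apply: ad; lia. Qed.

Definition par (e : R) x := forall k, x (- k) = e * x k.

(** Reverse the order of rows and of columns; every index changes sign. *)
Lemma jt_star e n a x : par e x -> jt n (star n a) x = e ^+ n * jt n a x.
Proof.
move=> xp; pose r := perm (@rev_ord_inj n).
pose M := \matrix_(i < n, j < n) x (a i - i%:Z + j%:Z).
have -> : jt n (star n a) x = \det (e *: row_perm r (col_perm r M)).
  congr (\det _); apply/matrixP => i j; rewrite !mxE !permE /=.
  rewrite -xp; congr x; rewrite /star.
  have := ltn_ord i; have := ltn_ord j; move: (nat_of_ord i) (nat_of_ord j) => p q; lia.
rewrite detZ row_permE col_permE !det_mulmx !det_perm odd_permV.
by congr (_ * _); rewrite mulrCA -expr2 sqrr_sign mulr1.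
Qed.

(** A change of x_k by s must be accompanied by a change of x_(-k) by e s to keep the parity. *)
Definition bump2 (e : R) (k : int) (s : R) (j : int) : R :=
  s *+ (j == k) + (e * s) *+ (j == - k).

Lemma par_add e x y : par e x -> par e y -> par e (fun k => x k + y k).
Proof. by move=> hx hy k; rewrite hx hy mulrDr. Qed.

Lemma par_bump2 e k s : e * e = 1 -> par e (bump2 e k s).
Proof.
move=> ee j; rewrite /bump2 mulrDr !mulrnAr mulrA ee mul1r eqr_opp eqr_oppLR.
by rewrite addrC.
Qed.

(** The smallest index a_m - m exceeds -(a_0 + m), so the mirror variable does not occur in the
    matrix. *)
Lemma bump2_top e m a s i j : decr m.+1 a -> 0 < a 0%N + a m -> (i <= m)%N -> (j <= m)%N ->
  bump2 e (a 0%N + m%:Z) s (a i - i%:Z + j%:Z) = s *+ ((i == 0%N) && (j == m)).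
Proof.
move=> ad a0 im jm; have h0 := ad _ _ (leq0n i) im; have hm := ad _ _ im (ltnSn m).
rewrite /bump2 (_ : (_ == - _) = false) ?addr0; last by apply/eqP; lia.
congr (_ *+ nat_of_bool _); apply/eqP/andP => [e1|[/eqP-> /eqP->]]; last lia.
by split; apply/eqP; lia.
Qed.

Lemma bump2_corner e m a s i j : decr m.+2 a -> a 0%N + a m.+1 = 0 ->
    (i < m.+2)%N -> (j < m.+2)%N ->
  bump2 e (a 0%N + m.+1%:Z) s (a i - i%:Z + j%:Z) =
  s *+ ((i == 0%N) && (j == m.+1)) + (e * s) *+ ((i == m.+1) && (j == 0%N)).
Proof.
move=> ad a0 im jm; have h0 := ad _ _ (leq0n i) im.
have hm := ad _ _ (im : (i <= m.+1)%N) (ltnSn _).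
rewrite /bump2; congr (_ *+ nat_of_bool _ + _ *+ nat_of_bool _).
  apply/eqP/andP => [e1|[/eqP-> /eqP->]]; last lia.
  by split; apply/eqP; lia.
apply/eqP/andP => [e1|[/eqP-> /eqP->]]; last lia.
by split; apply/eqP; lia.
Qed.

Lemma jt_even_abs n a b : decr n a -> decr n b ->
    (forall x, par 1 x -> jt n a x = jt n b x) ->
  perm_eq [seq `|a i|%N | i <- iota 0 n] [seq `|b i|%N | i <- iota 0 n].
Proof.
move=> ad bd h; apply: (@perm_of_prod R) => s s0.
have E c : \prod_(z <- [seq `|c i|%N | i <- iota 0 n]) s z = \prod_(i < n) s `|c i|%N.
  by rewrite big_map -[n in iota 0 n]subn0 -/(index_iota 0 n) big_mkord.
have [q hq] := jt_low (fun k => s `|k|%N) ad; have [q' hq'] := jt_low (fun k => s `|k|%N) bd.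
have n0 c : \prod_(i < n) s `|c i : int|%N != 0.
  by rewrite gt_eqF // prodr_gt0.
rewrite !E; apply: (@low_cmp R _ _ (\sum_(i < n) (`|a i| ^ 2))%N (\sum_(i < n) (`|b i| ^ 2))%N q q'
  (n0 (fun i : 'I_n => a i)) (n0 (fun i : 'I_n => b i))) => t.
rewrite -hq -hq'; apply: h => k; rewrite abszN mul1r //.
Qed.

Lemma decr_behead n a d : decr n.+1 a -> decr n (fun i => a i.+1 - d).
Proof. by move=> ad i j ij jn; rewrite lerD2r; apply: ad. Qed.

Lemma decr_abs_head n a b : decr n.+1 a -> decr n.+1 b -> 0 <= a 0%N + a n -> 0 <= b 0%N + b n ->
    perm_eq [seq `|a i|%N | i <- iota 0 n.+1] [seq `|b i|%N | i <- iota 0 n.+1] ->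
  a 0%N = b 0%N.
Proof.
move=> ad bd a0 b0 pe.
have key c c' : decr n.+1 c -> decr n.+1 c' -> 0 <= c 0%N + c n -> 0 <= c' 0%N + c' n ->
    perm_eq [seq `|c i|%N | i <- iota 0 n.+1] [seq `|c' i|%N | i <- iota 0 n.+1] ->
    c 0%N <= c' 0%N.
  move=> cd cd' c0 c0' pe'.
  have : absz (c 0%N) \in [seq `|c' i|%N | i <- iota 0 n.+1].
    by rewrite -(perm_mem pe') mem_head.
  case/mapP=> i.
  rewrite mem_iota => /= im e; have h0 := cd' _ _ (leq0n i) im.
  have hn := cd' _ _ (im : (i <= n)%N) (ltnSn n); have := cd _ _ (leq0n n) (ltnSn n).
  by move: (c 0%N) (c' 0%N) (c' i) (c n) (c' n) e c0 c0' h0 hn => p q r u v; lia.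
by apply/eqP; rewrite eq_le !key // perm_sym.
Qed.

Lemma decr_self_dual n a : decr n a ->
    perm_eq [seq a i | i <- iota 0 n] [seq - a i | i <- iota 0 n] ->
  forall i, (i < n)%N -> a i = star n a i.
Proof.
move=> ad pe.
have srt c : decr n c -> sorted (fun y z : int => z <= y) [seq c i | i <- iota 0 n].
  move=> cd; apply: (@homo_sorted_in _ _ [pred i | i < n]%N c ltn) (iota_ltn_sorted 0 n).
    by move=> i j _ jn ij; apply: cd => //; apply: ltnW.
  by apply/allP => i; rewrite mem_iota.
have pe' : perm_eq [seq - a i | i <- iota 0 n] [seq star n a i | i <- iota 0 n].
  rewrite perm_sym -(perm_rev [seq star n a i | i <- iota 0 n]).
  suff -> : rev [seq star n a i | i <- iota 0 n] = [seq - a i | i <- iota 0 n].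
    exact: perm_refl.
  apply: (@eq_from_nth _ 0) => [|i]; rewrite size_rev !size_map // size_iota => im.
  rewrite nth_rev ?size_map ?size_iota // !(nth_map 0%N) ?size_iota ?nth_iota //; try lia.
  by rewrite /star; congr (- a _); lia.
have e : [seq a i | i <- iota 0 n] = [seq star n a i | i <- iota 0 n].
  apply: (@sorted_eq _ (fun y z : int => z <= y)) (perm_trans pe pe').
  - by move=> y x z /= xy yz; apply: le_trans yz xy.
  - by move=> x y /= /andP[h1 h2]; apply/eqP; rewrite eq_le h1 h2.
  - exact: srt.
  - exact: srt (star_decr ad).
move=> i im; have := congr1 (fun l => nth 0 l i) e.
by rewrite !(nth_map 0%N) ?size_iota // nth_iota.
Qed.

(** With a_0 + a_(n-1) >= 0 the first entry has the largest absolute value, so a and b share it. If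
    that sum is 0, the variable of largest index sits at both corners and its quadratic coefficient
    strips both ends; if it is positive, the linear coefficient strips the first row. *)
Lemma jt_even_step n : (forall m a b, (m < n)%N -> decr m a -> decr m b ->
    (forall x, par 1 x -> jt m a x = jt m b x) -> eqst m a b) ->
  forall a b, decr n a -> decr n b -> 0 <= a 0%N + a n.-1 -> 0 <= b 0%N + b n.-1 ->
    (forall x, par 1 x -> jt n a x = jt n b x) -> eqst n a b.
Proof.
move=> IH a b ad bd a0 b0 h; have pe := jt_even_abs ad bd h.
case: n IH ad bd a0 b0 h pe => [|m] IH ad bd a0 b0 h pe; first by left.
have e0 := decr_abs_head ad bd a0 b0 pe.
case: m IH ad bd a0 b0 h pe => [|m] IH ad bd a0 b0 h pe.
  by left=> -[|//] _.
have e11 : 1 * 1 = 1 :> R by rewrite mulr1.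
have tail_eq : (forall i, (i < m.+1)%N -> b i.+1 = a i.+1) -> eqst m.+2 a b.
  by move=> tl; left=> -[|i] im; [rewrite e0|apply: tl].
(* The coefficient of -s^2: the inner determinant if the ends are opposite, and 0 otherwise, where
   the variable occurs in one corner only. *)
pose C (c : nat -> int) x := (c 0%N + c m.+1 == 0)%:R * jt m (fun i => c i.+1) x.
have pert c x : decr m.+2 c -> 0 <= c 0%N + c m.+1 -> exists d, forall s,
    jt m.+2 c (fun k => x k + bump2 1 (c 0%N + m.+1%:Z) s k) =
    jt m.+2 c x + s * d - s ^+ 2 * C c x.
  rewrite /C => cd; case: (ltgtP 0 (c 0%N + c m.+1)) => // [c0|c0] _.
    exists ((-1) ^+ m.+1 * jt m.+1 (fun i => c i.+1 - 1) x) => s.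
    by rewrite mul0r mulr0 subr0; apply: jt_top => i j im jm; apply: bump2_top.
  have [d hd] := jt_corner m c x 1; exists d => s.
  rewrite (hd s) => [|i j im jm]; first by rewrite /= !mul1r.
  exact: bump2_corner cd (esym c0) im jm.
have hC x : par 1 x -> C a x = C b x.
  move=> xp; have [d hd] := pert a x ad a0; have [d' hd'] := pert b x bd b0.
  have q s : s * d - s ^+ 2 * C a x = s * d' - s ^+ 2 * C b x.
    apply: (addrI (jt m.+2 a x)); rewrite {2}(h x xp) !addrA -hd -hd' -e0.
    exact/h/par_add/par_bump2.
  (* Adding the identities at 1 and -1 removes the unknown linear coefficients. *)
  have := q 1; have := q (-1); rewrite sqrrN expr1n !mul1r !mulN1r.
  by move: (C a x) (C b x) => u v; lra.
have tl (c : nat -> int) : decr m.+2 c -> decr m (fun i => c i.+1).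
  by move=> cd i j ij jm; apply: cd; lia.
have pos c c' : decr m.+2 c -> (forall x, par 1 x -> C c x = C c' x) ->
    c 0%N + c m.+1 = 0 -> c' 0%N + c' m.+1 = 0.
  move=> cd hc c0; apply/eqP; apply: contraT => n0.
  have [x xp] := jt_neq0 R (tl c cd); case/eqP; have := hc x; rewrite /C c0 eqxx (negPf n0).
  by rewrite mul0r mul1r; apply=> k; rewrite mul1r.
case: (eqVneq (a 0%N + a m.+1) 0) => [aeq|ane].
  have beq := pos a b ad hC aeq.
  have [] := IH m _ _ _ (tl a ad) (tl b bd).
  - by lia.
  - by move=> x xp; have := hC x xp; rewrite /C aeq beq eqxx !mul1r.
  - move=> e1; left=> -[|i] im; first by rewrite e0.
    by have [->|ne] := eqVneq i m; [lia|apply: e1; lia].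
  move=> e1; right=> -[|i] im.
    by rewrite /star subn1 /=; lia.
  have [->|ne] := eqVneq i m; first by rewrite /star (_ : (m.+2 - m.+2)%N = 0%N); lia.
  by rewrite e1 /star; [congr (- a _)|]; lia.
have bne : b 0%N + b m.+1 != 0.
  apply: contraNneq ane => /(pos b a bd); move=> -> // x xp; exact/esym/hC.
have apos : 0 < a 0%N + a m.+1 by rewrite lt_neqAle eq_sym ane.
have bpos : 0 < b 0%N + b m.+1 by rewrite lt_neqAle eq_sym bne.
have h' x : par 1 x -> jt m.+1 (fun i => a i.+1 - 1) x = jt m.+1 (fun i => b i.+1 - 1) x.
  move=> xp; have := h _ (par_add xp (par_bump2 (a 0%N + m.+1%:Z) 1 e11)).
  rewrite (@jt_top _ _ a _ _ 1) => [|i j im jm]; last exact: bump2_top.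
  rewrite (@jt_top _ _ b _ _ 1) => [|i j im jm]; last by rewrite e0; apply: bump2_top.
  rewrite (h x xp) => /addrI; rewrite !mul1r.
  by apply: mulfI; rewrite signr_eq0.
have [] := IH m.+1 _ _ (ltnSn _) (decr_behead 1 ad) (decr_behead 1 bd) h'.
  by move=> e1; apply: tail_eq => i im; have := e1 i im; lia.
(* The shifted tails are dual to each other. With K the shifted tail of a, the tails of a and b
   having the same absolute values means that |K + 1| and |K - 1| agree as multisets. So K is
   symmetric, hence self-dual, and the tails are equal after all. *)
move=> e1; apply: tail_eq.
pose K := [seq a i.+1 - 1 | i <- iota 0 m.+1].
have peK : perm_eq K (map -%R K).
  apply: abs_shift_sym; rewrite -!map_comp.
  have : perm_eq [seq `|a i.+1|%N | i <- iota 0 m.+1] [seq `|b i.+1|%N | i <- iota 0 m.+1].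
      have cE (c : nat -> int) : [seq `|c i|%N | i <- iota 0 m.+2] =
          `|c 0%N|%N :: [seq `|c i.+1|%N | i <- iota 0 m.+1].
        by rewrite -[iota 0 m.+2]/(0%N :: iota (1 + 0) m.+1) iotaDl map_cons -map_comp.
    by move: pe; rewrite !cE e0 perm_cons.
  rewrite perm_sym -(perm_rev [seq `|b i.+1|%N | i <- iota 0 m.+1]) perm_sym.
  have -> : rev [seq `|b i.+1|%N | i <- iota 0 m.+1] =
      [seq absz (a i.+1 - 1 - 1)%R | i <- iota 0 m.+1].
    apply: (@eq_from_nth _ 0%N) => [|i]; rewrite size_rev !size_map // size_iota => im.
    rewrite nth_rev ?size_map ?size_iota // !(nth_map 0%N) ?size_iota ?nth_iota //; try lia.
    have im' : (m.+1 - i.+1 < m.+1)%N by lia.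
    have := e1 _ im'; rewrite /star (_ : (m.+1 - (m.+1 - i.+1).+1 = i)%N); last by lia.
    by rewrite !add0n; move: (b _) (a _) => p q; lia.
  congr (perm_eq _ _); apply: eq_map => i /=.
  by rewrite subrK.
have sd := decr_self_dual (decr_behead 1 ad).
move=> i im; have := e1 i im; rewrite -sd //; first by lia.
by move: peK; rewrite /K -map_comp.
Qed.

Lemma jt_even n a b : decr n a -> decr n b ->
  (forall x, par 1 x -> jt n a x = jt n b x) -> eqst n a b.
Proof.
elim/ltn_ind: n a b => n IH a b ad bd h.
case: n IH ad bd h => [|n] IH ad bd h; first by left.
have norm c : decr n.+1 c -> exists c', [/\ eqst n.+1 c c', decr n.+1 c', 0 <= c' 0%N + c' n
    & forall x, par 1 x -> jt n.+1 c' x = jt n.+1 c x].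
  move=> cd; have [c0|c0] := leP 0 (c 0%N + c n); first by exists c; split=> //; left.
  exists (star n.+1 c); split; [by right|exact: star_decr| |].
    by rewrite /star subn1 subnn /=; lia.
  by move=> x xp; rewrite (jt_star _ _ xp) expr1n mul1r.
have [a' [sa ad' a0 ha]] := norm a ad; have [b' [sb bd' b0 hb]] := norm b bd.
have sab : eqst n.+1 a' b'.
  apply: (jt_even_step (fun m a b mn => IH m mn a b) ad' bd' a0 b0) => x xp.
  by rewrite ha // hb // h.
exact: eqst_trans sa (eqst_trans sab (eqst_sym sb)).
Qed.

(** Normalize by [star] to a_0 + a_(n-1) >= 0. If the sum is 0, the quadratic coefficient of the
    corner variable removes both ends. If it is positive, the determinant of the shifted tail
    vanishes too, so n - 1 is odd; a mixed coefficient shows the same for the determinant of size n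
    - 2, so n - 2 is odd as well, a contradiction. *)
Lemma jt_odd n a : decr n a -> (forall x, par (-1) x -> jt n a x = 0) ->
  odd n /\ forall i, (i < n)%N -> a i = star n a i.
Proof.
elim/ltn_ind: n a => n IH a ad h.
wlog a0 : a ad h / 0 <= a 0%N + a n.-1 => [hw|].
  have [/(hw a ad h)//|a0] := leP 0 (a 0%N + a n.-1).
  have [||on sd] := hw (star n a) (star_decr ad).
  - by move=> x xp; rewrite (jt_star _ _ xp) h ?mulr0.
  - have e2 : (n - n.-1.+1 = 0)%N by lia.
    by rewrite /star subn1 e2; lia.
  by split=> // i im; rewrite -(starK a im) -sd // starK.
case: n IH ad h a0 => [|[|m]] IH ad h a0.
- have := h (fun=> 0); rewrite jt0 => h0.
  by have /eqP := h0 (fun k => esym (mulr0 _)); rewrite oner_eq0.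
- split=> // -[|//] _; rewrite /star /=.
  apply/eqP; apply: contraT => n0.
  have := h (bump2 (-1) (a 0%N) 1) (par_bump2 _ _ _); rewrite mulrNN mulr1 => /(_ erefl)/eqP.
  rewrite /jt det_mx11 mxE /= subr0 addr0 /bump2 eqxx (negPf n0) addr0 oner_eq0.
  by [].
have e11 : -1 * -1 = 1 :> R by rewrite mulrNN mulr1.
have tl (c : nat -> int) : decr m.+2 c -> decr m (fun i => c i.+1).
  by move=> cd i j ij jm; apply: cd; lia.
have := a0; rewrite /= le_eqVlt => /predU1P[aeq|apos].
  have [||om sd] := IH m _ (fun i => a i.+1) (tl a ad); first by lia.
    move=> x xp; have [d hd] := jt_corner m a x (-1).
    have q s : s * d + s ^+ 2 * jt m (fun i => a i.+1) x = 0.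
      have := h _ (par_add xp (par_bump2 (a 0%N + m.+1%:Z) s e11)); rewrite (hd s).
        by rewrite h // add0r mulN1r mulNr opprK.
      by move=> i j im jm; apply: bump2_corner ad (esym aeq) im jm.
    have := q 1; have := q (-1); rewrite sqrrN expr1n !mul1r mulN1r.
    by move: (jt m _ x) => u; lra.
  split=> [|i im]; first by rewrite /= negbK.
  case: i im => [|i] im; first by rewrite /star subn1 /=; lia.
  have [->|ne] := eqVneq i m; first by rewrite /star (_ : (m.+2 - m.+2)%N = 0%N); lia.
  by rewrite sd /star; [congr (- a _)|]; lia.
have h1 x : par (-1) x -> jt m.+1 (fun i => a i.+1 - 1) x = 0.
  move=> xp; have := h _ (par_add xp (par_bump2 (a 0%N + m.+1%:Z) 1 e11)).
  rewrite (@jt_top _ _ a _ _ 1) => [|i j im jm]; last exact: bump2_top.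
  rewrite h // add0r mul1r => /eqP; rewrite mulf_eq0 signr_eq0 => /eqP.
  by [].
have [om sd] := IH m.+1 (ltnSn _) _ (decr_behead 1 ad) h1.
suff om' : odd m by move: om; rewrite /= om'.
(* The tail of a being self-dual, the top variable gives nothing; use the mixed
   coefficient of the variables at the positions (0, m) and (1, m + 1). *)
have h2 x : par (-1) x -> jt m (fun i => a i.+2 - 2) x = 0.
  move=> xp; have am : a m.+1 = 2 - a 1%N.
    by have := sd 0%N isT; rewrite /star subn1 /=; lia.
  have a01 : a 1%N <= a 0%N by apply: ad.
  have le1 i : (0 < i < m.+2)%N -> a m.+1 <= a i <= a 1%N.
    by move=> /andP[i0 im]; rewrite !ad.
  have a1 : 1 <= a 1%N by have := le1 1%N isT; lia.
  (* The two positions carry the indices a_0 + m and a_1 + m. If a_0 = a_1 this is one variable, and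
     its quadratic coefficient is wanted. Otherwise there are two, and the second may also occur in
     the first row, hence [jt_two_rows]. *)
  move: a01; rewrite le_eqVlt => /predU1P[a01|a01].
    have [c [c' hc]] := jt_two m a x.
    have q s : s * c + s * c' + s * s * jt m (fun i => a i.+2 - 2) x = 0.
      have := h _ (par_add xp (par_bump2 (a 0%N + m%:Z) s e11)); rewrite (hc s s).
        by rewrite h // add0r.
      move=> i j im jm; rewrite /bump2 (_ : (_ == - _) = false); last first.
        by apply/eqP; case: i im => [|i] im; [|have := le1 i.+1 im]; lia.
      rewrite addr0 -mulrnDr; congr (_ *+ _); case: i im => [|[|i]] im /=.
      - by rewrite addn0; congr nat_of_bool; apply/eqP/eqP; lia.
      - by rewrite add0n; congr nat_of_bool; apply/eqP/eqP; lia.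
      - have le := le1 i.+2 im; rewrite (_ : _ == _ = false) //; apply/eqP; lia.
    have := q 1; have := q (-1); rewrite !mul1r !mulN1r opprK mul1r.
    by move: (jt m _ x) => u; lra.
  have [c hc] := jt_two_rows m a x.
  have q t : c + t * jt m (fun i => a i.+2 - 2) x = 0.
    have xz := par_add xp (par_bump2 (a 1%N + m%:Z) t e11).
    have := h _ (par_add xz (par_bump2 (a 0%N + m%:Z) 1 e11)); rewrite (hc 1 t).
    - by rewrite h // add0r mul1r.
    - move=> i j im jm; rewrite /bump2 (_ : (_ == - _) = false); last first.
        by apply/eqP; case: i im => [|i] im; [|have := le1 i.+1 im]; lia.
      rewrite addr0; congr (_ *+ nat_of_bool _); case: i im => [|i] im /=.
        by apply/eqP/eqP; lia.
      by have := le1 i.+1 im => le; apply/eqP; lia.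
    - move=> i j im jm; have le := le1 i im.
      rewrite /bump2 (_ : (_ == - _) = false); last by apply/eqP; lia.
      rewrite addr0; congr (_ *+ nat_of_bool _).
      by apply/eqP/andP => [e1|[/eqP-> /eqP->]]; [split; apply/eqP|]; lia.
  have := q 1; have := q 0; rewrite mul0r mul1r.
  by move: (jt m _ x) => u; lra.
have tl2 : decr m (fun i => a i.+2 - 2).
  by move=> i j ij jm; rewrite lerD2r; apply: ad.
have mm : (m < m.+2)%N by [].
by have [] := IH m mm _ tl2 h2.
Qed.
End Parity.

(** * The classical cases *)

Section Classical.
Variables (R : realType) (X : lie_datum R).
Local Notation g := (alg X).
Local Notation E := (euc X).
Local Notation S := (simple_roots X).
Local Notation Phi := (root_set X).
Variables (bf : E -> E -> R) (rv th : E -> g) (B : g -> g -> R[i]).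
Hypothesis lf : lie_frame bf rv th B.
Let hr := lf_roots lf.

Variables (Sbar : seq E) (n : nat) (e : 'I_n -> E) (ct : classical_type).
Hypothesis he : forall i j, ip X (e i) (e j) = (i == j)%:R.
Hypothesis hspan : <<codom e>>%VS = fullv.
Hypothesis hroots : root_set X =i classical_roots e ct.
Hypothesis hsimple : simple_roots X =i classical_base e ct.
Hypothesis hSbar : Sbar =i A_base e.
Local Notation Rp := (Rbar_pos Sbar).
Local Notation co y i := (ip X y (e i)).

Lemma coB y z i : co (y - z) i = co y i - co z i.
Proof. by rewrite linearBl. Qed.

Lemma coD y z i : co (y + z) i = co y i + co z i.
Proof. by rewrite linearDl. Qed.

Lemma coZ c y i : co (c *: y) i = c * co y i.
Proof. by rewrite linearZl_LR. Qed.

Lemma co_inj y z : (forall i, co y i = co z i) -> y = z.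
Proof.
move=> h; pose d := y - z; suff d0 : d = 0 by apply/eqP; rewrite -subr_eq0 -/d d0.
have : ip X d d = 0.
  have dsp : d \in <<in_tuple (codom e)>>%VS by rewrite /= hspan memvf.
  rewrite [X in ip _ _ X](coord_span dsp) linear_sumr big1 // => k _.
  have /codomP[i ->] : (in_tuple (codom e))`_k \in codom e by apply: mem_nth.
  by rewrite linearZr_LR /= /d coB h subrr mulr0.
by case: (eqVneq d 0) => // /ip_gt0 + d0; rewrite d0 ltxx.
Qed.

Lemma refl_diff i j y k : i != j -> co (reflect (e i - e j) y) k = co y (tperm i j k).
Proof.
move=> ij; have nn : ip X (e i - e j) (e i - e j) = 2.
  by rewrite linearBr /= !coB !he !eqxx [j == i]eq_sym (negPf ij) /=; ring.
have cE : copair y (e i - e j) = co y i - co y j.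
  by rewrite /copair nn linearBr /=; field.
rewrite /Defs.reflect coB coZ cE coB !he.
case: tpermP => [->|->|/eqP ki /eqP kj].
- by rewrite eqxx [j == i]eq_sym (negPf ij) /=; ring.
- by rewrite eqxx (negPf ij) /=; ring.
- by rewrite [i == k]eq_sym [j == k]eq_sym (negPf ki) (negPf kj) /=; ring.
Qed.

Lemma refl_sum i j y k : i != j -> co (reflect (e i + e j) y) k =
  if (k == i) || (k == j) then - co y (tperm i j k) else co y k.
Proof.
move=> ij; have nn : ip X (e i + e j) (e i + e j) = 2.
  by rewrite linearDr /= !coD !he !eqxx [j == i]eq_sym (negPf ij) /=; ring.
have cE : copair y (e i + e j) = co y i + co y j.
  by rewrite /copair nn linearDr /=; field.
rewrite /Defs.reflect coB coZ cE coD !he.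
rewrite [i == k]eq_sym [j == k]eq_sym; case: tpermP => [->|->|/eqP ki /eqP kj].
- by rewrite eqxx (negPf ij) /=; ring.
- by rewrite eqxx [j == i]eq_sym (negPf ij) /=; ring.
- by rewrite (negPf ki) (negPf kj) /=; ring.
Qed.

Lemma refl_unit i y k : co (reflect (e i) y) k = if k == i then - co y k else co y k.
Proof.
rewrite /Defs.reflect coB coZ /copair he eqxx divr1 he eq_sym.
by case: (eqVneq k i) => [->|_] /=; ring.
Qed.

Lemma refl_double i y : reflect (e i *+ 2) y = reflect (e i) y.
Proof.
rewrite /Defs.reflect /copair -scaler_nat linearZr_LR /= linearZl_LR linearZr_LR /= he eqxx.
by rewrite scalerA /=; congr (_ - _ *: _); field.
Qed.

(* Invariance under the Weyl group of type B or C requires [G] even; in type D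
   only an even number of signs change at a time. *)
Lemma classical_inv_fun (G : R -> R) (ep : R) : (forall r, G (- r) = ep * G r) ->
    ep * ep = 1 -> ct = typeD \/ ep = 1 ->
  weyl_inv_fun (fun y : E => \prod_i G (co y i)).
Proof.
move=> hG epep hct; pose f y := \prod_i G (co y i).
have fA i j y : i != j -> f (reflect (e i - e j) y) = f y.
  move=> ij; rewrite /f [RHS](reindex_inj (@perm_inj _ (tperm i j))).
  by apply: eq_bigr => k _; rewrite refl_diff.
have fS i j y : i != j -> f (reflect (e i + e j) y) = f y.
  move=> ij; have ji : j != i by rewrite eq_sym.
  rewrite /f (bigD1 i) // (bigD1 j) //= [RHS](bigD1 i) // [X in _ = _ * X](bigD1 j) //=.
  rewrite !refl_sum // eqxx eqxx orbT tpermL tpermR !hG !mulrA; congr (_ * _).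
    by transitivity (ep * ep * (G (co y j) * G (co y i))); [ring|rewrite epep; ring].
  apply: eq_bigr => k /andP[ki kj]; rewrite refl_sum //.
  by rewrite (negPf ki) (negPf kj).
have fU i y : ep = 1 -> f (reflect (e i) y) = f y.
  move=> e1; apply: eq_bigr => k _; rewrite refl_unit; case: eqP => // _.
  by rewrite hG e1 mul1r.
have opp (s : seq E) : {in s, forall a y, f (reflect a y) = f y} ->
    {in with_opp s, forall a y, f (reflect a y) = f y}.
  move=> hs a; rewrite mem_cat => /orP[/hs //|/mapP[b bs ->]] y.
  by rewrite reflectNl hs.
have key a y : a \in Phi -> f (reflect a y) = f y.
  rewrite hroots mem_cat => /orP[/mem_A_roots[i [j [ij ->]]]|]; first exact: fA.
  rewrite mem_cat => /orP[] aS.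
    apply: (opp _ _ a aS) => b /mapP[[i j]]; rewrite mem_pairs /= => ij -> z; apply: fS.
    by apply: contraTneq ij => ->; rewrite ltnn.
  case: (ct) hct aS => // hct' aS; have e1 : ep = 1 by case: hct'.
    by apply: (opp _ _ a aS) => b /mapP[i _ ->] z; apply: fU.
  by apply: (opp _ _ a aS) => b /mapP[i _ ->] z; rewrite refl_double; apply: fU.
by move=> w y; elim=> // a w' aP _ IH /=; rewrite -/(f _) key.
Qed.

Lemma e_diff_span (i j : 'I_n) : (i <= j)%N -> e i - e j \in <<Sbar>>%VS /\ cone (e i - e j).
Proof.
have SS : {subset A_base e <= S} by move=> a aA; rewrite hsimple mem_cat aA.
move=> ij; have [m] : exists m, j = (i + m)%N :> nat by exists (j - i)%N; lia.
elim: m j ij => [|m IH] j ij je.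
  have -> : j = i by apply: val_inj; rewrite /= je addn0.
  by rewrite subrr mem0v; split=> //; apply: cone0.
have kn : (i + m < n)%N by have := ltn_ord j; lia.
pose k := Ordinal kn; rewrite -(subrKA (e k)).
have kj : e k - e j \in A_base e.
  by apply/mapP; exists (k, j); rewrite ?mem_pairs //= je addnS.
have [|s c] := IH k _ erefl; first by rewrite /=; lia.
split; first by apply: memvD s _; apply: memv_span; rewrite hSbar.
exact: coneD c (pos_cone (simple_pos hr (SS _ kj))).
Qed.

Lemma classical_hS : {subset Sbar <= S}.
Proof. by move=> a; rewrite hSbar hsimple mem_cat => ->. Qed.

Lemma A_root_mem i j : i != j -> e i - e j \in Phi.
Proof. by move=> ij; rewrite hroots mem_cat; apply/orP; left; apply/mem_A_roots; exists i, j. Qed.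

Lemma e_diff_Rp (i j : 'I_n) : (i < j)%N -> e i - e j \in Rp.
Proof.
move=> ij; have [s c] := e_diff_span (ltnW ij).
have aP : e i - e j \in Phi by apply: A_root_mem; apply: contraTneq ij => ->; rewrite ltnn.
by rewrite mem_Rp aP s (cone_root hr aP c).
Qed.

(** The sum of the coordinates vanishes on the span of [Sbar], but not on the roots e_i + e_j, e_i,
    2 e_i or their opposites. *)
Lemma mem_RpP a : a \in Rp -> exists i j : 'I_n, (i < j)%N /\ a = e i - e j.
Proof.
rewrite mem_Rp => /and3P[aP asp pos].
pose tr y := \sum_i co y i.
have trD y z : tr (y + z) = tr y + tr z.
  by rewrite /tr -big_split; apply: eq_bigr => i _; rewrite coD.
have trZ c y : tr (c *: y) = c * tr y.
  by rewrite /tr mulr_sumr; apply: eq_bigr => i _; rewrite coZ.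
have tre i : tr (e i) = 1.
  by rewrite /tr (bigD1 i) //= he eqxx big1 ?addr0 // => j ji; rewrite he eq_sym (negPf ji).
have tr0 : tr 0 = 0 by have := trZ 0 0; rewrite scale0r mul0r.
have trN y : tr (- y) = - tr y by rewrite -scaleN1r trZ mulN1r.
have tra : tr a = 0.
  have asp' : a \in <<in_tuple Sbar>>%VS := asp.
  rewrite (coord_span asp') (big_morph tr trD tr0) big1 // => k _.
  have : (in_tuple Sbar)`_k \in Sbar by apply: mem_nth.
  by rewrite trZ hSbar => /mapP[[i j] _ ->]; rewrite trD trN !tre subrr mulr0.
have opp (s : seq E) : {in s, forall b, tr b != 0} -> a \notin with_opp s.
  move=> hs; apply/negP; rewrite mem_cat => /orP[/hs|/mapP[b /hs b0 ab]]; first by rewrite tra eqxx.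
  by rewrite -oppr_eq0 -trN -ab tra eqxx in b0.
move: aP; rewrite hroots mem_cat => /orP[/mem_A_roots[i [j [ij ae]]]|].
 exists i, j; split=> //; case: (ltngtP i j) => // [ji|/val_inj e']; last by rewrite e' eqxx in ij.
  have aP := A_root_mem ij; have [_ c] := e_diff_span (ltnW ji).
  have aP' : e j - e i \in Phi by apply: A_root_mem; rewrite eq_sym.
  have := pos_notN hr aP; rewrite -ae => /(_ pos).
  by rewrite ae opprB (cone_root hr aP' c).
rewrite mem_cat => /orP[] aw.
  suff : a \notin with_opp (sum_roots e) by rewrite aw.
  by apply: opp => b /mapP[[i j] _ ->]; apply: lt0r_neq0; rewrite trD !tre; lra.
case: (ct) aw => // aw.
  suff : a \notin with_opp [seq e i | i <- enum 'I_n] by rewrite aw.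
  by apply: opp => b /mapP[i _ ->]; rewrite tre oner_eq0.
suff : a \notin with_opp [seq e i *+ 2 | i <- enum 'I_n] by rewrite aw.
by apply: opp => b /mapP[i _ ->]; apply: lt0r_neq0; rewrite mulr2n trD !tre; lra.
Qed.

Let hh (y : 'rV[R]_n) : E := \sum_k y 0 k *: e k.

Lemma co_hh y i : co (hh y) i = y 0 i.
Proof.
have co0 : co 0 i = 0 by have := coZ 0 0 i; rewrite scale0r mul0r.
rewrite /hh (big_morph (fun z => co z i) (fun u v => coD u v i) co0) (bigD1 i) //=.
rewrite coZ he eqxx mulr1 big1 ?addr0 // => k ki.
by rewrite coZ he (negPf ki) mulr0.
Qed.

Lemma classical_Rp : perm_eq Rp (map hh (gl_pos R n)).
Proof.
have hinj : injective hh.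
  by move=> u v uv; apply/rowP => i; rewrite -!co_hh uv.
have hd (i j : 'I_n) : hh (delta_mx 0 i - delta_mx 0 j) = e i - e j.
  apply: co_inj => k; rewrite co_hh coB !he !mxE !eqxx /=.
  by rewrite [i == k]eq_sym [j == k]eq_sym.
apply: uniq_perm; first exact: Rp_uniq.
  by rewrite map_inj_uniq ?gl_pos_uniq.
move=> a; apply/idP/mapP => [/mem_RpP[i [j [ij ->]]]|[z /mapP[[i j]]]].
  exists (delta_mx 0 i - delta_mx 0 j); last by rewrite hd.
  by apply/mapP; exists (i, j); rewrite ?mem_pairs.
by rewrite mem_pairs /= => ij -> ->; rewrite hd e_diff_Rp.
Qed.

Definition ext (m : 'I_n -> int) (i : nat) : int := if insub i is Some j then m j else 0.

Lemma extE m (i : 'I_n) : ext m i = m i.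
Proof. by rewrite /ext valK. Qed.

Lemma classical_altsum (m : 'I_n -> int) mu (G : R -> R) (x : int -> R) :
    (forall i, co mu i = (m i)%:~R) -> (forall z : int, G z%:~R = x z) ->
  altsum Rp (fun y => \prod_i G (co (mu + y) i)) = jt n (ext m) x.
Proof.
move=> muE Gx; have h0 : hh 0 = 0 by rewrite /hh big1 // => k _; rewrite mxE scale0r.
have hD : {morph hh : u v / u + v}.
  by move=> u v; rewrite /hh -big_split; apply: eq_bigr => k _; rewrite mxE scalerDl.
rewrite (altsum_perm _ classical_Rp) (altsum_map _ _ h0 hD).
transitivity (altsum (gl_pos R n) (fun y => \prod_i G ((m i)%:~R + y 0 i))).
  by apply: eq_altsum => y; apply: eq_bigr => i _; rewrite coD co_hh muE.
rewrite (gl_altsum_det (fun i v => G ((m i)%:~R + v))) /jt; congr (\det _).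
apply/matrixP => i j; rewrite !mxE extE -Gx; congr G.
by rewrite !rmorphD rmorphN /= -!pmulrn addrA addrAC.
Qed.

Lemma classical_decr (m : 'I_n -> int) mu : dom Sbar mu ->
  (forall i, co mu i = (m i)%:~R) -> decr n (ext m).
Proof.
move=> mud muE i j ij jn; have im := leq_ltn_trans ij jn.
have := extE m (Ordinal im); have := extE m (Ordinal jn); rewrite /= => -> ->.
rewrite -(ler_int R) -!muE -subr_ge0 -linearBr /=.
have [s c] := e_diff_span (ij : (Ordinal im <= Ordinal jn)%N).
by have := dom_ge0 hr classical_hS (ipW hr) mud s c.
Qed.

(** Reversal with a change of signs is the product of the reflections in e_i + e_(rev i), one for
    each exchanged pair. For odd n the middle coordinate must change sign alone, which is a
    reflection in types B and C only. *)
Lemma classical_star : ct <> typeD \/ ~~ odd n ->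
  exists2 u, in_weyl Phi u & forall y k, co (u y) k = - co y (rev_ord k).
Proof.
move=> hct.
have step (i : 'I_n) : exists2 a, a \in Phi & forall z k, co (reflect a z) k =
    if (k == i) || (rev_ord k == i) then - co z (rev_ord k) else co z k.
  have rk k : (rev_ord k == i) = (k == rev_ord i) by rewrite -(inj_eq rev_ord_inj) rev_ordK.
  have [ri|ri] := eqVneq (rev_ord i) i.
    have uP : e i \in Phi \/ e i *+ 2 \in Phi.
      have iE : i \in enum 'I_n by rewrite mem_enum.
      have mB : e i \in [seq e i | i <- enum 'I_n] by apply: map_f.
      have mC : e i *+ 2 \in [seq e i *+ 2 | i <- enum 'I_n] by apply: (map_f (fun i => e i *+ 2)).
      case: (ct) hroots hct => hR.
      - by left; rewrite hR !mem_cat mB ?orbT.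
      - by right; rewrite hR !mem_cat mC ?orbT.
      case=> // no; exfalso; move: no.
      have := congr1 val ri; rewrite /= => ri'.
      have := ltn_ord i; move: (nat_of_ord i) ri' => p pe pn.
      have -> : n = (p.+1 + p)%N by lia.
      by rewrite oddD /=; case: (odd p).
    have rE z k : co (reflect (e i) z) k =
        if (k == i) || (rev_ord k == i) then - co z (rev_ord k) else co z k.
      rewrite refl_unit rk ri orbb; case: eqP => // ->; by rewrite ri.
    by case: uP => uP; [exists (e i)|exists (e i *+ 2)] => // z k; rewrite ?refl_double rE.
  exists (e i + e (rev_ord i)).
    have mS : e i + e (rev_ord i) \in sum_roots e.
      case: (ltngtP i (rev_ord i)) => [lt|lt|e'].
      - by apply/mapP; exists (i, rev_ord i); rewrite ?mem_pairs.
      - by apply/mapP; exists (rev_ord i, i); rewrite ?mem_pairs // addrC.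
      - by case/eqP: ri; apply: val_inj.
    by rewrite hroots !mem_cat mS ?orbT.
  have ir : i != rev_ord i by rewrite eq_sym.
  move=> z k; rewrite (refl_sum _ _ ir) rk; case: tpermP => [->|->|/eqP/negPf-> /eqP/negPf->] //.
  by rewrite rev_ordK.
(* Listing only the i <= rev i uses each pair once. *)
have [w hw wE] : exists2 w, in_weyl Phi w & forall y k, co (w y) k =
    if (k \in [seq i : 'I_n <- enum 'I_n | (i <= rev_ord i)%N]) ||
       (rev_ord k \in [seq i : 'I_n <- enum 'I_n | (i <= rev_ord i)%N])
    then - co y (rev_ord k) else co y k.
  have : all (fun i : 'I_n => i <= rev_ord i)%N [seq i : 'I_n <- enum 'I_n | (i <= rev_ord i)%N].
    exact: filter_all.
  have : uniq [seq i : 'I_n <- enum 'I_n | (i <= rev_ord i)%N] by rewrite filter_uniq ?enum_uniq.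
  elim: [seq i <- enum 'I_n | _] => [_ _|i l IH] /=.
    by exists id => //; apply: weyl_id.
  move=> /andP[il ul] /andP[ile al]; have [w hw wE] := IH ul al.
  have [a aP aE] := step i; exists (reflect a \o w); first exact: weyl_refl.
  have ril : rev_ord i \notin l.
    apply: contra il => rl; have /= le := allP al _ rl.
    suff -> : i = rev_ord i by [].
    by apply: val_inj => /=; have := ltn_ord i; move: (nat_of_ord i) ile le => p; lia.
  move=> y k; rewrite /= aE !inE !wE rev_ordK.
  have [->|ki] := eqVneq k i; first by rewrite (negPf il) (negPf ril).
  have [rki|rki] := eqVneq (rev_ord k) i; last by [].
  by rewrite rki (negPf il) -(rev_ordK k) rki (negPf ril).
have ml (k : 'I_n) : (k \in [seq i : 'I_n <- enum 'I_n | (i <= rev_ord i)%N]) =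
    (k <= rev_ord k)%N by rewrite mem_filter mem_enum andbT.
by exists w => // y k; rewrite wE !ml rev_ordK; case: leqP => //= /ltnW ->.
Qed.

Lemma case_classical mu nu : Pbar_plus Sbar mu -> Pbar_plus Sbar nu -> same_alt Sbar mu nu ->
    (forall b, b \in [:: mu; nu] -> forall i, co b i \is a Num.int) ->
  diagram_conj Sbar mu nu.
Proof.
move=> /andP[_ mud] /andP[_ nud] h hint; have hS := classical_hS.
pose m i := Num.floor (co mu i); pose k i := Num.floor (co nu i).
have muE i : co mu i = (m i)%:~R.
  by rewrite /m; have /intrP[z ->] := hint mu (mem_head _ _) i; rewrite intrKfloor.
have nuE i : co nu i = (k i)%:~R.
  have nui : nu \in [:: mu; nu] by rewrite !inE eqxx orbT.
  by rewrite /k; have /intrP[z ->] := hint nu nui i; rewrite intrKfloor.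
have hjt (ep : R) (x : int -> R) : ep * ep = 1 -> ct = typeD \/ ep = 1 -> par ep x ->
    jt n (ext m) x = jt n (ext k) x.
  move=> e2 hct xp.
  (* Invariance is required on all of E, so x is extended to real arguments. Reading negative ones
     through their opposites makes the extension exactly even or odd, which the floor alone would
     not be. *)
  pose G (r : R) := if 0 <= r then x (Num.floor r) else ep * x (Num.floor (- r)).
  have Gx (z : int) : G z%:~R = x z.
    rewrite /G ler0z; case: ifP => _; first by rewrite intrKfloor.
    by rewrite -rmorphN /= intrKfloor xp mulrA e2 mul1r.
  have GN r : G (- r) = ep * G r.
    rewrite /G oppr_ge0 opprK; case: (ltgtP r 0) => [r0|r0|->].
    - by rewrite mulrA e2 mul1r.
    - by [].
    - by rewrite oppr0 floor0 -xp oppr0.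
  rewrite -(classical_altsum muE Gx) -(classical_altsum nuE Gx).
  exact: (h (fun y : E => \prod_i G (co y i)) (classical_inv_fun GN e2 hct)).
have ad := classical_decr mud muE; have bd := classical_decr nud nuE.
have same : (forall i : 'I_n, m i = k i) -> diagram_conj Sbar mu nu.
  move=> mk; suff -> : mu = nu by apply: conj_refl.
  by apply: co_inj => i; rewrite muE nuE mk.
have [eq_mk|st_mk] := jt_even ad bd (fun x => hjt 1 x (mulr1 1) (or_intror erefl)).
  by apply: same => i; have := eq_mk i (ltn_ord i); rewrite !extE.
have st_i (i : 'I_n) : k i = - m (rev_ord i).
  by have := st_mk i (ltn_ord i); rewrite /star -[(n - i.+1)%N]/(nat_of_ord (rev_ord i)) !extE.
(* In type D with n odd, nu = star mu makes each determinant on odd x equal to its own opposite. It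
   vanishes, so mu is self-dual by [jt_odd] and nu = mu. *)
have [/andP[/eqP tD on]|nD] := boolP ((if ct is typeD then true else false) && odd n).
  have ctD : ct = typeD by case: (ct) tD.
  have e11 : -1 * -1 = 1 :> R by rewrite mulrNN mulr1.
  have z (x : int -> R) : par (-1) x -> jt n (ext m) x = 0.
    move=> xp; have := hjt _ x e11 (or_introl ctD) xp.
    rewrite (eq_jt (a := ext k) (b := star n (ext m)) (y := x)) //.
    rewrite (jt_star _ _ xp) -signr_odd on expr1 mulN1r; move: (jt n _ x) => u; lra.
  have [_ sd] := jt_odd ad z; apply: same => i.
  by rewrite -(extE m) sd // -st_mk // extE.
have hct : ct <> typeD \/ ~~ odd n.
  by move: nD; rewrite negb_and => /orP[|no]; [case: (ct) => //; left|right].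
have [u hu uE] := classical_star hct; exists u; split=> //; last first.
  by apply: co_inj => i; rewrite nuE uE muE st_i rmorphN.
apply: (perm_Rp_of_simple lf hS hu) => s; rewrite hSbar => /mapP[[i j]].
rewrite mem_pairs /= => /eqP ij -> {s}.
have -> : u (e i - e j) = e (rev_ord j) - e (rev_ord i).
  have rk p q : (rev_ord p == q) = (p == rev_ord q) by rewrite -(inj_eq rev_ord_inj) rev_ordK.
  by apply: co_inj => q; rewrite uE !coB !he !rk opprB.
by apply: e_diff_Rp => /=; have := ltn_ord j; lia.
Qed.
End Classical.

Lemma datum_frame (R : realType) (X : lie_datum R) :
    simple_datum X \/ (exists n, X = gl_datum R n) ->
  exists bf x t B, @lie_frame R X bf x t B.
Proof.
case=> [sd|[n ->]]; first by have [bf [x [t lf]]] := simple_frame sd; do 4!eexists; exact: lf.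
by do 4!eexists; apply: gl_frame.
Qed.

Theorem theorem7p4 (R : realType) (X : lie_datum R) (Sbar : seq (euc X))
    (mu nu : euc X)
    (hX : simple_datum X \/ exists n : nat, X = gl_datum R n)
    (hSbar : {subset Sbar <= simple_roots X})
    (hmu : Pbar_plus Sbar mu) (hnu : Pbar_plus Sbar nu) :
  (diagram_conj Sbar mu nu -> same_induced Sbar mu nu)
  /\
  (same_induced Sbar mu nu ->
    let case_a := exists w, in_weyl (root_set X) w /\
      Pplus_chamber w mu /\ Pplus_chamber w nu in
    let case_b :=
      (exists2 w, in_weyl (root_set X) w & Eset Sbar mu `<=` Pplus_chamber w) /\
      (exists2 w, in_weyl (root_set X) w & Eset Sbar nu `<=` Pplus_chamber w) in
    let case_c := Pplus (mu + 2%:R *: rhobar Sbar) \/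
      Pplus (nu + 2%:R *: rhobar Sbar) in
    let case_d := exists n : nat, X = gl_datum R n in
    let case_e := classical_gl_case Sbar mu nu in
    (case_a -> mu = nu) /\
    (case_a \/ case_b \/ case_c \/ case_d \/ case_e ->
      diagram_conj Sbar mu nu)).
Proof.
have [bf [x [t [B lf]]]] := datum_frame hX; split.
  by move=> hc; have h := same_induced_conj lf hSbar hmu hnu hc.
move=> hind case_a case_b case_c case_d case_e.
have hsa := same_alt_of_induced lf hSbar hmu hnu hind.
have [/andP[_ mud] /andP[_ nud]] := conj hmu hnu.
have ha : case_a -> mu = nu.
  move=> [w [hw [/andP[_ d1] /andP[_ d2]]]].
  exact (case_same_chamber lf hSbar mud nud hsa hw d1 d2).
split=> // -[/ha <-|[[[w hw h1] [w' hw' h2]]|[hc|[[n eX]|he]]]].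
- exact: conj_refl.
- apply: (case_Eset lf hSbar mud nud hsa hw hw') => z hz.
    by have /andP[] : Pplus_chamber w (mu + rhobar Sbar - z (rhobar Sbar)) by apply: h1; exists z.
  by have /andP[] : Pplus_chamber w' (nu + rhobar Sbar - z (rhobar Sbar)) by apply: h2; exists z.
- case: hc => /andP[_ hd]; first exact: (case_dominant lf hSbar mud nud hsa hd).
  exact: (conj_sym lf (case_dominant lf hSbar nud mud (same_alt_sym hsa) hd)).
- by clear -eX hSbar hmu hnu hsa; subst X; apply: case_gl.
have [_ [n [e [ct [h1 h2 h3 h4 [h5 h6]]]]]] := he.
exact: (case_classical lf h1 h2 h3 h4 h5 hmu hnu hsa h6).
Qed.
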